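(* There is a linear programming-based fixed-parameter tractable algorithm for solving $MIN$-$SCTM$ with parameters $\omega=tw(G)$ and $\vartheta_{\max}$, running in time at most $$2^{O(\omega^2)}\,\vartheta_{\max}^{O(\omega)}\,O\big((n+m)^{2.5}\big).$$
   Context: Setting. $G$ is a connected hypergraph with node set $N_F=\{1,\dots,n\}$ and hyperedges $e_1,\dots,e_m\subseteq N_F$, where $|e_j|=k_j\le k$ for a constant $k$. Each pair of a node $i$ and a hyperedge $e_j$ with $i\in e_j$ has a benefit $r_{ji}\ge0$, each node $i$ has an adoption cost $c_i$ and a seeding cost $w_i$, and each hyperedge $e_j$ has an adoption threshold $\theta_j$. Standing assumptions: $r_{ji},c_i$ are integers, $c_i>0$, $\sum_{j:\,i\in e_j}r_{ji}\ge c_i$ for all $i$, and $\theta_j\in\{2,3,\dots,k_j\}$. SCTM activation process: for $S_0\subseteq N_F$ and $t=0,1,2,\dots$, $$\mathcal B_i(S_t)=\{j: i\in e_j,\ |S_t\cap e_j|\ge \theta_j-1\},\quad b_i(S_t)=\sum_{j\in\mathcal B_i(S_t)}r_{ji},\quad S_{t+1}=S_t\cup\{i\in N_F\setminus S_t: b_i(S_t)\ge c_i\}.$$ The limit (attained in finitely many steps) is $S_\infty$. $MIN$-$SCTM$ is $OPT=\min\{\sum_{i\in S_0}w_i : S_0\subseteq N_F,\ S_\infty=N_F\}$. $\vartheta_{\max}=\max\{\max_{i}c_i,\ \max_j\theta_j-1\}$. Treewidth $tw(G)$ of a (hyper)graph: a tree decomposition is a tree $T$ with bags $X_z$, $z\in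 T$, of nodes such that the bags cover all nodes, every (hyper)edge is contained in some bag, and for each node the tree nodes whose bags contain it form a subtree of $T$; its width is $\max_z|X_z|-1$; the treewidth is the minimum width. A problem is fixed-parameter tractable with respect to a parameter $p$ if it can be solved in $f(p)\,n^{O(1)}$ time with $f$ independent of the input size. ''Linear programming-based'' means that the problem is solved by solving an equivalent linear program. Running times use the convention that a linear program with $h$ variables and constraints can be solved in $O(h^{2.5})$ time (a known result of Jiang et al., 2020). *)

(* Defs.v *)
From HB Require Import structures.
From mathcomp Require Import all_boot all_order all_algebra.
From mathcomp Require Import boolp reals exp.

Set Implicit Arguments.
Unset Strict Implicit.
Unset Printing Implicit Defensive.

Import Order.TTheory GRing.Theory Num.Theory.

(** * Tree decompositions and treewidth of a hypergraph *)

Definition is_tree (V : finType) (t : rel V) : Prop :=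
  [/\ (0 < #|V|)%N, symmetric t, irreflexive t,
      (forall x y, connect t x y)
    & (forall p : seq V, ucycle t p -> (size p <= 2)%N)].

Section Treewidth.
Variables (n m : nat) (edge : 'I_m -> {set 'I_n}).

Definition tree_decomposition (V : finType) (t : rel V) (X : V -> {set 'I_n})
    : Prop :=
  [/\ is_tree t,
      (forall i, exists z, i \in X z),
      (forall j, exists z, edge j \subset X z)
    & (forall i z z', i \in X z -> i \in X z' ->
         connect [rel a b | [&& t a b, i \in X a & i \in X b]] z z')].

Definition decomposition_width (V : finType) (X : V -> {set 'I_n}) : nat :=
  (\max_(z : V) #|X z|)%N.-1.

Definition has_decomposition_of_width (w : nat) : Prop :=
  exists (V : finType) (t : rel V) (X : V -> {set 'I_n}),
    tree_decomposition t X /\ decomposition_width X = w.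

Lemma has_decomposition_ex : exists w, `[< has_decomposition_of_width w >].
Proof.
exists (decomposition_width (fun _ : unit => [set: 'I_n])).
apply/asboolP; exists unit, [rel _ _ | false], (fun=> setT); split => //; split.
- split => //; first by rewrite card_unit.
  + by move=> [] []; exact: connect0.
  + by case=> [|x [|y p]].
- by move=> i; exists tt; rewrite inE.
- by move=> j; exists tt; rewrite subsetT.
- by move=> i [] [] _ _; exact: connect0.
Qed.

Definition treewidth : nat := ex_minn has_decomposition_ex.

Definition hyper_connected : Prop :=
  (0 < n)%N /\
  forall u v,
    connect [rel a b | [exists j, (a \in edge j) && (b \in edge j)]] u v.

End Treewidth.

Local Open Scope ring_scope.

(** * MIN-SCTM *)

(* [benefit j i] is only ever read for [i \in edge j]. *)
Record instance (R : realType) := Instance {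
  nodes : nat;
  edges : nat;
  edge : 'I_edges -> {set 'I_nodes};
  benefit : 'I_edges -> 'I_nodes -> nat;
  cost : 'I_nodes -> nat;
  weight : 'I_nodes -> R;
  threshold : 'I_edges -> nat
}.

Arguments edge {R} i _.

Section SCTM.
Variables (R : realType) (I : instance R).
Local Notation N := 'I_(nodes I).
Local Notation E := 'I_(edges I).

Definition standing_assumptions : Prop :=
  [/\ hyper_connected (edge I),
      (forall i : N, 0 < cost i)%N,
      (forall i : N, cost i <= \sum_(j : E | i \in edge I j) benefit j i)%N
    & (forall j : E, 2 <= threshold j <= #|edge I j|)%N].

Definition active_edges (S : {set N}) (i : N) : {set E} :=
  [set j | (i \in edge I j) && (threshold j - 1 <= #|S :&: edge I j|)%N].

Definition received (S : {set N}) (i : N) : nat :=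
  (\sum_(j in active_edges S i) benefit j i)%N.

Definition activation_step (S : {set N}) : {set N} :=
  S :|: [set i in ~: S | (cost i <= received S i)%N].

Definition activation (S0 : {set N}) (t : nat) : {set N} :=
  iter t activation_step S0.

Definition activation_limit (S0 Sinf : {set N}) : Prop :=
  exists t0, forall t, (t0 <= t)%N -> activation S0 t = Sinf.

Definition sctm_feasible (S0 : {set N}) : Prop := activation_limit S0 setT.

Definition seeding_cost (S0 : {set N}) : R := \sum_(i in S0) weight i.

Definition sctm_solution (S0 : {set N}) (opt : R) : Prop :=
  [/\ sctm_feasible S0, opt = seeding_cost S0
    & forall S, sctm_feasible S -> opt <= seeding_cost S].

Definition theta_max : nat :=
  maxn (\max_(i : N) cost i)%N (\max_(j : E) (threshold j - 1))%N.

Definition feasible_hull (x : N -> R) : Prop :=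
  exists lam : {set N} -> R,
    [/\ forall S, 0 <= lam S,
        forall S, lam S != 0 -> sctm_feasible S,
        \sum_S lam S = 1
      & forall i, x i = \sum_(S : {set N} | i \in S) lam S].

End SCTM.

(** * Linear programs: minimise [obj^T y] subject to [A y >= b], [y] free *)

Record lin_prog (R : realType) := LinProg {
  lp_vars : nat;
  lp_cons : nat;
  lp_obj : 'cV[R]_lp_vars;
  lp_mat : 'M[R]_(lp_cons, lp_vars);
  lp_rhs : 'cV[R]_lp_cons
}.

Definition lp_feasible (R : realType) (L : lin_prog R) (y : 'cV_(lp_vars L)) : Prop :=
  forall i, lp_rhs L i 0 <= (lp_mat L *m y) i 0.
Arguments lp_feasible {R} L y.

Definition lp_value (R : realType) (L : lin_prog R) (y : 'cV_(lp_vars L)) : R :=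
  ((lp_obj L)^T *m y) 0 0.
Arguments lp_value {R} L y.

Definition lp_optimal (R : realType) (L : lin_prog R) (y : 'cV_(lp_vars L)) : Prop :=
  lp_feasible L y /\
  forall y', lp_feasible L y' -> lp_value L y <= lp_value L y'.
Arguments lp_optimal {R} L y.

Definition lp_size (R : realType) (L : lin_prog R) : nat := (lp_vars L + lp_cons L)%N.

(* The first [nodes I] variables are the seeding variables. Projected on them,
   the feasible region is exactly the convex hull of the incidence vectors of
   the feasible seed sets, and the LP objective is the seeding cost. Equality of
   the optimal values alone would be too weak: a one-point LP, written down
   after solving the instance by other means, would satisfy it. *)
Definition lp_equivalent (R : realType) (I : instance R) (L : lin_prog R) : Prop :=
  exists le_n : (nodes I <= lp_vars L)%N,
    let seed (y : 'cV[R]_(lp_vars L)) (i : 'I_(nodes I)) :=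
      y (widen_ord le_n i) 0 in
    (forall x : 'I_(nodes I) -> R,
       (exists y, lp_feasible L y /\ seed y =1 x) <-> feasible_hull x) /\
    (forall y, lp_feasible L y -> lp_value L y = \sum_i weight i * seed y i).

(** * Machine model: a unit-cost additive RAM, as a while language *)

(* The memory consists of arrays of natural numbers and arrays of reals, both
   named by natural numbers and indexed by natural numbers, initially 0. Reals
   can only be added, subtracted and compared. Neither multiplication nor
   rounding is available, so unit costs are realistic. A program is a finite
   syntactic object that does not depend on the input, so evaluating its
   expressions takes a bounded number of elementary operations. *)

Inductive nexpr :=
  | NCst of nat
  | NGet of nat & nexpr
  | NAdd of nexpr & nexpr
  | NSub of nexpr & nexpr.

Inductive rexpr :=
  | RNat of nexpr
  | RGet of nat & nexpr
  | RAdd of rexpr & rexpr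
  | RSub of rexpr & rexpr.

Inductive test :=
  | NLe of nexpr & nexpr
  | RLe of rexpr & rexpr.

Inductive cmd :=
  | Skip
  | NSet of nat & nexpr & nexpr
  | RSet of nat & nexpr & rexpr
  | Seq of cmd & cmd
  | If of test & cmd & cmd
  | While of test & cmd.

Record state (R : realType) := State {
  nmem : nat -> nat -> nat;
  rmem : nat -> nat -> R
}.

Section Semantics.
Variable R : realType.

Definition upd (T : Type) (mem : nat -> nat -> T) (a i : nat) (v : T) :=
  fun a' i' => if (a' == a) && (i' == i) then v else mem a' i'.

Fixpoint neval (s : state R) (e : nexpr) : nat :=
  match e with
  | NCst c => c
  | NGet a e1 => nmem s a (neval s e1)
  | NAdd e1 e2 => (neval s e1 + neval s e2)%N
  | NSub e1 e2 => (neval s e1 - neval s e2)%N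
  end.

Fixpoint reval (s : state R) (e : rexpr) : R :=
  match e with
  | RNat e1 => (neval s e1)%:R
  | RGet a e1 => rmem s a (neval s e1)
  | RAdd e1 e2 => reval s e1 + reval s e2
  | RSub e1 e2 => reval s e1 - reval s e2
  end.

Definition teval (s : state R) (b : test) : bool :=
  match b with
  | NLe e1 e2 => (neval s e1 <= neval s e2)%N
  | RLe e1 e2 => reval s e1 <= reval s e2
  end.

(* [exec c s t s']: started in [s], [c] halts in [s'] after [t] steps. *)
Inductive exec : cmd -> state R -> nat -> state R -> Prop :=
  | ExecSkip s : exec Skip s 1 s
  | ExecNSet a i e s :
      exec (NSet a i e) s 1
        (State (upd (nmem s) a (neval s i) (neval s e)) (rmem s))
  | ExecRSet a i e s :
      exec (RSet a i e) s 1
        (State (nmem s) (upd (rmem s) a (neval s i) (reval s e)))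
  | ExecSeq c1 c2 s s1 s2 t1 t2 :
      exec c1 s t1 s1 -> exec c2 s1 t2 s2 -> exec (Seq c1 c2) s (t1 + t2) s2
  | ExecIf b c1 c2 s s' t :
      exec (if teval s b then c1 else c2) s t s' -> exec (If b c1 c2) s t.+1 s'
  | ExecWhileStop b c s :
      ~~ teval s b -> exec (While b c) s 1 s
  | ExecWhileStep b c s s1 s2 t1 t2 :
      teval s b -> exec c s t1 s1 -> exec (While b c) s1 t2 s2 ->
      exec (While b c) s (t1 + t2).+1 s2.

(** ** Input and output conventions *)

(* Input. Natural arrays: 0 holds [:: n; m; number of incidences]; the p-th
   incidence (edge j, node i in edge j), in lexicographic order, has j in
   array 1, i in array 2 and r_ji in array 3, all at index p; 4 and 5 hold
   the thresholds and the adoption costs. Real array 0 holds the weights. *)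

Definition incidences (I : instance R) : seq ('I_(edges I) * 'I_(nodes I)) :=
  [seq (j, i) | j <- enum 'I_(edges I), i <- enum (edge I j)].

Definition load (I : instance R) : state R :=
  let inc := incidences I in
  {| nmem := fun a => nth 0%N
       match a with
       | 0 => [:: nodes I; edges I; size inc]
       | 1 => [seq val ji.1 | ji <- inc]
       | 2 => [seq val ji.2 | ji <- inc]
       | 3 => [seq benefit ji.1 ji.2 | ji <- inc]
       | 4 => [seq threshold j | j <- enum 'I_(edges I)]
       | 5 => [seq cost i | i <- enum 'I_(nodes I)]
       | _ => [::]
       end;
     rmem := fun a => nth 0
       match a with
       | 0 => [seq weight i | i <- enum 'I_(nodes I)]
       | _ => [::]
       end |}.

(* The linear program, with its matrix as a list of triples (row, column,
   value). Natural arrays: 6 holds [:: variables; constraints; triples], 7 the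
   rows, 8 the columns. Real arrays: 1 the values, 2 the right-hand side, 3
   the objective. *)
Definition lp_of_state (s : state R) : lin_prog R :=
  {| lp_vars := nmem s 6 0;
     lp_cons := nmem s 6 1;
     lp_obj := \col_j rmem s 3 j;
     lp_mat := \matrix_(i, j)
       \sum_(p < nmem s 6 2 | (nmem s 7 p == i) && (nmem s 8 p == j))
         rmem s 1 p;
     lp_rhs := \col_i rmem s 2 i |}.

(* The solution of the linear program is delivered in real array 4. *)
Definition put_solution (s : state R) (h : nat) (y : 'cV[R]_h) : state R :=
  {| nmem := nmem s;
     rmem := fun a i =>
       if a == 4 then oapp (fun j : 'I_h => y j 0) 0 (insub i) else rmem s a i |}.

(* Output: the indicator of the seed set in natural array 9, its cost at index
   0 of real array 5. *)
Definition output_seeds (n : nat) (s : state R) : {set 'I_n} :=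
  [set i : 'I_n | nmem s 9 i != 0%N].

Definition output_value (s : state R) : R := rmem s 5 0.

End Semantics.

(** * Linear programming-based algorithms *)

(* [lp_build] writes down one linear program; an LP solver returns some optimal
   solution, over which the algorithm has no control; [lp_read] continues from
   the final memory of [lp_build] and outputs the answer. *)
Record lp_algorithm := LPAlgorithm { lp_build : cmd; lp_read : cmd }.

(* The LP solver takes [kappa * h^2.5] steps, [h] being the number of variables
   and constraints. *)
Definition solves_within (R : realType) (kappa : R) (alg : lp_algorithm)
    (I : instance R) (time : R) : Prop :=
  exists t1 s1, exec (lp_build alg) (load I) t1 s1 /\
    let L := lp_of_state s1 in
    lp_equivalent I L /\
    forall y : 'cV[R]_(lp_vars L), lp_optimal L y ->
    exists t2 s2, exec (lp_read alg) (put_solution s1 y) t2 s2 /\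
      sctm_solution (output_seeds (nodes I) s2) (output_value s2) /\
      t1%:R + kappa * (lp_size L)%:R `^ (5 / 2) + t2%:R <= time.

(* Main.v *)
(* A seed set is feasible iff some order of the nodes lets every other node collect its
   cost from the hyperedges in which enough members precede it. Orders of the bags of a
   tree decomposition, with the hyperedges as additional leaves, suffice: although
   orders that agree on common nodes need not extend to a global one, a nonempty set
   of nodes that are never activated has a member that is minimal in every bag
   containing it, and this member has collected its cost from activated predecessors.
   A table entry of a bag records the order, the seeds, and the benefit collected so
   far, truncated at the cost, which makes 2^O(w^2) theta^O(w) entries.

   Merging bags into their parents turns the table entries into the nodes of a directed
   hypergraph. The linear program asks for a unit flow of derivations from initial
   entries to the root. From the support of any flow one can read off a complete
   derivation, walking down from the root, and subtract a multiple of it; induction on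
   the support writes the flow as a convex combination of derivations. Hence the seed
   variables range over the convex hull of the feasible seed sets, and every derivation
   in the support of an optimal flow is optimal.

   The tree decomposition is grown bag by bag. The boundary of a component of the
   remaining nodes is split by a small vertex separator, found by augmenting paths for
   one of the bipartitions of the boundary; if there is none, then the current guess
   of the treewidth was too low. *)

Require Import Defs.
From HB Require Import structures.
From mathcomp Require Import all_boot all_order all_algebra.
From mathcomp Require Import boolp reals exp zify ring lra.

Import Order.TTheory GRing.Theory Num.Theory.

Set Implicit Arguments.
Unset Strict Implicit.
Unset Printing Implicit Defensive.

Local Open Scope nat_scope.

(** * Program logic with step counts *)

(** The machine starts from the bare instance and can only add and subtract, so even the tree
    decomposition is produced by explicit loops, and a digit is extracted by repeated subtraction,
    in time linear in the code; this is affordable because all codes stay below the table size. A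
    node keeps one of [K = 4 * q] colours, distinct inside each bag, so the digits of a child and of
    its parent line up without any search. Thresholds of at least 2 force [omega >= 1], hence
    [K <= 4 * omega + 8] gives at most [36 * omega] digits, in a base [b = K + max cost + 1] that is
    at most [2 ^ (5 * omega) * theta]. A table thus has at most [P = 2 ^ (180 * omega ^ 2) * theta ^
    (36 * omega)] codes. A merge has one variable for every pair of codes, so the linear program has
    size [O(P ^ 2 * (n + m))] and takes [O(P ^ 5 * (n + m) ^ (5 / 2))] steps; everything else takes
    [O(P ^ 4 * (n + m) ^ 2)]. The solver may return a point that is no vertex, which is why the
    answer is read from the support and not by rounding. *)

Inductive bx :=
  | BLe of nexpr & nexpr
  | BLt of nexpr & nexpr
  | BEq of nexpr & nexpr
  | BNot of bx
  | BAnd of bx & bx.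

(* An expression that is 0 exactly when the condition holds. *)
Fixpoint bz (b : bx) : nexpr :=
  match b with
  | BLe e1 e2 => NSub e1 e2
  | BLt e1 e2 => NSub (NAdd e1 (NCst 1)) e2
  | BEq e1 e2 => NAdd (NSub e1 e2) (NSub e2 e1)
  | BNot b1 => NSub (NCst 1) (bz b1)
  | BAnd b1 b2 => NAdd (bz b1) (bz b2)
  end.

Definition Var (x : nat) : nexpr := NGet x (NCst 0).
Definition If' (b : bx) := If (NLe (bz b) (NCst 0)).
Definition While' (b : bx) := While (NLe (bz b) (NCst 0)).
Definition Set' (x : nat) (e : nexpr) := NSet x (NCst 0) e.

(* Cell 0 of array [x] is the loop counter, cell 1 the bound. *)
Definition For (x : nat) (e : nexpr) (c : cmd) : cmd :=
  Seq (NSet x (NCst 1) e) (Seq (Set' x (NCst 0))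
    (While (NLe (NAdd (Var x) (NCst 1)) (NGet x (NCst 1)))
       (Seq c (Set' x (NAdd (Var x) (NCst 1)))))).

Fixpoint nwr (c : cmd) : seq nat :=
  match c with
  | NSet a _ _ => [:: a]
  | Seq c1 c2 | If _ c1 c2 => nwr c1 ++ nwr c2
  | While _ c1 => nwr c1
  | _ => [::]
  end.

Fixpoint rwr (c : cmd) : seq nat :=
  match c with
  | RSet a _ _ => [:: a]
  | Seq c1 c2 | If _ c1 c2 => rwr c1 ++ rwr c2
  | While _ c1 => rwr c1
  | _ => [::]
  end.

Declare Scope cmd_scope.
Delimit Scope cmd_scope with cmd.
Infix ";;" := Seq (at level 60, right associativity) : cmd_scope.
Infix "+" := NAdd : cmd_scope.
Infix "-" := NSub : cmd_scope.

Section WP.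
Variable R : realType.
Implicit Types (s : state R) (c : cmd) (Q : state R -> Prop).

Fixpoint beval s (b : bx) : bool :=
  match b with
  | BLe e1 e2 => neval s e1 <= neval s e2
  | BLt e1 e2 => neval s e1 < neval s e2
  | BEq e1 e2 => neval s e1 == neval s e2
  | BNot b1 => ~~ beval s b1
  | BAnd b1 b2 => beval s b1 && beval s b2
  end.

Lemma bzE s b : (neval s (bz b) == 0) = beval s b.
Proof.
elim: b => [e1 e2|e1 e2|e1 e2|b IH|b1 IH1 b2 IH2] /=.
- by rewrite subn_eq0.
- by rewrite subn_eq0 addn1.
- by rewrite addn_eq0 !subn_eq0 eqn_leq.
- by rewrite -IH; case: (neval s (bz b)) => [|k].
- by rewrite addn_eq0 IH1 IH2.
Qed.

Definition setn s a i v := State (upd (nmem s) a i v) (rmem s).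
Definition setr s a i v := State (nmem s) (upd (rmem s) a i v).

(** The arrays that a command can write are read off its text, so by [exec_frame] every
    specification carries its frame for free; [wp_call] hands it to the continuation. *)
Definition frame (c : cmd) s s' :=
  (forall a, a \notin nwr c -> nmem s' a = nmem s a) /\
  (forall a, a \notin rwr c -> rmem s' a = rmem s a).

Lemma upd_neq (T : Type) (mem : nat -> nat -> T) a i v b :
  b != a -> upd mem a i v b = mem b.
Proof. by move=> ne; apply: funext => j; rewrite /upd (negPf ne). Qed.

Lemma frn c s s' a : frame c s s' -> a \notin nwr c -> nmem s' a = nmem s a.
Proof. by case=> H _; exact: H. Qed.

Lemma frr c s s' a : frame c s s' -> a \notin rwr c -> rmem s' a = rmem s a.
Proof. by case=> _ H; exact: H. Qed.

Lemma frame_refl c s : frame c s s. Proof. by []. Qed.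

Lemma frame_trans c s1 s2 s3 : frame c s1 s2 -> frame c s2 s3 -> frame c s1 s3.
Proof.
move=> [n1 r1] [n2 r2]; split=> a H; first by rewrite n2 ?n1.
by rewrite r2 ?r1.
Qed.

Lemma frame_sub c c' s s' :
  {subset nwr c <= nwr c'} -> {subset rwr c <= rwr c'} ->
  frame c s s' -> frame c' s s'.
Proof.
move=> sn sr [n1 r1]; split=> a H; [apply: n1 | apply: r1].
- by apply: contra H => /sn.
- by apply: contra H => /sr.
Qed.

Lemma exec_frame c s t s' : exec c s t s' -> frame c s s'.
Proof.
elim=> {c s t s'}.
- by move=> s; exact: frame_refl.
- by move=> a i e s; split=> b //=; rewrite inE => ne; rewrite upd_neq.
- by move=> a i e s; split=> b //=; rewrite inE => ne; rewrite upd_neq.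
- move=> c1 c2 s s1 s2 t1 t2 _ f1 _ f2.
  apply: frame_trans; [apply: frame_sub f1|apply: frame_sub f2] => a /= H;
    by rewrite mem_cat H ?orbT.
- move=> b c1 c2 s s' t _ f; apply: frame_sub f => a /=; rewrite mem_cat;
  by case: teval => H; rewrite H ?orbT.
- by move=> b c s _; exact: frame_refl.
- by move=> b c s s1 s2 t1 t2 _ _ f1 _ f2; exact: frame_trans f1 f2.
Qed.

(** Total correctness with an upper bound on the steps, so that costs can be rounded up at every
    composition. *)
Definition wp c s (T : nat) Q :=
  exists t s', [/\ exec c s t s', t <= T & Q s'].

Lemma wp_mono c s T T' Q Q' :
  wp c s T Q -> T <= T' -> (forall s', frame c s s' -> Q s' -> Q' s') ->
  wp c s T' Q'.
Proof.
move=> [t [s' [e le q]]] leT H; exists t, s'; split=> //.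
- exact: leq_trans le leT.
- exact: H (exec_frame e) q.
Qed.

Lemma wp_call c s T Q Q' :
  wp c s T Q -> (forall s', frame c s s' -> Q s' -> Q' s') -> wp c s T Q'.
Proof. by move=> w H; exact: wp_mono w (leqnn T) H. Qed.

Lemma wp_le c s T T' Q : wp c s T Q -> T <= T' -> wp c s T' Q.
Proof. by move=> w le; exact: wp_mono w le _. Qed.

Lemma wp_skip s Q : Q s -> wp Skip s 1 Q.
Proof. by move=> q; exists 1, s; split=> //; constructor. Qed.

Lemma wp_nset s a i e Q :
  Q (setn s a (neval s i) (neval s e)) -> wp (NSet a i e) s 1 Q.
Proof. by move=> q; exists 1; eexists; split; [constructor| |exact: q]. Qed.

Lemma wp_rset s a i e Q :
  Q (setr s a (neval s i) (reval s e)) -> wp (RSet a i e) s 1 Q.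
Proof. by move=> q; exists 1; eexists; split; [constructor| |exact: q]. Qed.

Lemma wp_seq c1 c2 s T1 T2 Q :
  wp c1 s T1 (fun s1 => wp c2 s1 T2 Q) -> wp (Seq c1 c2) s (T1 + T2) Q.
Proof.
move=> [t1 [s1 [e1 le1 [t2 [s2 [e2 le2 q]]]]]].
by exists (t1 + t2), s2; split=> //; [econstructor; eauto | exact: leq_add].
Qed.

Lemma wp_test b c1 c2 s T1 T2 Q :
  (teval s b -> wp c1 s T1 Q) -> (~~ teval s b -> wp c2 s T2 Q) ->
  wp (If b c1 c2) s (T1 + T2).+1 Q.
Proof.
move=> h1 h2; case E: (teval s b).
- have [t [s' [e le q]]] := h1 E; exists t.+1, s'; split=> //.
  + by constructor; rewrite E.
  + by rewrite ltnS (leq_trans le) ?leq_addr.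
- have [|t [s' [e le q]]] := h2; first by rewrite E.
  exists t.+1, s'; split=> //; first by constructor; rewrite E.
  by rewrite ltnS (leq_trans le) ?leq_addl.
Qed.

Lemma wp_if b c1 c2 s T1 T2 Q :
  (beval s b -> wp c1 s T1 Q) -> (~~ beval s b -> wp c2 s T2 Q) ->
  wp (If' b c1 c2) s (T1 + T2).+1 Q.
Proof. by move=> h1 h2; apply: wp_test; rewrite /= leqn0 bzE. Qed.

(* [mu] is a potential paying for the remaining iterations. *)
Lemma wp_while b c s (Inv : state R -> Prop) (mu : state R -> nat) Q :
  Inv s ->
  (forall s1, frame c s s1 -> Inv s1 -> teval s1 b -> exists2 T, T < mu s1 &
     wp c s1 T (fun s2 => Inv s2 /\ T + mu s2 < mu s1)) ->
  (forall s1, frame c s s1 -> Inv s1 -> ~~ teval s1 b -> Q s1) ->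
  wp (While b c) s (mu s).+1 Q.
Proof.
move=> I0 st fin.
have H k : forall s1, frame c s s1 -> Inv s1 -> mu s1 <= k ->
  wp (While b c) s1 (mu s1).+1 Q.
  elim: k => [|k IH] s1 f1 I1 le.
    case E: (teval s1 b).
      by have [T lt _] := st s1 f1 I1 E; lia.
    exists 1, s1; split=> //; first by constructor; rewrite E.
    by apply: fin; rewrite ?E.
  case E: (teval s1 b); last first.
    exists 1, s1; split=> //; first by constructor; rewrite E.
    by apply: fin; rewrite ?E.
  have [T lt [t1 [s2 [e2 le2 [I2 m2]]]]] := st s1 f1 I1 E.
  have [||t2 [s3 [e3 le3 q]]] := IH s2 _ I2.
  - by apply: frame_trans f1 _; have := exec_frame e2.
  - lia.
  exists (t1 + t2).+1, s3; split=> //; first by econstructor; eauto.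
  lia.
exact: H (leqnn _).
Qed.

Lemma wp_while' b c s (Inv : state R -> Prop) (mu : state R -> nat) Q :
  Inv s ->
  (forall s1, frame c s s1 -> Inv s1 -> beval s1 b -> exists2 T, T < mu s1 &
     wp c s1 T (fun s2 => Inv s2 /\ T + mu s2 < mu s1)) ->
  (forall s1, frame c s s1 -> Inv s1 -> ~~ beval s1 b -> Q s1) ->
  wp (While' b c) s (mu s).+1 Q.
Proof.
move=> I0 st fin; apply: (wp_while (Inv := Inv)) => // s1; rewrite /= leqn0 bzE.
- exact: st.
- exact: fin.
Qed.

(** The invariant is indexed by the number of finished rounds and must be blind to the counter array
    [x]. Since the body does not write [x] either, the counter still equals the index after the
    body, and the bookkeeping of the loop never enters a body specification. *)
Lemma wp_for x e c s N T (Inv : nat -> state R -> Prop) Q :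
  neval s e = N ->
  x \notin nwr c ->
  (forall i s1 j v, Inv i s1 -> Inv i (setn s1 x j v)) ->
  Inv 0 s ->
  (forall i s1, i < N -> nmem s1 x 0 = i -> frame (For x e c) s s1 ->
     Inv i s1 -> wp c s1 T (Inv i.+1)) ->
  (forall s1, frame (For x e c) s s1 -> Inv N s1 -> Q s1) ->
  wp (For x e c) s (N * (T + 3) + 3) Q.
Proof.
move=> NE xc blind I0 st fin.
have fs s1 j v : frame (For x e c) s1 (setn s1 x j v).
  by split=> a //= H; rewrite upd_neq //; move: H; rewrite inE negb_or => /andP[].
have fc s1 s2 : frame c s1 s2 -> frame (For x e c) s1 s2.
  apply: frame_sub => a /= H; last by rewrite mem_cat H.
  by rewrite !inE mem_cat H !orbT.
pose s0 := setn (setn s x 1 N) x 0 0.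
have f0 : frame (For x e c) s s0 by apply: frame_trans (fs _ _ _) (fs _ _ _).
have H k : forall i s1, i + k = N -> nmem s1 x 0 = i -> nmem s1 x 1 = N ->
    frame (For x e c) s s1 -> Inv i s1 ->
    wp (While (NLe (NAdd (Var x) (NCst 1)) (NGet x (NCst 1)))
       (Seq c (Set' x (NAdd (Var x) (NCst 1))))) s1 (k * (T + 3) + 1) Q.
  elim: k => [|k IH] i s1 ik xi xN f1 I1.
    exists 1, s1; split; [|by lia|].
    - by constructor; rewrite /= xi xN -ik addn0 addn1 ltnn.
    - by apply: fin => //; rewrite -ik addn0 in I1 *.
  have [|t1 [s2 [e2 le2 I2]]] := st i s1 _ xi f1 I1; first by lia.
  have f12 := exec_frame e2.
  have x2 j : nmem s2 x j = nmem s1 x j by rewrite (proj1 f12 _ xc).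
  pose s3 := setn s2 x 0 i.+1.
  have [|||||t4 [s4 [e4 le4 q]]] := IH i.+1 s3.
  - lia.
  - by rewrite /s3 /= /upd !eqxx.
  - by rewrite /s3 /= /upd eqxx /= x2.
  - exact: frame_trans f1 (frame_trans (fc _ _ f12) (fs _ _ _)).
  - exact: blind.
  exists ((t1 + 1) + t4).+1, s4; split=> //.
  - apply: (ExecWhileStep (s1 := s3)) e4; first by rewrite /= xi xN; lia.
    apply: ExecSeq e2 _.
    have -> : s3 = State (upd (nmem s2) x (neval s2 (NCst 0))
         (neval s2 (NAdd (Var x) (NCst 1)))) (rmem s2).
      by rewrite /s3 /setn /= x2 xi addn1.
    exact: ExecNSet.
  - lia.
have [|||||t [s1 [e1 le1 q]]] := H N 0 s0.
- by [].
- by rewrite /s0 /= /upd !eqxx.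
- by rewrite /s0 /= /upd !eqxx.
- exact: f0.
- by apply: (blind 0); apply: (blind 0).
exists (1 + (1 + t)), s1; split=> //; last by lia.
rewrite /For; econstructor; first exact: ExecNSet.
econstructor; first exact: ExecNSet.
by rewrite -/(setn s x 1 _) /= NE.
Qed.

End WP.

(** * Codes in base [b] *)

Definition digit_of b c x := x %/ b ^ c %% b.

(** Lowest digit first, so that dropping a digit is one division by [b] and [digS] drives the
    inductions. *)
Fixpoint enc b (f : nat -> nat) (L : nat) : nat :=
  if L is L'.+1 then f 0 + b * enc b (fun c => f c.+1) L' else 0.

Lemma digS b c x : digit_of b c.+1 x = digit_of b c (x %/ b).
Proof. by rewrite /digit_of expnS divnMA. Qed.

Lemma enc_lt b f L : (forall c, c < L -> f c < b) -> enc b f L < b ^ L.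
Proof.
elim: L f => [|L IH] f H //=.
have := IH (fun c => f c.+1) (fun c lt => H c.+1 lt).
by have := H 0 isT; rewrite expnS; nia.
Qed.

Lemma dig_enc b f L c : (forall c, c < L -> f c < b) -> c < L ->
  digit_of b c (enc b f L) = f c.
Proof.
elim: L f c => [|L IH] f c H //= lt.
have f0 := H 0 isT; have b0 : 0 < b by lia.
case: c lt => [|c] lt.
  by rewrite /digit_of expn0 divn1 addnC mulnC modnMDl modn_small.
rewrite digS addnC mulnC divnMDl // divn_small // addn0 (IH (fun c => f c.+1)) //.
by move=> c' lt'; apply: H.
Qed.

Lemma eq_enc b f g L : (forall c, c < L -> f c = g c) -> enc b f L = enc b g L.
Proof.
elim: L f g => [|L IH] f g H //=; rewrite H // (IH _ (fun c => g c.+1)) //.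
by move=> c lt; apply: H.
Qed.

Lemma dig_lt b c x : 0 < b -> digit_of b c x < b.
Proof. by move=> b0; rewrite ltn_mod. Qed.

(** * Digits by repeated subtraction, codes and powers by repeated addition *)

Section Digits.
Variable R : realType.
Implicit Types s : state R.

Definition Decode tgt : cmd := (
  Set' 24 (Var 20) ;;
  For 25 (Var 22) (
    Set' 23 (NCst 0) ;;
    For 26 (Var 24) (
      If' (BLe (Var 21) (Var 24))
        (Set' 24 (Var 24 - Var 21) ;; Set' 23 (Var 23 + NCst 1)) Skip) ;;
    NSet tgt (Var 25) (Var 24) ;;
    Set' 24 (Var 23)))%cmd.

(** Each quotient is found by a loop with as many rounds as its dividend, hence the factor [x] in
    the cost. The bound on [tgt] keeps the digits clear of the scratch registers. *)
Lemma Decode_wp tgt s x b L : 27 < tgt ->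
  nmem s 20 0 = x -> nmem s 21 0 = b -> nmem s 22 0 = L -> 0 < b ->
  wp (Decode tgt) s (L * (x * 8 + 12) + 10)
    (fun s' => forall c, c < L -> nmem s' tgt c = digit_of b c x).
Proof.
move=> tg sx sb sL b0.
have tgn j : j <= 27 -> (tgt == j) = false by lia.
have tgn' j : j <= 27 -> (j == tgt) = false by lia.
eapply wp_le.
  eapply wp_seq; apply: wp_nset => /=.
  eapply (wp_for (T := x * 8 + 9) (Inv := fun i s1 => 
     nmem s1 24 0 = x %/ b ^ i /\ forall c, c < i -> nmem s1 tgt c = digit_of b c x)).
  - exact: sL.
  - by rewrite /= !inE ?tgn'.
  - by move=> i s1 j v /=; rewrite /upd !tgn.
  - by rewrite /= /upd /= sx expn0 divn1.
  - move=> i s1 iL xi [fr _] [r1 dg].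
    have b1 : nmem s1 21 0 = b.
      by rewrite fr // !inE ?tgn'.
    eapply wp_le.
      eapply wp_seq; apply: wp_nset => /=.
      (* Register 24 is the running remainder and 23 the quotient so far. The loop has more rounds
         than necessary; the disjunction says that each round so far subtracted unless the remainder
         was already below [b]. *)
      eapply wp_seq, (wp_for (T := 5) (Inv := fun k s2 => 
        [/\ nmem s2 24 0 + b * nmem s2 23 0 = x %/ b ^ i,
            nmem s2 24 0 < b \/ k <= nmem s2 23 0 &
            nmem s2 21 0 = b /\ forall c, c < i -> nmem s2 tgt c = digit_of b c x])).
      + exact: r1.
      + by [].
      + by move=> k s2 j v; rewrite /= /upd /= !tgn.
      + rewrite /= /upd /= r1 muln0 addn0; split=> //; first by right.
        by split=> // c lt; rewrite tgn //= dg.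
      + move=> k s2 kr _ _ [e2 o2 [b2 d2]].
        eapply wp_le; first apply: wp_if => /= [t|t].
        * eapply wp_seq; apply: wp_nset => /=; apply: wp_nset => /=.
          rewrite /upd /= !tgn //= b2 in t *.
          split; [nia| |by split=> // c lt; rewrite tgn //; exact: d2].
          by case: o2; [lia|right; lia].
        * apply: wp_skip; rewrite b2 in t; split=> //; left; lia.
        * by [].
      + move=> s2 [fr2 _] [e2 o2 [b2 d2]].
        have lt2 : nmem s2 24 0 < b by case: o2 => //; rewrite /= /upd /=; nia.
        eapply wp_seq; apply: wp_nset => /=; apply: wp_nset => /=.
        rewrite /upd /= eqxx /= !tgn' //= tgn //=.
        have xi2 : nmem s2 25 0 = i by rewrite fr2.
        split.
          by rewrite expnSr divnMA -e2 addnC mulnC divnMDl // divn_small // addn0.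
        move=> c; rewrite ltnS leq_eqVlt => /orP[/eqP->|lt]; rewrite xi2 ?eqxx.
          by rewrite /digit_of -e2 addnC mulnC modnMDl modn_small.
        by rewrite (ltn_eqF lt) d2.
    have : x %/ b ^ i <= x by apply: leq_div.
    lia.
  - by move=> s1 _ [].
rewrite /=; lia.
Qed.

Definition Encode : cmd := (
  Set' 29 (NCst 0) ;;
  For 25 (Var 22) (
    Set' 24 (NCst 0) ;;
    For 26 (Var 21) (Set' 24 (Var 24 + Var 29)) ;;
    Set' 29 (Var 24 + NGet 41 (Var 22 - NCst 1 - Var 25))))%cmd.

(** Horner's rule from the top digit down: after [i] rounds register 29 is the code of the [i]
    highest digits. *)
Lemma Encode_wp s b L :
  nmem s 21 0 = b -> nmem s 22 0 = L ->
  wp Encode s (L * (b * 4 + 8) + 4)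
    (fun s' => nmem s' 29 0 = enc b (nmem s 41) L).
Proof.
move=> sb sL; eapply wp_le.
  eapply wp_seq; apply: wp_nset => /=.
  eapply (wp_for (T := b * 4 + 5) (Inv := fun i s1 =>
     nmem s1 29 0 = enc b (fun c => nmem s 41 (L - i + c)) i)).
  - exact: sL.
  - by [].
  - by [].
  - by [].
  - move=> i s1 iL xi fr e1.
    have b1 : nmem s1 21 0 = b by rewrite (frn fr).
    have L1 : nmem s1 22 0 = L by rewrite (frn fr).
    eapply wp_le.
      eapply wp_seq; apply: wp_nset => /=.
      eapply wp_seq, (wp_for (T := 1) (Inv := fun k s2 =>
         nmem s2 24 0 = k * enc b (fun c => nmem s 41 (L - i + c)) i)).
      + exact: b1.
      + by [].
      + by [].
      + by [].
      + move=> k s2 kb _ fr2 e2; apply: wp_nset => /=.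
        by rewrite /upd /= e2 (frn fr2) //= /upd /= e1; lia.
      + move=> s2 fr2 e2; apply: wp_nset => /=; rewrite /upd /= e2.
        rewrite !(frn fr2) //= /upd /= (frn fr) //= L1 xi /upd /=.
        rewrite addnC; congr (_ + _); first by congr (nmem s 41 _); lia.
        congr (_ * _); apply: eq_enc => c lt; congr (nmem s 41 _); lia.
    lia.
  - by move=> s1 _ ->; apply: eq_enc => c lt; rewrite subnn.
rewrite /=; lia.
Qed.

Definition Pow : cmd := (
  Set' 30 (NCst 1) ;;
  For 25 (Var 22) (
    Set' 24 (NCst 0) ;;
    For 26 (Var 21) (Set' 24 (Var 24 + Var 30)) ;;
    Set' 30 (Var 24)))%cmd.

Lemma Pow_wp s b L :
  nmem s 21 0 = b -> nmem s 22 0 = L ->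
  wp Pow s (L * (b * 4 + 8) + 4) (fun s' => nmem s' 30 0 = b ^ L).
Proof.
move=> sb sL; eapply wp_le.
  eapply wp_seq; apply: wp_nset => /=.
  eapply (wp_for (T := b * 4 + 5) (Inv := fun i s1 => nmem s1 30 0 = b ^ i)).
  - exact: sL.
  - by [].
  - by [].
  - by [].
  - move=> i s1 iL xi fr e1.
    have b1 : nmem s1 21 0 = b by rewrite (frn fr).
    eapply wp_le.
      eapply wp_seq; apply: wp_nset => /=.
      eapply wp_seq, (wp_for (T := 1) (Inv := fun k s2 => nmem s2 24 0 = k * b ^ i)).
      + exact: b1.
      + by [].
      + by [].
      + by [].
      + move=> k s2 kb _ fr2 e2; apply: wp_nset => /=.
        by rewrite /upd /= e2 (frn fr2) //= /upd /= e1; lia.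
      + by move=> s2 fr2 e2; apply: wp_nset => /=; rewrite /upd /= e2 expnS.
    lia.
  - by move=> s1 _ ->.
rewrite /=; lia.
Qed.

End Digits.

Local Notation eN := (NGet 0 (NCst 0)).
Local Notation eM := (NGet 0 (NCst 1)).
Local Notation eL := (NGet 0 (NCst 2)).
Local Notation eS := (eN + eN + eM)%cmd.
Local Notation eT := (eN + eN + eM + NCst 1)%cmd.
Local Notation eX := (eN + eN + eM + NCst 2)%cmd.
Local Notation eA := (eN + eN + eN + eL + eL)%cmd.

(** * Breadth-first search *)

(** The list of a vertex holds every arc that may start there after some reversals, so the scan
    first compares the present tail of the arc with the current vertex. *)
Definition BfsScan : cmd := (
  Set' 65 (NGet 62 (NGet 63 (Var 64) + Var 68)) ;;
  Set' 66 (NGet 51 (Var 65)) ;;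
  If' (BAnd (BEq (NGet 50 (Var 65)) (Var 64)) (BEq (NGet 56 (Var 66)) (NCst 0)))
    (NSet 56 (Var 66) (NCst 1) ;; NSet 60 (Var 66) (Var 65) ;;
     NSet 57 (Var 58) (Var 66) ;; Set' 58 (Var 58 + NCst 1))
    Skip)%cmd.

Definition BfsVisit : cmd := (
  Set' 64 (NGet 57 (Var 59)) ;;
  For 68 (NGet 61 (Var 64)) BfsScan ;;
  Set' 59 (Var 59 + NCst 1))%cmd.

Definition Bfs : cmd := (
  For 67 eX (NSet 56 (Var 67) (NCst 0)) ;;
  NSet 56 eS (NCst 1) ;; NSet 57 (NCst 0) eS ;;
  Set' 58 (NCst 1) ;; Set' 59 (NCst 0) ;;
  While' (BLt (Var 59) (Var 58)) BfsVisit)%cmd.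

Section Bfs.
Variable R : realType.
Implicit Types s : state R.
Variables (X A src : nat) (tl hd deg base : nat -> nat) (adj : nat -> nat).

(** Only the present tail of an arc must list it; longer lists are allowed, and this is what makes
    the property survive reversals. *)
Definition arcs_listed :=
  [/\ forall a, a < A -> tl a < X /\ hd a < X,
      forall a, a < A -> exists2 d, d < deg (tl a) & adj (base (tl a) + d) = a &
      forall x d, x < X -> d < deg x -> adj (base x + d) < A].

Definition graph_in s :=
  [/\ nmem s 50 =1 tl, nmem s 51 =1 hd, nmem s 61 =1 deg,
      nmem s 62 =1 adj & nmem s 63 =1 base].

(* [qs] is the queue, in order of discovery. *)
Definition search_tree (par : nat -> nat) (qs : seq nat) :=
  [/\ uniq qs, all (gtn X) qs, nth 0 qs 0 = src, 0 < size qs &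
      forall i, 0 < i < size qs -> let a := par (nth 0 qs i) in
        [/\ a < A, hd a = nth 0 qs i & index (tl a) qs < i]].

Definition queue_in s qs :=
  [/\ search_tree (nmem s 60) qs, nmem s 58 0 = size qs,
      forall i, i < size qs -> nmem s 57 i = nth 0 qs i &
      forall x, x < X -> nmem s 56 x = (x \in qs)].

Lemma search_tree_rcons par qs x a : search_tree par qs ->
  a < A -> tl a \in qs -> hd a = x -> x < X -> x \notin qs ->
  search_tree (fun y => if y == x then a else par y) (rcons qs x).
Proof.
move=> [u al h0 sz pr] aA ta ha xX xq; split.
- by rewrite rcons_uniq xq.
- by rewrite all_rcons /= xX.
- by rewrite nth_rcons sz.
- by rewrite size_rcons.
- rewrite size_rcons => i /andP[i0]; rewrite ltnS leq_eqVlt nth_rcons => /orP[/eqP ->|lt].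
    rewrite ltnn !eqxx; split=> //.
    by rewrite -cats1 index_cat ta index_mem.
  rewrite lt /=; have ne : nth 0 qs i != x.
    by apply: contraNneq xq => <-; rewrite mem_nth.
  rewrite (negPf ne); have [aA' ha' it] := pr i (introT andP (conj i0 lt)).
  split=> //; rewrite -cats1 index_cat.
  have -> // : tl (par (nth 0 qs i)) \in qs.
  by rewrite -index_mem; apply: ltn_trans it lt.
Qed.

Lemma eq_search_tree par par' qs : {in qs, par =1 par'} ->
  search_tree par qs -> search_tree par' qs.
Proof.
move=> E [u al h0 sz pr]; split=> // i /[dup] /andP[i0 lt] /pr /=.
by rewrite -E ?mem_nth.
Qed.

Lemma graph_frame c s s' : frame c s s' ->
  all (fun a => a \notin nwr c) [:: 50; 51; 61; 62; 63] ->
  graph_in s -> graph_in s'.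
Proof.
by move=> fr /and5P[? ? ? ? /andP[? _]] [? ? ? ? ?]; split=> y; rewrite (frn fr).
Qed.

Hypothesis listed : arcs_listed.

Lemma BfsScan_wp s qs x d :
  graph_in s -> queue_in s qs -> nmem s 64 0 = x -> nmem s 68 0 = d ->
  x < X -> x \in qs -> d < deg x ->
  wp BfsScan s 8 (fun s' => exists2 t, queue_in s' (qs ++ t) &
     forall a, a = adj (base x + d) -> tl a = x -> hd a \in qs ++ t).
Proof.
move=> [Et Eh Ed Ea Eb] [st szq qn mk] sx sd xX xq dx.
have [Htl _ HA] := listed.
have aA := HA _ _ xX dx.
have [_ hX] := Htl _ aA.
set a := adj (base x + d) in aA hX.
eapply wp_le.
  eapply wp_seq; apply: wp_nset => /=.
  eapply wp_seq; apply: wp_nset => /=.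
  apply: wp_if => /=; rewrite /upd /= Eb sx sd Ea -/a Et Eh => t.
    case/andP: t => /eqP ta; rewrite mk // eqb0 => hq.
    eapply wp_seq; apply: wp_nset => /=.
    eapply wp_seq; apply: wp_nset => /=.
    eapply wp_seq; apply: wp_nset => /=.
    apply: wp_nset => /=.
    exists [:: hd a]; last by move=> _ -> _; rewrite mem_cat inE eqxx orbT.
    rewrite cats1 /queue_in /= /upd /= szq.
    split.
    + apply: eq_search_tree (search_tree_rcons st aA _ erefl hX hq); last by rewrite ta.
      by move=> y _ /=; case: eqP.
    + by rewrite size_rcons addn1.
    + move=> i; rewrite size_rcons ltnS nth_rcons; case: ltngtP => // lt _.
      exact: qn.
    + move=> y yX; rewrite mem_rcons inE; case: eqP => //= _; exact: mk.
  apply: wp_skip => /=.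
  exists [::]; rewrite cats0; last first.
    by move=> b -> tb; move: t; rewrite tb eqxx mk // eqb0 negbK.
  by split.
by [].
Qed.

Lemma BfsVisit_wp s qs qi :
  graph_in s -> queue_in s qs -> nmem s 59 0 = qi -> qi < size qs ->
  let x := nth 0 qs qi in
  wp BfsVisit s (deg x * 11 + 5) (fun s' => nmem s' 59 0 = qi.+1 /\
    exists2 t, queue_in s' (qs ++ t) &
     forall a, a < A -> tl a = x -> hd a \in qs ++ t).
Proof.
move=> g q sqi lt x.
have [Et Eh Ed Ea Eb] := g.
have [[_ /allP al _ _ _] _ qn _] := q.
have xq : x \in qs by apply: mem_nth.
have xX : x < X by apply: al.
have [_ Hadj HA] := listed.
eapply wp_le.
  eapply wp_seq; apply: wp_nset => /=.
  eapply wp_seq, (wp_for (T := 8) (Inv := fun d s1 => exists2 t, queue_in s1 (qs ++ t) &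
     forall a d', d' < d -> a = adj (base x + d') -> tl a = x -> hd a \in qs ++ t)).
  - by rewrite /= /upd /= sqi qn // Ed.
  - by [].
  - by [].
  - by exists [::]; rewrite ?cats0.
  - move=> d s1 dlt sd fr [t q1 H].
    eapply wp_call.
      apply: (BfsScan_wp (x := x) (d := d) (qs := qs ++ t)) => //.
      + by apply: (graph_frame fr).
      + by rewrite (frn fr) //= /upd /= sqi qn.
      + by rewrite mem_cat xq.
    move=> s2 _ [t' q2 H2]; exists (t ++ t'); first by rewrite catA.
    move=> a d'; rewrite catA ltnS leq_eqVlt => /orP[/eqP ->|lt']; first exact: H2.
    by move=> ea ta; rewrite mem_cat (H a d').
  - move=> s1 fr [t q1 H]; apply: wp_nset => /=.
    rewrite /upd /= (frn fr) //= /upd /= sqi addn1; split=> //.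
    exists t => // a aA ta.
    by have [d dlt ed] := Hadj a aA; rewrite ta in dlt ed; exact: (H a d).
rewrite -/x; lia.
Qed.

Lemma Bfs_wp s n m :
  graph_in s -> nmem s 0 0 = n -> nmem s 0 1 = m -> X = n + n + m + 2 ->
  src = n + n + m ->
  wp Bfs s (X * 30 + \sum_(x < X) deg x * 11 + 20) (fun s' => exists qs,
    queue_in s' qs /\ forall a, a < A -> tl a \in qs -> hd a \in qs).
Proof.
move=> g sn sm EX Es.
(* The potential charges every vertex not yet taken from the queue with the cost of its visit. The
   queue has no repetitions, so a visit releases exactly its own charge. *)
pose mu s1 := \sum_(x < X | val x \notin mkseq (nmem s1 57) (nmem s1 59 0)) (deg x * 11 + 10).
eapply wp_le.
  eapply wp_seq, (wp_for (T := 1) (Inv := fun i s1 => forall x, x < i -> nmem s1 56 x = 0)).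
  - by rewrite /= sn sm.
  - by [].
  - by [].
  - by [].
  - move=> i s1 iX xi fr H; apply: wp_nset => /= x; rewrite /upd /= xi ltnS leq_eqVlt.
    by case: eqP => //= _; exact: H.
  - move=> s1 fr H.
    have g1 : graph_in s1 by apply: (graph_frame fr).
    have sn1 : nmem s1 0 0 = n by rewrite (frn fr).
    have sm1 : nmem s1 0 1 = m by rewrite (frn fr).
    eapply wp_seq; apply: wp_nset => /=.
    eapply wp_seq; apply: wp_nset => /=.
    eapply wp_seq; apply: wp_nset => /=.
    eapply wp_seq; apply: wp_nset => /=.
    apply: (wp_le (T := (\sum_(x < X) (deg x * 11 + 10)).+1)); last exact: leqnn.
    set s2 := setn _ _ _ _.
    have <- : mu s2 = \sum_(x < X) (deg x * 11 + 10) by apply: eq_bigl.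
    apply: (wp_while' (Inv := fun s3 => graph_in s3 /\ exists qs, 
      [/\ queue_in s3 qs, nmem s3 59 0 <= size qs &
        forall a, a < A -> tl a \in take (nmem s3 59 0) qs -> hd a \in qs])).
    + split=> //; exists [:: src]; split=> //; split.
      * by split=> //=; rewrite ?andbT; try lia; case=> [|[]].
      * by [].
      * by case=> // _ /=; rewrite /upd /= sn1 sm1 Es.
      * move=> x xX; rewrite /= /upd /= sn1 sm1 Es inE; case: eqP => //= _.
        by apply: H; rewrite -EX.
    + move=> s3 _ [g3 [qs [q3 le3 cl]]] /= lt.
      have [[u al _ _ _] szq qn _] := q3; rewrite szq in lt.
      set qi := nmem s3 59 0 in le3 cl lt.
      set x := nth 0 qs qi.
      have mk k : k <= size qs -> mkseq (nmem s3 57) k = take k qs.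
        move=> le; apply: (@eq_from_nth _ 0); first by rewrite size_mkseq size_take_min; lia.
        by move=> i; rewrite size_mkseq => ik; rewrite nth_mkseq // nth_take // qn //; lia.
      have xX : x < X by apply: (allP al); exact: mem_nth.
      have muE : mu s3 = deg x * 11 + 10 + \sum_(y < X | val y \notin take qi.+1 qs) (deg y * 11 + 10).
        rewrite /mu -/qi mk 1?ltnW //.
        rewrite (bigD1 (Ordinal xX)) /=; last first.
          move: u; rewrite -{1}(cat_take_drop qi.+1 qs) cat_uniq (take_nth 0 lt).
          by rewrite rcons_uniq => /andP[/andP[]].
        congr (_ + _); apply: eq_bigl => y.
        by rewrite (take_nth 0 lt) mem_rcons inE negb_or andbC; congr (_ && _).
      exists (deg x * 11 + 5); first by rewrite muE; lia.
      eapply wp_call; first by apply: (BfsVisit_wp g3 q3 (qi := qi)).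
      move=> s4 fr4 [qi4 [t q4 cl4]]; split.
        split; first by apply: (graph_frame fr4).
        exists (qs ++ t); split=> //; first by rewrite qi4 size_cat; lia.
        move=> a aA; rewrite qi4 takel_cat // (take_nth 0 lt) mem_rcons inE.
        case/orP=> [/eqP ta|ta]; first exact: cl4.
        by rewrite mem_cat cl.
      have -> : mu s4 = \sum_(y < X | val y \notin take qi.+1 qs) (deg y * 11 + 10).
        have [_ _ qn4 _] := q4.
        rewrite /mu qi4; apply: eq_bigl => y; congr (_ \notin _).
        apply: (@eq_from_nth _ 0); first by rewrite size_mkseq size_take_min; lia.
        move=> i; rewrite size_mkseq => ik; rewrite nth_mkseq // nth_take // qn4 ?nth_cat ?size_cat; try lia.
        by rewrite ifT //; lia.
      by rewrite muE; lia.
    + move=> s3 _ [_ [qs [q3 le3 cl]]] /=; rewrite -leqNgt => le.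
      exists qs; split=> // a aA ta; apply: cl => //.
      by case: q3 le => _ -> _ _ le; rewrite take_oversize.
rewrite big_split /= sum_nat_const card_ord; lia.
Qed.

End Bfs.

(** * Maximum flow by path reversal *)

(* The arrays [tl] and [hd] describe the residual graph: augmenting along a path
   swaps the ends of its arcs. *)
Definition Augment : cmd := (
  Set' 64 eT ;;
  While' (BNot (BEq (Var 64) eS)) (
    Set' 65 (NGet 60 (Var 64)) ;;
    Set' 66 (NGet 50 (Var 65)) ;;
    NSet 50 (Var 65) (Var 64) ;;
    NSet 51 (Var 65) (Var 66) ;;
    Set' 64 (Var 66)))%cmd.

Definition Flow : cmd := (
  Set' 70 (NCst 0) ;;
  For 71 (Var 31 + NCst 1) (
    If' (BEq (Var 70) (NCst 0))
      (Bfs ;; If' (BEq (NGet 56 eT) (NCst 0)) (Set' 70 (NCst 1)) Augment)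
      Skip))%cmd.

(** * Counting the arcs across a vertex set *)

Section Cuts.
Variable A : nat.
Implicit Types (tl hd : nat -> nat) (U : pred nat).

Definition leaving tl hd U := \sum_(a < A) (U (tl a) && ~~ U (hd a)).

(** Arcs leaving [U] minus arcs entering it. Reversals keep the sum of the two numbers, and
    reversing a path from source to target lowers the difference by 2 for every separating [U]. The
    number of augmentations is therefore visible in these counts, and no flow function has to be
    maintained. *)
Definition net tl hd U : int :=
  (\sum_(a < A) ((U (tl a))%:Z - (U (hd a))%:Z))%R.

Definition swapped tl hd tl' hd' := forall a, a < A ->
  (tl' a = tl a /\ hd' a = hd a) \/ (tl' a = hd a /\ hd' a = tl a).

Lemma net_leaving tl hd U :
  net tl hd U = ((leaving tl hd U)%:Z - (leaving hd tl U)%:Z)%R.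
Proof.
rewrite /net /leaving -!natz !natr_sum -sumrB; apply: eq_bigr => a _.
by rewrite !natz; case: (U (tl a)); case: (U (hd a)).
Qed.

Lemma swapped_crossing tl hd tl' hd' U : swapped tl hd tl' hd' ->
  leaving tl' hd' U + leaving hd' tl' U = leaving tl hd U + leaving hd tl U.
Proof.
move=> sw; rewrite /leaving -!big_split /=; apply: eq_bigr => a _.
by case: (sw a (ltn_ord a)) => -[-> ->] //; rewrite addnC.
Qed.

Lemma net_swap1 tl hd tl' hd' a0 U : a0 < A ->
  tl' a0 = hd a0 -> hd' a0 = tl a0 ->
  (forall a, a != a0 -> tl' a = tl a /\ hd' a = hd a) ->
  (net tl' hd' U = net tl hd U - 2 * ((U (tl a0))%:Z - (U (hd a0))%:Z))%R.
Proof.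
move=> a0A t0 h0 E; rewrite /net (bigD1 (Ordinal a0A)) //= t0 h0.
rewrite [in RHS](bigD1 (Ordinal a0A)) //=.
rewrite (eq_bigr (fun a : 'I_A => (U (tl a))%:Z - (U (hd a))%:Z)%R); first by ring.
by move=> a ne; have [|-> ->] := E a; first by rewrite -val_eqE in ne.
Qed.

End Cuts.

Section Flow.
Variable R : realType.
Implicit Types s : state R.
Variables (n m A : nat) (deg base adj : nat -> nat).
Let X := n + n + m + 2.
Let src := n + n + m.
Let tgt := n + n + m + 1.

(** Reversing the arc from [tl a] to [x] changes the net count by [-2 * (U (tl a) - U x)], and along
    the walk from the target back to the source these terms telescope. *)
Lemma Augment_wp s tl hd qs :
  nmem s 0 0 = n -> nmem s 0 1 = m ->
  nmem s 50 =1 tl -> nmem s 51 =1 hd ->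
  search_tree X A src tl hd (nmem s 60) qs -> tgt \in qs ->
  wp Augment s (X * 10 + 10) (fun s' =>
    swapped A tl hd (nmem s' 50) (nmem s' 51) /\
    forall U : pred nat, U src -> ~~ U tgt ->
      (net A (nmem s' 50) (nmem s' 51) U = net A tl hd U - 2)%R).
Proof.
move=> sn sm Et Eh st tq; have [u al h0 sz pr] := st.
have sX : size qs <= X.
  rewrite -(size_iota 0 X); apply: uniq_leq_size => // x xq.
  by rewrite mem_iota /= add0n; apply: (allP al).
pose mu s1 := index (nmem s1 64 0) qs * 9.
eapply wp_le.
  eapply wp_seq; apply: wp_nset => /=; rewrite /= sn sm -/tgt.
  apply: (wp_le (T := (tgt * 0 + X * 9).+1)); last exact: leqnn.
  set s0 := setn _ _ _ _.
  apply: (@wp_le _ _ _ (mu s0).+1); last first.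
    by rewrite ltnS muln0 add0n leq_mul2r /=; apply: leq_trans sX; apply: ltnW; rewrite index_mem.
  apply: (wp_while' (mu := mu) (Inv := fun s1 =>
    [/\ nmem s1 64 0 \in qs, swapped A tl hd (nmem s1 50) (nmem s1 51),
      forall i, 0 < i <= index (nmem s1 64 0) qs -> let a := nmem s 60 (nth 0 qs i) in
        nmem s1 50 a = tl a /\ nmem s1 51 a = hd a &
      forall U : pred nat, (net A (nmem s1 50) (nmem s1 51) U =
         net A tl hd U - 2 * ((U (nmem s1 64 0))%:Z - (U tgt)%:Z))%R])).
  - rewrite /s0 /=; split=> //.
    + by move=> a _; left; rewrite /upd /= Et Eh.
    + by move=> i _ /=; rewrite /upd /= Et Eh.
    + move=> U; rewrite {3}/upd /= subrr mulr0 subr0.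
      by apply: eq_bigr => a _; rewrite /upd /= Et Eh.
  - move=> s1 fr [xq sw un nt] /=.
    have -> : nmem s1 0 = nmem s 0 by rewrite (frn fr) //= upd_neq.
    rewrite sn sm -/src => xs.
    set x := nmem s1 64 0 in xq un nt xs.
    have ix : index x qs < size qs by rewrite index_mem.
    have ix0 : 0 < index x qs.
      rewrite lt0n; apply: contraNneq xs => E.
      by rewrite -(nth_index 0 xq) E h0.
    have := pr _ (introT andP (conj ix0 ix)); rewrite (nth_index 0 xq) /=.
    set a := nmem s 60 x => -[aA ha it].
    have [|ta1 ha1] := un (index x qs); first by rewrite ix0 leqnn.
    rewrite (nth_index 0 xq) -/a in ta1 ha1.
    have pa : nmem s1 60 = nmem s 60 by rewrite (frn fr) //= upd_neq.
    have tq1 : tl a \in qs by rewrite -index_mem; apply: ltn_trans ix.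
    exists 5; first by rewrite /mu -/x; lia.
    eapply wp_le; last exact: (leqnn 5).
    apply: (wp_seq (T1 := 1) (T2 := 4)); apply: wp_nset; rewrite /= pa -/x -/a.
    apply: (wp_seq (T1 := 1) (T2 := 3)); apply: wp_nset; rewrite /= {2}/upd /= /upd /= -/(upd _) ta1.
    apply: (wp_seq (T1 := 1) (T2 := 2)); apply: wp_nset; rewrite /= /upd /= -/(upd _) -/x.
    apply: (wp_seq (T1 := 1) (T2 := 1)); apply: wp_nset; rewrite /= /upd /= -/(upd _).
    apply: wp_nset; rewrite /= /upd /=.
    have E2 : forall U : pred nat, (net A (fun i' => if i' == a then x else nmem s1 50 i')
        (fun i' => if i' == a then tl a else nmem s1 51 i') U =
        net A (nmem s1 50) (nmem s1 51) U - 2 * ((U (tl a))%:Z - (U x)%:Z))%R.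
      move=> U; rewrite (@net_swap1 A (nmem s1 50) (nmem s1 51) _ _ a) ?eqxx ?ta1 ?ha1 ?ha //.
      by move=> b /negPf ->.
    split; last by rewrite /mu /= /upd /= -/x; lia.
    split=> //.
    + move=> b bA; case: eqP => [->|_]; last exact: sw.
      by right; rewrite ha.
    (* Parent arcs of different queue positions have different heads, so the reversal leaves the
       rest of the path intact. *)
    + move=> i /andP[i0 il]; have ne : nmem s 60 (nth 0 qs i) != a.
        apply/eqP => E; have ilt : i < size qs by lia.
        have [_ hi _] := pr i (introT andP (conj i0 ilt)).
        move: it il; rewrite E ha in hi; rewrite hi index_uniq //; lia.
      by rewrite (negPf ne); apply: un; rewrite i0 /=; lia.
    + by move=> U; rewrite E2 nt; ring.
  - move=> s1 fr [xq sw un nt] /=.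
    have -> : nmem s1 0 = nmem s 0 by rewrite (frn fr) //= upd_neq.
    rewrite negbK sn sm -/src => /eqP xs.
    by split=> // U Us Ut; rewrite nt xs Us (negPf Ut) subr0 mulr1.
rewrite muln0; lia.
Qed.

Variables (tl0 hd0 : nat -> nat).
Hypothesis listed0 : arcs_listed X A tl0 hd0 deg base adj.
Hypothesis listed0' : arcs_listed X A hd0 tl0 deg base adj.

Lemma swapped_listed tl hd : swapped A tl0 hd0 tl hd -> arcs_listed X A tl hd deg base adj.
Proof.
move=> sw; have [h1 h2 h3] := listed0; have [h1' h2' h3'] := listed0'.
by split=> // a aA; have [[-> e]|[-> e]] := sw a aA; rewrite ?e; auto.
Qed.

Lemma swapped_trans tl hd tl' hd' : swapped A tl0 hd0 tl hd ->
  swapped A tl hd tl' hd' -> swapped A tl0 hd0 tl' hd'.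
Proof.
move=> sw sw' a aA; have := sw a aA; have := sw' a aA.
by case=> -[-> ->] [] [-> ->]; auto.
Qed.

Definition flow_cost p := (p + 1) * (X * 40 + \sum_(x < X) deg x * 11 + 50) + 10.

Lemma Flow_wp s p :
  nmem s 0 0 = n -> nmem s 0 1 = m -> nmem s 31 0 = p ->
  graph_in tl0 hd0 deg base adj s ->
  wp Flow s (flow_cost p) (fun s' =>
    if nmem s' 70 0 == 0
    then forall U : pred nat, U src -> ~~ U tgt -> p < leaving A tl0 hd0 U
    else exists U : pred nat, [/\ nmem s' 70 0 = 1, U src, ~~ U tgt,
       leaving A tl0 hd0 U <= p & forall x, x < X -> nmem s' 56 x = U x]).
Proof.
move=> sn sm sp g; have [Et Eh Ed Ea Eb] := g.
eapply wp_le.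
  eapply wp_seq; apply: wp_nset => /=.
  eapply (wp_for (T := X * 40 + \sum_(x < X) deg x * 11 + 40) (Inv := fun i s1 =>
    if nmem s1 70 0 == 0
    then swapped A tl0 hd0 (nmem s1 50) (nmem s1 51) /\
      forall U : pred nat, U src -> ~~ U tgt ->
      (net A (nmem s1 50) (nmem s1 51) U = net A tl0 hd0 U - (2 * i)%:Z)%R
    else exists U : pred nat, [/\ nmem s1 70 0 = 1, U src, ~~ U tgt,
       leaving A tl0 hd0 U <= p & forall x, x < X -> nmem s1 56 x = U x])).
  - by rewrite /= /upd /= sp.
  - by [].
  - by [].
  - rewrite /=; split; first by move=> a aA; left; rewrite /upd /= Et Eh.
    move=> U _ _; rewrite muln0 subr0.
    by apply: eq_bigr => a _; rewrite /upd /= Et Eh.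
  - move=> i s1 ip _ fr I1; eapply wp_le; first apply: wp_if => /= f0.
    + move: I1; rewrite f0 => -[sw nt].
      have f0s : nmem s1 0 = nmem s 0 by rewrite (frn fr) //= upd_neq.
      have lst := swapped_listed sw.
      eapply wp_seq, wp_call.
        apply: (@Bfs_wp _ X A src (nmem s1 50) (nmem s1 51) deg base adj lst s1 n m) => //.
        * by split=> y //; rewrite (frn fr) //= /upd /=.
        * by rewrite f0s.
        * by rewrite f0s.
      move=> s2 fr2 [qs [[st szq qn mk] cl]] /=.
      have tgX : tgt < X by rewrite /tgt /X; lia.
      have srX : src < X by rewrite /src /X; lia.
      have n2 : nmem s2 0 0 = n by rewrite (frn fr2) ?f0s.
      have m2 : nmem s2 0 1 = m by rewrite (frn fr2) ?f0s.
      apply: wp_if => /=; rewrite n2 m2 -/tgt mk // eqb0 => tq.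
      * apply: wp_nset => /=; rewrite {1}/upd /=.
        have sq : src \in qs by case: st => _ _ <- sz _; rewrite mem_nth.
        exists (mem qs); split=> //.
        (* The reached set is closed, so no residual arc leaves it, while the number of arcs across
           it has not changed. Hence the arcs that originally left it are as many as the
           augmentations so far, which is at most [p]. *)
        have l0 : leaving A (nmem s1 50) (nmem s1 51) (mem qs) = 0.
          rewrite /leaving big1 // => a _; case: (boolP (mem qs _)) => //= ta.
          by rewrite (cl a) //.
        have := nt (mem qs) sq tq; rewrite !net_leaving l0.
        have := swapped_crossing (mem qs) sw; rewrite l0; lia.
      * eapply wp_call.
          apply: (@Augment_wp s2 (nmem s1 50) (nmem s1 51) qs) => //.
          - by move=> y; rewrite (frn fr2).
          - by move=> y; rewrite (frn fr2).
          - by rewrite negbK in tq.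
        move=> s3 fr3 [sw3 nt3]; rewrite (frn fr3) // (frn fr2) // f0; split.
          exact: swapped_trans sw sw3.
        by move=> U Us Ut; rewrite nt3 // nt //; lia.
    + by apply: wp_skip; move: I1; rewrite (negPf f0).
    + rewrite /=; lia.
  (* After [p + 1] augmentations half of the drop of the net count is [p + 1]; what still leaves [U]
     is not negative, so more than [p] arcs left it originally. *)
  - move=> s1 _; case: eqP => // _ [sw nt] U Us Ut.
    have := nt U Us Ut; rewrite !net_leaving.
    have := swapped_crossing U sw; lia.
rewrite /flow_cost; lia.
Qed.

End Flow.

(** * The flow network of the hypergraph *)

(* Node [i] is split into [i] and [n + i], hyperedge [j] is the vertex [2n + j], and
   [2n + m], [2n + m + 1] are the source and the target. The flags in arrays 53 to
   55 enable the arc through a node and its arcs from the source and to the target;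
   disabled arcs are loops. *)
Definition InitArcs : cmd :=
  For 67 eA (
    If' (BLt (Var 67) eN)
      (NSet 50 (Var 67) (Var 67) ;;
       If' (BEq (NGet 53 (Var 67)) (NCst 0))
         (NSet 51 (Var 67) (Var 67)) (NSet 51 (Var 67) (eN + Var 67)))
    (If' (BLt (Var 67) (eN + eN))
      (NSet 50 (Var 67) eS ;;
       If' (BEq (NGet 54 (Var 67 - eN)) (NCst 0))
         (NSet 51 (Var 67) eS) (NSet 51 (Var 67) (Var 67 - eN)))
    (If' (BLt (Var 67) (eN + eN + eN))
      (NSet 51 (Var 67) eT ;;
       If' (BEq (NGet 55 (Var 67 - (eN + eN))) (NCst 0))
         (NSet 50 (Var 67) eT) (NSet 50 (Var 67) (Var 67 - eN)))
    (If' (BLt (Var 67) (eN + eN + eN + eL))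
      (NSet 50 (Var 67) (eN + NGet 2 (Var 67 - (eN + eN + eN))) ;;
       NSet 51 (Var 67) (eN + eN + NGet 1 (Var 67 - (eN + eN + eN))))
      (NSet 50 (Var 67) (eN + eN + NGet 1 (Var 67 - (eN + eN + eN) - eL)) ;;
       NSet 51 (Var 67) (NGet 2 (Var 67 - (eN + eN + eN) - eL)))))))%cmd.

Definition SetLabels : cmd :=
  For 67 eA (
    If' (BLt (Var 67) eN) (NSet 52 (Var 67) (Var 67))
    (If' (BLt (Var 67) (eN + eN)) (NSet 52 (Var 67) (Var 67 - eN))
    (If' (BLt (Var 67) (eN + eN + eN)) (NSet 52 (Var 67) (Var 67 - (eN + eN)))
    (If' (BLt (Var 67) (eN + eN + eN + eL))
      (NSet 52 (Var 67) (NGet 2 (Var 67 - (eN + eN + eN))))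
      (NSet 52 (Var 67) (NGet 2 (Var 67 - (eN + eN + eN) - eL)))))))%cmd.

Definition ListArcs arr : cmd :=
  For 68 eA (
    Set' 64 (NGet arr (Var 68)) ;;
    NSet 62 (NGet 63 (Var 64) + NGet 61 (Var 64)) (Var 68) ;;
    NSet 61 (Var 64) (NGet 61 (Var 64) + NCst 1))%cmd.

Definition Setup : cmd := (
  For 67 eN (NSet 53 (Var 67) (NCst 1) ;; NSet 54 (Var 67) (NCst 1) ;;
             NSet 55 (Var 67) (NCst 1)) ;;
  InitArcs ;; SetLabels ;;
  Set' 72 (NCst 0) ;;
  For 67 eX (NSet 63 (Var 67) (Var 72) ;; NSet 61 (Var 67) (NCst 0) ;;
             Set' 72 (Var 72 + eA + eA)) ;;
  ListArcs 50 ;; ListArcs 51)%cmd.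

Section Network.
Variables (R : realType) (n m L : nat) (nd ej : nat -> nat).
Implicit Types s : state R.
Let X := n + n + m + 2.
Let src := n + n + m.
Let tgt := n + n + m + 1.
Let A := n + n + n + L + L.

Definition inputs_in s :=
  [/\ nmem s 0 0 = n, nmem s 0 1 = m, nmem s 0 2 = L,
      nmem s 1 =1 ej & nmem s 2 =1 nd].

Lemma inputs_frame c s s' : frame c s s' ->
  all (fun a => a \notin nwr c) [:: 0; 1; 2] -> inputs_in s -> inputs_in s'.
Proof.
move=> fr /and4P[h0 h1 h2 _] [e1 e2 e3 e4 e5].
by split; [| | |move=> y|move=> y]; rewrite (frn fr).
Qed.

Section Arcs.
Variables fi fs ft : nat -> nat.

Definition arc_tl a :=
  if a < n then a else if a < n + n then src
  else if a < n + n + n then (if ft (a - (n + n)) == 0 then tgt else a - n)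
  else if a < n + n + n + L then n + nd (a - (n + n + n))
  else n + n + ej (a - (n + n + n) - L).

Definition arc_hd a :=
  if a < n then (if fi a == 0 then a else n + a)
  else if a < n + n then (if fs (a - n) == 0 then src else a - n)
  else if a < n + n + n then tgt
  else if a < n + n + n + L then n + n + ej (a - (n + n + n))
  else nd (a - (n + n + n) - L).

End Arcs.

(** The node to which an arc is charged when it is cut. A cut of [p] arcs thereby becomes a set of
    at most [p] nodes, whatever kinds of arcs it consists of. *)
Definition arc_lab a :=
  if a < n then a else if a < n + n then a - n
  else if a < n + n + n then a - (n + n)
  else if a < n + n + n + L then nd (a - (n + n + n))
  else nd (a - (n + n + n) - L).

Definition arcs_in s fi fs ft := forall a, a < A ->
  nmem s 50 a = arc_tl ft a /\ nmem s 51 a = arc_hd fi fs a.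

Lemma InitArcs_wp s : inputs_in s ->
  wp InitArcs s (A * 30 + 3)
    (fun s' => arcs_in s' (nmem s 53) (nmem s 54) (nmem s 55)).
Proof.
move=> [sn sm sL se sd]; eapply wp_le.
  eapply (wp_for (T := 20) (Inv := fun i s1 => forall a, a < i ->
    nmem s1 50 a = arc_tl (nmem s 55) a /\
    nmem s1 51 a = arc_hd (nmem s 53) (nmem s 54) a)).
  - by rewrite /= sn sL.
  - by [].
  - by [].
  - by [].
  - move=> i s1 iA xi fr H.
    have e0 : nmem s1 0 = nmem s 0 by rewrite (frn fr).
    have e1 : nmem s1 1 = nmem s 1 by rewrite (frn fr).
    have e2 : nmem s1 2 = nmem s 2 by rewrite (frn fr).
    have e53 : nmem s1 53 = nmem s 53 by rewrite (frn fr).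
    have e54 : nmem s1 54 = nmem s 54 by rewrite (frn fr).
    have e55 : nmem s1 55 = nmem s 55 by rewrite (frn fr).
    have fin t h (s2 : state R) : nmem s2 50 =1 upd (nmem s1) 50 i t 50 ->
        nmem s2 51 =1 upd (nmem s1) 51 i h 51 ->
        t = arc_tl (nmem s 55) i -> h = arc_hd (nmem s 53) (nmem s 54) i ->
        forall a, a < i.+1 -> nmem s2 50 a = arc_tl (nmem s 55) a /\
        nmem s2 51 a = arc_hd (nmem s 53) (nmem s 54) a.
      move=> E1 E2 et eh a; rewrite E1 E2 /upd ltnS leq_eqVlt.
      by case: eqP => [->|_] //=; exact: H.
    eapply wp_le.
      apply: wp_if => /=; rewrite xi e0 sn => c1.
        eapply wp_seq; apply: wp_nset => /=.
        apply: wp_if => /=; rewrite /upd /= e53 ?e0 xi => c2; apply: wp_nset;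
        (apply: fin; [move=> y|move=> y| |]); rewrite /= /upd /= ?xi ?e0 ?sn //;
        by rewrite /arc_tl /arc_hd c1 ?c2 ?(negPf c2).
      apply: wp_if => /=; rewrite xi e0 sn => c2.
        eapply wp_seq; apply: wp_nset => /=.
        apply: wp_if => /=; rewrite /upd /= e54 ?e0 xi ?sn ?sm => c3; apply: wp_nset;
        (apply: fin; [move=> y|move=> y| |]); rewrite /= /upd /= ?xi ?e0 ?sn ?sm //;
        by rewrite /arc_tl /arc_hd (negPf c1) c2 ?c3 ?(negPf c3).
      apply: wp_if => /=; rewrite xi e0 sn => c3.
        eapply wp_seq; apply: wp_nset => /=.
        apply: wp_if => /=; rewrite /upd /= e55 ?e0 xi ?sn ?sm => c4; apply: wp_nset;
        (apply: fin; [move=> y|move=> y| |]); rewrite /= /upd /= ?xi ?e0 ?sn ?sm //;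
        by rewrite /arc_tl /arc_hd (negPf c1) (negPf c2) c3 ?c4 ?(negPf c4).
      apply: wp_if => /=; rewrite xi e0 sn sL => c4;
        eapply wp_seq; apply: wp_nset => /=; apply: wp_nset;
        (apply: fin; [move=> y|move=> y| |]);
        rewrite /= /upd /= ?xi ?e0 ?e1 ?e2 ?sn ?sL ?se ?sd //;
        by rewrite /arc_tl /arc_hd (negPf c1) (negPf c2) (negPf c3) ?c4 ?(negPf c4).
    by [].
  - by move=> s1 _ H a aA; apply: H.
by rewrite /A; lia.
Qed.

Lemma SetLabels_wp s : inputs_in s ->
  wp SetLabels s (A * 30 + 3)
    (fun s' => forall a, a < A -> nmem s' 52 a = arc_lab a).
Proof.
move=> [sn sm sL se sd]; eapply wp_le.
  eapply (wp_for (T := 20) (Inv := fun i s1 => forall a, a < i ->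
    nmem s1 52 a = arc_lab a)).
  - by rewrite /= sn sL.
  - by [].
  - by [].
  - by [].
  - move=> i s1 iA xi fr H.
    have e0 : nmem s1 0 = nmem s 0 by rewrite (frn fr).
    have e2 : nmem s1 2 = nmem s 2 by rewrite (frn fr).
    have fin h (s2 : state R) : nmem s2 52 =1 upd (nmem s1) 52 i h 52 ->
        h = arc_lab i -> forall a, a < i.+1 -> nmem s2 52 a = arc_lab a.
      move=> E1 eh a; rewrite E1 /upd ltnS leq_eqVlt.
      by case: eqP => [->|_] //=; exact: H.
    eapply wp_le.
      apply: wp_if => /=; rewrite xi e0 sn => c1.
        apply: wp_nset; apply: fin => [y|]; rewrite /= /upd /= ?xi //.
        by rewrite /arc_lab c1.
      apply: wp_if => /=; rewrite xi e0 sn => c2.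
        apply: wp_nset; apply: fin => [y|]; rewrite /= /upd /= ?xi ?e0 ?sn //.
        by rewrite /arc_lab (negPf c1) c2.
      apply: wp_if => /=; rewrite xi e0 sn => c3.
        apply: wp_nset; apply: fin => [y|]; rewrite /= /upd /= ?xi ?e0 ?sn //.
        by rewrite /arc_lab (negPf c1) (negPf c2) c3.
      apply: wp_if => /=; rewrite xi e0 sn sL => c4;
        apply: wp_nset; (apply: fin => [y|]);
        rewrite /= /upd /= ?xi ?e0 ?e2 ?sn ?sL ?sd //;
        by rewrite /arc_lab (negPf c1) (negPf c2) (negPf c3) ?c4 ?(negPf c4).
    by [].
  - by move=> s1 _ H a aA; apply: H.
by rewrite /A; lia.
Qed.

(* [lst x a]: arc [a] has been put on the list of [x]. *)
Definition adj_in s tot (lst : nat -> nat -> Prop) :=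
  [/\ forall x, x < X -> nmem s 63 x = x * (A + A),
      \sum_(x < X) nmem s 61 x = tot,
      forall x d, x < X -> d < nmem s 61 x -> nmem s 62 (nmem s 63 x + d) < A &
      forall x a, lst x a -> x < X /\
        exists2 d, d < nmem s 61 x & nmem s 62 (nmem s 63 x + d) = a].

Lemma ListArcs_wp arr s tot lst (e : nat -> nat) : inputs_in s ->
  arr = 50 \/ arr = 51 ->
  adj_in s tot lst -> tot + A <= A + A ->
  (forall a, a < A -> nmem s arr a = e a /\ e a < X) ->
  wp (ListArcs arr) s (A * 6 + 3)
    (fun s' => adj_in s' (tot + A) (fun x a => lst x a \/ a < A /\ e a = x)).
Proof.
move=> [sn sm sL _ _] harr ad tA ea; eapply wp_le.
  eapply (wp_for (T := 3) (Inv := fun i s1 =>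
     adj_in s1 (tot + i) (fun x a => lst x a \/ a < i /\ e a = x))).
  - by rewrite /= sn sL.
  - by case: harr => ->.
  - by [].
  - rewrite addn0; case: ad => h1 h2 h3 h4; split=> // x a [/h4 //|[]//].
  - move=> i s1 iA xi fr [h1 h2 h3 h4].
    have earr : nmem s1 arr = nmem s arr by rewrite (frn fr) //; case: harr => ->.
    have [ei eX] := ea i iA.
    eapply wp_le.
      eapply wp_seq; apply: wp_nset => /=.
      eapply wp_seq; apply: wp_nset => /=.
      apply: wp_nset; rewrite /= /upd /= xi earr ei.
      set x0 := e i in eX *.
      set q := nmem s1 63 x0 + nmem s1 61 x0.
      have le61 x : x < X -> nmem s1 61 x <= tot + i.
        by move=> xX; rewrite -h2 (bigD1 (Ordinal xX)) //= leq_addr.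
      (* Lists start [A + A] cells apart and all of them together are still shorter than that, so
         the new cell [q] holds no earlier entry. *)
      have qne x d : x < X -> d < nmem s1 61 x -> (nmem s1 63 x + d == q) = false.
        move=> xX dx; apply/eqP; rewrite /q !h1 // => E.
        have := le61 x xX; have := le61 x0 eX => l1 l2.
        case: (ltngtP x x0) => xx.
        + have : x.+1 * (A + A) <= x0 * (A + A) by rewrite leq_mul2r xx orbT.
          by rewrite mulSn; lia.
        + have : x0.+1 * (A + A) <= x * (A + A) by rewrite leq_mul2r xx orbT.
          by rewrite mulSn; lia.
        + by rewrite xx in E dx; lia.
      split; rewrite /= /upd /=.
      + exact: h1.
      + rewrite (bigD1 (Ordinal eX)) //= eqxx addn1 addSn addnS; congr _.+1.
        rewrite -h2 [in RHS](bigD1 (Ordinal eX)) //=; congr (_ + _).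
        by apply: eq_bigr => x ne; rewrite -val_eqE /= in ne; rewrite (negPf ne).
      + move=> x d xX; case: (eqVneq x x0) => [->|ne].
          rewrite addn1 ltnS leq_eqVlt => /orP[/eqP->|lt]; first by rewrite eqxx.
          by rewrite qne // h3.
        by move=> dx; rewrite qne // h3.
      + have old x a d : x < X -> d < nmem s1 61 x -> nmem s1 62 (nmem s1 63 x + d) = a ->
           exists2 d, d < (if x == x0 then nmem s1 61 x0 + 1 else nmem s1 61 x) &
             (if nmem s1 63 x + d == q then i else nmem s1 62 (nmem s1 63 x + d)) = a.
          by move=> xX dx da; exists d; [case: eqP dx => [->|_]; lia|rewrite qne].
        move=> x a [l|[]]; first by have [xX [d dx da]] := h4 x a (or_introl l);
          split=> //; exact: old dx da.
        rewrite ltnS leq_eqVlt => /orP[/eqP ->|lt] ex.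
          rewrite -ex; split=> //; exists (nmem s1 61 x0); first by rewrite eqxx addn1.
          by rewrite eqxx.
        by have [xX [d dx da]] := h4 x a (or_intror (conj lt ex)); split=> //; exact: old dx da.
    by [].
  - by move=> s1 _.
by rewrite /A; lia.
Qed.

Lemma graph_of s : graph_in (nmem s 50) (nmem s 51) (nmem s 61) (nmem s 63) (nmem s 62) s.
Proof. by []. Qed.

Hypothesis ndP : forall p, p < L -> nd p < n.
Hypothesis ejP : forall p, p < L -> ej p < m.

Let tlF := arc_tl (fun=> 1).
Let hdF := arc_hd (fun=> 1) (fun=> 1).

Definition network_in s :=
  adj_in s (A + A) (fun x a => a < A /\ (tlF a = x \/ hdF a = x)) /\
  forall a, a < A -> nmem s 52 a = arc_lab a.

Lemma network_frame c s s' : frame c s s' ->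
  all (fun a => a \notin nwr c) [:: 52; 61; 62; 63] ->
  network_in s -> network_in s'.
Proof.
move=> fr /and5P[h52 h61 h62 h63 _] [[h1 h2 h3 h4] h5]; split; last by move=> a; rewrite (frn fr) //; apply: h5.
by rewrite /adj_in (frn (a := 61) fr) // (frn (a := 62) fr) // (frn (a := 63) fr).
Qed.

Lemma arc_ends fi fs ft a : a < A ->
  [/\ arc_tl ft a < X, arc_hd fi fs a < X,
     arc_tl ft a = tlF a \/ arc_tl ft a = hdF a &
     arc_hd fi fs a = tlF a \/ arc_hd fi fs a = hdF a].
Proof.
rewrite /arc_tl /arc_hd /tlF /hdF /arc_tl /arc_hd /A /X /src /tgt => aA.
case: (ltnP a n) => c1 /=; first by do ?case: ifP => _; split; first [lia | by left | by right].
case: (ltnP a (n + n)) => c2 /=; first by do ?case: ifP => _; split; first [lia | by left | by right].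
case: (ltnP a (n + n + n)) => c3 /=; first by do ?case: ifP => _; split; first [lia | by left | by right].
case: (ltnP a (n + n + n + L)) => c4 /=.
  have p1 : a - (n + n + n) < L by lia.
  by have := ndP p1; have := ejP p1; split; first [lia | by left | by right].
have p1 : a - (n + n + n) - L < L by lia.
by have := ndP p1; have := ejP p1; split; first [lia | by left | by right].
Qed.

Lemma network_listed s tl hd : network_in s ->
  (forall a, a < A -> [/\ tl a < X, hd a < X, tl a = tlF a \/ tl a = hdF a &
     hd a = tlF a \/ hd a = hdF a]) ->
  arcs_listed X A tl hd (nmem s 61) (nmem s 63) (nmem s 62).
Proof.
move=> [[h1 h2 h3 h4] _] H; split=> //.
- by move=> a aA; have [] := H a aA.
- move=> a aA; have [_ _ t _] := H a aA.
  by have [|_ ] := h4 (tl a) a; first by split=> //; case: t => ->; auto.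
Qed.

Lemma Setup_wp s : inputs_in s ->
  wp Setup s (A * 100 + X * 30 + 100) network_in.
Proof.
move=> inp; have [sn sm sL se sd] := inp; eapply wp_le.
  eapply wp_seq, (wp_for (T := 3) (Inv := fun i s1 => forall v, v < i ->
    [/\ nmem s1 53 v = 1, nmem s1 54 v = 1 & nmem s1 55 v = 1])).
  - exact: sn.
  - by [].
  - by [].
  - by [].
  - move=> i s1 iN xi fr H; eapply wp_le.
      eapply wp_seq; apply: wp_nset => /=.
      eapply wp_seq; apply: wp_nset => /=.
      apply: wp_nset => v; rewrite /= /upd /= xi ltnS leq_eqVlt.
      by case: eqP => [->|_] //=; exact: H.
    by [].
  - move=> s1 fr H.
    have inp1 : inputs_in s1 by apply: (inputs_frame fr).
    eapply wp_seq, wp_call; first exact: InitArcs_wp.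
    move=> s2 fr2 arcs.
    have inp2 : inputs_in s2 by apply: (inputs_frame fr2).
    eapply wp_seq, wp_call; first exact: SetLabels_wp.
    move=> s3 fr3 labs.
    have inp3 : inputs_in s3 by apply: (inputs_frame fr3).
    have [n3 m3 L3 _ _] := inp3.
    eapply wp_seq; apply: wp_nset => /=.
    eapply wp_seq, (wp_for (T := 3) (Inv := fun i s4 => nmem s4 72 0 = i * (A + A) /\
      forall x, x < i -> nmem s4 63 x = x * (A + A) /\ nmem s4 61 x = 0)).
    + by rewrite /= /upd /= n3 m3.
    + by [].
    + by [].
    + by [].
    + move=> i s4 iX xi fr4 [hb H4]; eapply wp_le.
        eapply wp_seq; apply: wp_nset => /=.
        eapply wp_seq; apply: wp_nset => /=.
        apply: wp_nset => /=; rewrite /= /upd /= xi hb !(frn (a := 0) fr4) //= /upd /= n3 L3.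
        split; first by rewrite mulSn /A; lia.
        move=> x; rewrite ltnS leq_eqVlt.
        by case: eqP => [->|_] //=; exact: H4.
      by [].
    + move=> s4 fr4 [_ H4].
      have inp4 : inputs_in s4 by apply: (inputs_frame fr4).
      have a4 a : a < A -> nmem s4 50 a = tlF a /\ nmem s4 51 a = hdF a.
        move=> aA; rewrite (frn fr4) //= /upd /= (frn fr3) //.
        rewrite (frn (a := 51) fr4) //= /upd /= (frn (a := 51) fr3) //.
        have [-> ->] := arcs a aA; rewrite /tlF /hdF /arc_tl /arc_hd.
        split; do 3?[case: ltnP => ? //].
        all: try (by rewrite (proj1 (H _ _)) || (have [|_ -> //] := H (a - n); lia) ||
          (have [|_ _ -> //] := H (a - (n + n)); lia)).
        by have [|-> //] := H a.
      eapply wp_seq, wp_call.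
        apply: (@ListArcs_wp 50 s4 0 (fun _ _ => False) tlF inp4); auto.
        * split=> //; first by move=> x xX; have [] := H4 x xX.
          by rewrite big1 // => x _; have [] := H4 x (ltn_ord x).
          by move=> x d xX; have [_ ->] := H4 x xX.
        * by rewrite leq_addr.
        * move=> a aA; have [-> _] := a4 a aA.
          by have [] := @arc_ends (fun=> 1) (fun=> 1) (fun=> 1) a aA.
      move=> s5 fr5 ad5; eapply wp_call.
        apply: (@ListArcs_wp 51 s5 _ _ hdF _ _ ad5); auto.
        * exact: (inputs_frame fr5).
        * move=> a aA; rewrite (frn fr5) //; have [_ ->] := a4 a aA.
          by have [] := @arc_ends (fun=> 1) (fun=> 1) (fun=> 1) a aA.
      move=> s6 fr6 [h1 h2 h3 h4]; split.
        split=> // x a [aA [<-|<-]]; apply: h4; auto.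
      move=> a aA; rewrite (frn fr6) // (frn fr5) // (frn fr4) //=.
      by rewrite /upd /= labs.
by rewrite /A /X; lia.
Qed.

End Network.

(** * Balanced separators from tree decompositions *)

Section TreeSeparation.
Variables (n m : nat) (edge : 'I_m -> {set 'I_n}).
Variables (V : finType) (t : rel V) (X : V -> {set 'I_n}).
Hypothesis dec : tree_decomposition edge t X.
Implicit Types (D : {set V}) (z : V).

Let cover D := \bigcup_(d in D) X d.

(** A union of components of the tree without [z]. *)
Definition attached z D := z \notin D /\
  forall x y, x \in D -> y \notin D -> t x y -> y = z.

(** The hyperedge lies in some bag [y]. If [y] is outside [D], the subtree of a node of the
    hyperedge that also occurs in [D] has to pass through [z]. *)
Lemma attached_separates z D j : attached z D ->
  edge j \subset cover D \/ edge j :&: cover D \subset X z.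
Proof.
move=> [zD cl]; have [[_ sy _ _ _] _ cov sub] := dec.
have [y ey] := cov j; case: (boolP (y \in D)) => yD.
  by left; apply: subset_trans ey (bigcup_sup y yD).
right; apply/subsetP => i; rewrite inE => /andP[ij /bigcupP[d dD id]].
have iy := subsetP ey i ij; apply: contraT => iz.
have clo : closed [rel a b | [&& t a b, i \in X a & i \in X b]] (mem D).
  move=> a b /= /and3P[tab ia ib]; apply/idP/idP => h; apply: contraT => h'.
    by rewrite (cl a b h h' tab) (negPf iz) in ib.
  by rewrite sy in tab; rewrite (cl b a h h' tab) (negPf iz) in ia.
have : (d \in D) = (y \in D) by exact: (closed_connect clo (sub i d y id iy)).
by rewrite dD (negPf yD).
Qed.

(** While [D] covers at least [2 * q] nodes of [W] it can be shrunk. If it consists of several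
    branches at [z], splitting off one of them leaves [q] nodes on one of the two parts. If it is a
    single branch, [z] moves to its root [z'], which loses fewer than [q] nodes. *)
Lemma balanced_attached (W : {set 'I_n}) q : (forall z, #|X z| < q) ->
  forall k z D, #|D| <= k -> attached z D -> q <= #|W :&: cover D| ->
  exists z' D', [/\ attached z' D', q <= #|W :&: cover D'| & #|W :&: cover D'| < 2 * q].
Proof.
move=> Xq; have [[_ sy ir con acy] _ _ _] := dec.
elim=> [|k IH] z D Dk att Wq.
  move: Dk; rewrite leqn0 cards_eq0 => /eqP D0; move: Wq.
  by rewrite D0 /cover big_set0 setI0 cards0 leqn0 => /eqP q0; have := Xq z; rewrite q0.
have [lt|ge] := ltnP #|W :&: cover D| (2 * q); first by exists z, D.
have [zD cl] := att.
have : [exists z', (z' \in D) && t z z'].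
  apply: contraT => /existsPn no.
  have clo : closed t (mem D).
    have H a b : t a b -> a \in D -> b \in D.
      move=> tab aD; apply: contraT => bD; have bz := cl a b aD bD tab.
      by have := no a; rewrite aD sy -bz tab.
    by move=> a b tab; apply/idP/idP; apply: H => //; rewrite sy.
  have [d dD] : exists d, d \in D.
    apply/set0Pn; apply: contraTneq Wq => ->.
    by rewrite /cover big_set0 setI0 cards0 -ltnNge (leq_ltn_trans _ (Xq z)).
  have : (d \in D) = (z \in D) by exact: (closed_connect clo (con d z)).
  by rewrite dD (negPf zD).
case/existsP => z' /andP[z'D tzz'].
pose r := [rel x y | [&& x \in D, y \in D & t x y]].
have rsym : symmetric r by move=> x y /=; rewrite sy andbCA.
pose D1 := [set x in D | connect r z' x].
have z'1 : z' \in D1 by rewrite inE z'D connect0.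
have att1 : attached z D1.
  split; first by rewrite inE (negPf zD).
  move=> x y; rewrite !inE => /andP[xD cx]; case: (boolP (y \in D)) => yD /= ny txy.
    by case/negP: ny; apply: connect_trans cx (connect1 _); rewrite /= xD yD.
  exact: cl xD yD txy.
have att2 : attached z (D :\: D1).
  split; first by rewrite inE (negPf zD) andbF.
  move=> x y; rewrite !inE => /andP[nx xD]; rewrite xD /= in nx.
  case: (boolP (y \in D)) => yD /= ny txy; last exact: cl xD yD txy.
  move: ny; rewrite andbT negbK => cy; case/negP: nx.
  by apply: connect_trans cy (connect1 _); rewrite /= xD yD sy.
have covU : cover D = cover D1 :|: cover (D :\: D1).
  rewrite /cover -bigcup_setU; apply: eq_bigl => x; rewrite !inE.
  by case: (x \in D) => //=; case: connect.
have le2 : #|W :&: cover D| <= #|W :&: cover D1| + #|W :&: cover (D :\: D1)|.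
  by rewrite covU setIUr cardsU leq_subr.
have D1s : D1 \subset D by apply/subsetP => x; rewrite inE => /andP[].
have cD := cardsID D1 D; rewrite (setIidPr D1s) in cD.
have p1 : 0 < #|D1| by apply/card_gt0P; exists z'.
have [D20|D2n] := eqVneq (D :\: D1) set0; last first.
  have p2 : 0 < #|D :\: D1| by rewrite card_gt0.
  have [g1|l1] := leqP q #|W :&: cover D1|; first by apply: (IH z D1) => //; lia.
  by apply: (IH z (D :\: D1)) => //; lia.
have DD1 : D = D1.
  by apply/eqP; rewrite eqEsubset D1s andbT -setD_eq0 D20.
apply: (IH z' (D :\ z')).
- by have := cardsD1 z' D; rewrite z'D; lia.
- split; first by rewrite !inE eqxx.
  move=> x y; rewrite !inE => /andP[xz' xD] ny txy.
  move: ny; rewrite negb_and negbK => /orP[/eqP//|yD].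
  have yz := cl x y xD yD txy; subst y.
  (* A second vertex [x] of the branch adjacent to [z] would close a cycle through [z], [z'] and a
     path inside [D]. *)
  move: xD; rewrite DD1 inE => /andP[xD /connectP[p pth lst]].
  case/shortenP: pth lst => p' pth' u' _ lst'.
  have sub : {subset p' <= D}.
    elim: p' z' pth' {tzz' z'D p1 DD1 D20 cD D1s le2 covU att2 att1 z'1 D1 xz' u' lst'} => //= b p0 IH' a /andP[/and3P[_ bD _] pp] c.
    by rewrite inE => /orP[/eqP->//|]; apply: IH' pp c.
  have tp : path t z' p' by apply: sub_path pth' => a b /and3P[].
  have := acy (z :: z' :: p'); rewrite /ucycle /= in u' *.
  rewrite tzz' rcons_path tp -lst' txy /= => H.
  have : size (z :: z' :: p') <= 2.
    apply: H; rewrite u' andbT inE negb_or.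
    apply/andP; split.
      by apply: contraNneq zD => ->.
    by apply: contra zD => /sub.
  by case: p' lst' {tp sub u' pth' H} => //= E; rewrite E eqxx in xz'.
- move: ge; have -> : cover D = X z' :|: cover (D :\ z') by rewrite /cover (big_setD1 z').
  rewrite setIUr cardsU => ge.
  have : #|W :&: X z'| <= #|X z'| by rewrite subset_leq_card // subsetIr.
  by have := Xq z'; lia.
Qed.

(** The balanced part covers fewer than [2 * q] of at least [3 * q] nodes, so [q] of them remain on
    the other side. The bag of the attaching vertex is the separator. *)
Lemma tree_separation (W : {set 'I_n}) q : (forall z, #|X z| < q) -> 3 * q <= #|W| ->
  exists B Y : {set 'I_n}, [/\ #|Y| < q, q <= #|W :&: B|, q <= #|W :\: B| &
    forall j, edge j \subset B \/ edge j :&: B \subset Y].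
Proof.
move=> Xq Wq; have [[/card_gt0P[z _] _ _ _ _] cov _ _] := dec.
have q0 : 0 < q by apply: leq_ltn_trans (Xq z).
have att0 : attached z [set~ z].
  by split; [rewrite !inE eqxx | move=> x y _; rewrite !inE negbK => /eqP].
have g0 : q <= #|W :&: cover [set~ z]|.
  have : #|W| <= #|W :&: cover [set~ z]| + #|X z|.
    rewrite -(cardsID (cover [set~ z]) W) leq_add2l subset_leq_card //.
    apply/subsetP => i; rewrite inE => /andP[nc _]; have [y iy] := cov i.
    case: (eqVneq y z) => [<-//|yz]; case/negP: nc.
    by apply/bigcupP; exists y; rewrite // !inE.
  by have := Xq z; lia.
have [z' [D [att ge lt]]] := balanced_attached Xq (leqnn _) att0 g0.
exists (cover D), (X z'); split=> //; last by move=> j; apply: attached_separates.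
by have := cardsID (cover D) W; lia.
Qed.

End TreeSeparation.

(** * Components and boundaries with respect to shared hyperedges *)

Section Share.
Variables (n m : nat) (edge : 'I_m -> {set 'I_n}).
Implicit Types (U : {set 'I_n}) (u v w : 'I_n).

Definition share u w := [exists j, (u \in edge j) && (w \in edge j)].

Lemma shareP u w : reflect (exists2 j, u \in edge j & w \in edge j) (share u w).
Proof.
by apply: (iffP existsP) => [[j /andP[]]|[j h1 h2]]; exists j => //; rewrite h1.
Qed.

Lemma share_sym : symmetric share.
Proof. by move=> u w; apply/shareP/shareP => -[j]; exists j. Qed.

Definition component U v :=
  [set u | connect [rel a b | [&& a \in U, b \in U & share a b]] v u].

Definition bdry U v := [set w | (w \notin U) && [exists c in component U v, share c w]].

Lemma comp_rel_sym U : connect_sym [rel a b | [&& a \in U, b \in U & share a b]].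
Proof. by apply: sym_connect_sym => a b /=; rewrite share_sym andbCA. Qed.

Lemma comp_refl U v : v \in component U v.
Proof. by rewrite inE connect0. Qed.

Lemma comp_eq U v u : u \in component U v -> component U u = component U v.
Proof.
rewrite inE => c; apply/setP => w; rewrite !inE.
by rewrite (same_connect (comp_rel_sym U) c).
Qed.

Lemma comp_sub U v : v \in U -> component U v \subset U.
Proof.
move=> vU; apply/subsetP => u; rewrite inE => c.
have clo : closed [rel a b | [&& a \in U, b \in U & share a b]] (mem U).
  by move=> a b /and3P[aU bU _]; rewrite /= aU bU.
by have : (v \in U) = (u \in U) := closed_connect clo c; rewrite vU => <-.
Qed.

Lemma comp_step U v u w : v \in U -> u \in component U v -> w \in U -> share u w ->
  w \in component U v.
Proof.
move=> vU uc wU sh; have uU := subsetP (comp_sub vU) u uc.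
move: uc; rewrite !inE => c; apply: connect_trans c (connect1 _).
by rewrite /= uU wU.
Qed.

Lemma comp_closed U v u w : v \in U -> u \in component U v -> share u w ->
  w \in component U v :|: bdry U v.
Proof.
move=> vU uc sh; rewrite in_setU.
case: (boolP (w \in U)) => wU; first by rewrite (comp_step vU uc).
by apply/orP; right; rewrite inE wU; apply/exists_inP; exists u.
Qed.

(** Leastness of a component with its boundary: [P] has to be closed only along steps that start
    inside the component, since boundary nodes are not expanded. *)
Lemma comp_min U v (P : {set 'I_n}) : v \in U -> v \in P ->
  (forall u w, u \in P -> u \in component U v -> share u w -> w \in P) ->
  component U v :|: bdry U v \subset P.
Proof.
move=> vU vP cl; have cP : component U v \subset P.
  apply/subsetP => u uc; have := uc; rewrite inE => c.
  have clo : closed [rel a b | [&& a \in U, b \in U & share a b]] (mem (P :&: component U v)).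
    move=> a b /and3P[aU bU sh]; apply/idP/idP => /setIP[h hc]; apply/setIP.
      by split; [exact: cl h hc sh | exact: comp_step vU hc bU sh].
    rewrite share_sym in sh.
    by split; [exact: cl h hc sh | exact: comp_step vU hc aU sh].
  have : (v \in P :&: component U v) = (u \in P :&: component U v) := closed_connect clo c.
  by rewrite !in_setI vP comp_refl uc !andbT => <-.
rewrite subUset cP; apply/subsetP => w; rewrite inE => /andP[_ /exists_inP[c cC sh]].
exact: cl (subsetP cP c cC) cC sh.
Qed.

End Share.

(** * Reachability and cuts of the network in terms of the hypergraph *)

Section NetworkCuts.
Variables (n m L : nat) (nd ej : nat -> nat) (edge : 'I_m -> {set 'I_n}).
Hypothesis ndP : forall p, p < L -> nd p < n.
Hypothesis ejP : forall p, p < L -> ej p < m.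
Hypothesis incP : forall (i : 'I_n) (j : 'I_m),
  reflect (exists2 p, p < L & nd p = i /\ ej p = j) (i \in edge j).
Let X := n + n + m + 2.
Let src := n + n + m.
Let tgt := n + n + m + 1.
Let A := n + n + n + L + L.

Local Notation TL := (arc_tl n m L nd ej).
Local Notation HD := (arc_hd n m L nd ej).
Local Notation LAB := (arc_lab n L nd).

Lemma arc_node fi fs ft i : i < n ->
  [/\ TL ft i = i, HD fi fs i = (if fi i == 0 then i else n + i) & LAB i = i].
Proof. by move=> iN; rewrite /arc_tl /arc_hd /arc_lab iN. Qed.

Lemma arc_src fi fs ft i : i < n -> [/\ TL ft (n + i) = src,
  HD fi fs (n + i) = (if fs i == 0 then src else i) & LAB (n + i) = i].
Proof.
move=> iN; rewrite /arc_tl /arc_hd /arc_lab.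
have -> : (n + i < n) = false by lia.
have -> : (n + i < n + n) by lia.
by rewrite addKn.
Qed.

Lemma arc_tgt fi fs ft i : i < n ->
  [/\ TL ft (n + n + i) = (if ft i == 0 then tgt else n + i),
  HD fi fs (n + n + i) = tgt & LAB (n + n + i) = i].
Proof.
move=> iN; rewrite /arc_tl /arc_hd /arc_lab.
have -> : (n + n + i < n) = false by lia.
have -> : (n + n + i < n + n) = false by lia.
have -> : (n + n + i < n + n + n) by lia.
by rewrite addKn -(addnA n n i) addKn.
Qed.

Lemma arc_out fi fs ft p : p < L -> [/\ TL ft (n + n + n + p) = n + nd p,
  HD fi fs (n + n + n + p) = n + n + ej p & LAB (n + n + n + p) = nd p].
Proof.
move=> pL; rewrite /arc_tl /arc_hd /arc_lab.
have -> : (n + n + n + p < n) = false by lia.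
have -> : (n + n + n + p < n + n) = false by lia.
have -> : (n + n + n + p < n + n + n) = false by lia.
have -> : (n + n + n + p < n + n + n + L) by lia.
by rewrite addKn.
Qed.

Lemma arc_in fi fs ft p : p < L -> [/\ TL ft (n + n + n + L + p) = n + n + ej p,
  HD fi fs (n + n + n + L + p) = nd p & LAB (n + n + n + L + p) = nd p].
Proof.
move=> pL; rewrite /arc_tl /arc_hd /arc_lab.
have -> : (n + n + n + L + p < n) = false by lia.
have -> : (n + n + n + L + p < n + n) = false by lia.
have -> : (n + n + n + L + p < n + n + n) = false by lia.
have -> : (n + n + n + L + p < n + n + n + L) = false by lia.
by rewrite -(addnA (n + n + n)) !addKn.
Qed.

Lemma arc_cases (P : nat -> Prop) :
  (forall i, i < n -> P i) -> (forall i, i < n -> P (n + i)) ->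
  (forall i, i < n -> P (n + n + i)) -> (forall p, p < L -> P (n + n + n + p)) ->
  (forall p, p < L -> P (n + n + n + L + p)) -> forall a, a < A -> P a.
Proof.
move=> h1 h2 h3 h4 h5 a aA; rewrite /A in aA.
case: (ltnP a n) => c1; first exact: h1.
case: (ltnP a (n + n)) => c2; first by rewrite -(subnKC c1); apply: h2; lia.
case: (ltnP a (n + n + n)) => c3; first by rewrite -(subnKC c2); apply: h3; lia.
case: (ltnP a (n + n + n + L)) => c4; first by rewrite -(subnKC c3); apply: h4; lia.
by rewrite -(subnKC c4); apply: h5; lia.
Qed.

(* Source arc into [v] only, no target arcs, and only the nodes of [U] let the
   search through: it explores the component of [v] in [U]. *)
Lemma reach_comp (fi fs ft : nat -> nat) (U : {set 'I_n}) (v : 'I_n) (M : pred nat) :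
  v \in U -> (forall u : 'I_n, (fi u != 0) = (u \in U)) ->
  (forall u : 'I_n, (fs u != 0) = (u == v)) -> (forall u, u < n -> ft u = 0) ->
  M src -> (forall a, a < A -> M (TL ft a) -> M (HD fi fs a)) ->
  (forall Y : pred nat, Y src -> (forall a, a < A -> Y (TL ft a) -> Y (HD fi fs a)) ->
     forall x, M x -> Y x) ->
  forall u : 'I_n, M u = (u \in component edge U v :|: bdry edge U v).
Proof.
move=> vU Ei Es Et Ms cl mn u; apply/idP/idP.
  pose C := component edge U v :|: bdry edge U v.
  pose Y (x : nat) := [exists i : 'I_n, (i \in C) && ((x == i) || (i \in U) && ((x == n + i) ||
     [exists j : 'I_m, (i \in edge j) && (x == n + n + j)]))] || (x == src) || (x == tgt).
  have CU i : i \in C -> i \in U -> i \in component edge U v.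
    by rewrite in_setU => /orP[//|]; rewrite inE => /andP[/negPf->].
  have Yin (i : 'I_n) : i \in C -> Y i.
    by move=> iC; rewrite /Y; apply/orP; left; apply/orP; left; apply/existsP; exists i; rewrite iC eqxx.
  have Yout (i : 'I_n) : i \in C -> i \in U -> Y (n + i).
    move=> iC iU; rewrite /Y; apply/orP; left; apply/orP; left; apply/existsP; exists i.
    by rewrite iC iU eqxx orbT.
  have inY (i : 'I_n) : Y i -> i \in C.
    rewrite /Y /src /tgt => /orP[/orP[/existsP[i' /andP[iC H]]|]|]; last 2 first.
    - by have := ltn_ord i; lia.
    - by have := ltn_ord i; lia.
    case/orP: H => [/eqP/val_inj->//|/andP[_ /orP[|/existsP[j /andP[_]]]]];
      by have := ltn_ord i; lia.
  have outY (i : 'I_n) : Y (n + i) -> i \in C /\ i \in U.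
    rewrite /Y /src /tgt => /orP[/orP[/existsP[i' /andP[iC H]]|]|]; last 2 first.
    - by have := ltn_ord i; lia.
    - by have := ltn_ord i; lia.
    case/orP: H => [|/andP[iU /orP[|/existsP[j /andP[_]]]]].
    + by have := ltn_ord i'; lia.
    + by rewrite eqn_add2l => /eqP/val_inj->.
    + by have := ltn_ord i; lia.
  have edY (j : 'I_m) : Y (n + n + j) -> exists i, [/\ i \in C, i \in U & i \in edge j].
    rewrite /Y /src /tgt => /orP[/orP[/existsP[i' /andP[iC H]]|]|]; last 2 first.
    - by have := ltn_ord j; lia.
    - by have := ltn_ord j; lia.
    case/orP: H => [|/andP[iU /orP[|/existsP[j' /andP[ij]]]]].
    + by have := ltn_ord i'; lia.
    + by have := ltn_ord i'; lia.
    + by rewrite eqn_add2l => /eqP/val_inj->; exists i'.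
  move=> Mu; apply: (inY u); apply: (mn Y) Mu; first by rewrite /Y eqxx orbT.
  apply: arc_cases => [i iN|i iN|i iN|p pL|p pL].
  - have [-> -> _] := arc_node fi fs ft iN.
    case: (fi i =P 0) => //= fi0 /(inY (Ordinal iN)) iC; apply: (Yout (Ordinal iN)) => //.
    by rewrite -Ei /=; apply/eqP.
  - have [-> -> _] := arc_src fi fs ft iN; have := Es (Ordinal iN) => /=.
    case: (fs i =P 0) => //= _ /esym/eqP E _; rewrite -[i]/(val (Ordinal iN)) E.
    by apply: Yin; rewrite in_setU comp_refl.
  - have [_ -> _] := arc_tgt fi fs ft iN; by rewrite /Y eqxx orbT.
  - have [-> -> _] := arc_out fi fs ft pL => /(outY (Ordinal (ndP pL)))[iC iU].
    rewrite /Y; apply/orP; left; apply/orP; left; apply/existsP; exists (Ordinal (ndP pL)).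
    rewrite iC iU; apply/orP; right; apply/orP; right; apply/existsP; exists (Ordinal (ejP pL)).
    by rewrite eqxx andbT; apply/incP; exists p.
  - have [-> -> _] := arc_in fi fs ft pL => /(edY (Ordinal (ejP pL)))[i [iC iU ij]].
    apply: (Yin (Ordinal (ndP pL))); apply: comp_closed vU (CU i iC iU) _.
    by apply/shareP; exists (Ordinal (ejP pL)) => //; apply/incP; exists p.
have Mstep (a b : 'I_n) : M a -> a \in U -> share edge a b -> M b.
  move=> Ma aU /shareP[j /incP[p pL [pa pj]] /incP[p' pL' [pb pj']]].
  have h1 : M (n + a).
    have [t h _] := arc_node fi fs ft (ltn_ord a).
    have := cl a; rewrite t h ifN ?Ei //; apply=> //.
    by have := ltn_ord a; rewrite /A; lia.
  have h2 : M (n + n + j).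
    have [t h _] := arc_out fi fs ft pL.
    have := cl (n + n + n + p); rewrite t h pa pj; apply=> //; rewrite /A; lia.
  have [t h _] := arc_in fi fs ft pL'.
  have := cl (n + n + n + L + p'); rewrite t h pb pj'; apply=> //; rewrite /A; lia.
have Mv : M v.
  have [t h _] := arc_src fi fs ft (ltn_ord v).
  have := cl (n + v); rewrite t h ifN ?Es //; apply=> //.
  by have := ltn_ord v; rewrite /A; lia.
suff /subsetP sb : component edge U v :|: bdry edge U v \subset [set u : 'I_n | M u].
  by move=> /sb; rewrite inE.
apply: comp_min => //; first by rewrite inE.
move=> a b aM ac; rewrite !in_set in aM *; apply: Mstep => //.
exact: subsetP (comp_sub edge vU) a ac.
Qed.

Section Cut.
Variables (fi fs ft : nat -> nat) (U : pred nat).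
Hypothesis fi1 : forall i, i < n -> fi i != 0.
Hypotheses (Us : U src) (Ut : ~~ U tgt).

Definition cut_nodes := [set i : 'I_n |
  [exists a : 'I_A, [&& U (TL ft a), ~~ U (HD fi fs a) & LAB a == i]]].

Lemma leaving_card : leaving A (TL ft) (HD fi fs) U =
  #|[set a : 'I_A | U (TL ft a) && ~~ U (HD fi fs a)]|.
Proof.
rewrite -sum1_card big_mkcond; apply: eq_bigr => a _; rewrite inE.
by case: (U (TL ft a)); case: (U (HD fi fs a)).
Qed.

(** Each cut node chooses a crossing arc that carries its label, and the label makes the choice
    injective. *)
Lemma cut_small : #|cut_nodes| <= leaving A (TL ft) (HD fi fs) U.
Proof.
rewrite leaving_card; set B := [set a | _].
pose f (i : 'I_n) := [pick a : 'I_A | (a \in B) && (LAB a == i)].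
have fP i : i \in cut_nodes -> exists2 a : 'I_A, f i = Some a & (a \in B) && (LAB a == i).
  rewrite inE => /existsP[a /and3P[h1 h2 h3]]; rewrite /f.
  by case: pickP => [a' H|/(_ a)]; [exists a' | rewrite inE h1 h2 h3].
have inj : {in cut_nodes &, injective f}.
  move=> i i' /fP[a -> /andP[_ /eqP ai]] /fP[a' -> /andP[_ /eqP ai']] [E].
  by apply: val_inj; rewrite /= -ai -ai' E.
rewrite -(card_in_imset inj) -(card_imset B (@Some_inj _)); apply: subset_leq_card.
by apply/subsetP => o /imsetP[i /fP[a -> /andP[aB _]] ->]; apply: imset_f.
Qed.

Lemma cut_arc a (i : 'I_n) : a < A -> LAB a = i -> i \notin cut_nodes ->
  U (TL ft a) -> U (HD fi fs a).
Proof.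
move=> aA ai; rewrite inE => /existsPn/(_ (Ordinal aA)) /= H u.
by move: H; rewrite u ai eqxx andbT negbK.
Qed.

(** The path from [i] through the common hyperedge to [w] uses only arcs labelled [i] or [w], and
    none of them crosses. *)
Lemma cut_share (i w : 'I_n) : i \notin cut_nodes -> w \notin cut_nodes ->
  share edge i w -> U i -> U w.
Proof.
move=> ic wc /shareP[j /incP[p pL [pa pj]] /incP[p' pL' [pb pj']]] Ui.
have h1 : U (n + i).
  have [t h l] := arc_node fi fs ft (ltn_ord i).
  have := @cut_arc i i; rewrite t h ifN ?fi1 //; apply=> //.
  by have := ltn_ord i; rewrite /A; lia.
have h2 : U (n + n + j).
  have [t h l] := arc_out fi fs ft pL.
  have := @cut_arc (n + n + n + p) i; rewrite t h l pa pj; apply=> //; rewrite /A; lia.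
have [t h l] := arc_in fi fs ft pL'.
have := @cut_arc (n + n + n + L + p') w; rewrite t h l pb pj'; apply=> //; rewrite /A; lia.
Qed.

Lemma cut_source (i : 'I_n) : i \notin cut_nodes -> fs i != 0 -> U i.
Proof.
move=> ic fsi; have [t h l] := arc_src fi fs ft (ltn_ord i).
have := @cut_arc (n + i) i; rewrite t h l ifN //; apply=> //.
by have := ltn_ord i; rewrite /A; lia.
Qed.

Lemma cut_target (i : 'I_n) : i \notin cut_nodes -> ft i != 0 -> ~~ U i.
Proof.
move=> ic fti; apply: contra Ut => Ui.
have h1 : U (n + i).
  have [t h l] := arc_node fi fs ft (ltn_ord i).
  have := @cut_arc i i; rewrite t h ifN ?fi1 //; apply=> //.
  by have := ltn_ord i; rewrite /A; lia.
have [t h l] := arc_tgt fi fs ft (ltn_ord i).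
have := @cut_arc (n + n + i) i; rewrite t h l ifN //; apply=> //.
by have := ltn_ord i; rewrite /A; lia.
Qed.

(** A component without cut nodes lies on one side of the cut, together with its boundary up to cut
    nodes. On the source side no uncut node may lead to the target, and on the other side none may
    be fed by the source. *)
Lemma cut_misses (U0 : {set 'I_n}) (v : 'I_n) : v \in U0 ->
  [disjoint cut_nodes & component edge U0 v] ->
  (forall w, w \in bdry edge U0 v -> w \notin cut_nodes -> fs w = 0) \/
  (forall w, w \in bdry edge U0 v -> w \notin cut_nodes -> ft w = 0).
Proof.
move=> vU dis.
have notc x : x \in component edge U0 v -> x \notin cut_nodes.
  by move=> xc; apply: contraL dis => xn; apply/pred0Pn; exists x; rewrite /= xn.
have side : component edge U0 v :|: bdry edge U0 v \subset
    [set w : 'I_n | (w \in cut_nodes) || (U w == U v)].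
  apply: comp_min => // [|x w]; first by rewrite inE eqxx orbT.
  rewrite in_set => xP xc sh; rewrite in_set.
  rewrite (negPf (notc x xc)) /= in xP; move/eqP: xP => <-.
  case: (boolP (w \in cut_nodes)) => //= wn.
  apply/eqP; apply/idP/idP; apply: cut_share => //; try exact: notc.
  by rewrite share_sym.
have bd w : w \in bdry edge U0 v -> w \notin cut_nodes -> U w = U v.
  move=> wb wn; have := subsetP side w; rewrite in_setU wb orbT in_set (negPf wn) /=.
  by move=> /(_ isT)/eqP.
case E: (U v); [right|left] => w wb wn; apply/eqP; apply: contraT => H.
- by have := cut_target wn H; rewrite bd // E.
- by have := cut_source wn H; rewrite bd // E.
Qed.

End Cut.

(** Put on the source side the nodes of [B], the out-copies of those outside [Y], and the hyperedges
    that meet [B] outside [Y]. Such hyperedges lie inside [B], so only the inner arcs of nodes of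
    [Y] can cross. *)
Lemma separation_cut (fi fs ft : nat -> nat) (B Y : {set 'I_n}) :
  (forall j, edge j \subset B \/ edge j :&: B \subset Y) ->
  (forall i : 'I_n, fs i != 0 -> i \in B) ->
  (forall i : 'I_n, ft i != 0 -> i \notin B) ->
  exists U : pred nat, [/\ U src, ~~ U tgt & leaving A (TL ft) (HD fi fs) U <= #|Y|].
Proof.
move=> sep sB tB.
pose U (x : nat) := [|| [exists i : 'I_n, (i \in B) && (x == i)],
  [exists i : 'I_n, [&& i \in B, i \notin Y & x == n + i]],
  [exists j : 'I_m, ~~ (edge j :&: B \subset Y) && (x == n + n + j)] | x == src].
have Uin (i : 'I_n) : U i = (i \in B).
  apply/idP/idP => [|iB]; last by rewrite /U; apply/or4P; constructor 1; apply/existsP; exists i; rewrite iB /=.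
  rewrite /U => /or4P[/existsP[i' /andP[iB /eqP/val_inj->]]//|/existsP[i' /and3P[_ _]]|/existsP[j /andP[_]]|];
    by have := ltn_ord i; rewrite ?/src; lia.
have Uout (i : 'I_n) : U (n + i) = (i \in B) && (i \notin Y).
  apply/idP/idP => [|/andP[iB iY]]; last first.
    by rewrite /U; apply/or4P; constructor 2; apply/existsP; exists i; rewrite iB iY /=.
  rewrite /U => /or4P[/existsP[i' /andP[_]]|/existsP[i' /and3P[iB iY]]|/existsP[j /andP[_]]|].
  - by have := ltn_ord i'; lia.
  - by rewrite eqn_add2l => /eqP/val_inj->; rewrite iB iY.
  - by have := ltn_ord i; lia.
  - by have := ltn_ord i; rewrite /src; lia.
have Ued (j : 'I_m) : U (n + n + j) = ~~ (edge j :&: B \subset Y).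
  apply/idP/idP => [|h]; last first.
    by rewrite /U; apply/or4P; constructor 3; apply/existsP; exists j; rewrite h /=.
  rewrite /U => /or4P[/existsP[i' /andP[_]]|/existsP[i' /and3P[_ _]]|/existsP[j' /andP[h]]|].
  - by have := ltn_ord i'; lia.
  - by have := ltn_ord i'; lia.
  - by rewrite eqn_add2l => /eqP/val_inj->.
  - by have := ltn_ord j; rewrite /src; lia.
have Us : U src by rewrite /U eqxx !orbT.
have Ut : ~~ U tgt.
  rewrite /U /tgt; apply/negP => /or4P[/existsP[i' /andP[_]]|/existsP[i' /and3P[_ _]]|/existsP[j' /andP[h]]|].
  - by have := ltn_ord i'; lia.
  - by have := ltn_ord i'; lia.
  - by have := ltn_ord j'; lia.
  - by rewrite /src; lia.
exists U; split=> //; rewrite leaving_card.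
have nA (i : 'I_n) : i < A by have := ltn_ord i; rewrite /A; lia.
rewrite -(card_imset Y (f := fun i => Ordinal (nA i))); last first.
  by move=> i i' [E]; apply: val_inj.
apply: subset_leq_card; apply/subsetP => -[a aA]; rewrite inE /=.
suff : U (TL ft a) -> ~~ U (HD fi fs a) -> exists2 i : 'I_n, i \in Y & a = i.
  by move=> H /andP[h1 h2]; have [i iY E] := H h1 h2; apply/imsetP; exists i => //; apply: val_inj.
move: a aA; apply: arc_cases => [i iN|i iN|i iN|p pL|p pL].
- have [-> -> _] := arc_node fi fs ft iN; case: ifP => _; first by move=> ->.
  rewrite (Uin (Ordinal iN)) (Uout (Ordinal iN)) => -> /=; rewrite negbK => h.
  by exists (Ordinal iN).
- have [-> -> _] := arc_src fi fs ft iN; case: ifP => [_ -> //|/negbT fsi _].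
  by rewrite (Uin (Ordinal iN)) sB.
- have [-> -> _] := arc_tgt fi fs ft iN; case: ifP => [_|/negbT fti]; first by move=> ->.
  by rewrite (Uout (Ordinal iN)) (negPf (tB (Ordinal iN) fti)).
- have [-> -> _] := arc_out fi fs ft pL.
  rewrite (Uout (Ordinal (ndP pL))) (Ued (Ordinal (ejP pL))) negbK => /andP[iB iY] sub.
  case/negP: iY; apply: subsetP sub _ _; rewrite inE iB andbT; apply/incP; by exists p.
- have [-> -> _] := arc_in fi fs ft pL.
  rewrite (Uin (Ordinal (ndP pL))) (Ued (Ordinal (ejP pL))).
  case: (sep (Ordinal (ejP pL))) => [sub _|->//].
  by rewrite (subsetP sub) //; apply/incP; exists p.
Qed.

End NetworkCuts.

(** * Growing a tree decomposition *)

Section Bags.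
Variables (n m : nat) (edge : 'I_m -> {set 'I_n}).
Implicit Types (birth : 'I_n -> nat) (bag : nat -> {set 'I_n}) (par : nat -> nat).
Local Notation component := (component edge).
Local Notation bdry := (bdry edge).

Definition unborn birth : {set 'I_n} := [set i | birth i == 0].

Definition last_birth birth (W : {set 'I_n}) := \max_(i in W) birth i.

(** A partial tree decomposition with bags numbered from 1, where [birth] is the first bag of a node
    and 0 means none. The third clause makes the bags of each node a subtree. The fourth keeps the
    boundary of every unborn component inside one bag, so that a new bag has a place to hang from.
    The fifth puts a hyperedge whose nodes are all born into the birth bag of its last-born node. *)
Definition bags_ok N b birth bag par :=
  [/\ (forall i, birth i <= N) /\ (forall i, 0 < birth i -> i \in bag (birth i)),
      forall t i, 0 < t <= N -> i \in bag t -> 0 < birth i <= t,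
      forall t, 0 < t <= N -> par t < t /\
        forall i, i \in bag t -> birth i < t -> i \in bag (par t),
      forall v, v \in unborn birth -> let W := bdry (unborn birth) v in
        W \subset bag (last_birth birth W) /\ #|W| <= b &
      forall j u w, u \in edge j -> w \in edge j -> 0 < birth w <= birth u ->
        w \in bag (birth u)].

Lemma bags_ok0 birth bag par : (forall i, birth i = 0) -> bags_ok 0 0 birth bag par.
Proof.
move=> b0; split.
- by split=> i; rewrite b0.
- by case.
- by case.
- move=> v vU; have U1 : unborn birth = setT by apply/setP => i; rewrite !inE b0.
  have -> : bdry (unborn birth) v = set0 by apply/setP => i; rewrite !inE b0.
  by move=> W; rewrite sub0set cards0.
- by move=> j u w; rewrite !b0.
Qed.

Lemma bags_ok_le N b b' birth bag par : b <= b' ->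
  bags_ok N b birth bag par -> bags_ok N b' birth bag par.
Proof.
move=> le [h1 h2 h3 h4 h5]; split=> // v vU; have [? le'] := h4 v vU.
by split=> //; exact: leq_trans le' le.
Qed.

Lemma comp_subset (U U' : {set 'I_n}) v : v \in U -> v \in U' -> U' \subset U ->
  component U' v \subset component U v.
Proof.
move=> vU vU' sub; apply/subsetP => u; rewrite !inE; apply: connect_sub => a b.
move=> /and3P[aU bU sh]; apply: connect1.
by rewrite /= (subsetP sub) // (subsetP sub).
Qed.

Section Extend.
Variables (N b b' : nat) (birth birth' : 'I_n -> nat) (bag bag' : nat -> {set 'I_n}).
Variables (par par' : nat -> nat) (v : 'I_n) (NB : {set 'I_n}).
Hypothesis ok : bags_ok N b birth bag par.
Let U := unborn birth.
Let U' := unborn birth'.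
Let W := bdry U v.
Let C := component U v.
Hypotheses (vU : v \in U) (vNB : v \in NB) (NBC : NB \subset C).
Hypothesis birthE : forall i, birth' i = if i \in NB then N.+1 else birth i.
Hypothesis bagE : forall t, t <= N -> bag' t = bag t.
Hypothesis bagN : bag' N.+1 = W :|: NB.
Hypothesis parE : forall t, t <= N -> par' t = par t.
Hypothesis parN : par' N.+1 = last_birth birth W.
Hypotheses (bb : b <= b')
  (small : forall v', v' \in U' -> v' \in C -> #|bdry U' v'| <= b').

Let NBU : NB \subset U.
Proof. exact: subset_trans NBC (comp_sub edge vU). Qed.

Let U'E : U' = U :\: NB.
Proof.
apply/setP => i; rewrite !inE birthE; case: ifP => // iNB.
Qed.

Let U'U : U' \subset U. Proof. by rewrite U'E subsetDl. Qed.

Let oldb i : i \notin NB -> birth' i = birth i.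
Proof. by rewrite birthE => /negPf->. Qed.

Let born_old i : 0 < birth i -> i \notin NB.
Proof. by move=> b0; apply: contraL b0 => /(subsetP NBU); rewrite inE => /eqP->. Qed.

Lemma bdry_new v' : v' \in U' -> v' \in C -> bdry U' v' \subset W :|: NB.
Proof.
move=> v'U' v'C; have v'U := subsetP U'U v' v'U'.
apply/subsetP => w; rewrite inE => /andP[wU' /exists_inP[c cC' sh]].
have cC : c \in C.
  by rewrite /C -(comp_eq v'C); apply: subsetP (comp_subset v'U v'U' U'U) c cC'.
have := comp_closed vU cC sh; rewrite !in_setU -/C -/W => /orP[wC|->//].
by move: wU'; rewrite U'E inE (subsetP (comp_sub edge vU)) // andbT negbK => ->; rewrite orbT.
Qed.

(** Otherwise the component of [v'] would not have shrunk and would still contain [v], which is born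
    now. Hence the last birth on the boundary is the new bag. *)
Lemma bdry_meets v' : v' \in U' -> v' \in C -> exists2 w, w \in NB & w \in bdry U' v'.
Proof.
move=> v'U' v'C; have v'U := subsetP U'U v' v'U'.
have [/exists_inP[w h1 h2]|/exists_inPn no] := boolP [exists w in NB, w \in bdry U' v'].
  by exists w.
have sub : component U v' :|: bdry U v' \subset component U' v' :|: bdry U' v'.
  apply: comp_min => //; first by rewrite in_setU comp_refl.
  move=> u w; rewrite in_setU => /orP[uC' _ sh|uW' uC sh]; first exact: comp_closed sh.
  have uU := subsetP (comp_sub edge v'U) u uC.
  have uNB : u \in NB by move: uW'; rewrite inE U'E inE uU andbT negbK => /andP[].
  by have := no u uNB; rewrite uW'.
have : v \in component U' v' :|: bdry U' v'.
  by apply: subsetP sub v _; rewrite in_setU (comp_eq v'C) comp_refl.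
rewrite in_setU => /orP[/(subsetP (comp_sub edge v'U'))|vW'].
  by rewrite U'E inE vNB.
by have := no v vNB; rewrite vW'.
Qed.

Lemma bdry_old v' : v' \in U' -> v' \notin C -> bdry U' v' = bdry U v'.
Proof.
move=> v'U' v'C; have v'U := subsetP U'U v' v'U'.
have disj u : u \in component U v' -> u \notin NB.
  move=> uC; apply: contra v'C => /(subsetP NBC) uC2.
  by rewrite /C -(comp_eq uC2) (comp_eq uC) comp_refl.
have sub : component U v' :|: bdry U v' \subset component U' v' :|: bdry U' v'.
  apply: comp_min => //; first by rewrite in_setU comp_refl.
  move=> u w; rewrite in_setU => /orP[uC' _ sh|uW' uC sh]; first exact: comp_closed sh.
  have uU := subsetP (comp_sub edge v'U) u uC.
  by move: uW'; rewrite inE U'E inE uU (negPf (disj u uC)).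
apply/eqP; rewrite eqEsubset; apply/andP; split; apply/subsetP => w wW.
  have := wW; rewrite inE => /andP[wU' /exists_inP[c cC' sh]].
  have cC := subsetP (comp_subset v'U v'U' U'U) c cC'.
  have := comp_closed v'U cC sh; rewrite in_setU => /orP[wC|//].
  move: wU'; rewrite U'E inE (disj w wC) /=.
  by rewrite (subsetP (comp_sub edge v'U) w wC).
have := subsetP sub w; rewrite !in_setU wW orbT => /(_ isT)/orP[wC'|//].
have := subsetP U'U w (subsetP (comp_sub edge v'U') w wC').
by move: wW; rewrite inE => /andP[/negPf->].
Qed.

(** Remaining components inside [C] are bounded by the new bag, those outside keep their old
    boundary. A hyperedge through a new node stays within [C] and its boundary, so its born nodes
    are in the new bag. *)
Lemma bags_extend : bags_ok N.+1 b' birth' bag' par'.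
Proof.
have [[h1 h1'] h2 h3 h4 h5] := ok.
have [hW _] := h4 v vU; rewrite -/U -/W in hW.
have mbN : last_birth birth W <= N by apply/bigmax_leqP => i _.
have WU w : w \in W -> 0 < birth w by rewrite inE => /andP[]; rewrite inE lt0n.
split.
- split=> i; first by rewrite birthE; case: ifP => // _; apply: leqW.
  rewrite birthE; case: ifP => iNB; first by rewrite bagN inE iNB orbT.
  by move=> b0; rewrite bagE // h1'.
- move=> t i /andP[t0]; rewrite leq_eqVlt => /orP[/eqP->|].
    rewrite bagN inE birthE => /orP[iW|->]; last by rewrite leqnn.
    by rewrite (negPf (born_old (WU i iW))) WU // leqW.
  rewrite ltnS => tN; rewrite bagE // => iV.
  have := h2 t i; rewrite t0 tN => /(_ isT iV) /andP[i0 it].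
  by rewrite oldb ?born_old // i0.
- move=> t /andP[t0]; rewrite leq_eqVlt => /orP[/eqP->|].
    rewrite parN ltnS; split=> // i; rewrite bagN inE => /orP[iW|iNB].
      by rewrite bagE // => _; apply: subsetP hW i iW.
    by rewrite birthE iNB ltnn.
  rewrite ltnS => tN; have [|pt hp] := h3 t; first by rewrite t0.
  rewrite parE //; split=> // i; rewrite !bagE //; last by apply: leq_trans tN; apply: ltnW.
  move=> iV it; apply: hp => //; move: it; rewrite oldb //; apply: born_old.
  by have := h2 t i; rewrite t0 tN => /(_ isT iV) /andP[].
- move=> v' v'U' W'; case: (boolP (v' \in C)) => v'C.
    split; last exact: small.
    have [w wNB wW'] := bdry_meets v'U' v'C.
    have -> : last_birth birth' W' = N.+1.
      apply/eqP; rewrite eqn_leq; apply/andP; split.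
        by apply/bigmax_leqP => i _; rewrite birthE; case: ifP => // _; apply: leqW.
      by apply: leq_trans (leq_bigmax_cond _ wW'); rewrite birthE wNB.
    by rewrite bagN; apply: bdry_new.
  have EW : W' = bdry U v' by apply: bdry_old.
  have [sub le] := h4 v' (subsetP U'U v' v'U').
  have EL : last_birth birth' W' = last_birth birth (bdry U v').
    rewrite EW; apply: eq_bigr => w; rewrite inE => /andP[wU _].
    by rewrite oldb // born_old // lt0n; rewrite inE in wU.
  rewrite EL EW; split; last exact: leq_trans le bb.
  by rewrite bagE //; apply/bigmax_leqP.
- move=> j u w uj wj; rewrite [birth' u]birthE; case: ifP => uNB.
    rewrite bagN => /andP[w0 _].
    have sh : share edge u w by apply/shareP; exists j.
    have := comp_closed vU (subsetP NBC u uNB) sh.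
    rewrite !in_setU -/C -/W => /orP[wC|->//].
    apply/orP; case E: (w \in NB); [by right | left].
    rewrite birthE E in w0.
    by have := subsetP (comp_sub edge vU) w wC; rewrite inE => /eqP E0; rewrite E0 in w0.
  move=> /andP[w0 wu]; rewrite bagE //.
  have wNB : w \notin NB.
    by apply: contraL wu; rewrite birthE => ->; rewrite -ltnNge ltnS.
  by rewrite oldb // in w0 wu; apply: h5 uj wj _; rewrite w0.
Qed.

End Extend.

(* [q] counts the nodes of [W] on either side of the separator [S]; fewer than [q]
   nodes of [S] cannot make up for the side that the component does not touch. *)
Lemma bdry_separated q (W C S Y W' : {set 'I_n}) (v : 'I_n) :
  [disjoint W & C] -> #|S| < q -> Y \subset W -> q <= #|Y| ->
  W' \subset W :|: (v |: S :&: C) -> (forall w, w \in W' -> w \notin S -> w \notin Y) ->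
  #|W'| <= #|W|.
Proof.
move=> dis Sq YW Yq sub miss.
have sub2 : W' \subset (W :\: (Y :\: S)) :|: (v |: S :&: C).
  apply/subsetP => w wW'; have := subsetP sub w wW'; rewrite !in_setU => /orP[wW|->]; last by rewrite orbT.
  apply/orP; left; rewrite in_setD wW andbT in_setD negb_and negbK.
  by case: (boolP (w \in S)) => //= wS; apply: miss.
have := subset_leq_card sub2.
have [+ _] := leq_card_setU (W :\: (Y :\: S)) (v |: S :&: C); rewrite cardsU1.
have : #|W :\: (Y :\: S)| = #|W| - #|Y :\: S|.
  by rewrite cardsD; congr (_ - _); apply: eq_card => w; rewrite !inE; case: (boolP (w \in Y)) => [/(subsetP YW)->|]; rewrite ?andbF ?andbT.
have := cardsID S Y.
have : #|Y :&: S| + #|S :&: C| <= #|S|.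
  have -> : #|Y :&: S| + #|S :&: C| = #|(Y :&: S) :|: (S :&: C)|.
    rewrite cardsU [X in _ - X](_ : _ = 0) ?subn0 //; apply/eqP; rewrite cards_eq0 -subset0.
    apply/subsetP => w; rewrite !inE => /andP[/andP[wY _] /andP[_ wC]].
    by have := disjointFr dis (subsetP YW w wY); rewrite wC.
  by apply: subset_leq_card; apply/subsetP => w; rewrite !inE => /orP[]/andP[].
have : #|Y :\: S| <= #|W|.
  by apply: subset_leq_card; apply: subset_trans YW; apply: subsetDl.
case: (v \notin S :&: C); lia.
Qed.

End Bags.

(** * The tree decomposition program *)

(* Registers: 32 to 34 hold the bounds [q], [4 q] on the colours and [3 q] on the
   boundary, 85 the number of bags, 86 the first free cell of array 82. Arrays: 80
   youngest bag of a node, counted from 1, with 0 for none; 81 its colour; 82 the rows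
   of nodes indexed by colours, row [t] from cell [83 t] on; 84 the parents of the bags. *)
Definition PickNode : cmd := (
  Set' 87 eN ;;
  For 92 eN (If' (BEq (NGet 80 (Var 92)) (NCst 0)) (Set' 87 (Var 92)) Skip))%cmd.

(** Truncated subtraction turns the last assignment into a maximum: register 89 ends as the last
    birth on the boundary, which is the parent of the new bag. The boundary is written straight into
    the row that this bag will occupy. *)
Definition CollectBdry : cmd :=
  For 92 eN (
    NSet 90 (Var 92) (NCst 0) ;; NSet 91 (Var 92) (NCst 0) ;;
    If' (BEq (NGet 56 (Var 92)) (NCst 0)) Skip
      (If' (BEq (NGet 80 (Var 92)) (NCst 0)) (NSet 90 (Var 92) (NCst 1))
        (NSet 82 (Var 86 + NGet 81 (Var 92)) (Var 92 + NCst 1) ;;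
         Set' 88 (Var 88 + NCst 1) ;;
         Set' 89 (Var 89 + (NGet 80 (Var 92) - Var 89)))))%cmd.

Definition ExploreComponent : cmd := (
  For 92 eN (
    If' (BEq (NGet 80 (Var 92)) (NCst 0))
      (NSet 53 (Var 92) (NCst 1)) (NSet 53 (Var 92) (NCst 0)) ;;
    NSet 54 (Var 92) (NCst 0) ;; NSet 55 (Var 92) (NCst 0)) ;;
  NSet 54 (Var 87) (NCst 1) ;;
  InitArcs ;; Bfs ;;
  Set' 88 (NCst 0) ;; Set' 89 (NCst 0) ;;
  CollectBdry)%cmd.

Section Explore.
Variables (R : realType) (n m L : nat) (nd ej : nat -> nat) (edge : 'I_m -> {set 'I_n}).
Implicit Types s : state R.
Hypothesis ndP : forall p, p < L -> nd p < n.
Hypothesis ejP : forall p, p < L -> ej p < m.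
Hypothesis incP : forall (i : 'I_n) (j : 'I_m),
  reflect (exists2 p, p < L & nd p = i /\ ej p = j) (i \in edge j).
Let X := n + n + m + 2.
Let src := n + n + m.
Let tgt := n + n + m + 1.
Let A := n + n + n + L + L.
Local Notation inputs_in := (@inputs_in R n m L nd ej).
Local Notation network_in := (@network_in R n m L nd ej).

(* Nodes are shifted by one: 0 marks an unused colour. *)
Definition row_is (f : nat -> nat) (col : nat -> nat) (W : {set 'I_n}) :=
  (forall u : 'I_n, u \in W -> f (col u) = u.+1) /\
  (forall c, f c != 0 -> exists2 u : 'I_n, u \in W & col u = c /\ f c = u.+1).

Lemma row_is0 f col : (forall c, f c = 0) -> row_is f col set0.
Proof. by move=> f0; split=> [u|c]; rewrite ?inE // f0. Qed.

Lemma row_is_ext f f' (col col' : nat -> nat) (W : {set 'I_n}) : f =1 f' -> (forall u : 'I_n, u \in W -> col u = col' u) ->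
  row_is f col W -> row_is f' col' W.
Proof.
move=> ef ec [h1 h2]; split=> [u uW|c]; first by rewrite -ef -ec // h1.
by rewrite -ef => /h2[u uW [e1 e2]]; exists u; rewrite // -ec.
Qed.

Lemma row_is_add f (col : nat -> nat) W (u : 'I_n) c : row_is f col W -> (f c = 0) -> col u = c ->
  row_is (fun c' => if c' == c then u.+1 else f c') col (u |: W).
Proof.
move=> [h1 h2] fc cu; split=> [w|c'].
  rewrite !inE => /orP[/eqP->|wW]; first by rewrite cu eqxx.
  by case: eqP => [E|_]; [move: (h1 w wW); rewrite E fc | exact: h1].
case: (c' =P c) => [-> _|_ nz]; first by exists u; [rewrite !inE eqxx | split].
have [w wW E] := h2 c' nz.
by exists w; rewrite // inE wW orbT.
Qed.

Lemma PickNode_wp s : nmem s 0 0 = n ->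
  wp PickNode s (n * 6 + 4) (fun s' =>
    (exists v : 'I_n, nmem s' 87 0 = v /\ nmem s 80 v = 0) \/
    (nmem s' 87 0 = n /\ forall v : 'I_n, nmem s 80 v != 0)).
Proof.
move=> sn; eapply wp_le.
  eapply wp_seq; apply: wp_nset => /=.
  eapply (wp_for (T := 3) (Inv := fun i s1 =>
    (exists v : 'I_n, nmem s1 87 0 = v /\ nmem s 80 v = 0) \/
    (nmem s1 87 0 = n /\ forall v : 'I_n, v < i -> nmem s 80 v != 0))).
  - by rewrite /= /upd /= sn.
  - by [].
  - by [].
  - by right; rewrite /= /upd /= sn.
  - move=> i s1 iN xi fr H; eapply wp_le.
      apply: wp_if => /=; rewrite xi (frn (a := 80) fr) //= => c0.
        apply: wp_nset; left; exists (Ordinal iN); rewrite /= /upd /= xi; split=> //.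
        exact/eqP.
      apply: wp_skip; case: H => [|[-> H]]; [by left|right; split=> // v].
      rewrite ltnS leq_eqVlt => /orP[/eqP->|]; [exact: c0 | exact: H].
    by [].
  - by move=> s1 fr [|[-> H]]; [left|right; split=> // v; apply: H].
by rewrite /=; lia.
Qed.

Lemma ExploreFlags_wp s (U : {set 'I_n}) : nmem s 0 0 = n ->
  (forall u : 'I_n, (nmem s 80 u == 0) = (u \in U)) ->
  wp (For 92 eN (
    If' (BEq (NGet 80 (Var 92)) (NCst 0))
      (NSet 53 (Var 92) (NCst 1)) (NSet 53 (Var 92) (NCst 0)) ;;
    NSet 54 (Var 92) (NCst 0) ;; NSet 55 (Var 92) (NCst 0)))%cmd s (n * 8 + 3) (fun s' =>
    forall u : 'I_n, [/\ nmem s' 53 u = (u \in U), nmem s' 54 u = 0 & nmem s' 55 u = 0]).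
Proof.
move=> sn EU; eapply (wp_for (T := 5) (Inv := fun i s1 => forall u : 'I_n, u < i ->
   [/\ nmem s1 53 u = (u \in U), nmem s1 54 u = 0 & nmem s1 55 u = 0])).
- by [].
- by [].
- by [].
- by [].
- move=> i s1 iN xi fr H; eapply wp_le.
    eapply wp_seq; apply: wp_if => /=; rewrite xi (frn (a := 80) fr) //= => c0;
    apply: wp_nset; rewrite /=;
    eapply wp_seq; apply: wp_nset; apply: wp_nset => u;
    rewrite /= /upd /= xi ltnS leq_eqVlt; case: eqP => [ui|_] //=; try (exact: H);
    by rewrite -EU ui ?c0 ?(negPf c0).
  by [].
- by move=> s1 _ H u; apply: H.
Qed.

Lemma CollectBdry_wp s (U C W : {set 'I_n}) : nmem s 0 0 = n ->
  (forall u : 'I_n, (nmem s 80 u == 0) = (u \in U)) ->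
  C \subset U -> [disjoint W & U] ->
  (forall u : 'I_n, nmem s 56 u = (u \in C :|: W)) ->
  {in W &, forall u w : 'I_n, nmem s 81 u = nmem s 81 w -> u = w} ->
  (forall x, nmem s 86 0 <= x -> nmem s 82 x = 0) ->
  nmem s 88 0 = 0 -> nmem s 89 0 = 0 ->
  wp CollectBdry s (n * 20 + 3) (fun s' =>
    [/\ forall u : 'I_n, nmem s' 90 u = (u \in C) /\ nmem s' 91 u = 0,
      row_is (fun c => nmem s' 82 (nmem s 86 0 + c)) (nmem s 81) W,
      forall x, x < nmem s 86 0 -> nmem s' 82 x = nmem s 82 x,
      nmem s' 88 0 = #|W| & nmem s' 89 0 = \max_(u in W) nmem s 80 u]).
Proof.
move=> sn EU CU dWU mk inj z82 s88 s89.
set VB := nmem s 86 0.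
pose Wi i := [set u in W | u < i].
have W0 : Wi 0 = set0 by apply/setP => u; rewrite !inE andbF.
have WS i (iN : i < n) : Wi i.+1 = if Ordinal iN \in W then Ordinal iN |: Wi i else Wi i.
  apply/setP => u; rewrite inE ltnS leq_eqVlt andb_orr.
  case: (boolP (Ordinal iN \in W)) => iW; rewrite !inE -?[u == Ordinal iN]val_eqE /=.
    by congr (_ || _); case: eqP => // E; rewrite ?andbF ?andbT // (_ : u = Ordinal iN) //; apply: val_inj.
  case: (eqVneq (u : nat) i) => [E|_]; last by rewrite andbF.
  by rewrite (_ : u = Ordinal iN) ?(negPf iW) //; apply: val_inj.
have notin i (iN : i < n) : Ordinal iN \notin Wi i by rewrite inE ltnn andbF.
eapply (wp_for (T := 17) (Inv := fun i s1 =>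
    [/\ forall u : 'I_n, u < i -> nmem s1 90 u = (u \in C) /\ nmem s1 91 u = 0,
      row_is (fun c => nmem s1 82 (VB + c)) (nmem s 81) (Wi i),
      forall x, x < VB -> nmem s1 82 x = nmem s 82 x,
      nmem s1 88 0 = #|Wi i| & nmem s1 89 0 = \max_(u in Wi i) nmem s 80 u])).
- by [].
- by [].
- by [].
- rewrite W0 cards0 big_set0; split=> //.
  by apply: row_is0 => c; apply: z82; rewrite leq_addr.
- move=> i s1 iN xi fr [h1 h2 h3 h4 h5].
  pose io := Ordinal iN.
  have e80 : nmem s1 80 = nmem s 80 by rewrite (frn fr).
  have e81 : nmem s1 81 = nmem s 81 by rewrite (frn fr).
  have e86 : nmem s1 86 = nmem s 86 by rewrite (frn fr).
  have e56 : nmem s1 56 = nmem s 56 by rewrite (frn fr).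
  have mki : nmem s 56 i = (io \in C :|: W) by rewrite -mk.
  have Ei : (nmem s 80 i == 0) = (io \in U) by rewrite -EU.
  have WnU : io \in W -> io \notin U by move=> iW; rewrite (disjointFr dWU iW).
  eapply wp_le.
    eapply wp_seq; apply: wp_nset => /=.
    eapply wp_seq; apply: wp_nset => /=.
    apply: wp_if => /=; rewrite /upd /= xi e56 mki eqb0 in_setU negb_or => t1.
      apply: wp_skip; case/andP: t1 => iC iW.
      rewrite WS -/io (negPf iW) /= /upd /=; split=> // u; rewrite ltnS leq_eqVlt.
      by case: eqP => [ui|_]; [rewrite (_ : u = io) ?(negPf iC) //; apply: val_inj | exact: h1].
    apply: wp_if => /=; rewrite /upd /= e80 xi Ei => t2.
      have iC : io \in C by move: t1; rewrite negb_and !negbK => /orP[//|/WnU]; rewrite t2.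
      have iW : io \notin W by apply: contraL t2 => /WnU.
      apply: wp_nset; rewrite WS -/io (negPf iW) /= /upd /= xi; split=> // u; rewrite ltnS leq_eqVlt.
      by case: eqP => [ui|_]; [rewrite (_ : u = io) ?iC //; apply: val_inj | exact: h1].
    have iC : io \notin C by apply: contra t2 => /(subsetP CU).
    have iW : io \in W by move: t1; rewrite (negPf iC) negbK.
    eapply wp_seq; apply: wp_nset => /=.
    eapply wp_seq; apply: wp_nset => /=.
    apply: wp_nset; rewrite WS -/io iW /= /upd /= xi e80 e81 e86 -/VB h4 h5.
    have rowi : nmem s1 82 (VB + nmem s 81 i) = 0.
      apply/eqP; apply: contraT => nz; have [_ /(_ _ nz)] := h2.
      move=> [u]; rewrite inE => /andP[uW ui] [ce _].
      by have := inj u io uW iW ce => E; rewrite E ltnn in ui.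
    split.
    + move=> u; rewrite ltnS leq_eqVlt.
      by case: eqP => [ui|_]; [rewrite (_ : u = io) ?(negPf iC) //; apply: val_inj | exact: h1].
    + apply: row_is_ext (row_is_add h2 rowi (erefl (nmem s 81 io))) => // c.
      by rewrite eqn_add2l addn1.
    + by move=> x xV; rewrite ifF; [exact: h3 | apply/negbTE; rewrite neq_ltn (leq_trans xV) ?leq_addr].
    + by rewrite cardsU1 notin addn1.
    + by rewrite big_setU1 ?notin //= maxnC maxnE.
  by [].
- move=> s1 _ [h1 h2 h3 h4 h5].
  have Wn : Wi n = W by apply/setP => u; rewrite inE ltn_ord andbT.
  by rewrite Wn in h2 h4 h5; split=> // u; apply: h1.
Qed.

End Explore.

Definition ReadSides : cmd := (
  For 92 eN (NSet 53 (Var 92) (NCst 1) ;; NSet 54 (Var 92) (NCst 0) ;;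
             NSet 55 (Var 92) (NCst 0)) ;;
  Set' 94 (NCst 0) ;; Set' 95 (NCst 0) ;;
  For 92 (Var 33) (
    If' (BEq (NGet 82 (Var 86 + Var 92)) (NCst 0)) Skip
      (If' (BEq (NGet 43 (Var 92)) (NCst 0))
        (NSet 55 (NGet 82 (Var 86 + Var 92) - NCst 1) (NCst 1) ;;
         Set' 95 (Var 95 + NCst 1))
        (NSet 54 (NGet 82 (Var 86 + Var 92) - NCst 1) (NCst 1) ;;
         Set' 94 (Var 94 + NCst 1)))))%cmd.

Definition TryCode : cmd := (
  Set' 20 (Var 93) ;; Set' 21 (NCst 2) ;; Set' 22 (Var 33) ;; Decode 43 ;;
  ReadSides ;;
  If' (BAnd (BLe (Var 32) (Var 94)) (BLe (Var 32) (Var 95))) (InitArcs ;; Flow) Skip)%cmd.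

(** A bipartition of the boundary is a number below [2 ^ K], read in base 2 along the colours.
    Digits at colours absent from the boundary are ignored, so bipartitions may recur. *)
Definition Search : cmd := (
  Set' 70 (NCst 0) ;; Set' 21 (NCst 2) ;; Set' 22 (Var 33) ;; Pow ;;
  For 93 (Var 30) (If' (BEq (Var 70) (NCst 0)) TryCode Skip))%cmd.

(** The augmentations have reversed arcs, so the arcs are laid out afresh before the cut of the last
    reached set is collected. *)
Definition MarkCut : cmd := (
  InitArcs ;;
  For 92 eA (
    If' (BAnd (BNot (BEq (NGet 56 (NGet 50 (Var 92))) (NCst 0)))
              (BEq (NGet 56 (NGet 51 (Var 92))) (NCst 0)))
      (NSet 91 (NGet 52 (Var 92)) (NCst 1)) Skip))%cmd.

(** Induction on the queue position: each entry was reached by an arc from an earlier one. *)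
Lemma search_tree_min X A src tl hd par qs (Y : pred nat) :
  search_tree X A src tl hd par qs -> Y src ->
  (forall a, a < A -> Y (tl a) -> Y (hd a)) -> forall x, x \in qs -> Y x.
Proof.
move=> [u al h0 sz pr] Ys cl.
suff H k i : i <= k -> i < size qs -> Y (nth 0 qs i).
  by move=> x xq; rewrite -(nth_index 0 xq); apply: H (leqnn _) _; rewrite index_mem.
elim: k i => [|k IH] i; first by rewrite leqn0 => /eqP-> _; rewrite h0.
case: i => [|i] ik lt; first by rewrite h0.
have [aA ha it] := pr i.+1 lt; rewrite -ha; apply: cl => //.
have tq : tl (par (nth 0 qs i.+1)) \in qs by rewrite -index_mem (ltn_trans it).
by rewrite -(nth_index 0 tq); apply: IH; [lia | rewrite index_mem].
Qed.

(** * Finding a component with its boundary, and a small separator of the boundary *)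

Section Find.
Variables (R : realType) (n m L : nat) (nd ej : nat -> nat) (edge : 'I_m -> {set 'I_n}).
Implicit Types s : state R.
Hypothesis ndP : forall p, p < L -> nd p < n.
Hypothesis ejP : forall p, p < L -> ej p < m.
Hypothesis incP : forall (i : 'I_n) (j : 'I_m),
  reflect (exists2 p, p < L & nd p = i /\ ej p = j) (i \in edge j).
Let X := n + n + m + 2.
Let src := n + n + m.
Let tgt := n + n + m + 1.
Let A := n + n + n + L + L.
Local Notation inputs_in := (@inputs_in R n m L nd ej).
Local Notation network_in := (@network_in R n m L nd ej).
Local Notation TL := (arc_tl n m L nd ej).
Local Notation HD := (arc_hd n m L nd ej).

Lemma network_degrees s : network_in s -> \sum_(x < X) nmem s 61 x = A + A.
Proof. by case=> -[]. Qed.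

Lemma Explore_wp s (v : 'I_n) :
  let U := [set u : 'I_n | nmem s 80 u == 0] in
  let W := bdry edge U v in
  inputs_in s -> network_in s -> nmem s 87 0 = v -> v \in U ->
  {in W &, forall u w : 'I_n, nmem s 81 u = nmem s 81 w -> u = w} ->
  (forall x, nmem s 86 0 <= x -> nmem s 82 x = 0) ->
  wp ExploreComponent s (n * 30 + A * 60 + X * 30 + 60) (fun s' =>
    [/\ forall u : 'I_n, nmem s' 90 u = (u \in component edge U v) /\ nmem s' 91 u = 0,
      row_is (fun c => nmem s' 82 (nmem s 86 0 + c)) (nmem s 81) W,
      forall x, x < nmem s 86 0 -> nmem s' 82 x = nmem s 82 x,
      nmem s' 88 0 = #|W| & nmem s' 89 0 = \max_(u in W) nmem s 80 u]).
Proof.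
move=> U W inp net sv vU inj z82; have [sn sm sL se sd] := inp.
eapply wp_le.
  eapply wp_seq, wp_call.
    apply: (@ExploreFlags_wp _ n s U) => // u; by rewrite inE.
  move=> s1 fr1 fl1; eapply wp_seq; apply: wp_nset => /=.
  have v1 : nmem s1 87 0 = v by rewrite (frn fr1).
  rewrite v1; set s2 := setn _ _ _ _.
  have inp2 : inputs_in s2 by apply: (inputs_frame fr1).
  eapply wp_seq, wp_call; first exact: InitArcs_wp inp2.
  move=> s3 fr3 arcs.
  have inp3 : inputs_in s3 by apply: (inputs_frame fr3).
  have [n3 m3 L3 _ _] := inp3.
  have net3 : network_in s3.
    by apply: (network_frame fr3) => //; apply: (network_frame fr1).
  have lst : arcs_listed X A (nmem s3 50) (nmem s3 51) (nmem s3 61) (nmem s3 63) (nmem s3 62).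
    apply: (network_listed net3) => a aA; have [-> ->] := arcs a aA.
    by have [] := arc_ends ndP ejP (nmem s2 53) (nmem s2 54) (nmem s2 55) aA.
  have wB := Bfs_wp (src := src) lst (graph_of s3) n3 m3 erefl erefl.
  rewrite -big_distrl /= (network_degrees net3) in wB.
  eapply wp_seq, wp_call; first exact: wB.
  move=> s4 fr4 [qs [[st szq qn mk] cl]].
  have mkC (u : 'I_n) : nmem s4 56 u = (u \in component edge U v :|: W).
    rewrite mk; last by have := ltn_ord u; rewrite /X; lia.
    congr nat_of_bool.
    apply: (@reach_comp n m L nd ej edge ndP ejP incP (nmem s2 53) (nmem s2 54)
      (nmem s2 55) U v (mem qs)) => //.
    - by move=> w; rewrite /s2 /= /upd /=; have [-> _ _] := fl1 w; rewrite eqb0 negbK.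
    - move=> w; rewrite /s2 /= /upd /=; have [_ -> _] := fl1 w.
      by rewrite -val_eqE /=; case: ifP.
    - by move=> w wN; rewrite /s2 /= /upd /=; have [_ _ ->] := fl1 (Ordinal wN).
    - by case: st => _ _ E sz _; rewrite -[n + n + m]/src -E; apply: mem_nth.
    - move=> a aA; have [<- <-] := arcs a aA; exact: cl.
    - move=> Y Ys clY x xq; apply: (search_tree_min st Ys) xq => a aA.
      by have [-> ->] := arcs a aA; exact: clY.
  eapply wp_seq; apply: wp_nset => /=; eapply wp_seq; apply: wp_nset => /=.
  set s5 := setn _ _ _ _.
  have e80 : nmem s5 80 = nmem s 80 by rewrite /s5 /= !upd_neq // (frn fr4) // (frn fr3) // /s2 /= upd_neq // (frn fr1).
  have e81 : nmem s5 81 = nmem s 81 by rewrite /s5 /= !upd_neq // (frn fr4) // (frn fr3) // /s2 /= upd_neq // (frn fr1).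
  have e82 : nmem s5 82 = nmem s 82 by rewrite /s5 /= !upd_neq // (frn fr4) // (frn fr3) // /s2 /= upd_neq // (frn fr1).
  have e86 : nmem s5 86 = nmem s 86 by rewrite /s5 /= !upd_neq // (frn fr4) // (frn fr3) // /s2 /= upd_neq // (frn fr1).
  eapply wp_call.
    apply: (@CollectBdry_wp _ n s5 U (component edge U v) W).
    - by rewrite /s5 /= /upd /= (frn fr4).
    - by move=> u; rewrite e80 inE.
    - exact: comp_sub.
    - by rewrite disjoints_subset; apply/subsetP => u; rewrite !inE => /andP[].
    - by [].
    - by rewrite e81.
    - by rewrite e86 e82.
    - by [].
    - by [].
  by move=> s6 fr6; rewrite e80 e81 e82 e86.
rewrite /=; lia.
Qed.

Definition ind (Y : {set 'I_n}) (u : nat) : nat := [exists i in Y, val i == u].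

Lemma indE Y (u : 'I_n) : ind Y u = (u \in Y).
Proof.
rewrite /ind; congr nat_of_bool; apply/exists_inP/idP => [[i iY /eqP/val_inj<-]//|uY].
by exists u.
Qed.

Lemma arc_tl_eq (ft ft' : nat -> nat) a : (forall u : 'I_n, ft u = ft' u) -> TL ft a = TL ft' a.
Proof.
move=> E; rewrite /arc_tl; case: ifP => // c1; case: ifP => // c2; case: ifP => // c3.
have u : a - (n + n) < n by lia.
by rewrite (E (Ordinal u)).
Qed.

Lemma arc_hd_eq (fi fi' fs fs' : nat -> nat) a : (forall u : 'I_n, fi u = fi' u) ->
  (forall u : 'I_n, fs u = fs' u) -> HD fi fs a = HD fi' fs' a.
Proof.
move=> E1 E2; rewrite /arc_hd; case: ifP => c1; first by rewrite (E1 (Ordinal c1)).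
case: ifP => // c2; have u : a - n < n by lia.
by rewrite (E2 (Ordinal u)).
Qed.

Definition sides_in s (Y Z : {set 'I_n}) := forall u : 'I_n,
  [/\ nmem s 53 u = 1, nmem s 54 u = (u \in Y) & nmem s 55 u = (u \in Z)].

Lemma ReadSides_wp s (W : {set 'I_n}) K VB : nmem s 0 0 = n -> nmem s 33 0 = K ->
  nmem s 86 0 = VB ->
  row_is (fun c => nmem s 82 (VB + c)) (nmem s 81) W ->
  (forall u : 'I_n, u \in W -> nmem s 81 u < K) ->
  let Y := [set u in W | nmem s 43 (nmem s 81 u) != 0] in
  wp ReadSides s (n * 6 + K * 12 + 10) (fun s' =>
    [/\ sides_in s' Y (W :\: Y), nmem s' 94 0 = #|Y| & nmem s' 95 0 = #|W :\: Y|]).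
Proof.
move=> sn sK sV row colK Y.
pose col := nmem s 81.
pose Wi i := [set u in W | col u < i].
have W0 : Wi 0 = set0 by apply/setP => u; rewrite !inE andbF.
have rowi (u : 'I_n) : u \in W -> nmem s 82 (VB + col u) = u.+1 by case: row => + _; apply.
have inj (u w : 'I_n) : u \in W -> w \in W -> col u = col w -> u = w.
  by move=> uW wW E; apply/val_inj/succn_inj; rewrite -!rowi ?E.
have WS0 i : nmem s 82 (VB + i) = 0 -> Wi i.+1 = Wi i.
  move=> z; apply/setP => u; rewrite !inE ltnS leq_eqVlt.
  by case: (boolP (u \in W)) => //= uW; case: eqP => //= E; have := rowi u uW; rewrite E z.
have WS1 i (u : 'I_n) : u \in W -> col u = i -> Wi i.+1 = u |: Wi i.
  move=> uW E; apply/setP => w; rewrite !inE ltnS leq_eqVlt.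
  case: (eqVneq w u) => [->|wu]; first by rewrite uW E eqxx.
  case: (boolP (w \in W)) => //= wW; case: eqP => //= E'.
  by rewrite (inj w u wW uW) ?E ?eqxx in wu.
eapply wp_le.
  eapply wp_seq, (wp_for (T := 3) (Inv := fun i s1 => forall u : 'I_n, u < i ->
    [/\ nmem s1 53 u = 1, nmem s1 54 u = 0 & nmem s1 55 u = 0])).
  - exact: sn.
  - by [].
  - by [].
  - by [].
  - move=> i s1 iN xi fr H; eapply wp_le.
      eapply wp_seq; apply: wp_nset => /=; eapply wp_seq; apply: wp_nset => /=.
      apply: wp_nset => u; rewrite /= /upd /= xi ltnS leq_eqVlt.
      by case: eqP => //= _; exact: H.
    by [].
  move=> s1 fr1 fl1.
  eapply wp_seq; apply: wp_nset => /=; eapply wp_seq; apply: wp_nset => /=.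
  eapply (wp_for (N := K) (T := 8) (Inv := fun i s2 => 
    [/\ sides_in s2 (Y :&: Wi i) ((W :\: Y) :&: Wi i), nmem s2 94 0 = #|Y :&: Wi i| &
        nmem s2 95 0 = #|(W :\: Y) :&: Wi i|])).
  - by rewrite /= /upd /= (frn fr1) // sK.
  - by [].
  - by [].
  - rewrite /= /upd /= W0 !setI0 cards0; split=> // u; rewrite /= /upd /= inE.
    by apply: fl1.
  - move=> i s2 iK xi fr2 [h1 h2 h3].
    have e86 : nmem s2 86 = nmem s 86 by rewrite (frn fr2) //= !upd_neq // (frn fr1).
    have e82 : nmem s2 82 = nmem s 82 by rewrite (frn fr2) //= !upd_neq // (frn fr1).
    have e43 : nmem s2 43 = nmem s 43 by rewrite (frn fr2) //= !upd_neq // (frn fr1).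
    eapply wp_le.
      apply: wp_if => /=; rewrite e86 e82 xi sV => t1.
        by apply: wp_skip; rewrite WS0 //; apply/eqP.
      have [u uW [cu fu]] := (proj2 row) i t1.
      have uWi : u \notin Wi i by rewrite inE /col cu ltnn andbF.
      have uY : (u \in Y) = (nmem s 43 i != 0) by rewrite inE uW cu.
      apply: wp_if => /=; rewrite e43 xi => t2;
      eapply wp_seq; apply: wp_nset => /=; apply: wp_nset;
      rewrite /= /upd /= e86 e82 xi sV fu subn1 /= (WS1 i u uW cu).
      + have nY : u \notin Y by rewrite uY negbK.
        have E1 : Y :&: (u |: Wi i) = Y :&: Wi i.
          by apply/setP => w; rewrite !in_setI in_setU1; case: (w =P u) => [->|//]; rewrite (negPf nY).
        have E2 : (W :\: Y) :&: (u |: Wi i) = u |: ((W :\: Y) :&: Wi i).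
          apply/setP => w; rewrite !in_setI !in_setU1 in_setI in_setD.
          by case: (w =P u) => [->|//]; rewrite nY uW.
        rewrite E1 E2; split=> //; last first.
          by rewrite cardsU1 in_setI (negPf uWi) andbF addn1 h3.
        move=> w; have [f1 f2 f3] := h1 w; split=> //=.
        by rewrite /= /upd /= in_setU1 -val_eqE /=; case: eqP.
      + have Yu : u \in Y by rewrite uY.
        have E1 : (W :\: Y) :&: (u |: Wi i) = (W :\: Y) :&: Wi i.
          by apply/setP => w; rewrite !in_setI in_setU1 in_setD; case: (w =P u) => [->|//]; rewrite Yu.
        have E2 : Y :&: (u |: Wi i) = u |: (Y :&: Wi i).
          by apply/setP => w; rewrite !in_setI !in_setU1 in_setI; case: (w =P u) => [->|//]; rewrite Yu.
        rewrite E1 E2; split=> //; last first.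
          by rewrite cardsU1 in_setI (negPf uWi) andbF addn1 h2.
        move=> w; have [f1 f2 f3] := h1 w; split=> //=.
        by rewrite /= /upd /= in_setU1 -val_eqE /=; case: eqP.
    by [].
  - have WK : Wi K = W.
      by apply/setP => u; rewrite inE; case: (boolP (u \in W)) => //= /colK.
    move=> s2 _; rewrite WK (setIidPl (subsetDl W Y)) (setIidPl _) //.
    by apply/subsetP => u; rewrite inE => /andP[].
by rewrite /=; lia.
Qed.

Lemma leaving_eq tl hd tl' hd' (U : pred nat) :
  (forall a, a < A -> tl a = tl' a /\ hd a = hd' a) ->
  leaving A tl hd U = leaving A tl' hd' U.
Proof. by move=> E; apply: eq_bigr => a _; have [-> ->] := E a (ltn_ord a). Qed.

Definition cut_size (Y Z : {set 'I_n}) (U : pred nat) :=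
  leaving A (TL (ind Z)) (HD (ind setT) (ind Y)) U.

Lemma sides_arcs s Y Z : sides_in s Y Z -> forall a,
  TL (nmem s 55) a = TL (ind Z) a /\
  HD (nmem s 53) (nmem s 54) a = HD (ind setT) (ind Y) a.
Proof.
move=> H a; split; [apply: arc_tl_eq | apply: arc_hd_eq] => u; have [h1 h2 h3] := H u.
- by rewrite h3 indE.
- by rewrite h1 indE inE.
- by rewrite h2 indE.
Qed.

Section Search.
Variables (p q K VB : nat) (W : {set 'I_n}) (s0 : state R).
Let col := nmem s0 81.

Definition search_in s :=
  [/\ [/\ inputs_in s, network_in s & nmem s 81 = col],
      [/\ nmem s 31 0 = p, nmem s 32 0 = q, nmem s 33 0 = K & nmem s 86 0 = VB],
      row_is (fun c => nmem s 82 (VB + c)) col W &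
      forall u : 'I_n, u \in W -> col u < K].

Lemma search_frame c s s' : frame c s s' ->
  all (fun a => a \notin nwr c) [:: 0; 1; 2; 52; 61; 62; 63; 81; 31; 32; 33; 86; 82] ->
  search_in s -> search_in s'.
Proof.
rewrite /= => fr /and5P[i0 i1 i2 n0 /and5P[n1 n2 n3 c1 /and5P[h1 h2 h3 h4 /andP[h5 _]]]].
move=> [[inp net ec] [e1 e2 e3 e4] row colK]; split=> //.
- split; first by apply: (inputs_frame fr) => //=; rewrite i0 i1 i2.
  + by apply: (network_frame fr) => //=; rewrite n0 n1 n2 n3.
  + by rewrite (frn fr).
- by rewrite !(frn fr).
- by rewrite (frn fr).
Qed.

Definition found s := exists (Y : {set 'I_n}) (U : pred nat),
  [/\ [/\ Y \subset W, q <= #|Y| & q <= #|W :\: Y|], sides_in s Y (W :\: Y),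
     U src /\ ~~ U tgt, cut_size Y (W :\: Y) U <= p &
     forall x, x < X -> nmem s 56 x = U x].

Definition missed (Y : {set 'I_n}) := q <= #|Y| -> q <= #|W :\: Y| ->
  forall U : pred nat, U src -> ~~ U tgt -> p < cut_size Y (W :\: Y) U.

Definition try_cost := K * (2 ^ K * 8 + 30) + n * 6 + A * 30 +
  (p + 1) * (X * 40 + (A + A) * 11 + 50) + 60.

Definition side_of code := [set u in W | digit_of 2 (col u) code != 0].

Lemma TryCode_wp s code : search_in s -> nmem s 70 0 = 0 -> nmem s 93 0 = code ->
  code < 2 ^ K ->
  wp TryCode s try_cost (fun s' =>
    if nmem s' 70 0 == 0 then missed (side_of code) else found s').
Proof.
move=> sin s70 s93 codeK; have [[inp net ec] [e1 e2 e3 e4] row colK] := sin.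
have [sn _ _ _ _] := inp.
eapply wp_le.
  eapply wp_seq; apply: wp_nset => /=; eapply wp_seq; apply: wp_nset => /=.
  eapply wp_seq; apply: wp_nset => /=.
  eapply wp_seq, wp_call; first by apply: (@Decode_wp _ 43 _ code 2 K).
  move=> s1 fr1 dg.
  have sin1 : search_in s1 by apply: (search_frame fr1).
  have [[[n1 _ _ _ _] _ ec1] [_ _ K1 VB1] row1 _] := sin1.
  eapply wp_seq, wp_call.
    apply: (@ReadSides_wp s1 W K VB) => //; first by rewrite ec1.
    by rewrite ec1.
  rewrite ec1 => s2 fr2.
  have -> : [set u in W | nmem s1 43 (col u) != 0] = side_of code.
    by apply/setP => u; rewrite !inE; case: (boolP (u \in W)) => //= uW; rewrite dg ?colK.
  set Y := side_of code => -[sd c1 c2].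
  have sin2 : search_in s2 by apply: (search_frame fr2).
  have [[inp2 net2 _] [p2 q2 K2 VB2] _ _] := sin2.
  have s270 : nmem s2 70 0 = 0 by rewrite (frn fr2) // (frn fr1).
  have YW : Y \subset W by apply/subsetP => u; rewrite inE => /andP[].
  apply: wp_if; rewrite /= q2 c1 c2 => t; last first.
    apply: wp_skip; rewrite s270 /= => l1 l2; by rewrite l1 l2 in t.
  have {t} [l1 l2] := andP t.
  eapply wp_seq, wp_call; first exact: (InitArcs_wp inp2).
  move=> s3 fr3 arcs.
  have sin3 : search_in s3 by apply: (search_frame fr3).
  have [[inp3 net3 _] [p3 _ _ _] _ _] := sin3; have [n3 m3 _ _ _] := inp3.
  have lst tl hd : (forall a, a < A -> (tl a = nmem s3 50 a \/ tl a = nmem s3 51 a) /\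
      (hd a = nmem s3 50 a \/ hd a = nmem s3 51 a)) ->
      arcs_listed X A tl hd (nmem s3 61) (nmem s3 63) (nmem s3 62).
    move=> H; apply: (network_listed net3) => a aA; have [at1 ah1] := arcs a aA.
    have [g1 g2 g3 g4] := arc_ends ndP ejP (nmem s2 53) (nmem s2 54) (nmem s2 55) aA.
    have [] := H a aA; rewrite at1 ah1.
    by move=> [->|->] [->|->].
  have wF := @Flow_wp _ n m A (nmem s3 61) (nmem s3 63) (nmem s3 62) (nmem s3 50)
    (nmem s3 51) (lst _ _ (fun a _ => conj (or_introl erefl) (or_intror erefl)))
    (lst _ _ (fun a _ => conj (or_intror erefl) (or_introl erefl))) s3 p n3 m3 p3 (graph_of s3).
  rewrite /flow_cost -big_distrl /= (network_degrees net3) in wF.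
  have lE (U : pred nat) : leaving A (nmem s3 50) (nmem s3 51) U = cut_size Y (W :\: Y) U.
    apply: leaving_eq => a aA; have [-> ->] := arcs a aA; exact: sides_arcs.
  eapply wp_call; first exact: wF.
  move=> s4 fr4 /=; case: ifP => _ H.
    by move=> _ _ U Us Ut; rewrite -lE; apply: H.
  have [U [h1 h2 h3 h4 h5]] := H; exists Y, U; split=> //; last by rewrite -lE.
  by move=> u; rewrite !(frn fr4) // !(frn fr3) //; exact: sd.
have cK : K * (code * 8 + 12) <= K * (2 ^ K * 8 + 12) by rewrite leq_mul2l; lia.
rewrite /= /try_cost; rewrite /A /X in cK *; nia.
Qed.

Lemma Search_wp s : search_in s ->
  {in W &, forall u w : 'I_n, col u = col w -> u = w} ->
  wp Search s (2 ^ K * (try_cost + 10) + K * 20 + 30) (fun s' =>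
    if nmem s' 70 0 == 0 then forall Y : {set 'I_n}, Y \subset W -> missed Y
    else found s').
Proof.
move=> sin inj; have [_ [_ _ e3 _] _ colK] := sin.
eapply wp_le.
  eapply wp_seq; apply: wp_nset => /=; eapply wp_seq; apply: wp_nset => /=.
  eapply wp_seq; apply: wp_nset => /=.
  eapply wp_seq, wp_call; first by apply: (@Pow_wp _ _ 2 K).
  move=> s1 fr1 p1.
  have s170 : nmem s1 70 0 = 0 by rewrite (frn fr1).
  have sin1 : search_in s1 by apply: (search_frame fr1).
  eapply (wp_for (N := 2 ^ K) (T := try_cost + 3) (Inv := fun i s2 =>
    search_in s2 /\ if nmem s2 70 0 == 0 then forall c, c < i -> missed (side_of c)
    else found s2)).
  - exact: p1.
  - by [].
  - by move=> i s2 j v [H1 H2]; split=> //; exact: H2.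
  - by split=> //; rewrite s170.
  - move=> i s2 iK xi _ [sin2 H]; eapply wp_le.
      apply: wp_if => /= t.
        eapply wp_call.
          by apply: (TryCode_wp (code := i)) => //; apply/eqP.
        move=> s3 fr3 /= H3; split; first by apply: (search_frame fr3).
        move: H3; case: ifP => // _ H3 c; rewrite ltnS leq_eqVlt => /orP[/eqP->//|].
        by move: H; rewrite t; apply.
      apply: wp_skip; split=> //; move: H; case: ifP => // t0; by rewrite t0 in t.
    by rewrite addn1 addn3.
  (* Every subset of [W] is the side of some code: digit 1 at the colours of its members, which are
     distinct on [W]. *)
  - move=> s2 _ [_]; case: ifP => // _ H Y YW.
    have [c cK E] : exists2 c, c < 2 ^ K & side_of c = Y.
      pose f (c : nat) := nat_of_bool [exists u in Y, col u == c].
      have f2 c : c < K -> f c < 2 by rewrite /f; case: [exists u in _, _].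
      exists (enc 2 f K); first exact: enc_lt.
      apply/setP => u; rewrite inE; case: (boolP (u \in W)) => /= uW; last first.
        by apply/esym/negbTE; apply: contra uW => /(subsetP YW).

      rewrite dig_enc ?colK // /f eqb0 negbK.
      apply/exists_inP/idP => [[w wY /eqP E]|uY]; last by exists u.
      by rewrite -(inj w u) // (subsetP YW).
    by rewrite -E; apply: H.
by rewrite /=; nia.
Qed.

Lemma MarkCut_wp s Y U : search_in s -> sides_in s Y (W :\: Y) ->
  (forall x, x < X -> nmem s 56 x = (U x : bool)) ->
  (forall u : 'I_n, nmem s 91 u = 0) ->
  wp MarkCut s (A * 40 + 10) (fun s' => forall u : 'I_n,
    (nmem s' 91 u != 0) = (u \in cut_nodes n m L nd ej (ind setT) (ind Y) (ind (W :\: Y)) U)).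
Proof.
move=> sin sd mk z91; have [[inp net _] _ _ _] := sin.
eapply wp_le.
  eapply wp_seq, wp_call; first exact: (InitArcs_wp inp).
  move=> s1 fr1 arcs.
  have sin1 : search_in s1 by apply: (search_frame fr1).
  have [[[n1 _ L1 _ _] net1 _] _ _ _] := sin1.
  have arc a : a < A -> [/\ nmem s1 50 a = TL (ind (W :\: Y)) a,
     nmem s1 51 a = HD (ind setT) (ind Y) a, nmem s1 50 a < X & nmem s1 51 a < X].
    move=> aA; have [e1 e2] := arcs a aA; have [d1 d2] := sides_arcs sd a.
    have [g1 g2 _ _] := arc_ends ndP ejP (nmem s 53) (nmem s 54) (nmem s 55) aA.
    by rewrite e1 e2 g1 g2 d1 d2.
  eapply (wp_for (N := A) (T := 3) (Inv := fun i s2 => forall u : 'I_n,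
    (nmem s2 91 u != 0) = [exists a : 'I_A, [&& a < i, U (TL (ind (W :\: Y)) a),
      ~~ U (HD (ind setT) (ind Y) a) & arc_lab n L nd a == u]])).
  - by rewrite /= n1 L1.
  - by [].
  - by [].
  - by move=> u; rewrite (frn fr1) // z91; apply/esym/negbTE/existsPn => a; rewrite ltn0.
  - move=> i s2 iA xi fr2 H.
    have e52 : nmem s2 52 = nmem s1 52 by rewrite (frn fr2).
    have e50 : nmem s2 50 = nmem s1 50 by rewrite (frn fr2).
    have e51 : nmem s2 51 = nmem s1 51 by rewrite (frn fr2).
    have e56 : nmem s2 56 = nmem s 56 by rewrite (frn fr2) // (frn fr1).
    have lab : nmem s1 52 i = arc_lab n L nd i by case: net1 => _; apply.
    have [a1 a2 x1 x2] := arc i iA.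
    have ex (u : 'I_n) : [exists a : 'I_A, [&& a < i.+1, U (TL (ind (W :\: Y)) a),
        ~~ U (HD (ind setT) (ind Y) a) & arc_lab n L nd a == u]] =
        [&& U (TL (ind (W :\: Y)) i), ~~ U (HD (ind setT) (ind Y) i) & arc_lab n L nd i == u]
        || (nmem s2 91 u != 0).
      rewrite H; apply/existsP/orP => [[a /andP[]]|[h|/existsP[a /andP[ai h]]]].
      - rewrite ltnS leq_eqVlt => /orP[/eqP<-|ai] h; [by left | right].
        by apply/existsP; exists a; rewrite ai.
      - by exists (Ordinal iA); rewrite /= ltnSn.
      - by exists a; rewrite ltnW.
    eapply wp_le.
      apply: wp_if => /=; rewrite e50 e51 e56 xi !mk // a1 a2 !eqb0 negbK => t.
        apply: wp_nset => u; rewrite ex /= /upd /= e52 xi lab; case/andP: t => -> -> /=.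
        case: (arc_lab n L nd i =P u) => [<-|/eqP ne]; first by rewrite eqxx.
        by rewrite [u == _ :> nat]eq_sym (negPf ne).
      by apply: wp_skip => u; rewrite ex andbA (negPf t).
    by [].
  - move=> s2 _ H u; rewrite H inE; apply: eq_existsb => a.
    by rewrite ltn_ord.
by rewrite /=; lia.
Qed.

End Search.

End Find.

Definition AddNode : cmd := (
  Set' 94 (NCst 0) ;;
  For 95 (Var 33)
    (If' (BEq (NGet 82 (Var 86 + Var 95)) (NCst 0)) (Set' 94 (Var 95)) Skip) ;;
  NSet 81 (Var 92) (Var 94) ;;
  NSet 82 (Var 86 + Var 94) (Var 92 + NCst 1) ;;
  NSet 80 (Var 92) (Var 85))%cmd.

Definition Extend : cmd := (
  NSet 91 (Var 87) (NCst 1) ;;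
  Set' 85 (Var 85 + NCst 1) ;;
  NSet 83 (Var 85) (Var 86) ;;
  NSet 84 (Var 85) (Var 89) ;;
  For 92 eN
    (If' (BAnd (BNot (BEq (NGet 90 (Var 92)) (NCst 0)))
               (BNot (BEq (NGet 91 (Var 92)) (NCst 0)))) AddNode Skip))%cmd.

(** * Colouring and storing the nodes of a new bag *)

Section Extension.
Variables (R : realType) (n : nat).
Implicit Types s : state R.

Lemma row_is_inj f (col : nat -> nat) (W : {set 'I_n}) : row_is f col W ->
  {in W &, forall u w : 'I_n, col u = col w -> u = w}.
Proof.
move=> [h _] u w uW wW E; apply/val_inj/succn_inj.
by rewrite -(h u uW) -(h w wW) E.
Qed.

Lemma AddNode_wp s (u : 'I_n) K VB N (col : nat -> nat) (W : {set 'I_n}) :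
  nmem s 92 0 = u -> nmem s 33 0 = K -> nmem s 86 0 = VB -> nmem s 85 0 = N ->
  nmem s 81 = col -> row_is (fun c => nmem s 82 (VB + c)) col W -> #|W| < K ->
  wp AddNode s (K * 6 + 10) (fun s' => exists2 c, c < K & [/\
    nmem s 82 (VB + c) = 0, nmem s' 82 =1 fun x => if x == VB + c then u.+1 else nmem s 82 x,
    nmem s' 81 =1 (fun x => if x == u then c else col x) &
    nmem s' 80 =1 (fun x => if x == u then N else nmem s 80 x)]).
Proof.
move=> s92 s33 s86 s85 s81 row WK.
(* Pigeonhole: if no colour were free, the [K] colours would name [K] different nodes of [W]. *)
have [c0 c0K z0] : exists2 c, c < K & nmem s 82 (VB + c) = 0.
  have [/existsP[c /eqP E]|/existsPn no] := boolP [exists c : 'I_K, nmem s 82 (VB + c) == 0].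
    by exists c.
  have : #|'I_K| <= #|W|.
    have wit (c : 'I_K) : exists w : 'I_n, (w \in W) && (col w == c).
      by have [w wW [E _]] := (proj2 row) c (no c); exists w; rewrite wW E /=.
    rewrite -cardsT -(card_imset [set: 'I_K] (f := fun c => xchoose (wit c))).
      apply: subset_leq_card; apply/subsetP => w /imsetP[c _ ->].
      by have /andP[] := xchooseP (wit c).
    move=> c c' E; apply: val_inj => /=; have /andP[_ /eqP <-] := xchooseP (wit c).
    by have /andP[_ /eqP <-] := xchooseP (wit c'); rewrite E.
  by rewrite card_ord leqNgt WK.
eapply wp_le.
  eapply wp_seq; apply: wp_nset => /=.
  eapply wp_seq, (wp_for (N := K) (T := 3) (Inv := fun i s1 =>
    if c0 < i then nmem s1 94 0 < K /\ nmem s 82 (VB + nmem s1 94 0) = 0 else True)).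
  - exact: s33.
  - by [].
  - by [].
  - by rewrite ltn0.
  - move=> i s1 iK xi fr H; eapply wp_le.
      apply: wp_if => /=; rewrite (frn (a := 86) fr) //= (frn (a := 82) fr) //= /upd /= s86 xi => t.
        apply: wp_nset; rewrite /= /upd /= xi; case: ifP => // _; split=> //; exact/eqP.
      apply: wp_skip; rewrite ltnS leq_eqVlt; case: eqP => [E|_]; last exact: H.
      by rewrite -E z0 in t.
    by [].
  - move=> s1 fr1; rewrite c0K => -[cK zc].
    eapply wp_seq; apply: wp_nset => /=; eapply wp_seq; apply: wp_nset => /=.
    apply: wp_nset; exists (nmem s1 94 0) => //; split=> //= x;
    rewrite /= /upd /= !(frn (a := 92) fr1) //= /upd /= s92.
    + by rewrite (frn (a := 86) fr1) //= (frn (a := 82) fr1) //= /upd /= s86 addn1.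
    + by rewrite (frn (a := 81) fr1) //= /upd /= s81.
    + by rewrite (frn (a := 85) fr1) //= (frn (a := 80) fr1) //= /upd /= s85.
by rewrite /=; lia.
Qed.

Lemma Extend_wp s (v : 'I_n) K VB N (W C S : {set 'I_n}) :
  let NB := C :&: (v |: S) in
  nmem s 0 0 = n -> nmem s 33 0 = K -> nmem s 86 0 = VB -> nmem s 85 0 = N ->
  nmem s 87 0 = v ->
  (forall u : 'I_n, nmem s 90 u = (u \in C)) ->
  (forall u : 'I_n, (nmem s 91 u != 0) = (u \in S)) ->
  row_is (fun c => nmem s 82 (VB + c)) (nmem s 81) W ->
  (forall u, u \in W -> nmem s 81 u < K) ->
  [disjoint W & C] -> #|W :|: NB| <= K ->
  wp Extend s (n * (K * 6 + 20) + 20) (fun s' => [/\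
    [/\ nmem s' 85 0 = N.+1,
      nmem s' 83 =1 (fun t => if t == N.+1 then VB else nmem s 83 t) &
      nmem s' 84 =1 (fun t => if t == N.+1 then nmem s 89 0 else nmem s 84 t)],
    forall u : 'I_n, nmem s' 80 u = if u \in NB then N.+1 else nmem s 80 u,
    forall u : 'I_n, if u \in NB then is_true (nmem s' 81 u < K) else nmem s' 81 u = nmem s 81 u,
    row_is (fun c => nmem s' 82 (VB + c)) (nmem s' 81) (W :|: NB) &
    forall x, x < VB \/ VB + K <= x -> nmem s' 82 x = nmem s 82 x]).
Proof.
move=> NB sn s33 s86 s85 s87 s90 s91 row colK dis cardK.
pose Ni i := [set u in NB | u < i].
have N0 : Ni 0 = set0 by apply/setP => u; rewrite !inE andbF.
have NS i (iN : i < n) : Ni i.+1 = if Ordinal iN \in NB then Ordinal iN |: Ni i else Ni i.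
  apply/setP => u; rewrite inE ltnS leq_eqVlt andb_orr.
  have E : (u \in NB) && (u == i :> nat) = (u == Ordinal iN) && (Ordinal iN \in NB).
    rewrite -[u == Ordinal iN]val_eqE /=; case: eqP => //= E; last by rewrite andbF.
    by rewrite andbT (_ : u = Ordinal iN) //; apply: val_inj.
  by rewrite E; case: (boolP (Ordinal iN \in NB)) => iB; rewrite ?andbT ?andbF !inE.
eapply wp_le.
  eapply wp_seq; apply: wp_nset => /=; eapply wp_seq; apply: wp_nset => /=.
  eapply wp_seq; apply: wp_nset => /=; eapply wp_seq; apply: wp_nset => /=.
  rewrite /upd /= s85 s86 s87 addn1 -/(upd _).
  set s0 := setn _ _ _ _.
  eapply (wp_for (N := n) (T := K * 6 + 15) (Inv := fun i s1 =>
    [/\ forall u : 'I_n, nmem s1 80 u = if u \in Ni i then N.+1 else nmem s 80 u,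
     forall u : 'I_n, if u \in Ni i then is_true (nmem s1 81 u < K) else nmem s1 81 u = nmem s 81 u,
     row_is (fun c => nmem s1 82 (VB + c)) (nmem s1 81) (W :|: Ni i) &
     forall x, x < VB \/ VB + K <= x -> nmem s1 82 x = nmem s 82 x])).
  - by rewrite /= /upd /= sn.
  - by [].
  - by [].
  - by rewrite N0 setU0; split=> // u; rewrite inE.
  - move=> i s1 iN xi fr [h1 h2 h3 h4].
    pose io := Ordinal iN.
    have e90 : nmem s1 90 = nmem s 90 by rewrite (frn fr) // /s0 /= !upd_neq.
    have e91 x : nmem s1 91 x = if x == v then 1 else nmem s 91 x.
      by rewrite (frn fr) // /s0 /= /upd /=.
    have t90 : (nmem s1 90 i != 0) = (io \in C) by rewrite e90 (s90 io) eqb0 negbK.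
    have t91 : (nmem s1 91 i != 0) = (io \in v |: S).
      by rewrite e91 in_setU1 -val_eqE /=; case: ifP => //= _; rewrite (s91 io).
    have tNB : (io \in NB) = (nmem s1 90 i != 0) && (nmem s1 91 i != 0).
      by rewrite t90 t91 in_setI.
    eapply wp_le.
      apply: wp_if => /=; rewrite xi -tNB => t; last first.
        by apply: wp_skip; rewrite NS -/io (negPf t).
      have iNi : io \notin Ni i by rewrite inE ltnn andbF.
      have iW : io \notin W.
        by apply: contraL t => iW; rewrite in_setI (disjointFr dis iW).
      eapply wp_call.
        apply: (@AddNode_wp s1 io K VB N.+1 (nmem s1 81) (W :|: Ni i)) => //.
        + by rewrite (frn fr).
        + by rewrite (frn fr).
        + by rewrite (frn fr).
        + apply: leq_trans cardK; apply: proper_card; apply/properP; split.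
            by apply: setUS; apply/subsetP => u; rewrite inE => /andP[].
          by exists io; rewrite !in_setU ?t ?orbT // (negPf iW) (negPf iNi).
      move=> s2 fr2 [c cK [z e82 e81 e80]]; rewrite NS -/io t; split.
      + move=> u; rewrite e80 in_setU1 -val_eqE /=; case: eqP => //= _; exact: h1.
      + move=> u; rewrite e81 in_setU1 -val_eqE /=; case: eqP => //= _; exact: h2.
      + have -> : W :|: (io |: Ni i) = io |: (W :|: Ni i) by rewrite setUCA.
        have row' : row_is (fun c => nmem s1 82 (VB + c)) (nmem s2 81) (W :|: Ni i).
          apply: row_is_ext h3 => // u; rewrite in_setU e81 => uW; rewrite ifN //.
          apply: contraTneq uW => E; have -> : u = io by apply: val_inj.
          by rewrite (negPf iW) (negPf iNi).
        have ci : nmem s2 81 io = c by rewrite e81 eqxx.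
        apply: row_is_ext (row_is_add row' z ci) => // c'.
        by rewrite e82 eqn_add2l.
      + move=> x Hx; rewrite e82 ifN ?h4 //; apply/eqP => E; rewrite E in Hx.
        case: Hx; rewrite ?ltnNge ?leq_addr // leq_add2l leqNgt cK //.
    by lia.
  - have Nn : Ni n = NB by apply/setP => u; rewrite inE ltn_ord andbT.
    move=> s1 fr; rewrite Nn => -[h1 h2 h3 h4]; split=> //; split.
    + by rewrite (frn fr).
    + by move=> t; rewrite (frn fr) // /s0 /= /upd /=.
    + by move=> t; rewrite (frn fr) // /s0 /= /upd /=.
by rewrite /=; lia.
Qed.

End Extension.

(* [32] guesses the treewidth plus 2; it is raised when no partition of the boundary
   has a small separator, which shows that the guess was too low. *)
Definition Iter : cmd := (
  PickNode ;;
  If' (BLt (Var 87) eN) (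
    ExploreComponent ;;
    If' (BLt (Var 88) (Var 34)) (Set' 70 (NCst 1))
      (Search ;; If' (BEq (Var 70) (NCst 0)) Skip MarkCut) ;;
    If' (BEq (Var 70) (NCst 0))
      (Set' 31 (Var 31 + NCst 1) ;; Set' 32 (Var 32 + NCst 1) ;;
       Set' 33 (Var 33 + NCst 4) ;; Set' 34 (Var 34 + NCst 3))
      Extend ;;
    Set' 86 (Var 86 + (eN + eN + eN + eN + NCst 8))) Skip)%cmd.

Definition TreeDec : cmd := (
  Setup ;;
  Set' 31 (NCst 1) ;; Set' 32 (NCst 2) ;; Set' 33 (NCst 8) ;; Set' 34 (NCst 6) ;;
  Set' 85 (NCst 0) ;; Set' 86 (NCst 0) ;;
  For 96 (eN + eN) Iter)%cmd.

Lemma treewidth_bags n m (edge : 'I_m -> {set 'I_n}) :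
  exists (V : finType) (t : rel V) (X : V -> {set 'I_n}),
    tree_decomposition edge t X /\ forall z, #|X z| <= (treewidth edge).+1.
Proof.
rewrite /treewidth; case: ex_minnP => w /asboolP[V [t [X [dec E]]]] _.
exists V, t, X; split=> // z; rewrite -E /decomposition_width.
by apply: leq_trans (leqSpred _); apply: (leq_bigmax (F := fun z => #|X z|)).
Qed.

(** * Invariant, cost and termination of the decomposition program *)

Section TreeDec.
Variables (R : realType) (n m L : nat) (nd ej : nat -> nat) (edge : 'I_m -> {set 'I_n}).
Implicit Types s : state R.
Hypothesis ndP : forall p, p < L -> nd p < n.
Hypothesis ejP : forall p, p < L -> ej p < m.
Hypothesis incP : forall (i : 'I_n) (j : 'I_m),
  reflect (exists2 p, p < L & nd p = i /\ ej p = j) (i \in edge j).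
Let X := n + n + m + 2.
Let src := n + n + m.
Let tgt := n + n + m + 1.
Let A := n + n + n + L + L.
Local Notation inputs_in := (@inputs_in R n m L nd ej).
Local Notation network_in := (@network_in R n m L nd ej).
Local Notation tw := (treewidth edge).

(* Rows are [stride] apart, which exceeds the number of colours. *)
Definition stride := n + n + n + n + 8.

Definition birth_in s (u : 'I_n) := nmem s 80 u.

Definition bag_in s t : {set 'I_n} :=
  if t == 0 then set0 else [set u : 'I_n | nmem s 82 (nmem s 83 t + nmem s 81 u) == u.+1].

(** A boundary has at most [3 * q] nodes, and [v] with a separator adds at most [q], whence [4 * q]
    colours. The bound [3 * (q - 2) <= n] holds because [q] rises only in front of a boundary with
    [3 * q] nodes; it limits the number of rises and keeps the colours below the stride. [N] is
    bounded by the number of born nodes because each bag gives birth to one. *)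
Definition td_in s N q VB :=
  [/\ [/\ inputs_in s, network_in s, nmem s 85 0 = N & nmem s 86 0 = VB],
      [/\ nmem s 31 0 = q.-1, nmem s 32 0 = q, nmem s 33 0 = 4 * q & nmem s 34 0 = 3 * q],
      bags_ok edge N (3 * q) (birth_in s) (bag_in s) (nmem s 84),
      (forall t, 0 < t <= N -> nmem s 83 t + stride <= VB /\
        row_is (fun c => if c < stride then nmem s 82 (nmem s 83 t + c) else 0)
          (nmem s 81) (bag_in s t)) &
      [/\ forall u : 'I_n, nmem s 81 u < 4 * q,
        2 <= q /\ 3 * (q - 2) <= n, q <= tw + 2,
        N <= #|[set u | birth_in s u != 0]| & forall x, VB <= x -> nmem s 82 x = 0]].

Lemma td_frame c s s' N q VB : frame c s s' ->
  all (fun a => a \notin nwr c)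
    [:: 0; 1; 2; 52; 61; 62; 63; 85; 86; 31; 32; 33; 34; 80; 81; 82; 83; 84] ->
  td_in s N q VB -> td_in s' N q VB.
Proof.
rewrite /= => fr /and5P[i0 i1 i2 n0 /and5P[n1 n2 n3 c85 /and5P[c86 c31 c32 c33
  /and5P[c34 c80 c81 c82 /and3P[c83 c84 _]]]]].
move=> [[inp net e85 e86] [e31 e32 e33 e34] ok rows [h1 h2 h3 h4 h5]].
have eb : birth_in s' = birth_in s by apply: funext => u; rewrite /birth_in (frn fr).
have eg : bag_in s' = bag_in s.
  by apply: funext => t; rewrite /bag_in (frn (a := 82) fr) // (frn (a := 83) fr) // (frn (a := 81) fr).
split.
- split; first by apply: (inputs_frame fr) => //=; rewrite i0 i1 i2.
  + by apply: (network_frame fr) => //=; rewrite n0 n1 n2 n3.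
  + by rewrite (frn fr).
  + by rewrite (frn fr).
- by rewrite !(frn fr).
- by rewrite eb eg (frn fr).
- by rewrite eg (frn (a := 82) fr) // (frn (a := 83) fr) // (frn (a := 81) fr).
- by rewrite eb (frn (a := 82) fr) // (frn (a := 81) fr).
Qed.

Lemma stride_colours q : 3 * (q - 2) <= n -> 4 * q <= stride.
Proof. by rewrite /stride => h; lia. Qed.

(** Otherwise all bags of an optimal decomposition have fewer than [q] nodes, and the balanced
    separation that they yield would be a cut of at most [q - 1] arcs for one of the bipartitions
    tried. *)
Lemma missed_treewidth q (W : {set 'I_n}) : 1 < q -> 3 * q <= #|W| ->
  (forall Y : {set 'I_n}, Y \subset W -> missed m L nd ej q.-1 q W Y) -> q <= tw + 1.
Proof.
move=> q1 Wq H; rewrite leqNgt; apply/negP => lt.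
have [V [t [Xb [dec Xtw]]]] := treewidth_bags edge.
have Xq z : #|Xb z| < q by apply: leq_ltn_trans (Xtw z) _; rewrite -addn1.
have [B [Y [Yq g1 g2 sep]]] := tree_separation dec Xq Wq.
have EB : W :\: (W :&: B) = W :\: B by rewrite setDIr setDv set0U.
have := H (W :&: B) (subsetIl W B); rewrite /missed EB => /(_ g1 g2) {}H.
have hs (i : 'I_n) : ind (W :&: B) i != 0 -> i \in B.
  by rewrite indE eqb0 negbK inE => /andP[].
have ht (i : 'I_n) : ind (W :\: B) i != 0 -> i \notin B.
  by rewrite indE eqb0 negbK inE => /andP[].
have [U [Us Ut le]] := separation_cut ndP ejP incP (ind [set: 'I_n]) sep hs ht.
by have := H U Us Ut; rewrite /cut_size; lia.
Qed.

(** The cube of the number of bipartitions: one factor counts them, one pays for decoding by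
    subtraction, one absorbs [q] and the number of colours. *)
Definition iter_cost := 700 * 2 ^ (3 * (4 * tw + 8)) * (n + A + X + 1).

Lemma Iter_cost q K : q <= tw + 2 -> K = 4 * q -> 2 <= q ->
  (n * 6 + 4) + (n * 30 + A * 60 + X * 30 + 60) +
  (2 ^ K * (try_cost n m L q.-1 K + 10) + K * 20 + 30) + (A * 40 + 10) +
  (n * (K * 6 + 20) + 20) + 50 <= iter_cost.
Proof.
move=> qt -> q2; rewrite /iter_cost /try_cost -/X -/A.
set K' := 4 * q; set Z := n + A + X + 1; set P := 2 ^ K'.
have KP : K' < P by apply: ltn_expl.
have PP : P ^ 3 <= 2 ^ (3 * (4 * tw + 8)).
  by rewrite -expnM mulnC leq_exp2l // leq_mul2l /=; rewrite /K'; lia.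
have q1 : q.-1 + 1 <= P by lia.
have Z1 : 1 <= Z by rewrite /Z addn1.
have nZ : n <= Z by rewrite /Z; lia.
have AZ : A <= Z by rewrite /Z; lia.
have XZ : X <= Z by rewrite /Z; lia.
have P1 : 1 <= P by lia.
apply: (@leq_trans (700 * P ^ 3 * Z)); last by rewrite leq_mul2r leq_mul2l PP !orbT.
clearbody Z P X A.
have e1 : K' * (P * 8 + 30) <= P * (P * 38) by apply: leq_mul; lia.
have e2 : (q.-1 + 1) * (X * 40 + (A + A) * 11 + 50) <= P * (Z * 112) by apply: leq_mul; lia.
have e3 : P * (K' * (P * 8 + 30) + n * 6 + A * 30 +
   (q.-1 + 1) * (X * 40 + (A + A) * 11 + 50) + 60 + 10) <=
   P * (P * (P * 38) + Z * 36 + P * (Z * 112) + 70).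
  by rewrite leq_mul2l; apply/orP; right; lia.
have e4 : n * (K' * 6 + 20) <= Z * (P * 26) by apply: leq_mul; lia.
have m1 : P <= P ^ 3 by rewrite -{1}(expn1 P) leq_pexp2l.
have m2 : P ^ 2 <= P ^ 3 by rewrite leq_pexp2l.
have z1 : P ^ 3 <= P ^ 3 * Z by rewrite leq_pmulr.
have z2 : P * Z <= P ^ 3 * Z by rewrite leq_mul2r m1 orbT.
have z3 : P ^ 2 * Z <= P ^ 3 * Z by rewrite leq_mul2r m2 orbT.
have z4 : Z <= P * Z by rewrite leq_pmull.
have E1 : P * (P * (P * 38) + Z * 36 + P * (Z * 112) + 70) =
  38 * P ^ 3 + 36 * (P * Z) + 112 * (P ^ 2 * Z) + 70 * P by ring.
have E2 : Z * (P * 26) = 26 * (P * Z) by ring.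
have E3 : 700 * P ^ 3 * Z = 700 * (P ^ 3 * Z) by ring.
rewrite E3; rewrite E1 in e3; rewrite E2 in e4.
move: (P ^ 3 * Z) (P ^ 2 * Z) (P * Z) (P ^ 3) (P ^ 2) z1 z2 z3 z4 m1 m2 e3 e4 {E1 E2 E3}.
lia.
Qed.

Lemma td_bag_row s N q VB t : td_in s N q VB -> t <= N ->
  {in bag_in s t &, forall u w : 'I_n, nmem s 81 u = nmem s 81 w -> u = w}.
Proof.
case=> _ _ _ rows _; case: t => [|t] tN; first by move=> u w; rewrite inE.
have [//|_ row] := rows t.+1; exact: row_is_inj row.
Qed.

(** Membership is tested by a row entry that names the node itself, so recolouring nodes that are
    still unborn cannot add them to an old bag. *)
Lemma old_bag s s' N q VB : td_in s N q VB ->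
  (forall x, x < VB -> nmem s' 82 x = nmem s 82 x) ->
  (forall t, t <= N -> nmem s' 83 t = nmem s 83 t) ->
  (forall u : 'I_n, birth_in s u != 0 -> nmem s' 81 u = nmem s 81 u) ->
  (forall u : 'I_n, nmem s' 81 u < stride) ->
  forall t, t <= N -> bag_in s' t = bag_in s t /\ (0 < t ->
    row_is (fun c => if c < stride then nmem s' 82 (nmem s' 83 t + c) else 0)
          (nmem s' 81) (bag_in s' t)).
Proof.
case=> _ _ [_ hb _ _ _] rows _ e82 e83 e81 c81 [|t] tN; first by [].
have tN' : 0 < t.+1 <= N by [].
have [le row] := rows t.+1 tN'.
have old c : c < stride -> nmem s' 82 (nmem s 83 t.+1 + c) = nmem s 82 (nmem s 83 t.+1 + c).
  by move=> cs; apply: e82; apply: leq_trans le; rewrite ltn_add2l.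
have E : bag_in s' t.+1 = bag_in s t.+1.
  apply/setP => u; apply/idP/idP.
    rewrite inE e83 // old // => /eqP E; have := (proj2 row) (nmem s' 81 u).
    rewrite c81 E => /(_ isT)[w wB [_ [wu]]].
    by rewrite (_ : u = w) //; apply: val_inj.
  move=> uB; have /andP[b0 _] := hb t.+1 u tN' uB.
  have E' := e81 u; rewrite -lt0n in E'.
  by rewrite inE e83 // E' // old -?E' //; move: uB; rewrite inE E'.
split=> // _; rewrite E; apply: row_is_ext row => [c|u uB].
  by case: ifP => // cs; rewrite e83 // old.
by have /andP[b0 _] := hb t.+1 u tN' uB; rewrite e81 // -lt0n.
Qed.

Lemma bags_ok_ext N b b' birth bag bag' par par' : b <= b' ->
  (forall t, t <= N -> bag' t = bag t) -> (forall t, t <= N -> par' t = par t) ->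
  bags_ok edge N b birth bag par -> bags_ok edge N b' birth bag' par'.
Proof.
move=> bb E1 E2 ok; have [[h1 h1'] h2 h3 h4 h5] := bags_ok_le bb ok; split.
- by split=> // i i0; rewrite E1 //; apply: h1'.
- by move=> t i tN; rewrite E1; [apply: h2 | case/andP: tN].
- move=> t tN; have [lt h] := h3 t tN; have tN' : t <= N by case/andP: tN.
  by rewrite E2 // !E1 //; apply: leq_trans tN'; apply: ltnW.
- move=> v vU W; have [sub le] := h4 v vU; split=> //.
  by rewrite E1 //; apply/bigmax_leqP.
- by move=> j u w uj wj bw; rewrite E1 //; apply: h5 uj wj bw.
Qed.

Lemma Iter_wp s N q VB : td_in s N q VB ->
  wp Iter s iter_cost (fun s' =>
    if [forall u : 'I_n, birth_in s u != 0]
    then td_in s' N q VB /\ forall u, birth_in s' u != 0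
    else td_in s' N.+1 q (VB + stride) \/ td_in s' N q.+1 (VB + stride)).
Proof.
move=> td; have [[inp net s85 s86] [s31 s32 s33 s34] ok rows [colK [q2 qn] qtw Nborn z82]] := td.
have [sn _ _ _ _] := inp.
apply: (wp_le _ (Iter_cost qtw erefl q2)); eapply wp_le.
  eapply wp_seq, wp_call; first exact: PickNode_wp sn.
  move=> s1 fr1 pick.
  have td1 : td_in s1 N q VB by apply: (td_frame fr1).
  have eb1 : birth_in s1 = birth_in s by apply: funext => u; rewrite /birth_in (frn fr1).
  have [[inp1 net1 _ _] _ _ _ _] := td1; have [n1 _ _ _ _] := inp1.
  apply: wp_if => /=; rewrite n1 => tv; last first.
    apply: wp_skip; case: pick => [[v [v87 _]]|[_ all]].
      by case/negP: tv; rewrite v87.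
    have -> : [forall u : 'I_n, birth_in s u != 0] by apply/forallP => u; apply: all.
    by split=> // u; rewrite eb1; apply: all.
  case: pick => [[v [v87 vb]]|[v87 _]]; last by rewrite v87 ltnn in tv.
  have -> : [forall u : 'I_n, birth_in s u != 0] = false.
    by apply/negbTE/negP => /forallP/(_ v); rewrite /birth_in vb.
  have [[_ _ c85 c86] [c31 c32 c33 c34] ok1 rows1 [colK1 _ _ Nborn1 z821]] := td1.
  pose U := [set u : 'I_n | nmem s1 80 u == 0].
  have EU : unborn (birth_in s1) = U by apply/setP => u; rewrite !inE.
  pose W := bdry edge U v; pose C := component edge U v.
  have vU : v \in U by rewrite inE (frn fr1) // vb.
  have [_ _ _ bW _] := ok1; have [subW cardW] := bW v (ltac:(by rewrite EU)).
  rewrite EU -/W in subW cardW.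
  have lbN : last_birth (birth_in s1) W <= N.
    by apply/bigmax_leqP => i _; case: ok1 => -[].
  have injW : {in W &, forall u w : 'I_n, nmem s1 81 u = nmem s1 81 w -> u = w}.
    by move=> u w uW wW; apply: (td_bag_row td1 lbN); apply: (subsetP subW).
  have WC : [disjoint W & C].
    apply/pred0P => u /=; apply/negbTE/negP => /andP[uW uC].
    by move: uW; rewrite inE (subsetP (comp_sub edge vU) u uC).
  have colW u : u \in W -> nmem s1 81 u < 4 * q by [].
  eapply wp_seq, wp_call.
    apply: (@Explore_wp _ n m L nd ej edge ndP ejP incP s1 v inp1 net1 v87 vU injW).
    by rewrite c86.
  rewrite c86 -/W -/C => s2 fr2 [f90 row2 old82 f88 f89].
  have keep2 a : a \notin nwr ExploreComponent -> nmem s2 a = nmem s1 a by exact: (frn fr2).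
  have inp2 : inputs_in s2 by apply: (inputs_frame fr2).
  have net2 : network_in s2 by apply: (network_frame fr2).
  have col2 : nmem s2 81 = nmem s1 81 by rewrite keep2.
  have sin2 : search_in m L nd ej q.-1 q (4 * q) VB W s2 s2.
    split=> //; first by rewrite !keep2.
    - by rewrite col2.
    - by move=> u uW; rewrite col2; apply: colW.
  have z91 (u : 'I_n) : nmem s2 91 u = 0 by case: (f90 u).
  eapply wp_seq.
  (* Common postcondition of the two ways to extend: with a boundary below [3 * q] the set [S] is
     empty and [v] alone is added, otherwise [S] comes from a cut. The last clause is what
     [bags_extend] asks about the components that remain. *)
  apply: (wp_call (Q := fun s3 => 
    [/\ forall a, a \in [:: 0; 1; 2; 52; 61; 62; 63; 80; 81; 82; 83; 84; 85; 86; 87; 88; 89; 90; 31; 32; 33; 34] ->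
          nmem s3 a = nmem s2 a &
     if nmem s3 70 0 == 0 then q <= tw + 1 /\ 3 * q <= #|W|
     else exists S : {set 'I_n}, [/\ forall u : 'I_n, (nmem s3 91 u != 0) = (u \in S),
       #|W :|: (C :&: (v |: S))| <= 4 * q &
       forall (U' : {set 'I_n}) v', v' \in U' -> v' \in C ->
         [disjoint v |: S & component edge U' v'] ->
         bdry edge U' v' \subset W :|: (C :&: (v |: S)) -> #|bdry edge U' v'| <= 3 * q]])).
    apply: wp_if => /=; rewrite f88 keep2 // c34 => tW.
      apply: wp_nset; split.
        by move=> a; rewrite !inE => /or4P[|||]; do ?[case/orP]; move/eqP ->.
      rewrite /= /upd /=; exists set0; split.
      - by move=> u; rewrite z91 inE.
      - rewrite setU0; apply: leq_trans (leq_card_setU _ _) _.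
        have : #|C :&: [set v]| <= 1 by rewrite -(cards1 v) subset_leq_card // subsetIr.
        lia.
      - move=> U' v' _ _ _ sub; apply: leq_trans (subset_leq_card sub) _.
        apply: leq_trans (leq_card_setU _ _) _; rewrite setU0.
        have : #|C :&: [set v]| <= 1 by rewrite -(cards1 v) subset_leq_card // subsetIr.
        lia.
    have tW' : 3 * q <= #|W| by rewrite leqNgt.
    eapply wp_seq, wp_call.
      by apply: (Search_wp ndP ejP sin2) => u w uW wW; rewrite col2; apply: injW.
    move=> s3 fr3 H; apply: wp_if => /= t70.
      apply: wp_skip; split.
        by move=> a; rewrite !inE => /or4P[|||]; do ?[case/orP]; move/eqP ->; rewrite (frn fr3).
      by rewrite t70; rewrite t70 in H; split=> //; apply: missed_treewidth H.
    rewrite (negPf t70) in H; have [Y [Us [[YW Y1 Y2] sd [u1 u2] cs mk]]] := H.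
    have sin3 : search_in m L nd ej q.-1 q (4 * q) VB W s2 s3 by apply: (search_frame fr3).
    eapply wp_call.
      apply: (MarkCut_wp ndP ejP sin3 sd mk) => u; rewrite (frn fr3) //.
    move=> s4 fr4 f91; split.
      by move=> a; rewrite !inE => /or4P[|||]; do ?[case/orP]; move/eqP ->; rewrite (frn fr4) // (frn fr3).
    rewrite (frn fr4) // (negPf t70).
    set S := cut_nodes _ _ _ _ _ _ _ _ _ in f91; exists S.
    have Sq : #|S| < q.
      by apply: leq_ltn_trans (cut_small _ _ _ _ _ _ _ _ _) _; apply: leq_ltn_trans cs _; lia.
    split=> //.
    - apply: leq_trans (leq_card_setU _ _) _.
      have : #|C :&: (v |: S)| <= #|v |: S| by rewrite subset_leq_card // subsetIr.
      rewrite cardsU1 => le1; have le2 : (v \notin S) + #|S| <= q by case: (v \notin S) => /=; rewrite ?add1n // ltnW.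
      by rewrite (mulSn 3) addnC leq_add // (leq_trans le1).
    - move=> U' v' v'U' v'C dis sub.
      have sub' : bdry edge U' v' \subset W :|: (v |: S :&: C).
        apply: subset_trans sub _; apply: setUS; apply/subsetP => w; rewrite !inE.
        by case/andP=> wC /orP[->//|->]; rewrite wC orbT.
      have dis' : [disjoint S & component edge U' v'].
        by apply: disjointWl dis; apply: subsetUr.
      have fi1 i : i < n -> ind [set: 'I_n] i != 0.
        by move=> iN; rewrite (indE setT (Ordinal iN)) inE.
      apply: leq_trans cardW.
      (* A remaining component misses one side of the bipartition outside [S]. Either side has [q]
         nodes, which pays for [v] and the separator nodes that join the boundary. *)
      have [miss|miss] := cut_misses incP fi1 u1 u2 v'U' dis'.
      + apply: (bdry_separated WC Sq YW Y1 sub') => w wb wS.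
        by have /eqP := miss w wb wS; rewrite indE eqb0.
      + apply: (bdry_separated WC Sq (subsetDl W Y) Y2 sub') => w wb wS.
        by have /eqP := miss w wb wS; rewrite indE eqb0.
  move=> s3 _ [keep3 H3].
  have inp3 : inputs_in s3 by case: inp2 => *; split=> [|||y|y]; rewrite keep3.
  have net3 : network_in s3.
    case: net2 => -[? ? ? ?] ?; split; last by move=> a aA; rewrite keep3 //; auto.
    by split; rewrite ?(keep3 61) ?(keep3 62) ?(keep3 63).
  have [n3 _ _ _ _] := inp3.
  have e80 : nmem s3 80 = nmem s1 80 by rewrite keep3 // keep2.
  have e81 : nmem s3 81 = nmem s1 81 by rewrite keep3 // keep2.
  have e83 : nmem s3 83 = nmem s1 83 by rewrite keep3 // keep2.
  have e84 : nmem s3 84 = nmem s1 84 by rewrite keep3 // keep2.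
  have e82 : nmem s3 82 = nmem s2 82 by rewrite keep3.
  have c4s : 4 * q <= stride by apply: stride_colours.
  have z2 x : VB + stride <= x -> nmem s2 82 x = 0.
    move=> le; apply/eqP; apply: contraT => nz.
    have leV := leq_trans (leq_addr _ _) le; rewrite -(subnKC leV) in nz.
    have [w wW [cw _]] := (proj2 row2) (x - VB) nz.
    have := colW w wW; rewrite cw => lt4; have := leq_trans lt4 c4s.
    by rewrite ltn_subLR // ltnNge le.
  have old_col (s4 : state R) : nmem s4 81 = nmem s1 81 ->
      forall u : 'I_n, nmem s4 81 u < stride.
    by move=> -> u; apply: leq_trans (colK1 u) c4s.
  eapply wp_seq, (wp_call (Q := fun s4 => [/\ nmem s4 0 = nmem s3 0, nmem s4 86 = nmem s3 86 &
     td_in (setn s4 86 0 (VB + stride)) N.+1 q (VB + stride) \/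
     td_in (setn s4 86 0 (VB + stride)) N q.+1 (VB + stride)])).
    apply: wp_if => /= t70.
      rewrite t70 in H3; have [q_tw cW] := H3.
      eapply wp_seq; apply: wp_nset => /=; eapply wp_seq; apply: wp_nset => /=.
      eapply wp_seq; apply: wp_nset => /=; apply: wp_nset.
      rewrite /= /upd /= !keep3 // !keep2 // c31 c32 c33 c34; split=> //.
      right; set s4 := setn _ _ _ _.
      have old : forall t, t <= N -> bag_in s4 t = bag_in s1 t /\ (0 < t ->
          row_is (fun c => if c < stride then nmem s4 82 (nmem s4 83 t + c) else 0)
          (nmem s4 81) (bag_in s4 t)).
        apply: (old_bag td1).
        - by move=> x xV; rewrite /s4 /= !upd_neq // e82; apply: old82.
        - by move=> y _; rewrite /s4 /= !upd_neq // e83.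
        - by move=> u _; rewrite /s4 /= !upd_neq // e81.
        - by apply: old_col; rewrite /s4 /= !upd_neq.
      split.
      - split=> //; first by rewrite /s4 /= /upd /= keep3 // keep2.
      - by rewrite /s4 /= /upd /=; split=> //; lia.
      - have -> : birth_in s4 = birth_in s1 by apply: funext => u; rewrite /birth_in /s4 /= !upd_neq // e80.
        apply: bags_ok_ext ok1; first by lia.
          by move=> t tN; have [-> _] := old t tN.
        by move=> t _; rewrite /s4 /= !upd_neq // e84.
      - move=> t tN; have tN' : t <= N by case/andP: tN.
        have [_ row] := old t tN'; split; last by apply: row; case/andP: tN.
        have [le _] := rows1 t tN; rewrite /s4 /= !upd_neq // e83.
        by apply: leq_trans le (leq_addr _ _).
      - have Wn : 3 * q <= n by apply: leq_trans cW _; have := max_card (mem W); rewrite card_ord.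
        split.
        + move=> u; rewrite /s4 /= !upd_neq // e81.
          by apply: leq_trans (colK1 u) _; rewrite leq_mul2l leqnSn orbT.
        + by split; lia.
        + by lia.
        + have -> : birth_in s4 = birth_in s1 by apply: funext => u; rewrite /birth_in /s4 /= !upd_neq // e80.
          exact: Nborn1.
        + by move=> x le; rewrite /s4 /= !upd_neq // e82 z2.
    rewrite (negPf t70) in H3; have [S [fS cK sm]] := H3.
    have f90' (u : 'I_n) : nmem s3 90 u = (u \in C) by rewrite keep3 //; case: (f90 u).
    have row3 : row_is (fun c => nmem s3 82 (VB + c)) (nmem s3 81) W by rewrite e82 e81.
    have colW3 u : u \in W -> nmem s3 81 u < 4 * q by rewrite e81.
    have k85 : nmem s3 85 0 = N by rewrite keep3 // keep2.
    have k86 : nmem s3 86 0 = VB by rewrite keep3 // keep2.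
    have k33 : nmem s3 33 0 = 4 * q by rewrite keep3 // keep2.
    have k87 : nmem s3 87 0 = v by rewrite keep3 // keep2.
    eapply wp_call.
      exact: (Extend_wp n3 k33 k86 k85 k87 f90' fS row3 colW3 WC cK).
    set NB := C :&: (v |: S).
    move=> s4 fr4 [[g85 g83 g84] g80 g81 g82 old4].
    have k89 : nmem s3 89 0 = last_birth (birth_in s1) W by rewrite keep3 // f89.
    split; [by rewrite (frn fr4) | by rewrite (frn fr4) |].
    left; set s5 := setn _ _ _ _.
    have NBC : NB \subset C by apply: subsetIl.
    have vNB : v \in NB by rewrite /NB in_setI setU11 andbT /C comp_refl.
    have NB0 u : u \in NB -> birth_in s1 u = 0.
      by move/(subsetP NBC)/(subsetP (comp_sub edge vU)); rewrite inE => /eqP.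
    have b5 u : birth_in s5 u = if u \in NB then N.+1 else birth_in s1 u.
      by rewrite /birth_in /s5 /= upd_neq // g80 e80.
    have col5 (u : 'I_n) : nmem s5 81 u < 4 * q.
      rewrite /s5 /= upd_neq //; have := g81 u; case: ifP => // _ ->.
      by rewrite e81.
    have old : forall t, t <= N -> bag_in s5 t = bag_in s1 t /\ (0 < t ->
          row_is (fun c => if c < stride then nmem s5 82 (nmem s5 83 t + c) else 0)
          (nmem s5 81) (bag_in s5 t)).
      apply: (old_bag td1).
      - by move=> x xV; rewrite /s5 /= upd_neq // old4; [rewrite e82 old82 | left].
      - by move=> t tN; rewrite /s5 /= upd_neq // g83 ifN ?e83 //; lia.
      - move=> u b0; rewrite /s5 /= upd_neq //; have := g81 u.
        have uNB : (u \in NB) = false by apply/negbTE; apply: contra b0 => /NB0->.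
        by rewrite uNB => ->; rewrite e81.
      - by move=> u; apply: leq_trans (col5 u) c4s.
    have row5 : row_is (fun c => if c < stride then nmem s5 82 (nmem s5 83 N.+1 + c) else 0)
          (nmem s5 81) (W :|: NB).
      have e c : nmem s5 82 (nmem s5 83 N.+1 + c) = nmem s4 82 (VB + c).
        by rewrite /s5 /= !upd_neq // g83 eqxx.
      apply: row_is_ext g82 => [c|u _]; last by rewrite /s5 /= upd_neq.
      rewrite e; case: ltnP => // cs; rewrite old4; last by right; rewrite leq_add2l (leq_trans c4s).
      by rewrite e82 z2 // leq_add2l.
    have bag5 : bag_in s5 N.+1 = W :|: NB.
      apply/setP => u; rewrite inE; have cs : nmem s5 81 u < stride by apply: leq_trans (col5 u) c4s.
      apply/eqP/idP => [E|uB]; last by have := (proj1 row5) u uB; rewrite cs.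
      have := (proj2 row5) (nmem s5 81 u); rewrite cs E => /(_ isT) [w wB [_ [wu]]].
      by rewrite (_ : u = w) //; apply: val_inj.
    split.
    - split; first by exact: (inputs_frame fr4 _ inp3).
      + exact: (network_frame fr4 _ net3).
      + by rewrite /s5 /= upd_neq.
      + by [].
    - by rewrite /s5 /= !upd_neq // !(frn fr4) // !keep3 // !keep2.
    - apply: (bags_extend (v := v) (NB := NB) ok1) => //.
      + by move=> t tN; have [-> _] := old t tN.
      + by move=> t tN; rewrite /s5 /= upd_neq // g84 ifN ?e84 //; lia.
      + by rewrite /s5 /= upd_neq // g84 eqxx k89 EU.
      + move=> v' v'U; rewrite EU => v'C.
        have NBu : [disjoint v |: S & component edge (unborn (birth_in s5)) v'].
          apply/pred0P => w /=; apply/negbTE/negP => /andP[wS wC].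
          have := subsetP (comp_sub edge v'U) w wC; rewrite inE b5.
          case: ifP => // /negbT wNB w0.
          have U5 : unborn (birth_in s5) \subset U.
            by apply/subsetP => x; rewrite !inE b5; case: ifP.
          have : w \in C.
            rewrite /C -(comp_eq v'C).
            exact: (subsetP (comp_subset edge (subsetP U5 v' v'U) v'U U5) w wC).
          by move=> wC'; move: wNB; rewrite in_setI wC' wS.
        apply: sm => //.
        rewrite -[X in _ \subset X :|: _]/W -/NB.
        apply: (bdry_new (edge := edge) (birth := birth_in s1) (N := N) (v := v)) => //; rewrite ?EU //.
    - move=> t /andP[t0]; rewrite leq_eqVlt => /orP[/eqP->|].
        rewrite bag5; split=> //; rewrite /s5 /= upd_neq // g83 eqxx //.
      rewrite ltnS => tN; have [_ row] := old t tN; split; last exact: row.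
      have [|le _] := rows1 t; first by rewrite t0.
      rewrite /s5 /= upd_neq // g83 ifN ?e83; last by lia.
      by apply: leq_trans le (leq_addr _ _).
    - split=> //.
      + apply: leq_ltn_trans Nborn1 _; apply: proper_card; apply/properP; split.
          by apply/subsetP => u; rewrite !inE b5; case: ifP.
        by exists v; rewrite in_set ?b5 ?vNB // NB0.
      + move=> x le; rewrite /s5 /= upd_neq // old4 ?e82 ?z2 //.
        by right; apply: leq_trans le; rewrite leq_add2l.
  (* The row at [VB] is given up even when no bag was added, because the boundary has already been
     written into it. *)
  move=> s4 fr4 [e0 e86 H4]; apply: wp_nset.
  have -> : neval s4 (Var 86 + (eN + eN + eN + eN + NCst 8))%cmd = VB + stride.
    by rewrite /= e0 n3 e86 keep3 // keep2 // c86 /stride.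
  exact: H4.
by rewrite -/X -/A; lia.
Qed.

Lemma TreeDec_wp s : inputs_in s -> 0 < n -> nmem s 80 =1 (fun=> 0) ->
  nmem s 81 =1 (fun=> 0) -> nmem s 82 =1 (fun=> 0) ->
  wp TreeDec s (A * 100 + X * 30 + 120 + (n + n) * (iter_cost + 3)) (fun s' =>
    exists N q VB, td_in s' N q VB /\ forall u, birth_in s' u != 0).
Proof.
move=> inp n0 z80 z81 z82; eapply wp_le.
  eapply wp_seq, wp_call; first exact: (Setup_wp ndP ejP inp).
  move=> s1 fr1 net1.
  have inp1 : inputs_in s1 by apply: (inputs_frame fr1).
  have [n1 _ _ _ _] := inp1.
  do 6 (eapply wp_seq; apply: wp_nset => /=).
  set s2 := setn _ _ _ _.
  (* Each round adds a bag or raises [q], unless all nodes are born. There are at most [n] bags and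
     [q - 2] is at most [n / 3], so [2 * n] rounds suffice. *)
  eapply (wp_for (N := n + n) (T := iter_cost) (Inv := fun i s3 => exists N q VB,
    td_in s3 N q VB /\ ((forall u, birth_in s3 u != 0) \/ i <= N + (q - 2)))).
  - by rewrite /s2 /= /upd /= n1.
  - by [].
  - by [].
  - exists 0, 2, 0.
    have b0 u : birth_in s2 u = 0 by rewrite /birth_in /s2 /= !upd_neq // (frn fr1) // z80.
    split; last by right.
    split=> //.
    + apply: bags_ok_le (bags_ok0 edge _ _ b0) => //.
    + by case=> [|t] /andP[].
    + split=> //.
      * by move=> u; rewrite /s2 /= !upd_neq // (frn fr1) // z81.
      * by rewrite addnC leq_addr.
      * by move=> x _; rewrite /s2 /= !upd_neq // (frn fr1) // z82.
  - move=> i s3 iN _ _ [N [q [VB [td H]]]].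
    eapply wp_call; first exact: (Iter_wp td).
    move=> s4 _ /=; case: ifP => [_ [td4 all]|/negbT/forallPn[u]].
      by exists N, q, VB; split=> //; left.
    rewrite negbK => /eqP u0 H4.
    have {H} le : i <= N + (q - 2) by case: H => // /(_ u); rewrite u0.
    have [_ _ _ _ [_ [q2 _] _ _ _]] := td.
    case: H4 => td4; [exists N.+1, q | exists N, q.+1]; exists (VB + stride); split=> //; right; lia.
  - move=> s3 _ [N [q [VB [td [all|le]]]]]; first by exists N, q, VB.
    exists N, q, VB; split=> // u; apply/negP => /eqP u0.
    have [_ _ _ _ [_ [q2 qn] _ Nb _]] := td.
    have : #|[set u | birth_in s3 u != 0]| < #|[set: 'I_n]|.
      apply: proper_card; apply/properP; split; first exact: subsetT.
      by exists u; rewrite !inE // u0.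
    rewrite cardsT card_ord => lt.
    lia.
rewrite -/X -/A; lia.
Qed.

End TreeDec.

(** * The hyperflow linear program *)

Section Hyperflow.
Variables (R : realType) (n Q D : nat) (par : nat -> nat).
Variables (valid : nat -> nat -> nat -> bool) (after : nat -> nat -> nat -> nat).
Variables (initok : nat -> nat -> bool) (birth : 'I_n -> nat).
Variable sdf : nat -> 'I_n -> bool.
Hypothesis Q0 : (0 < Q)%N.
Hypothesis D0 : (0 < D)%N.
Hypothesis par_lt : forall q, (0 < q <= Q)%N -> (par q < q)%N.
Hypothesis after_lt : forall q x a, (after q x a < D)%N.
Hypothesis birthP : forall i, (0 < birth i <= Q)%N.

(* Items are merged into their parents in the order [Q], [Q - 1], ..., [1].  The
   table of [p] before merge [it] occupies the rows from [ver it p] on. *)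
Definition orow (it : nat) : nat := (Q.+1 + it) * D.

Fixpoint ver (it p : nat) : nat :=
  if it is it'.+1 then if p == par (Q - it') then orow it' else ver it' p
  else (p * D)%N.

Definition RB : nat := ((Q.+1 + Q) * D)%N.
Definition last_row : nat := orow Q.-1.
Definition vop (it x a : nat) : nat := (n + ((it * D + x) * D + a))%N.
Definition vg (q x : nat) : nat := (n + (Q * D * D + (q * D + x)))%N.
Definition NV : nat := (n + (Q * D * D + Q.+1 * D))%N.

Definition seeded (q a : nat) (i : 'I_n) : bool := (birth i == q) && sdf a i.

(** The column of a merge operation: it produces one entry of the new parent table, consumes one
    entry each of the old parent table and of the child, and is charged to the seed row of every
    node born in the child and marked by [a]. *)
Definition wop (it x a r : nat) : R :=
  ((orow it + after (Q - it) x a == r)%N%:R - (ver it (par (Q - it)) + x == r)%N%:R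
  - (ver it (Q - it) + a == r)%N%:R
  - \sum_(i < n) (seeded (Q - it) a i && (RB + i == r))%N%:R)%R.

(** Invalid operations and inadmissible entries own variables too, so that the numbering is plain
    counting, but these variables occur in no row. *)
Definition lhs (r : nat) (Y : nat -> R) : R :=
  (\sum_(it < Q) \sum_(x < D) \sum_(a < D | valid (Q - it)%N x a)
     wop it x a r * Y (vop it x a)
  + \sum_(i < n) (RB + i == r)%N%:R * Y i
  + \sum_(q < Q.+1) \sum_(x < D | initok q x) (q * D + x == r)%N%:R * Y (vg q x))%R.

(** The amount [M] delivered at the root is kept general because peeling lowers it. *)
Definition flow (M : R) (Y : nat -> R) : Prop :=
  (forall v, (v < NV)%N -> 0 <= Y v)%R /\
  forall r, (r < RB + n)%N -> lhs r Y = ((r == last_row)%:R * M)%R.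

(** ** Selections: integral points *)

(* [st it p] is the state of item [p] before merge [it]. *)
Definition selection (st : nat -> nat -> nat) : Prop :=
  [/\ st Q 0 = 0, forall it p, (st it p < D)%N,
      forall q, (q <= Q)%N -> initok q (st 0 q) &
      forall it, (it < Q)%N -> let q := (Q - it)%N in
        [/\ valid q (st it (par q)) (st it q),
            st it.+1 (par q) = after q (st it (par q)) (st it q) &
            forall p, (p < q)%N -> p != par q -> st it.+1 p = st it p]].

Definition sel_seeds (st : nat -> nat -> nat) : {set 'I_n} :=
  [set i | sdf (st (Q - birth i) (birth i)) i].

Definition sel_vec (st : nat -> nat -> nat) (v : nat) : R :=
  ([exists i in sel_seeds st, val i == v] ||
   [exists it : 'I_Q, v == vop it (st it (par (Q - it))) (st it (Q - it))] ||
   [exists q : 'I_Q.+1, v == vg q (st 0 q)])%N%:R%R.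

Lemma vop_inj it x a it' x' a' : (x < D)%N -> (a < D)%N -> (x' < D)%N -> (a' < D)%N ->
  vop it x a = vop it' x' a' -> [/\ it = it', x = x' & a = a'].
Proof.
move=> xD aD xD' aD' /addnI E.
have Ea : a = a' by have := congr1 (modn^~ D) E; rewrite !modnMDl !modn_small.
have : (it * D + x = it' * D + x')%N by subst a'; move/addIn: E => /eqP; rewrite eqn_pmul2r // => /eqP.
move=> E2; have Ex : x = x' by have := congr1 (modn^~ D) E2; rewrite !modnMDl !modn_small.
by subst x'; move/addIn: E2 => /eqP; rewrite eqn_pmul2r // => /eqP.
Qed.

Lemma vg_inj q x q' x' : (x < D)%N -> (x' < D)%N ->
  vg q x = vg q' x' -> q = q' /\ x = x'.
Proof.
move=> xD xD' /addnI/addnI E.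
have Ex : x = x' by have := congr1 (modn^~ D) E; rewrite !modnMDl !modn_small.
by subst x'; move/addIn: E => /eqP; rewrite eqn_pmul2r // => /eqP.
Qed.

Lemma vop_lt it x a : (it < Q)%N -> (x < D)%N -> (a < D)%N ->
  (n <= vop it x a < n + Q * D * D)%N.
Proof.
move=> iQ xD aD; rewrite leq_addr ltn_add2l /=.
apply: (@leq_trans ((it * D + x).+1 * D)); first by rewrite mulSn addnC ltn_add2r.
rewrite leq_mul2r; apply/orP; right.
apply: (@leq_trans (it.+1 * D)); first by rewrite mulSn addnC ltn_add2r.
by rewrite leq_mul2r iQ orbT.
Qed.

Lemma vg_lt q x : (q <= Q)%N -> (x < D)%N -> (n + Q * D * D <= vg q x < NV)%N.
Proof.
move=> qQ xD; rewrite /vg /NV addnA leq_addr /= -addnA !ltn_add2l.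
apply: (@leq_trans (q.+1 * D)); first by rewrite mulSn addnC ltn_add2r.
by rewrite leq_mul2r ltnS qQ orbT.
Qed.

Lemma ver_lt it p x : (it <= Q)%N -> (p <= Q)%N -> (x < D)%N ->
  (ver it p + x < (Q.+1 + it) * D)%N.
Proof.
move=> iQ pQ xD; elim: it iQ => [|it IH] iQ /=.
  rewrite addn0; apply: (@leq_trans (p.+1 * D)); first by rewrite mulSn addnC ltn_add2r.
  by rewrite leq_mul2r ltnS pQ orbT.
case: ifP => _; first by rewrite /orow addnS mulSn addnC ltn_add2r.
by apply: leq_trans (IH (ltnW iQ)) _; rewrite leq_mul2r addnS leqnSn orbT.
Qed.

Lemma orow_eq it z it' z' : (z < D)%N -> (z' < D)%N ->
  (orow it + z = orow it' + z')%N -> it = it' /\ z = z'.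
Proof.
move=> zD zD' E.
have Ez : z = z' by have := congr1 (modn^~ D) E; rewrite !modnMDl !modn_small.
by subst z'; move/addIn: E => /eqP; rewrite eqn_pmul2r // eqn_add2l => /eqP.
Qed.

Lemma orow_lt it z : (it < Q)%N -> (z < D)%N -> (orow it + z < RB)%N.
Proof.
move=> iQ zD; apply: (@leq_trans ((Q.+1 + it).+1 * D)).
  by rewrite mulSn addnC ltn_add2r.
by rewrite leq_mul2r -addnS leq_add2l iQ orbT.
Qed.

Lemma init_lt q x it z : (q <= Q)%N -> (x < D)%N -> (q * D + x < orow it + z)%N.
Proof.
move=> qQ xD; apply: (@leq_trans (q.+1 * D)); first by rewrite mulSn addnC ltn_add2r.
apply: leq_trans (leq_addr _ _); rewrite leq_mul2r; apply/orP; right.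
by apply: leq_trans (leq_addr _ _).
Qed.

Section SelVec.
Variable st : nat -> nat -> nat.
Hypothesis sel : selection st.
Let Z := sel_vec st.

Lemma sel_vec_seed (i : 'I_n) : Z i = (i \in sel_seeds st)%N%:R%R.
Proof.
have [_ stD _ _] := sel; rewrite /Z /sel_vec; congr (_ %:R)%R; congr nat_of_bool.
apply/idP/idP => [|iS]; last by apply/orP; left; apply/orP; left; apply/exists_inP; exists i.
case/orP=> [/orP[/exists_inP[j jS /eqP/val_inj<-]//|/existsP[it /eqP E]]|/existsP[q /eqP E]].
- by have /andP[] := vop_lt (ltn_ord it) (stD it (par (Q - it))) (stD it (Q - it)%N); rewrite -E leqNgt ltn_ord.
- have qQ : (q <= Q)%N by rewrite -ltnS.
  have /andP[] := vg_lt qQ (stD 0%N q); rewrite -E => le _.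
  by have := leq_trans (leq_addr _ _) le; rewrite leqNgt ltn_ord.
Qed.

Lemma sel_vec_op it x a : (it < Q)%N -> (x < D)%N -> (a < D)%N ->
  Z (vop it x a) = ((x == st it (par (Q - it))) && (a == st it (Q - it)%N))%N%:R%R.
Proof.
have [_ stD _ _] := sel; move=> iQ xD aD; rewrite /Z /sel_vec; congr (_ %:R)%R; congr nat_of_bool.
have /andP[l1 l2] := vop_lt iQ xD aD.
apply/idP/idP => [|/andP[/eqP-> /eqP->]]; last first.
  by apply/orP; left; apply/orP; right; apply/existsP; exists (Ordinal iQ).
case/orP=> [/orP[/exists_inP[j jS /eqP E]|/existsP[it' /eqP E]]|/existsP[q /eqP E]].
- by move: l1; rewrite -E leqNgt ltn_ord.
- by have [-> -> ->] := vop_inj xD aD (stD _ _) (stD _ _) E; rewrite !eqxx.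
- have qQ : (q <= Q)%N by rewrite -ltnS.
  by have /andP[] := vg_lt qQ (stD 0%N q); rewrite -E leqNgt l2.
Qed.

Lemma sel_vec_g q x : (q <= Q)%N -> (x < D)%N -> Z (vg q x) = (x == st 0 q)%N%:R%R.
Proof.
have [_ stD _ _] := sel; move=> qQ xD; rewrite /Z /sel_vec; congr (_ %:R)%R; congr nat_of_bool.
have /andP[l1 l2] := vg_lt qQ xD.
apply/idP/idP => [|/eqP->]; last first.
  by apply/orP; right; apply/existsP; exists (Ordinal (qQ : (q < Q.+1)%N)).
case/orP=> [/orP[/exists_inP[j jS /eqP E]|/existsP[it' /eqP E]]|/existsP[q' /eqP E]].
- by have := leq_trans (leq_addr _ _) l1; rewrite -E leqNgt ltn_ord.
- have /andP[_] := vop_lt (ltn_ord it') (stD it' (par (Q - it'))) (stD it' (Q - it')%N).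
  by rewrite -E ltnNge l1.
- by have [-> ->] := vg_inj xD (stD 0%N q') E; rewrite eqxx.
Qed.

Lemma sel_vec_ge0 v : (0 <= Z v)%R. Proof. exact: ler0n. Qed.

Lemma sum_pick (P : pred nat) (F : nat -> R) x0 : x0 < D -> P x0 ->
  (\sum_(x < D | P x) F x * (val x == x0)%:R)%R = F x0.
Proof.
move=> xD Px; rewrite (bigD1 (Ordinal xD)) //= eqxx mulr1 big1 ?addr0 // => x /andP[_ ne].
by rewrite -val_eqE /= in ne; rewrite (negPf ne) mulr0.
Qed.

Lemma lhs_sel r : lhs r Z =
  (\sum_(it < Q) wop it (st it (par (Q - it)%N)) (st it (Q - it)%N) r
  + \sum_(i < n) (RB + i == r)%N%:R * (i \in sel_seeds st)%:R
  + \sum_(q < Q.+1) (q * D + st 0%N q == r)%N%:R)%R.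
Proof.
have [_ stD ini stp] := sel; rewrite /lhs; congr (_ + _ + _)%R.
- apply: eq_bigr => it _; have [vld _ _] := stp it (ltn_ord it).
  rewrite (bigD1 (Ordinal (stD it (par (Q - it))))) //= [X in (_ + X)%R]big1 ?addr0 => [|x ne].
    rewrite (eq_bigr (fun a : 'I_D => wop it (st it (par (Q - it))) a r * (val a == st it (Q - it)%N)%:R)%R).
      by rewrite (sum_pick (P := valid (Q - it) (st it (par (Q - it)))) (fun a => wop it (st it (par (Q - it))) a r)).
    by move=> a _; rewrite sel_vec_op // eqxx.
  rewrite big1 // => a _; rewrite sel_vec_op //.
  by rewrite -val_eqE /= in ne; rewrite (negPf ne) mulr0.
- by apply: eq_bigr => i _; rewrite sel_vec_seed.
- apply: eq_bigr => q _; have qQ : (q <= Q)%N by rewrite -ltnS.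
  rewrite (eq_bigr (fun x : 'I_D => (q * D + x == r)%N%:R * (val x == st 0%N q)%:R)%R).
    by rewrite (sum_pick (P := initok q) (fun x => (q * D + x == r)%N%:R%R)) ?ini.
  by move=> x _; rewrite sel_vec_g.
Qed.

Lemma sel_flow : flow 1 Z.
Proof.
have [st0 stD ini stp] := sel; split=> [v _|r rR]; first exact: sel_vec_ge0.
rewrite lhs_sel mulr1.
case: (ltnP r RB) => rRB.
  rewrite [X in (_ + X + _)%R]big1 => [|i _]; last by rewrite gtn_eqF ?mul0r // ltn_addr.
  rewrite addr0.
  (* [T it] counts how often row [r] is the current entry of an item alive before merge [it]. A
     merge changes it by its own column, so the columns telescope from the initial entries to the
     root entry. *)
  pose T it : R := (\sum_(p < (Q - it).+1) (ver it p + st it p == r)%N%:R)%R.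
  have step it : (it < Q)%N ->
      T it.+1 = (T it + wop it (st it (par (Q - it))) (st it (Q - it)%N) r)%R.
    move=> iQ; have [_ sa so] := stp it iQ.
    have q0 : (0 < Q - it)%N by rewrite subn_gt0.
    have pq := par_lt (ltac:(by rewrite q0 leq_subr) : (0 < Q - it <= Q)%N).
    rewrite /T /wop [X in (_ - X)%R]big1 => [|i _]; last by rewrite gtn_eqF ?andbF // ltn_addr.
    have -> : ((Q - it.+1).+1 = Q - it)%N by rewrite subnS prednK.
    rewrite big_ord_recr /= -sa (bigD1 (Ordinal pq)) //= eqxx [in RHS](bigD1 (Ordinal pq)) //=.
    rewrite (eq_bigr (fun p : 'I_(Q - it) => (ver it p + st it p == r)%N%:R%R)); first by ring.
    by move=> p ne; rewrite -val_eqE /= in ne; rewrite (negPf ne) so.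
  have : T Q = (T 0%N + \sum_(it < Q) wop it (st it (par (Q - it))) (st it (Q - it)%N) r)%R.
    have H k : (k <= Q)%N -> T k = (T 0%N + \sum_(it < k) wop it (st it (par (Q - it))) (st it (Q - it)%N) r)%R.
      elim: k => [|k IH] kQ; first by rewrite big_ord0 addr0.
      by rewrite step // IH ?big_ord_recr ?addrA // ltnW.
    exact: H.
  have verQ : ver Q 0%N = last_row.
    rewrite /last_row; have E := prednK Q0; rewrite -{1}E /= ifT //.
    have : (par (Q - Q.-1) < Q - Q.-1)%N by apply: par_lt; lia.
    have -> : Q - Q.-1 = 1 by lia.
    by case: (par 1).
  have -> : T Q = (r == last_row)%N%:R%R.
    by rewrite /T subnn big_ord1 /= st0 addn0 verQ eq_sym.
  by rewrite /T subn0 addrC => ->.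
have lr : (last_row < RB)%N by have := @orow_lt Q.-1 0%N; rewrite addn0; apply=> //; lia.
rewrite (gtn_eqF (leq_trans lr rRB)).
have [i0 ->] : exists i0 : 'I_n, r = (RB + i0)%N.
  have h : (r - RB < n)%N by rewrite ltn_subLR.
  by exists (Ordinal h); rewrite /= subnKC.
rewrite [X in (_ + _ + X)%R]big1 ?addr0 => [|q _]; last first.
  rewrite ltn_eqF //; apply: (@leq_trans RB); last exact: leq_addr.
  apply: (@leq_trans (q.+1 * D)); first by rewrite mulSn addnC ltn_add2r.
  by rewrite leq_mul2r (leq_trans (ltn_ord q)) ?orbT // leq_addr.
rewrite [X in (_ + X)%R](bigD1 i0) //= eqxx mul1r [X in (_ + (_ + X))%R]big1 ?addr0; last first.
  by move=> i ne; rewrite eqn_add2l -val_eqE /= in ne *; rewrite (negPf ne) mul0r.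
have Eit it : (it < Q)%N -> wop it (st it (par (Q - it))) (st it (Q - it)%N) (RB + i0) =
    (- (seeded (Q - it) (st it (Q - it)%N) i0)%:R)%R.
  move=> iQ.
  have vlt p x : (p <= Q)%N -> (x < D)%N -> (ver it p + x < RB + i0)%N.
    move=> pQ xD; apply: (leq_trans (ver_lt (ltnW iQ) pQ xD)).
    apply: leq_trans (leq_addr _ _); by rewrite leq_mul2r leq_add2l (ltnW iQ) orbT.
  have q0 : (0 < Q - it)%N by rewrite subn_gt0.
  have pq := par_lt (ltac:(by rewrite q0 leq_subr) : (0 < Q - it <= Q)%N).
  rewrite /wop (bigD1 i0) //= eqxx andbT [X in (- (_ + X))%R]big1 ?addr0; last first.
    by move=> i ne; rewrite eqn_add2l -val_eqE /= in ne *; rewrite (negPf ne) andbF.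
  rewrite (ltn_eqF (vlt _ _ _ _)) ?stD ?(leq_trans (ltnW pq)) ?leq_subr //.
  rewrite (ltn_eqF (vlt _ _ _ _)) ?stD ?leq_subr //.
  rewrite ltn_eqF ?subr0 ?sub0r //.
  by apply: leq_trans (leq_addr _ _); apply: orow_lt.
have /andP[b0 bQ] := birthP i0.
(* Only the merge of the birth item of [i0] is charged to its seed row, so the row compares the seed
   variable with a single mark. *)
have iQ : (Q - birth i0 < Q)%N by lia.
rewrite (bigD1 (Ordinal iQ)) //= Eit // subKn // [X in (_ + X + _)%R]big1 => [|it ne]; last first.
  rewrite Eit // /seeded; case: eqP => [E|]; last by rewrite oppr0.
  by case/eqP: ne; apply: val_inj; rewrite /= E subKn // ltnW.
by rewrite /seeded eqxx inE addr0 addNr.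
Qed.

End SelVec.

(** ** Extracting a selection from the support of a flow *)

Definition opsum (F : nat -> nat -> nat -> R) : R :=
  (\sum_(it < Q) \sum_(x < D) \sum_(a < D | valid (Q - it)%N x a) F it x a)%R.

Lemma opsum_ge0 F :
  (forall it x a, it < Q -> x < D -> a < D -> valid (Q - it) x a -> (0 <= F it x a)%R) ->
  (0 <= opsum F)%R.
Proof. by move=> H; do 2!(apply: sumr_ge0 => ? _); apply: sumr_ge0 => a ?; apply: H. Qed.

Lemma opsum_gt0 F it x a :
  (forall it x a, it < Q -> x < D -> a < D -> valid (Q - it) x a -> (0 <= F it x a)%R) ->
  it < Q -> x < D -> a < D -> valid (Q - it) x a -> (0 < F it x a)%R -> (0 < opsum F)%R.
Proof.
move=> H iQ xD aD V F0; rewrite /opsum (bigD1 (Ordinal iQ)) //= (bigD1 (Ordinal xD)) //=.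
rewrite (bigD1 (Ordinal aD)) //= -!addrA ltr_wpDr //.
apply: addr_ge0; first by apply: sumr_ge0 => ? /andP[? _]; apply: H.
apply: addr_ge0; first by apply: sumr_ge0 => ? _; apply: sumr_ge0 => ? ?; apply: H.
by do 2!(apply: sumr_ge0 => ? _); apply: sumr_ge0 => ? ?; apply: H.
Qed.

Lemma opsum0 F :
  (forall it x a, it < Q -> x < D -> a < D -> valid (Q - it) x a -> F it x a = 0%R) ->
  opsum F = 0%R.
Proof. by move=> H; do 2!(apply: big1 => ? _); apply: big1 => a ?; apply: H. Qed.

Lemma opsum_ex F : (0 < opsum F)%R ->
  exists it x a, [/\ it < Q, x < D, a < D, valid (Q - it) x a & (0 < F it x a)%R].
Proof.
move=> F0; apply: contrapT => H; move: F0; rewrite ltNge => /negP; apply.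
apply: sumr_le0 => it _; apply: sumr_le0 => x _; apply: sumr_le0 => a v.
by rewrite leNgt; apply/negP => F0; apply: H; exists it, x, a; split.
Qed.

Lemma opsum_eq F G :
  (forall it x a, it < Q -> x < D -> a < D -> valid (Q - it) x a -> F it x a = G it x a) ->
  opsum F = opsum G.
Proof. by move=> H; do 2!(apply: eq_bigr => ? _); apply: eq_bigr => a ?; apply: H. Qed.

Lemma opsumD c F G :
  opsum (fun it x a => F it x a + c * G it x a)%R = (opsum F + c * opsum G)%R.
Proof.
rewrite /opsum mulr_sumr -big_split; apply: eq_bigr => it _.
rewrite mulr_sumr -big_split; apply: eq_bigr => x _.
by rewrite mulr_sumr -big_split.
Qed.

Definition initsum (F : nat -> nat -> R) : R :=
  (\sum_(q < Q.+1) \sum_(x < D | initok q x) F q x)%R.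

Lemma initsum_ge0 F : (forall q x, q <= Q -> x < D -> (0 <= F q x)%R) -> (0 <= initsum F)%R.
Proof. by move=> H; apply: sumr_ge0 => q _; apply: sumr_ge0 => x _; apply: H; rewrite // -ltnS. Qed.

Lemma initsum0 F : (forall q x, q <= Q -> x < D -> initok q x -> F q x = 0%R) -> initsum F = 0%R.
Proof. by move=> H; apply: big1 => q _; apply: big1 => x ?; apply: H; rewrite // -ltnS. Qed.

Lemma initsum_ex F : (0 < initsum F)%R ->
  exists q x, [/\ q <= Q, x < D, initok q x & (0 < F q x)%R].
Proof.
move=> F0; apply: contrapT => H; move: F0; rewrite ltNge => /negP; apply.
apply: sumr_le0 => q _; apply: sumr_le0 => x v.
by rewrite leNgt; apply/negP => F0; apply: H; exists q, x; split; rewrite // -ltnS.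
Qed.

Definition supply (Y : nat -> R) (r : nat) : R :=
  (opsum (fun it x a => (orow it + after (Q - it)%N x a == r)%N%:R * Y (vop it x a))
   + initsum (fun q x => (q * D + x == r)%N%:R * Y (vg q x)))%R.

Definition consumption (Y : nat -> R) (r : nat) : R :=
  opsum (fun it x a => ((ver it (par (Q - it)) + x == r)%N%:R + (ver it (Q - it) + a == r)%N%:R)
    * Y (vop it x a))%R.

Lemma qP it : it < Q -> [/\ 0 < Q - it, Q - it <= Q, par (Q - it) < Q - it & par (Q - it) <= Q].
Proof.
move=> iQ; have q0 : 0 < Q - it by rewrite subn_gt0.
have pq : par (Q - it) < Q - it by apply: par_lt; rewrite q0 leq_subr.
by split=> //; rewrite ?leq_subr // (leq_trans (ltnW pq)) ?leq_subr.
Qed.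

Lemma ver_ltRB it p x i : it < Q -> p <= Q -> x < D -> (ver it p + x < RB + i).
Proof.
move=> iQ pQ xD; apply: (leq_trans (ver_lt (ltnW iQ) pQ xD)).
by apply: leq_trans (leq_addr _ _); rewrite leq_mul2r leq_add2l (ltnW iQ) orbT.
Qed.

Lemma balance M Y r : flow M Y -> r < RB ->
  supply Y r = (consumption Y r + (r == last_row)%:R * M)%R.
Proof.
move=> [_ H] rRB; move: (H r (ltn_addr _ rRB)) => {}H; rewrite -H /lhs.
rewrite [X in (_ = _ + (_ + X + _))%R]big1 => [|i _]; last by rewrite gtn_eqF ?mul0r // ltn_addr.
rewrite addr0 /supply addrA -/(opsum (fun it x a => wop it x a r * Y (vop it x a))%R); congr (_ + _)%R.
rewrite -[X in (_ = _ + X)%R]mul1r -opsumD; apply: opsum_eq => it x a iQ xD aD V.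
rewrite /wop big1 => [|i _]; last by rewrite (gtn_eqF (ltn_addr _ rRB)) andbF.
by rewrite mul1r; ring.
Qed.

Lemma seed_row M Y (i : 'I_n) : flow M Y ->
  Y i = opsum (fun it x a => (seeded (Q - it)%N a i)%:R * Y (vop it x a))%R.
Proof.
move=> [_ /(_ (RB + i))]; rewrite ltn_add2l ltn_ord => /(_ isT).
have lr : last_row < RB by have := @orow_lt Q.-1 0; rewrite addn0; apply=> //; lia.
rewrite (gtn_eqF (ltn_addr _ lr)) mul0r /lhs.
rewrite (bigD1 i) //= eqxx mul1r [X in (_ + (_ + X) + _)%R]big1 ?addr0; last first.
  by move=> j ne; rewrite eqn_add2l -val_eqE /= in ne *; rewrite (negPf ne) mul0r.
rewrite [X in (_ + _ + X)%R]big1 ?addr0 => [|q _]; last first.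
  apply: big1 => x _; rewrite ltn_eqF ?mul0r //; apply: (@leq_trans RB); last exact: leq_addr.
  apply: (@leq_trans (q.+1 * D)); first by rewrite mulSn addnC ltn_add2r.
  by rewrite leq_mul2r (leq_trans (ltn_ord q)) ?orbT // leq_addr.
move/eqP; rewrite addrC addr_eq0 => /eqP->.
rewrite -/(opsum (fun it x a => wop it x a (RB + i) * Y (vop it x a))%R).
rewrite -mulN1r -[LHS]add0r -(opsum0 (F := fun _ _ _ => 0%R)) // -opsumD.
apply: opsum_eq => it x a iQ xD aD V; rewrite add0r mulN1r -mulNr; congr (_ * _)%R.
have [_ ? _ ?] := qP iQ.
rewrite /wop (bigD1 i) //= eqxx andbT [X in (_ - (_ + X))%R]big1 ?addr0; last first.
  by move=> j ne; rewrite eqn_add2l -val_eqE /= in ne *; rewrite (negPf ne) andbF.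
rewrite (ltn_eqF (ver_ltRB _ _ _ _)) // (ltn_eqF (ver_ltRB _ _ _ _)) //.
rewrite ltn_eqF ?subr0 ?sub0r ?opprK //.
by apply: leq_trans (leq_addr _ _); apply: orow_lt.
Qed.

Lemma flow_op M Y it x a : flow M Y -> it < Q -> x < D -> a < D -> (0 <= Y (vop it x a))%R.
Proof.
move=> [Y0 _] iQ xD aD; apply: Y0; have /andP[_ h] := vop_lt iQ xD aD.
by apply: leq_trans h _; rewrite leq_add2l leq_addr.
Qed.

Lemma flow_g M Y q x : flow M Y -> q <= Q -> x < D -> (0 <= Y (vg q x))%R.
Proof. by move=> [Y0 _] iQ xD; apply: Y0; have /andP[_ h] := vg_lt iQ xD. Qed.

(** By [balance] this is also the supply of the row, so a demanded row has a producer with a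
    positive variable. *)
Definition demanded M Y r := (0 < consumption Y r + (r == last_row)%:R * M)%R.

Lemma op_demands M Y it x a : flow M Y -> (0 <= M)%R -> it < Q -> x < D -> a < D ->
  valid (Q - it) x a -> (0 < Y (vop it x a))%R ->
  demanded M Y (ver it (par (Q - it)) + x) /\ demanded M Y (ver it (Q - it) + a).
Proof.
move=> fl M0 iQ xD aD V Y0; split; apply: ltr_wpDr; rewrite ?mulr_ge0 ?ler0n //.
- apply: (opsum_gt0 (it := it) (x := x) (a := a)) => // [it' x' a' *|].
    by rewrite mulr_ge0 ?addr_ge0 ?ler0n // (flow_op fl).
  by rewrite mulr_gt0 // eqxx ltr_wpDr // ltr0n.
- apply: (opsum_gt0 (it := it) (x := x) (a := a)) => // [it' x' a' *|].
    by rewrite mulr_ge0 ?addr_ge0 ?ler0n // (flow_op fl).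
  by rewrite mulr_gt0 // eqxx ltr_wpDl // ltr0n.
Qed.

Lemma demanded_op M Y it z : flow M Y -> it < Q -> z < D -> demanded M Y (orow it + z) ->
  exists x a, [/\ x < D, a < D, valid (Q - it) x a, after (Q - it) x a = z
                & (0 < Y (vop it x a))%R].
Proof.
move=> fl iQ zD; rewrite /demanded -(balance fl) ?orow_lt // /supply [X in (_ + X)%R]initsum0 ?addr0.
  case/opsum_ex => it' [x [a [iQ' xD aD V]]].
  case: eqP => [E|_]; last by rewrite mul0r ltxx.
  by have [? ?] := orow_eq (after_lt _ _ _) zD E; subst it'; rewrite mul1r; exists x, a.
by move=> q x qQ xD _; rewrite ltn_eqF ?mul0r // init_lt.
Qed.

Lemma demanded_init M Y q x : flow M Y -> q <= Q -> x < D -> demanded M Y (q * D + x) ->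
  initok q x /\ (0 < Y (vg q x))%R.
Proof.
move=> fl qQ xD; rewrite /demanded -(balance fl); last first.
  by have := @init_lt q x 0 0 qQ xD; rewrite addn0 /orow addn0 => /leq_trans; apply;
     rewrite leq_mul2r leq_addr orbT.
rewrite /supply opsum0 ?add0r => [|it x' a' iQ *]; last by rewrite gtn_eqF ?mul0r // init_lt.
case/initsum_ex => q' [x' [qQ' xD' V]].
case: eqP => [E|_]; last by rewrite mul0r ltxx.
have [? ?] : q' = q /\ x' = x by apply: vg_inj; rewrite // /vg E.
by subst q' x'; rewrite mul1r.
Qed.

(** A selection that is fixed from merge [it0] on, found from the last merge backwards. What keeps
    it extendable is that the chosen entries of all items alive before merge [it0] are demanded. *)
Definition partial (M : R) (Y : nat -> R) (st : nat -> nat -> nat) (it0 : nat) : Prop :=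
  [/\ st Q 0 = 0, forall it p, st it p < D,
      forall p, p <= Q - it0 -> demanded M Y (ver it0 p + st it0 p) &
      forall it, it0 <= it < Q -> let q := Q - it in
        [/\ valid q (st it (par q)) (st it q),
            st it.+1 (par q) = after q (st it (par q)) (st it q),
            forall p, p < q -> p != par q -> st it.+1 p = st it p &
            (0 < Y (vop it (st it (par q)) (st it q)))%R]].

Lemma verQ : ver Q 0 = last_row.
Proof.
rewrite /last_row; have E := prednK Q0; rewrite -{1}E /= ifT //.
have : par (Q - Q.-1) < Q - Q.-1 by apply: par_lt; lia.
have -> : Q - Q.-1 = 1 by lia.
by case: (par 1).
Qed.

Lemma partial_init M Y : flow M Y -> (0 < M)%R -> partial M Y (fun _ _ => 0) Q.
Proof.
move=> fl M0; split=> // [p|it]; last by lia.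
rewrite subnn leqn0 => /eqP->; rewrite addn0 verQ /demanded eqxx mul1r ltr_wpDl //.
by apply: opsum_ge0 => *; rewrite mulr_ge0 ?addr_ge0 ?ler0n // (flow_op fl).
Qed.

Lemma partial_ex M Y st it : flow M Y -> partial M Y st it.+1 -> it < Q ->
  exists x a, [/\ x < D, a < D, valid (Q - it) x a, after (Q - it) x a = st it.+1 (par (Q - it))
                & (0 < Y (vop it x a))%R].
Proof.
move=> fl [_ stD dm _] iQ; apply: (demanded_op fl) => //.
have [_ _ pq _] := qP iQ.
have := dm (par (Q - it)); rewrite /= eqxx; apply; lia.
Qed.

Lemma partial_step M Y st it x a : flow M Y -> (0 <= M)%R -> partial M Y st it.+1 -> it < Q ->
  x < D -> a < D -> valid (Q - it) x a -> after (Q - it) x a = st it.+1 (par (Q - it)) ->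
  (0 < Y (vop it x a))%R ->
  partial M Y (fun it' p => if it' == it then
      if p == Q - it then a else if p == par (Q - it) then x else st it.+1 p
    else st it' p) it.
Proof.
move=> fl M0 [st0 stD dm ok] iQ xD aD V Ez Y0; have [q0 qQ pq _] := qP iQ.
have nq : (par (Q - it) == Q - it) = false by rewrite ltn_eqF.
have [d1 d2] := op_demands fl M0 iQ xD aD V Y0.
split=> [|it' p|p pl|it' /andP[l1 l2] /=].
- by rewrite ifN // gtn_eqF.
- by case: ifP => // _; case: ifP => // _; case: ifP.
- rewrite eqxx; case: eqP => [->//|ne]; case: eqP => [->//|ne2].
  by have := dm p; rewrite /= (introF eqP ne2); apply; lia.
case: (it' =P it) => [->|ne].
  by rewrite !eqxx nq (gtn_eqF (ltnSn it)); split=> // p pl /negPf->; rewrite (ltn_eqF pl).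
rewrite gtn_eqF; last by lia.
by apply: ok; lia.
Qed.

Lemma partial_sel M Y st : flow M Y -> partial M Y st 0 ->
  selection st /\ forall v, n <= v -> sel_vec st v != 0%R -> (0 < Y v)%R.
Proof.
move=> fl [st0 stD dm ok].
have ini q : q <= Q -> initok q (st 0 q) /\ (0 < Y (vg q (st 0 q)))%R.
  by move=> qQ; apply: (demanded_init fl qQ (stD _ _)); apply: dm; rewrite subn0.
split.
  split=> // [q /ini[]//|it iQ q]; have [//|? ? ? _] := ok it.
  by split.
move=> v nv; rewrite /sel_vec pnatr_eq0 eqb0 negbK.
case/orP=> [/orP[/exists_inP[i _ /eqP E]|/existsP[it /eqP->]]|/existsP[q /eqP->]].
- by move: nv; rewrite -E leqNgt ltn_ord.
- by have [|_ _ _] := ok it; first by rewrite ltn_ord.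
- by apply: (ini q _).2; rewrite -ltnS.
Qed.

Lemma flow_selection M Y : flow M Y -> (0 < M)%R ->
  exists2 st, selection st & forall v, n <= v -> sel_vec st v != 0%R -> (0 < Y v)%R.
Proof.
move=> fl M0.
have H k : k <= Q -> exists st, partial M Y st (Q - k).
  elim: k => [|k IH] kQ; first by exists (fun _ _ => 0); rewrite subn0; apply: partial_init.
  have iQ : Q - k.+1 < Q by lia.
  have [st pst] := IH (ltnW kQ); rewrite -subSS (subSn kQ) in pst.
  have [x [a [xD aD V E Y0]]] := partial_ex fl pst iQ.
  by eexists; apply: (partial_step fl (ltW M0) pst iQ xD aD V E Y0).
have [st] := H Q (leqnn Q); rewrite subnn => /(partial_sel fl)[? ?].
by exists st.
Qed.

(** ** The projection of the flow polyhedron *)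

(** Merges up to [it] use table versions that lie strictly below the rows of merge [it]. *)
Lemma later_consumption Y it z : z < D ->
  (forall it' x a, it < it' < Q -> x < D -> a < D -> valid (Q - it') x a -> Y (vop it' x a) = 0%R) ->
  consumption Y (orow it + z) = 0%R.
Proof.
move=> zD H; apply: opsum0 => it' x a iQ xD aD V; have [_ ? _ ?] := qP iQ.
case: (ltnP it it') => [l|l]; first by rewrite H ?mulr0 ?l.
have lt p y : p <= Q -> y < D -> ver it' p + y < orow it + z.
  move=> pQ yD; apply: leq_trans (ver_lt (ltnW iQ) pQ yD) _.
  by apply: leq_trans (leq_addr _ _); rewrite leq_mul2r leq_add2l l orbT.
by rewrite !ltn_eqF ?addr0 ?mul0r // lt.
Qed.

Lemma flow_ge0 M Y : flow M Y -> (0 <= M)%R.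
Proof.
move=> fl; have lr : last_row < RB by have := @orow_lt Q.-1 0; rewrite addn0; apply=> //; lia.
have := balance fl lr; rewrite eqxx mul1r.
have -> : consumption Y last_row = 0%R.
  by rewrite -[last_row]addn0 later_consumption // => it' x a; lia.
rewrite add0r => <-; apply: addr_ge0.
  by apply: opsum_ge0 => *; rewrite mulr_ge0 ?ler0n // (flow_op fl).
by apply: initsum_ge0 => *; rewrite mulr_ge0 ?ler0n // (flow_g fl).
Qed.

(** Induction from the last merge backwards: when later merges carry nothing, the product of this
    one has no consumer, and nothing is delivered at the root. *)
Lemma flow0 Y it x a : flow 0%R Y -> it < Q -> x < D -> a < D -> valid (Q - it) x a ->
  Y (vop it x a) = 0%R.
Proof.
move=> fl; have [k] := ubnP (Q - it); elim: k => // k IH in it x a * => lk iQ xD aD V.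
have := balance fl (orow_lt iQ (after_lt (Q - it) x a)).
rewrite later_consumption // => [|it' x' a' /andP[l1 l2] xD' aD' V']; last by apply: IH => //; lia.
rewrite mulr0 addr0 => E; apply/eqP; rewrite eq_le (flow_op fl) // andbT leNgt; apply/negP => Y0.
suff : (0 < supply Y (orow it + after (Q - it) x a))%R by rewrite E ltxx.
apply: ltr_wpDr; first by apply: initsum_ge0 => *; rewrite mulr_ge0 ?ler0n // (flow_g fl).
apply: (opsum_gt0 (it := it) (x := x) (a := a)) => // [*|].
  by rewrite mulr_ge0 ?ler0n // (flow_op fl).
by rewrite eqxx mul1r.
Qed.

Lemma flow0_seed Y (i : 'I_n) : flow 0%R Y -> Y i = 0%R.
Proof. by move=> fl; rewrite (seed_row _ fl); apply: opsum0 => *; rewrite flow0 ?mulr0. Qed.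

Lemma lhsD r c Y Z : lhs r (fun v => Y v + c * Z v)%R = (lhs r Y + c * lhs r Z)%R.
Proof.
rewrite /lhs !mulrDr.
rewrite -/(opsum (fun it x a => wop it x a r * Y (vop it x a))%R).
rewrite -/(opsum (fun it x a => wop it x a r * Z (vop it x a))%R).
rewrite -/(opsum (fun it x a => wop it x a r * (Y (vop it x a) + c * Z (vop it x a)))%R).
have -> : opsum (fun it x a => wop it x a r * (Y (vop it x a) + c * Z (vop it x a)))%R =
  (opsum (fun it x a => wop it x a r * Y (vop it x a)) +
   c * opsum (fun it x a => wop it x a r * Z (vop it x a)))%R.
  by rewrite -opsumD; apply: opsum_eq => *; ring.
have -> : (\sum_(i < n) (RB + i == r)%N%:R * (Y i + c * Z i) =
  \sum_(i < n) (RB + i == r)%N%:R * Y i + c * \sum_(i < n) (RB + i == r)%N%:R * Z i)%R.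
  by rewrite mulr_sumr -big_split; apply: eq_bigr => i _ /=; ring.
have -> : (\sum_(q < Q.+1) \sum_(x < D | initok q x) (q * D + x == r)%N%:R * (Y (vg q x) + c * Z (vg q x)) =
  \sum_(q < Q.+1) \sum_(x < D | initok q x) (q * D + x == r)%N%:R * Y (vg q x) +
  c * \sum_(q < Q.+1) \sum_(x < D | initok q x) (q * D + x == r)%N%:R * Z (vg q x))%R.
  rewrite mulr_sumr -big_split; apply: eq_bigr => q _ /=.
  by rewrite mulr_sumr -big_split; apply: eq_bigr => x _ /=; ring.
by ring.
Qed.

(** The amount [e] is the least value of [Y] on the support of the selection, seed variables
    excluded. These need no minimum: by [seed_row] they are nonnegative combinations of operation
    variables, so they stay nonnegative when the latter do. *)
Lemma peel M Y st : flow M Y -> selection st ->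
  (forall v, n <= v -> sel_vec st v != 0%R -> (0 < Y v)%R) ->
  exists2 e, (0 < e)%R & flow (M - e)%R (fun v => Y v + (- e) * sel_vec st v)%R /\
    exists2 v, n <= v < NV & (0 < Y v)%R /\ (Y v + (- e) * sel_vec st v = 0)%R.
Proof.
move=> fl sel sup.
pose P := [pred v : 'I_NV | (n <= v) && (sel_vec st v != 0%R)].
have [_ stD _ _] := sel.
(* The minimum is over a nonempty set: the variable of the initial root entry belongs to it. *)
have g0 : vg 0 (st 0 0) < NV by case/andP: (@vg_lt 0 (st 0 0) (leq0n _) (stD _ _)).
have P0 : P (Ordinal g0).
  by rewrite /P inE /= leq_addr /= sel_vec_g // eqxx oner_neq0.
have [v Pv mv] := arg_minP (fun v : 'I_NV => Y v) P0.
have {Pv} /andP[nv Zv] := Pv.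
have Z1 u : sel_vec st u != 0%R -> sel_vec st u = 1%R.
  by rewrite /sel_vec; case: (_ || _); rewrite ?eqxx.
exists (Y v); first exact: sup.
have rows r : r < RB + n ->
    lhs r (fun v' => Y v' + (- Y v) * sel_vec st v')%R = ((r == last_row)%:R * (M - Y v))%R.
  by move=> rR; rewrite lhsD (fl.2 r) // ((sel_flow sel).2 r) //; ring.
have pos u : n <= u < NV -> (0 <= Y u + (- Y v) * sel_vec st u)%R.
  move=> /andP[nu uN]; have [E|ne] := eqVneq (sel_vec st u) 0%R.
    by rewrite E mulr0 addr0; apply: fl.1.
  by rewrite (Z1 _ ne) mulr1 subr_ge0; apply: (mv (Ordinal uN)); rewrite /P inE /= nu.
split; last first.
  exists v; rewrite ?nv ?ltn_ord //; split; first exact: sup.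
  by rewrite (Z1 _ Zv) mulr1 addrN.
split=> // u uN; case: (leqP n u) => [nu|un]; first by rewrite pos ?nu.
have Es := @seed_row 1 _ (Ordinal un) (sel_flow sel); rewrite /= in Es.
have Ey := @seed_row M _ (Ordinal un) fl; rewrite /= in Ey.
rewrite Es Ey -opsumD; apply: opsum_ge0 => it x a iQ xD aD V.
rewrite mulrCA -mulrDr mulr_ge0 ?ler0n // pos //.
have /andP[l1 l2] := vop_lt iQ xD aD.
by rewrite l1 (leq_trans l2) // leq_add2l leq_addr.
Qed.

Variable feas : {set 'I_n} -> Prop.
Hypothesis sel_feas : forall st, selection st -> feas (sel_seeds st).

Lemma flow_hull M Y : flow M Y ->
  exists lam : {set 'I_n} -> R,
    [/\ forall S, (0 <= lam S)%R, forall S, lam S != 0%R -> feas S, (\sum_S lam S)%R = M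
      & forall i : 'I_n, Y i = (\sum_(S : {set 'I_n} | i \in S) lam S)%R].
Proof.
have [k] := ubnP #|[set v : 'I_NV | (n <= v) && (0 < Y v)%R]|.
elim: k => // k IH in M Y * => lk fl.
have := flow_ge0 fl; rewrite le_eqVlt => /orP[/eqP M0|M0].
  (* At [M = 0] variables that occur in no row may still be positive; only the seed variables have
     to vanish. *)
  exists (fun=> 0%R); split=> // [S|| i]; rewrite ?eqxx ?big1 //.
  by apply: flow0_seed; rewrite M0.
have [st sel sup] := flow_selection fl M0.
have [e e0 [fl' [v /andP[nv vN] [Yv Yv']]]] := peel fl sel sup.
have [|lam [l0 lf ls li]] := IH _ _ _ fl'.
  rewrite ltnS in lk; apply: leq_trans _ lk; apply: proper_card; apply/properP; split.
    apply/subsetP => u; rewrite !inE => /andP[-> /=]; move/lt_le_trans; apply.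
    by rewrite gerDl mulNr oppr_le0 mulr_ge0 ?sel_vec_ge0 // ltW.
  by exists (Ordinal vN); rewrite inE /= nv // Yv' ltxx.
exists (fun S => lam S + e * (S == sel_seeds st)%:R)%R; split=> [S|S|| i].
- by rewrite addr_ge0 // mulr_ge0 ?ler0n // ltW.
- have [->|_] := eqVneq S (sel_seeds st); first by move=> _; apply: sel_feas.
  by rewrite mulr0 addr0; apply: lf.
- rewrite big_split /= ls (bigD1 (sel_seeds st)) //= eqxx mulr1 big1 ?addr0 ?subrK //.
  by move=> S /negPf->; rewrite mulr0.
rewrite big_split /= -li sel_vec_seed // mulNr -addrA -[LHS]addr0; congr (_ + _)%R.
apply/esym/eqP; rewrite addrC subr_eq0; apply/eqP.
case: (boolP (i \in sel_seeds st)) => [iS|iS].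
  by rewrite (bigD1 (sel_seeds st)) //= eqxx big1 ?addr0 // => S /andP[_ /negPf->]; rewrite mulr0.
rewrite mulr0 big1 // => S iS'; case: eqP => [E|]; last by rewrite mulr0.
by rewrite E (negPf iS) in iS'.
Qed.

Hypothesis feas_sel : forall S, feas S -> exists2 st, selection st & sel_seeds st = S.

Lemma flow_project (x : 'I_n -> R) :
  (exists2 Y, flow 1%R Y & forall i : 'I_n, Y i = x i) <->
  exists lam : {set 'I_n} -> R,
    [/\ forall S, (0 <= lam S)%R, forall S, lam S != 0%R -> feas S, (\sum_S lam S)%R = 1%R
      & forall i : 'I_n, x i = (\sum_(S : {set 'I_n} | i \in S) lam S)%R].
Proof.
split=> [[Y fl Yx]|[lam [l0 lf ls li]]].
  have [lam [? ? ? H]] := flow_hull fl; exists lam; split=> // i; by rewrite -Yx H.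
(* Only feasible sets have selections; a set of weight 0 receives a dummy so that choice applies to
   all sets. *)
have ch S : exists st, lam S != 0%R -> selection st /\ sel_seeds st = S.
  have [_|ne] := eqVneq (lam S) 0%R; first by exists (fun _ _ => 0).
  by have [st ? ?] := feas_sel (lf _ ne); exists st.
have {ch} [st stP] := choice ch.
exists (fun v => \sum_S lam S * sel_vec (st S) v)%R; last first.
  move=> i; rewrite li [RHS]big_mkcond; apply: eq_bigr => S _.
  have [->|ne] := eqVneq (lam S) 0%R; first by rewrite mul0r; case: ifP.
  have [s E] := stP S ne; rewrite sel_vec_seed // E.
  by case: ifP; rewrite ?mulr1 ?mulr0.
split=> [v _|r rR]; first by apply: sumr_ge0 => S _; rewrite mulr_ge0 ?sel_vec_ge0.
have H s : lhs r (fun v => \sum_(S <- s) lam S * sel_vec (st S) v)%R =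
    (\sum_(S <- s) lam S * (r == last_row)%:R)%R.
  elim: s => [|S s IH].
    rewrite big_nil; transitivity (lhs r (fun v => 0 + (-1) * 0)%R).
      congr lhs; apply/funext => v; by rewrite big_nil mulr0 addr0.
    by rewrite lhsD mulN1r subrr.
  rewrite big_cons -IH.
  transitivity (lhs r (fun v => (\sum_(S <- s) lam S * sel_vec (st S) v) + lam S * sel_vec (st S) v)%R).
    congr lhs; apply/funext => v; by rewrite big_cons addrC.
  rewrite lhsD addrC; congr (_ + _)%R.
  have [->|ne] := eqVneq (lam S) 0%R; first by rewrite !mul0r.
  have [s' _] := stP S ne; rewrite ((sel_flow s').2 r) // ?mulr1 //.
by rewrite H -mulr_suml ls mulr1 mul1r.
Qed.

(* Peeling the selection off an optimal point leaves a nonnegative combination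
   of feasible sets, so no selection in its support can exceed the average. *)
Lemma flow_optimal (w : 'I_n -> R) Y st : flow 1%R Y -> selection st ->
  (forall v, n <= v -> sel_vec st v != 0%R -> (0 < Y v)%R) ->
  (forall Y', flow 1%R Y' -> \sum_(i < n) w i * Y i <= \sum_(i < n) w i * Y' i)%R ->
  forall S, feas S -> (\sum_(i in sel_seeds st) w i <= \sum_(i in S) w i)%R.
Proof.
move=> fl sel sup opt.
have selw st' : selection st' ->
    (\sum_(i < n) w i * sel_vec st' i)%R = (\sum_(i in sel_seeds st') w i)%R.
  move=> s'; rewrite [RHS]big_mkcond; apply: eq_bigr => i _; rewrite sel_vec_seed //.
  by case: ifP; rewrite ?mulr1 ?mulr0.
have lower S : feas S -> (\sum_(i < n) w i * Y i <= \sum_(i in S) w i)%R.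
  by case/feas_sel => st' s' <-; rewrite -selw //; apply/opt/sel_flow.
move=> S fS; apply: le_trans (lower S fS).
have [e e0 [fl' _]] := peel fl sel sup.
have [lam [l0 lf ls li]] := flow_hull fl'.
have E : (\sum_(i < n) w i * Y i =
    e * (\sum_(i in sel_seeds st) w i) + \sum_(S : {set 'I_n}) lam S * \sum_(i in S) w i)%R.
  rewrite -selw // mulr_sumr; apply/eqP; rewrite addrC -subr_eq -sumrB; apply/eqP.
  rewrite (eq_bigr (fun i => \sum_(S : {set 'I_n}) (i \in S)%:R * (lam S * w i))%R); last first.
    move=> i _; rewrite mulrCA -mulrBr -mulNr li mulr_sumr [LHS]big_mkcond; apply: eq_bigr => S' _.
    by case: ifP; rewrite ?mul1r ?mul0r // mulrC.
  rewrite exchange_big; apply: eq_bigr => S' _; rewrite mulr_sumr [RHS]big_mkcond.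
  by apply: eq_bigr => i _; case: ifP; rewrite ?mul1r ?mul0r.
have : (\sum_(S : {set 'I_n}) lam S * (\sum_(i < n) w i * Y i) <=
    \sum_(S : {set 'I_n}) lam S * \sum_(i in S) w i)%R.
  apply: ler_sum => S' _; have [->|ne] := eqVneq (lam S') 0%R; first by rewrite !mul0r.
  by rewrite ler_wpM2l // lower //; apply: lf.
rewrite -mulr_suml ls => le.
rewrite -(ler_pM2l e0); lra.
Qed.

End Hyperflow.

(** * Tables of activation orders *)

(* A code lists in base [b], for every colour [c < K], the rank of the node of
   colour [c] (digit [c]), its seed mark (digit [K + c]) and the benefit it has
   been promised so far, truncated at [b - 1] (digit [2 K + c]). *)
Section Codes.
Variables (K b : nat) (vn : nat -> nat -> nat) (par thr : nat -> nat).
Variables (rv : nat -> nat -> nat) (cst : nat -> nat).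

Definition rankd x c := digit_of b c x.
Definition seedd x c := digit_of b (K + c) x.
Definition accd x c := digit_of b (2 * K + c) x.

Definition shared q c := (vn q c != 0) && (vn (par q) c == vn q c).

(** Ranks are compared through the strict order alone, because the same node may have different
    numbers of predecessors in different items. A node that does not continue to the parent has seen
    all items that contain it, so it must be marked or have collected its cost by now. *)
Definition valid q x a := [forall c : 'I_K, (vn q c != 0) ==>
  if vn (par q) c == vn q c then
    (seedd x c == seedd a c) && [forall d : 'I_K, shared q d ==>
      ((rankd x c < rankd x d) == (rankd a c < rankd a d))]
  else (seedd a c != 0) || (cst (vn q c).-1 <= accd a c)].

Definition after_digit q x a d :=
  if (2 * K <= d) && shared q (d - 2 * K)
  then minn b.-1 (digit_of b d x + digit_of b d a) else digit_of b d x.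

Definition after q x a := enc b (after_digit q x a) (3 * K).

Definition preds q x c := #|[set d : 'I_K | (vn q d != 0) && (rankd x d < rankd x c)]|.

Definition promise q x c := if thr q - 1 <= preds q x c then rv q c else 0.

(** Only an upper bound, since claiming less than is due does no harm to soundness; in particular
    the digit may be truncated. *)
Definition initok q x := [forall c : 'I_K, accd x c <= promise q x c].

Lemma after_digit_lt q x a d : 0 < b -> after_digit q x a d < b.
Proof.
move=> b0; rewrite /after_digit; case: ifP => _; last exact: dig_lt.
by apply: (@leq_ltn_trans b.-1); rewrite ?geq_minl // ltn_predL.
Qed.

Lemma after_lt q x a : 0 < b -> after q x a < b ^ (3 * K).
Proof. by move=> b0; apply: enc_lt => c _; apply: after_digit_lt. Qed.

Lemma rank_after q x a c : 0 < b -> c < K -> rankd (after q x a) c = rankd x c.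
Proof.
move=> b0 cK; rewrite /rankd dig_enc => [|d _|]; [|exact: after_digit_lt|by lia].
by rewrite /after_digit ifF //; apply/negbTE/nandP; left; lia.
Qed.

Lemma seed_after q x a c : 0 < b -> c < K -> seedd (after q x a) c = seedd x c.
Proof.
move=> b0 cK; rewrite /seedd dig_enc => [|d _|]; [|exact: after_digit_lt|by lia].
by rewrite /after_digit ifF //; apply/negbTE/nandP; left; lia.
Qed.

Lemma acc_after q x a c : 0 < b -> c < K -> accd (after q x a) c =
  if shared q c then minn b.-1 (accd x c + accd a c) else accd x c.
Proof.
move=> b0 cK; rewrite /accd dig_enc => [|d _|]; [|exact: after_digit_lt|by lia].
by rewrite /after_digit leq_addr addKn.
Qed.

End Codes.

(** * Monotonicity and stabilisation of the activation process *)

Section Activation.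
Variables (R : realType) (I : instance R).
Local Notation n := (nodes I).

Lemma activation_sub (S : {set 'I_n}) t t' : t <= t' -> activation S t \subset activation S t'.
Proof.
move/subnKC <-; elim: (t' - t) => [|d IH]; first by rewrite addn0.
by rewrite addnS; apply: (subset_trans IH); apply: subsetUl.
Qed.

Lemma activation_stable (S : {set 'I_n}) :
  exists t, activation_step (activation S t) = activation S t.
Proof.
apply: contrapT => H.
suff h t : t <= #|activation S t| by have := leq_trans (h n.+1) (max_card _); rewrite card_ord ltnn.
elim: t => // t IH; apply: leq_ltn_trans IH _; apply: proper_card.
rewrite properEneq (activation_sub _ (leqnSn t)) andbT; apply/eqP => E.
by apply: H; exists t; rewrite [RHS]E.
Qed.

Lemma activation_stays (S : {set 'I_n}) t t' :
  activation_step (activation S t) = activation S t -> t <= t' -> activation S t' = activation S t.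
Proof.
move=> E /subnKC <-; elim: (t' - t) => [|d IH]; first by rewrite addn0.
by rewrite addnS; rewrite -[LHS]/(activation_step (activation S (t + d))) IH.
Qed.

End Activation.

Lemma sum_shift a m (F : nat -> nat) : \sum_(a <= p < a + m) F p = \sum_(j < m) F (a + j).
Proof. by rewrite -{1}[a]add0n big_addn addKn big_mkord; apply: eq_bigr => j _; rewrite addnC. Qed.

(** * Selections and feasible seed sets *)

Section Items.
Variables (R : realType) (I : instance R).
Local Notation n := (nodes I).
Local Notation m := (edges I).
Variables (K b N : nat) (vn : nat -> nat -> nat) (par thr : nat -> nat) (rv : nat -> nat -> nat).
Variables (cst : nat -> nat) (V : nat -> {set 'I_n}) (col : 'I_n -> nat) (birth : 'I_n -> nat).
Let Q := N + m.
Hypothesis b0 : 0 < b.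
Hypothesis colK : forall u, col u < K.
Hypothesis vnV : forall q u, q <= Q -> u \in V q -> vn q (col u) = u.+1.
Hypothesis Vvn : forall q c, q <= Q -> vn q c != 0 -> exists2 u, u \in V q & col u = c /\ vn q c = u.+1.
Hypothesis V0 : V 0 = set0.
Hypothesis par_lt : forall q, 0 < q <= Q -> par q < q.
Hypothesis birthV : forall i, i \in V (birth i).
Hypothesis birthQ : forall i, birth i <= Q.
Hypothesis birth_min : forall q i, q <= Q -> i \in V q -> birth i <= q.
Hypothesis V_par : forall q i, q <= Q -> i \in V q -> birth i != q -> i \in V (par q).
Hypothesis V_edge : forall j : 'I_m, V (N.+1 + j) = edge I j.
Hypothesis thr_edge : forall j : 'I_m, thr (N.+1 + j) = threshold j.
Hypothesis rv_edge : forall (j : 'I_m) i, i \in edge I j -> rv (N.+1 + j) (col i) = benefit j i.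
Hypothesis rv_bag : forall q c, q <= N -> rv q c = 0.
Hypothesis cstE : forall i : 'I_n, cst i = cost i.

Local Notation valid := (valid K b vn par cst).
Local Notation after := (after K b vn par).
Local Notation initok := (initok K b vn thr rv).
Local Notation rank := (rankd b).
Local Notation sd := (seedd K b).
Local Notation acc := (accd K b).
Local Notation shared := (shared vn par).
Local Notation preds := (preds K b vn).
Local Notation promise := (promise K b vn thr rv).
Local Notation D := (b ^ (3 * K)).
Local Notation sdf := (fun a (i : 'I_n) => sd a (col i) != 0).
Local Notation selection := (selection Q D par valid after initok).
Local Notation sel_seeds := (sel_seeds Q birth sdf).

Lemma birth_pos i : 0 < birth i.
Proof. by have := birthV i; case: (birth i) => //; rewrite V0 inE. Qed.

Lemma edge_item (j : 'I_m) : N.+1 + j <= Q.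
Proof. by rewrite addSn /Q ltn_add2l. Qed.

Lemma col_inj q u v : q <= Q -> u \in V q -> v \in V q -> col u = col v -> u = v.
Proof. by move=> qQ /(vnV qQ) eu /(vnV qQ) ev E; apply/val_inj; move: ev; rewrite -E eu => -[]. Qed.

Lemma shared_in q u : 0 < q <= Q -> u \in V q -> shared q (col u) = (u \in V (par q)).
Proof.
move=> /andP[q0 qQ] uV; have pQ : par q <= Q by rewrite (leq_trans (ltnW (par_lt _))) // q0.
rewrite /shared (vnV qQ uV) /=; apply/eqP/idP => [E|/(vnV pQ)//].
have [|w wV [ew E']] := @Vvn (par q) (col u) pQ; first by rewrite E.
by suff -> : u = w by []; apply/val_inj; move: E'; rewrite E => -[].
Qed.

Lemma shared_notin q u : 0 < q <= Q -> u \notin V q -> u \in V (par q) -> shared q (col u) = false.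
Proof.
move=> /andP[q0 qQ] uV uP; have pQ : par q <= Q by rewrite (leq_trans (ltnW (par_lt _))) // q0.
apply/negbTE/negP => /andP[nz /eqP E]; have [w wV [ew E']] := Vvn qQ nz.
move: E; rewrite E' (vnV pQ uP) => -[/val_inj E]; by rewrite E wV in uV.
Qed.

Lemma predsE q x i : q <= Q ->
  preds q x (col i) = #|[set u in V q | rank x (col u) < rank x (col i)]|.
Proof.
move=> qQ; pose co u : 'I_K := Ordinal (colK u).
rewrite -(card_in_imset (f := co)) => [|u v]; last first.
  by rewrite !inE => /andP[uV _] /andP[vV _] /(congr1 val) /=; apply: col_inj vV.
apply: eq_card => d; rewrite inE; apply/idP/imsetP => [/andP[nz lt]|[u]].
  have [u uV [eu _]] := Vvn qQ nz; exists u; last by apply/val_inj.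
  by rewrite inE uV eu.
by rewrite inE => /andP[uV lt] -> /=; rewrite (vnV qQ uV).
Qed.

Section Soundness.
Variable st : nat -> nat -> nat.
Hypothesis sel : selection st.
Let cur q := st (Q - q) q.

(** Merges change accumulated benefits only, so the order and the marks of an item are those it
    started with. *)
Lemma fixed_digits it p : p <= Q -> it <= Q - p -> forall c, c < K ->
  rank (st it p) c = rank (st 0 p) c /\ sd (st it p) c = sd (st 0 p) c.
Proof.
have [_ _ _ stp] := sel; move=> pQ; elim: it => [|it IH] ip c cK //.
have iQ : it < Q by lia.
have [_ Ea Eo] := stp it iQ.
have [<- <-] := IH (ltnW ip) c cK.
have [->|ne] := eqVneq p (par (Q - it)); first by rewrite Ea rank_after ?seed_after.
by rewrite Eo //; lia.
Qed.

Lemma sel_agree q i : 0 < q <= Q -> i \in V q -> i \in V (par q) ->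
  sd (cur q) (col i) = sd (cur (par q)) (col i) /\
  forall j, j \in V q -> j \in V (par q) ->
    (rank (cur q) (col i) < rank (cur q) (col j)) =
    (rank (cur (par q)) (col i) < rank (cur (par q)) (col j)).
Proof.
move=> qq iq ip; have /andP[q0 qQ] := qq; have pq := par_lt qq.
have [_ _ _ /(_ (Q - q))] := sel; rewrite subKn // => /(_ ltac:(lia))[vl _ _].
have fx u : rank (st (Q - q) (par q)) (col u) = rank (cur (par q)) (col u) /\
            sd (st (Q - q) (par q)) (col u) = sd (cur (par q)) (col u).
  have [-> ->] := fixed_digits (ltac:(lia) : par q <= Q) (ltac:(lia) : Q - q <= Q - par q) (colK u).
  by have [-> ->] := fixed_digits (ltac:(lia) : par q <= Q) (leqnn _) (colK u).
have sh j : j \in V q -> j \in V (par q) -> shared q (col j) by move=> jq jp; rewrite shared_in.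
have := forallP vl (Ordinal (colK i)); have /andP[nz e] := sh i iq ip.
rewrite /= nz e /= => /andP[/eqP e1 /forallP e2]; split.
  by rewrite -(fx i).2 e1.
move=> j jq jp; have /eqP := implyP (e2 (Ordinal (colK j))) (sh j jq jp).
by rewrite /= (fx i).1 (fx j).1 => ->.
Qed.

(** In its birth item a node is not shared with the parent, as the parent is an earlier item, so the
    final check of [valid] applies. *)
Lemma sel_birth i : i \in sel_seeds st \/ cost i <= acc (cur (birth i)) (col i).
Proof.
have q0 := birth_pos i; have qQ := birthQ i.
have [_ _ _ /(_ (Q - birth i))] := sel; rewrite subKn // => /(_ ltac:(lia))[vl _ _].
have := forallP vl (Ordinal (colK i)); rewrite /= (vnV qQ (birthV i)) /=.
case: ifP => [E|_].
  have iP : i \in V (par (birth i)).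
    by rewrite -shared_in ?q0 ?birthV // /shared (vnV qQ (birthV i)) E.
  have pl := par_lt (ltac:(by rewrite q0) : 0 < birth i <= Q).
  by have := birth_min (leq_trans (ltnW pl) qQ) iP; rewrite leqNgt pl.
by case/orP=> h; [left; rewrite inE | right; rewrite -cstE].
Qed.

Let Phi i it := \sum_(p < Q.+1 | (p <= Q - it) && (i \in V p)) acc (st it p) (col i).

(* Merging moves promised benefits to the parent and can only lose some. *)
Lemma Phi_dec i it : it <= Q - birth i -> Phi i it <= Phi i 0.
Proof.
elim: it => // it IH lt; apply: leq_trans (IH (ltnW lt)).
have b1 := birth_pos i.
have iQ : it < Q by lia.
have [q0 qQ pq pQ] := qP par_lt iQ.
have [_ _ _ stp] := sel; have [_ Ea Eo] := stp it iQ.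
have qS : Q - it < Q.+1 by lia.
have pS : par (Q - it) < Q.+1 by lia.
have bq : birth i != Q - it by apply/eqP; lia.
have qq : 0 < Q - it <= Q by rewrite q0.
case: (boolP (i \in V (Q - it))) => [iV|iV].
  have iP := V_par qQ iV bq.
  rewrite /Phi [X in _ <= X](bigD1 (Ordinal qS)) /=; last by rewrite leqnn.
  rewrite [X in _ <= _ + X](bigD1 (Ordinal pS)) /=; last first.
    by rewrite iP -val_eqE /= ltn_eqF // ltnW.
  rewrite (bigD1 (Ordinal pS)) /=; last by rewrite iP andbT subnS -ltnS prednK.
  rewrite Ea acc_after // shared_in // iP addnA leq_add //; first by rewrite addnC geq_minr.
  rewrite leq_eqVlt; apply/orP; left; apply/eqP.
  have E (p : 'I_Q.+1) : ((p <= Q - it.+1) && (i \in V p)) && (p != Ordinal pS) =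
     (((p <= Q - it) && (i \in V p)) && (p != Ordinal qS)) && (p != Ordinal pS).
    by rewrite -!val_eqE /=; case: (i \in V p); rewrite ?andbF // !andbT; congr (_ && _); lia.
  rewrite (eq_bigl _ _ E); apply: eq_bigr => p /andP[/andP[/andP[l1 _] n1] n2].
  by rewrite -!val_eqE /= in n1 n2; rewrite Eo //; lia.
rewrite /Phi leq_eqVlt; apply/orP; left; apply/eqP.
have E (p : 'I_Q.+1) : ((p <= Q - it.+1) && (i \in V p)) = ((p <= Q - it) && (i \in V p)).
  case: (nat_of_ord p =P Q - it) => [->|ne]; first by rewrite (negPf iV) !andbF.
  by congr (_ && _); lia.
rewrite (eq_bigl _ _ E); apply: eq_bigr => p /andP[l1 iVp].
have pl : p < Q - it by rewrite ltn_neqAle l1 andbT; apply: contra iV => /eqP <-.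
case: (nat_of_ord p =P par (Q - it)) => [Ep|/eqP ne]; last by rewrite Eo.
by rewrite Ep Ea acc_after // shared_notin // -Ep.
Qed.

(** What has arrived at the birth item is bounded by what all items promised initially. Bags promise
    nothing, and a hyperedge pays only when enough of its members precede [i]. *)
Lemma sel_benefit i : i \notin sel_seeds st ->
  cost i <= \sum_(j : 'I_m | (i \in edge I j) &&
     (threshold j - 1 <= #|[set u in edge I j | rank (cur (N.+1 + j)) (col u) < rank (cur (N.+1 + j)) (col i)]|))
     benefit j i.
Proof.
move=> ns; have [|le] := sel_birth i; first by rewrite (negPf ns).
have q0 := birth_pos i; have qQ := birthQ i.
apply: (leq_trans le); apply: (@leq_trans (Phi i (Q - birth i))).
  have bS : birth i < Q.+1 by [].
  by rewrite /Phi (bigD1 (Ordinal bS)) /= ?birthV ?subKn ?leqnn // /cur leq_addr.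
apply: (leq_trans (Phi_dec (leqnn _))).
have [_ _ ini _] := sel.
have bound (p : 'I_Q.+1) : i \in V p -> acc (st 0 p) (col i) <= promise p (st 0 p) (col i).
  by move=> _; apply: (forallP (ini p _) (Ordinal (colK i))); rewrite -ltnS.
rewrite /Phi; apply: (@leq_trans (\sum_(p < Q.+1 | i \in V p) promise p (st 0 p) (col i))).
  rewrite (eq_bigl (fun p : 'I_Q.+1 => i \in V p)) => [|p]; last by rewrite subn0 -ltnS ltn_ord.
  by apply: leq_sum => p ip; apply: bound.
have ES : Q.+1 = N.+1 + m by rewrite addSn.
rewrite (big_mkcond (fun p : 'I_Q.+1 => i \in V p)) /=.
rewrite -(big_mkord xpredT (fun p => if i \in V p then promise p (st 0 p) (col i) else 0)).
rewrite ES (@big_cat_nat _ _ _ N.+1) //= ?leq_addr // big_nat_cond big1 ?add0n; last first.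
  by move=> p /andP[/andP[_ pN] _]; rewrite /promise rv_bag // !if_same.
rewrite sum_shift [X in _ <= X]big_mkcond.
apply: leq_sum => j _; rewrite V_edge; case: (boolP (i \in edge I j)) => //= iE.
have jQ := edge_item j.
have iV : i \in V (N.+1 + j) by rewrite V_edge.
rewrite /promise thr_edge rv_edge // predsE // V_edge.
have e u : rank (cur (N.+1 + j)) (col u) = rank (st 0 (N.+1 + j)) (col u).
  by have [] := fixed_digits jQ (leqnn _) (colK u).
rewrite (eq_card (B := mem [set u in edge I j | rank (cur (N.+1 + j)) (col u) < rank (cur (N.+1 + j)) (col i)])) //.
by move=> u; rewrite !inE !e.
Qed.

(** Induction over the items, for the nodes born so far. If the candidate [i] is beaten in the new
    item, let [k'] be minimal there. Were [k'] born earlier, both would lie in the parent, where the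
    orders agree and [i] is minimal. So [k'] is born here, occurs in no earlier item, and takes
    over. *)
Lemma minimal_node (U : {set 'I_n}) : U != set0 ->
  exists2 i, i \in U & forall q j, q <= Q -> i \in V q -> j \in U -> j \in V q ->
    rank (cur q) (col i) <= rank (cur q) (col j).
Proof.
move=> U0.
suff H q : q <= Q -> (exists2 i, i \in U & birth i <= q) ->
  exists2 i, (i \in U) && (birth i <= q) & forall p j, p <= q -> i \in V p -> j \in U -> j \in V p ->
    rank (cur p) (col i) <= rank (cur p) (col j).
  have [i iU] := set0Pn _ U0.
  by have [|k /andP[kU _] ?] := H Q (leqnn Q); [exists i | exists k].
elim: q => [|q IH] qQ [i0 i0U i0q]; first by have := birth_pos i0; lia.
pose W := U :&: V q.+1.
have minW : forall w, w \in W -> exists2 i, i \in W & rank (cur q.+1) (col i) <= rank (cur q.+1) (col w) /\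
    forall j, j \in W -> rank (cur q.+1) (col i) <= rank (cur q.+1) (col j).
  move=> w wW; case: (arg_minnP (fun i => rank (cur q.+1) (col i)) wW) => i iW mi.
  by exists i => //; split=> [|j /mi//]; apply: mi.
have born i : i \in W -> birth i = q.+1 -> (forall j, j \in W -> rank (cur q.+1) (col i) <= rank (cur q.+1) (col j)) ->
  exists2 i, (i \in U) && (birth i <= q.+1) & forall p j, p <= q.+1 -> i \in V p -> j \in U -> j \in V p ->
    rank (cur p) (col i) <= rank (cur p) (col j).
  rewrite inE => /andP[iU iV] bi mi; exists i; first by rewrite iU bi leqnn.
  move=> p j pq ip jU jp.
  have Ep : p = q.+1 by apply/eqP; rewrite eqn_leq pq -bi birth_min // (leq_trans pq).
  by subst p; apply: mi; rewrite inE jU.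
have [/exists_inP[k kU kq]|none] := boolP [exists i in U, birth i <= q].
  have [|i /andP[iU iq] mi] := IH (ltnW qQ); first by exists k.
  have ext : (i \in V q.+1 -> forall j, j \in W -> rank (cur q.+1) (col i) <= rank (cur q.+1) (col j)) ->
    exists2 i, (i \in U) && (birth i <= q.+1) & forall p j, p <= q.+1 -> i \in V p -> j \in U -> j \in V p ->
      rank (cur p) (col i) <= rank (cur p) (col j).
    move=> h; exists i; first by rewrite iU (leq_trans iq).
    move=> p j; rewrite leq_eqVlt => /orP[/eqP->|]; last by rewrite ltnS; apply: mi.
    by move=> iV jU jV; apply: h => //; rewrite inE jU.
  case: (boolP (i \in V q.+1)) => [iV|iV]; last by apply: ext; rewrite (negPf iV).
  have iW : i \in W by rewrite inE iU.
  have [k' k'W [le mk]] := minW i iW.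
  have [E|lt] : rank (cur q.+1) (col k') = rank (cur q.+1) (col i) \/
      rank (cur q.+1) (col k') < rank (cur q.+1) (col i) by lia.
    by apply: ext => _ j /mk; rewrite E.
  apply: (born k') => //; apply/eqP; apply: contraT => bk; exfalso.
  have /andP[k'U k'V] : (k' \in U) && (k' \in V q.+1) by rewrite inE in k'W.
  have kP := V_par qQ k'V bk.
  have iP : i \in V (par q.+1) by apply: V_par => //; rewrite neq_ltn ltnS iq.
  have pq := par_lt (qQ : 0 < q.+1 <= Q).
  have := mi (par q.+1) k' (pq : par q.+1 <= q) iP k'U kP.
  have [_ /(_ i iV iP) E] := sel_agree (qQ : 0 < q.+1 <= Q) k'V kP.
  by rewrite leqNgt -E lt.
have bi i : i \in U -> birth i <= q.+1 -> birth i = q.+1.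
  move=> iU le; apply/eqP; rewrite eqn_leq le ltnNge /=.
  by apply: contra none => h; apply/exists_inP; exists i.
have i0V : i0 \in V q.+1 by rewrite -(bi i0) //.
have i0W : i0 \in W by rewrite inE i0U.
have [i iW [_ mi]] := minW i0 i0W.
apply: (born i) => //; move: iW; rewrite inE => /andP[iU iV].
by apply: bi => //; apply: birth_min.
Qed.

Lemma selection_feasible : sctm_feasible (sel_seeds st).
Proof.
have [t E] := activation_stable (sel_seeds st).
exists t => t' tt'; rewrite (activation_stays E tt').
apply/eqP; rewrite -subTset; apply/subsetP => i0 _; apply: contraT => ni0; exfalso.
have U0 : ~: activation (sel_seeds st) t != set0 by apply/set0Pn; exists i0; rewrite inE.
(* All predecessors of a minimal inactive node in its hyperedges are active, so the hyperedges
   counted by [sel_benefit] are active for it and would activate it. *)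
have [i] := minimal_node U0; rewrite inE => ni mi.
have ns : i \notin sel_seeds st.
  by apply: contra ni => h; apply: (subsetP (activation_sub _ (leq0n t))).
case/negP: ni; rewrite -E !inE; apply/orP; case: (boolP (i \in activation (sel_seeds st) t)); [by left|move=> ni; right].
rewrite /=; apply: (leq_trans (sel_benefit ns)); rewrite /received.
rewrite [X in _ <= X](bigID (fun j => (i \in edge I j) &&
     (threshold j - 1 <= #|[set u in edge I j | rank (cur (N.+1 + j)) (col u) < rank (cur (N.+1 + j)) (col i)]|))) /=.
apply: leq_trans (leq_addr _ _); rewrite leq_eqVlt; apply/orP; left; apply/eqP; apply: eq_bigl => j.
rewrite inE; apply/idP/idP => [h|/andP[_ //]]; rewrite h andbT; case/andP: h => iE th.
rewrite iE /=; apply: (leq_trans th); apply: subset_leq_card; apply/subsetP => u; rewrite !inE => /andP[uE lt].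
rewrite uE andbT; apply: contraT => nu; exfalso.
have := mi (N.+1 + j) u; rewrite !V_edge inE => /(_ (edge_item j) iE nu uE).
by rewrite leqNgt lt.
Qed.

End Soundness.

Section Completeness.
Variable S : {set 'I_n}.
Hypothesis feas : sctm_feasible S.
Hypothesis Kb : K < b.
Hypothesis cost_b : forall i : 'I_n, cost i < b.

Lemma activated i : exists t, i \in activation S t.
Proof. by have [t /(_ t (leqnn t)) E] := feas; exists t; rewrite E. Qed.

Let time i := ex_minn (activated i).

Lemma time_le i t : (time i <= t) = (i \in activation S t).
Proof.
rewrite /time; case: ex_minnP => t0 h mn; apply/idP/idP => [le|/mn//].
exact: (subsetP (activation_sub _ le)).
Qed.

Let timec c := if [pick i : 'I_n | i.+1 == c] is Some i then time i else 0.

Lemma timecE (i : 'I_n) : timec i.+1 = time i.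
Proof. by rewrite /timec; case: pickP => [j /eqP[/val_inj->]//|/(_ i)]; rewrite eqxx. Qed.

Let marked c := [exists i in S, i.+1 == c].

Lemma markedE (i : 'I_n) : marked i.+1 = (i \in S).
Proof. by apply/exists_inP/idP => [[j jS /eqP[/val_inj<-]]//|iS]; exists i. Qed.

(** The rank by activation time, with ties for nodes activated together. Counting within the item
    keeps it at most [K], hence a digit, whereas the time itself is not bounded by [b]. *)
Let before q c := #|[set d : 'I_K | (vn q d != 0) && (timec (vn q d) < timec (vn q c))]|.

Let init_digit q d :=
  if d < K then (if vn q d != 0 then before q d else 0)
  else if d < 2 * K then (if vn q (d - K) != 0 then marked (vn q (d - K)) : nat else 0)
  else if vn q (d - 2 * K) != 0 then
    minn b.-1 (if thr q - 1 <= before q (d - 2 * K) then rv q (d - 2 * K) else 0) else 0.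

Let init q := enc b (init_digit q) (3 * K).

Fixpoint sel_of it p := if it is it'.+1 then
    if p == par (Q - it') then after (Q - it') (sel_of it' p) (sel_of it' (Q - it'))
    else sel_of it' p
  else init p.

Lemma before_le q c : before q c <= K.
Proof. by rewrite -[X in _ <= X]card_ord; apply: max_card. Qed.

Lemma init_digit_lt q d : init_digit q d < b.
Proof.
rewrite /init_digit; case: ifP => _.
  by case: ifP => _ //; apply: leq_ltn_trans Kb; apply: before_le.
case: ifP => [lt|_]; case: ifP => _ //; first by case: marked => //; lia.
by apply: (@leq_ltn_trans b.-1); rewrite ?geq_minl // ltn_predL.
Qed.

Lemma init_rank q c : c < K -> rank (init q) c = if vn q c != 0 then before q c else 0.
Proof.
move=> cK; rewrite /rankd dig_enc => [|d _|]; [|exact: init_digit_lt|by lia].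
by rewrite /init_digit cK.
Qed.

Lemma init_seed q c : c < K -> sd (init q) c = if vn q c != 0 then marked (vn q c) : nat else 0.
Proof.
move=> cK; rewrite /seedd dig_enc => [|d _|]; [|exact: init_digit_lt|by lia].
rewrite /init_digit ifF; last by lia.
by rewrite ifT ?addKn //; lia.
Qed.

Lemma init_acc q c : c < K -> acc (init q) c = if vn q c != 0 then
  minn b.-1 (if thr q - 1 <= before q c then rv q c else 0) else 0.
Proof.
move=> cK; rewrite /accd dig_enc => [|d _|]; [|exact: init_digit_lt|by lia].
rewrite /init_digit ifF; last by lia.
by rewrite ifF ?addKn //; lia.
Qed.

Lemma sel_of_lt it p : sel_of it p < D.
Proof.
elim: it p => [|it IH] p /=; first by apply: enc_lt => *; apply: init_digit_lt.
by case: ifP => // _; apply: after_lt.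
Qed.

Lemma sel_of_digits it p c : c < K ->
  rank (sel_of it p) c = rank (init p) c /\ sd (sel_of it p) c = sd (init p) c.
Proof.
move=> cK; elim: it => //= it [<- <-]; case: ifP => // _.
by rewrite rank_after ?seed_after.
Qed.

Lemma before_lt q c d : c < K -> vn q c != 0 -> (before q c < before q d) = (timec (vn q c) < timec (vn q d)).
Proof.
move=> cK nz; have mono x y : timec (vn q x) <= timec (vn q y) -> before q x <= before q y.
  move=> le; apply: subset_leq_card; apply/subsetP => z; rewrite !inE => /andP[-> /= lt].
  exact: leq_trans lt le.
apply/idP/idP => [lt|lt]; first by rewrite ltnNge; apply: contraL lt => /mono; rewrite -leqNgt.
apply: proper_card; apply/properP; split.
  by apply/subsetP => z; rewrite !inE => /andP[-> /= /ltn_trans->].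
by exists (Ordinal cK); rewrite !inE nz /= ?ltnn.
Qed.

Lemma init_rank_lt q c d : c < K -> d < K -> vn q c != 0 -> vn q d != 0 ->
  (rank (init q) c < rank (init q) d) = (timec (vn q c) < timec (vn q d)).
Proof. by move=> cK dK c0 d0; rewrite !init_rank // c0 d0 before_lt. Qed.

Lemma init_ok q : initok q (init q).
Proof.
apply/forallP => c; rewrite init_acc //; case: ifP => // nz.
apply: leq_trans (geq_minr _ _) _; rewrite /promise.
suff -> : preds q (init q) c = before q c by [].
apply: eq_card => d; rewrite !inE; case: (boolP (vn q d != 0)) => //= nd.
by rewrite init_rank_lt.
Qed.

Let Psi i it := \sum_(p < Q.+1 | (p <= Q - it) && (i \in V p)) acc (sel_of it p) (col i).

(** A node outside [S] is activated at a step [t + 1], and every hyperedge active for it at time [t]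
    has enough members of strictly smaller activation time. A single truncated benefit already
    covers the cost. *)
Lemma Psi_init i : i \notin S -> cost i <= Psi i 0.
Proof.
move=> nS.
have [t Et] : exists t, time i = t.+1.
  case E: (time i) => [|t]; last by exists t.
  by have := time_le i 0; rewrite E => /esym; rewrite -[activation S 0]/S (negPf nS).
have rc : cost i <= received (activation S t) i.
  have := time_le i t.+1; rewrite Et leqnn => /esym.
  rewrite -[activation S t.+1]/(activation_step (activation S t)) !inE => /orP[|/andP[]//].
  by rewrite -time_le Et ltnn.
have Q1 : Q.+1 = N.+1 + m by rewrite addSn.
have low : \sum_(j in active_edges (activation S t) i) minn b.-1 (benefit j i) <= Psi i 0.
  rewrite /Psi; rewrite (eq_bigl (fun p : 'I_Q.+1 => i \in V p)) => [|p]; last by rewrite subn0 -ltnS ltn_ord.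
  rewrite (big_mkcond (fun p : 'I_Q.+1 => i \in V p)) /=.
  rewrite -(big_mkord xpredT (fun p => if i \in V p then acc (sel_of 0 p) (col i) else 0)).
  rewrite Q1 (@big_cat_nat _ _ _ N.+1) //= ?leq_addr //; apply: leq_trans (leq_addl _ _).
  rewrite sum_shift big_mkcond.
  apply: leq_sum => j _; rewrite V_edge inE; case: (boolP (i \in edge I j)) => //= iE.
  case: ifP => // th.
  have jQ := edge_item j.
  have iV : i \in V (N.+1 + j) by rewrite V_edge.
  rewrite init_acc // (vnV jQ iV) /= thr_edge rv_edge // ifT //.
  apply: (leq_trans th).
  pose co u : 'I_K := Ordinal (colK u).
  rewrite -(card_in_imset (f := co)) => [|u v]; last first.
    by rewrite !inE -!V_edge => /andP[_ uV] /andP[_ vV] /(congr1 val) /=; apply: col_inj vV.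
  apply: subset_leq_card; apply/subsetP => d /imsetP[u]; rewrite !inE -V_edge => /andP[ua uV] -> /=.
  by rewrite (vnV jQ uV) (vnV jQ iV) !timecE /= Et ltnS time_le.
apply: leq_trans low.
have [/exists_inP[j jA big]|small] := boolP [exists j in active_edges (activation S t) i, b.-1 <= benefit j i].
  by rewrite (bigD1 j) //= (minn_idPl big); have := cost_b i; lia.
rewrite (eq_bigr (fun j => benefit j i)) // => j jA; apply/minn_idPr; rewrite leqNgt.
by apply: contra small => /ltnW h; apply/exists_inP; exists j.
Qed.

(** A merge preserves the total unless the truncation bites, and then the parent digit alone is
    [b - 1], which is at least the cost. *)
Lemma Psi_ge i it : i \notin S -> it <= Q - birth i -> cost i <= Psi i it.
Proof.
move=> nS; elim: it => [_|it IH lt]; first exact: Psi_init.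
have {}IH := IH (ltnW lt).
have b1 := birth_pos i.
have iQ : it < Q by lia.
have [q0 qQ pq pQ] := qP par_lt iQ.
have qS : Q - it < Q.+1 by lia.
have pS : par (Q - it) < Q.+1 by lia.
have bq : birth i != Q - it by apply/eqP; lia.
have qq : 0 < Q - it <= Q by rewrite q0.
case: (boolP (i \in V (Q - it))) => [iV|iV].
  have iP := V_par qQ iV bq.
  move: IH; rewrite /Psi (bigD1 (Ordinal qS)) /=; last by rewrite leqnn.
  rewrite (bigD1 (Ordinal pS)) /=; last by rewrite iP -val_eqE /= ltn_eqF // ltnW.
  rewrite [X in _ -> _ <= X](bigD1 (Ordinal pS)) /=; last by rewrite iP andbT subnS -ltnS prednK.
  rewrite eqxx acc_after // shared_in // iP => le.
  have cb := cost_b i.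
  set A1 := acc (sel_of it (Q - it)) (col i) in le *.
  set A2 := acc (sel_of it (par (Q - it))) (col i) in le *.
  have [h|h] := leqP b.-1 (A2 + A1).
    by apply: (@leq_trans b.-1); [lia | apply: leq_trans (leq_addr _ _)].
  apply: (leq_trans le); rewrite addnA [A1 + A2]addnC leq_add2l.
  rewrite leq_eqVlt; apply/orP; left; apply/eqP.
  have E (p : 'I_Q.+1) : (((p <= Q - it) && (i \in V p)) && (p != Ordinal qS)) && (p != Ordinal pS) =
     ((p <= Q - it.+1) && (i \in V p)) && (p != Ordinal pS).
    by rewrite -!val_eqE /=; case: (i \in V p); rewrite ?andbF // !andbT; congr (_ && _); lia.
  rewrite (eq_bigl _ _ E); apply: eq_bigr => p /andP[/andP[l1 _] n1].
  by rewrite -!val_eqE /= in n1; rewrite (negPf n1).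
apply: (leq_trans IH); rewrite /Psi leq_eqVlt; apply/orP; left; apply/eqP.
have E (p : 'I_Q.+1) : ((p <= Q - it) && (i \in V p)) = ((p <= Q - it.+1) && (i \in V p)).
  case: (nat_of_ord p =P Q - it) => [->|ne]; first by rewrite (negPf iV) !andbF.
  by congr (_ && _); lia.
rewrite (eq_bigl _ _ E); apply: eq_bigr => p /andP[l1 iVp] /=.
case: (nat_of_ord p =P par (Q - it)) => [Ep|//].
by rewrite Ep acc_after // shared_notin // -Ep.
Qed.

Lemma sel_of_root it : it <= Q -> sel_of it 0 = 0.
Proof.
have vn0 c : vn 0 c = 0.
  by apply/eqP; apply: contraT => /(Vvn (leq0n Q))[u]; rewrite V0 inE.
have dig0 c : digit_of b c 0 = 0 by rewrite /digit_of div0n mod0n.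
have enc0 L : enc b (fun=> 0) L = 0 by elim: L => //= L ->; rewrite muln0.
elim: it => [|it IH] iQ /=.
  rewrite -[RHS](enc0 (3 * K)); apply: eq_enc => c _.
  by rewrite /init_digit !vn0 /= !if_same.
rewrite IH ?(ltnW iQ) //; case: eqP => // E.
rewrite -[RHS](enc0 (3 * K)); apply: eq_enc => c _; rewrite /after_digit /shared -E vn0 !dig0.
by rewrite [0 == _]eq_sym andNb andbF.
Qed.

Lemma sel_of_selection : selection sel_of /\ sel_seeds sel_of = S.
Proof.
split; last first.
  apply/setP => i; rewrite inE (sel_of_digits _ _ (colK i)).2 init_seed // vnV // markedE.
  by case: (i \in S).
split=> [|it p|q qQ|it iQ]; [exact: sel_of_root|exact: sel_of_lt|exact: init_ok|].
have [q0 qQ pq pQ] := qP par_lt iQ.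
rewrite /= eqxx; split=> // [|p pl /negPf->//].
apply/forallP => c; apply/implyP => nz; case: eqP => [E|ne].
  rewrite !(sel_of_digits _ _ (ltn_ord c)).2 !init_seed // E nz eqxx /=.
  apply/forallP => d; apply/implyP => /andP[nd /eqP Ed].
  rewrite !(sel_of_digits _ _ (ltn_ord c)).1 !(sel_of_digits _ _ (ltn_ord d)).1.
  by rewrite !init_rank_lt ?E ?Ed.
have [u uV [eu E]] := Vvn qQ nz.
rewrite (sel_of_digits _ _ (ltn_ord c)).2 init_seed // nz E markedE /= cstE.
case: (boolP (u \in S)) => //= uS.
have bu : birth u = Q - it.
  apply/eqP; apply: contraT => /(V_par qQ uV) uP.
  by case: ne; rewrite E -eu; apply: vnV.
(* When its birth item is merged, no other item alive contains [u], so the total is a single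
   digit. *)
have := Psi_ge (it := it) uS; rewrite bu subKn ?(ltnW iQ) // => /(_ (leqnn _)) h.
apply: (leq_trans h); rewrite /Psi -eu.
have qS : Q - it < Q.+1 by lia.
rewrite (bigD1 (Ordinal qS)) /= ?leqnn ?uV // big1 ?addn0 // => p /andP[/andP[l1 up]].
by rewrite -val_eqE /= => ne'; have := birth_min (ltac:(lia) : p <= Q) up; rewrite bu; lia.
Qed.

End Completeness.

End Items.

(** * Adding the hyperedges to the tree of bags *)

(* Item 0 is an empty root, items [1..N] are the bags, item [N + 1 + j] is the
   hyperedge [j], attached to its youngest node.  Arrays 110 and 111 hold the
   thresholds and, parallel to the rows, the benefits. *)
Definition EdgeItems : cmd := (
  NSet 83 (NCst 0) (Var 86) ;;
  Set' 86 (Var 86 + (eN + eN + eN + eN + NCst 8)) ;;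
  For 97 eM (
    NSet 83 (Var 85 + NCst 1 + Var 97) (Var 86) ;;
    NSet 84 (Var 85 + NCst 1 + Var 97) (NCst 0) ;;
    NSet 110 (Var 85 + NCst 1 + Var 97) (NGet 4 (Var 97)) ;;
    Set' 86 (Var 86 + (eN + eN + eN + eN + NCst 8))) ;;
  For 97 eL (
    Set' 98 (Var 85 + NCst 1 + NGet 1 (Var 97)) ;;
    Set' 99 (NGet 2 (Var 97)) ;;
    NSet 82 (NGet 83 (Var 98) + NGet 81 (Var 99)) (Var 99 + NCst 1) ;;
    NSet 111 (NGet 83 (Var 98) + NGet 81 (Var 99)) (NGet 3 (Var 97)) ;;
    If' (BLt (NGet 84 (Var 98)) (NGet 80 (Var 99)))
      (NSet 84 (Var 98) (NGet 80 (Var 99))) Skip))%cmd.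

Section EdgeItems.
Variables (R : realType) (n m L : nat) (nd ej : nat -> nat) (edge : 'I_m -> {set 'I_n}).
Variables (ben : 'I_m -> 'I_n -> nat) (thf : 'I_m -> nat).
Implicit Types s : state R.
Hypothesis ndP : forall p, p < L -> nd p < n.
Hypothesis ejP : forall p, p < L -> ej p < m.
Hypothesis incP : forall (i : 'I_n) (j : 'I_m),
  reflect (exists2 p, p < L & nd p = i /\ ej p = j) (i \in edge j).
Local Notation inputs_in := (@inputs_in R n m L nd ej).
Local Notation stride := (stride n).

Definition vn_in K s q c := if c < K then nmem s 82 (nmem s 83 q + c) else 0.
Definition rv_in K s q c := if c < K then nmem s 111 (nmem s 83 q + c) else 0.

Definition item_set N s q : {set 'I_n} :=
  if q <= N then bag_in n s q else if insub (q - N.+1) is Some j then edge j else set0.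

(** The hypotheses of the correspondence between selections and seed sets, as facts about memory. *)
Record items_ok s N K : Prop := ItemsOk {
  ok_inputs : inputs_in s;
  ok_N : nmem s 85 0 = N;
  ok_K : nmem s 33 0 = K;
  ok_col : forall u : 'I_n, nmem s 81 u < K;
  ok_vnV : forall q (u : 'I_n), q <= N + m -> u \in item_set N s q -> vn_in K s q (nmem s 81 u) = u.+1;
  ok_Vvn : forall q c, q <= N + m -> vn_in K s q c != 0 ->
    exists2 u, u \in item_set N s q & nmem s 81 u = c /\ vn_in K s q c = u.+1;
  ok_V0 : item_set N s 0 = set0;
  ok_par : forall q, 0 < q <= N + m -> nmem s 84 q < q;
  ok_birth : forall i : 'I_n, i \in item_set N s (birth_in s i);
  ok_birth_le : forall i : 'I_n, birth_in s i <= N;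
  ok_birth_min : forall q (i : 'I_n), q <= N + m -> i \in item_set N s q -> birth_in s i <= q;
  ok_Vpar : forall q (i : 'I_n), q <= N + m -> i \in item_set N s q -> birth_in s i != q ->
    i \in item_set N s (nmem s 84 q);
  ok_Vedge : forall j : 'I_m, item_set N s (N.+1 + j) = edge j;
  ok_thr : forall j : 'I_m, nmem s 110 (N.+1 + j) = thf j;
  ok_rv : forall (j : 'I_m) i, i \in edge j -> rv_in K s (N.+1 + j) (nmem s 81 i) = ben j i;
  ok_rv0 : forall q c, q <= N -> rv_in K s q c = 0
}.

Lemma items_frame c s s' N K : frame c s s' ->
  all (fun a => a \notin nwr c) [:: 0; 1; 2; 85; 33; 80; 81; 82; 83; 84; 110; 111] ->
  items_ok s N K -> items_ok s' N K.
Proof.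
rewrite /= => fr /and5P[i0 i1 i2 c85 /and5P[c33 c80 c81 c82 /and5P[c83 c84 c110 c111 _]]] ok.
have eb (i : 'I_n) : birth_in s' i = birth_in s i by rewrite /birth_in (frn fr).
have eg : bag_in n s' = bag_in n s.
  by apply: funext => t; rewrite /bag_in (frn (a := 82) fr) // (frn (a := 83) fr) // (frn (a := 81) fr).
have ei q : item_set N s' q = item_set N s q by rewrite /item_set eg.
have ev q c' : vn_in K s' q c' = vn_in K s q c' by rewrite /vn_in (frn (a := 82) fr) // (frn (a := 83) fr).
have er q c' : rv_in K s' q c' = rv_in K s q c' by rewrite /rv_in (frn (a := 111) fr) // (frn (a := 83) fr).
case: ok => h1 h2 h3 h4 h5 h6 h7 h8 h9 h10 h11 h12 h13 h14 h15 h16.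
split.
- by apply: (inputs_frame fr) => //=; rewrite i0 i1 i2.
- by rewrite (frn fr).
- by rewrite (frn fr).
- by move=> u; rewrite (frn (a := 81) fr).
- by move=> q u; rewrite ei ev (frn (a := 81) fr) //; apply: h5.
- by move=> q c'; rewrite ei ev (frn (a := 81) fr) //; apply: h6.
- by rewrite ei.
- by move=> q; rewrite (frn (a := 84) fr) //; apply: h8.
- by move=> i; rewrite eb ei.
- by move=> i; rewrite eb.
- by move=> q i; rewrite eb ei; apply: h11.
- by move=> q i; rewrite eb (frn (a := 84) fr) // !ei; apply: h12.
- by move=> j; rewrite ei.
- by move=> j; rewrite (frn (a := 110) fr).
- by move=> j i; rewrite er (frn (a := 81) fr) //; apply: h15.
- by move=> q c'; rewrite er; apply: h16.
Qed.

Lemma EdgeItems_wp s N q VB : td_in L nd ej edge s N q VB -> (forall u : 'I_n, birth_in s u != 0) ->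
  (forall p (j : 'I_m) (i : 'I_n), p < L -> ej p = j -> nd p = i -> nmem s 3 p = ben j i) ->
  (forall j : 'I_m, nmem s 4 j = thf j) -> nmem s 111 =1 (fun=> 0) ->
  wp EdgeItems s (m * 7 + L * 12 + 8) (fun s' => items_ok s' N (4 * q) /\
    (forall u : 'I_n, birth_in s' u = birth_in s u)).
Proof.
move=> [[inp net e85 e86] [e31 e32 e33 e34] ok rows [colK [q2 qn] qtw Nb z82]] born benE thrE z111.
have [sn sm sL se sd] := inp.
set K := 4 * q in e33 colK *.
have Ks : K <= stride by rewrite /stride; lia.
have [[bN bV] bt bp _ be] := ok.
have colS u : u < n -> nmem s 81 u < stride.
  by move=> un; apply: leq_trans (colK (Ordinal un)) Ks.
pose VB1 := VB + stride.
have stE (s1 : state R) : nmem s1 0 0 = n -> nmem s1 86 0 + (nmem s1 0 0 + nmem s1 0 0 + nmem s1 0 0 + nmem s1 0 0 + 8) = nmem s1 86 0 + stride.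
  by move=> ->.
pose base t := if t == 0 then VB else if t <= N then nmem s 83 t else VB1 + (t - N.+1) * stride.
pose addr p := VB1 + ej p * stride + nmem s 81 (nd p).
have addr_inj p p' : p < L -> p' < L -> addr p = addr p' -> ej p = ej p' /\ nmem s 81 (nd p) = nmem s 81 (nd p').
  move=> pL pL' E; have c1 := colS _ (ndP pL); have c2 := colS _ (ndP pL').
  have E2 : ej p * stride + nmem s 81 (nd p) = ej p' * stride + nmem s 81 (nd p') by move: E; rewrite /addr; lia.
  have e1 : nmem s 81 (nd p) = nmem s 81 (nd p').
    by have := congr1 (modn^~ stride) E2; rewrite !modnMDl !modn_small.
  split=> //; move: E2; rewrite e1 => /addIn/eqP; rewrite eqn_pmul2r; last by rewrite /stride; lia.
  by move/eqP.
pose mxb i j := \max_(p < L | (p < i) && (ej p == j)) nmem s 80 (nd p).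
eapply wp_le.
  eapply wp_seq; apply: wp_nset => /=.
  eapply wp_seq; apply: wp_nset => /=; rewrite /upd /= e86 sn.
  eapply wp_seq, (wp_for (N := m) (T := 4) (Inv := fun i s1 =>
    [/\ nmem s1 86 0 = VB1 + i * stride,
      forall t, t < N.+1 + i -> nmem s1 83 t = base t,
      forall t, t <= N -> nmem s1 84 t = nmem s 84 t,
      forall j, j < i -> nmem s1 84 (N.+1 + j) = 0 &
      forall j, j < i -> nmem s1 110 (N.+1 + j) = nmem s 4 j])).
  - by rewrite /= /upd /= sm.
  - by [].
  - by [].
  - rewrite /= /upd /=; split=> // [|t]; first by rewrite addn0.
    by rewrite addn0 ltnS /base; case: eqP => //= _ ->.
  - move=> i s1 im xi fr [h1 h2 h3 h4 h5].
    have n1 : nmem s1 0 0 = n by rewrite (frn fr).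
    have k85 : nmem s1 85 0 = N by rewrite (frn fr) //= /upd /= e85.
    have k4 : nmem s1 4 = nmem s 4 by rewrite (frn fr).
    eapply wp_le.
      eapply wp_seq; apply: wp_nset => /=; eapply wp_seq; apply: wp_nset => /=.
      eapply wp_seq; apply: wp_nset => /=; apply: wp_nset => /=.
      rewrite /upd /= !xi k85 n1 h1 k4 -addn1; split.
      + by rewrite mulSn /stride; lia.
      + move=> t; rewrite addnS ltnS leq_eqVlt => /orP[/eqP->|lt].
          rewrite addn1 eqxx /base /= ifF ?addKn //; lia.
        by rewrite addn1 (ltn_eqF lt) h2.
      + by move=> t tN; rewrite ifF ?h3 //; lia.
      + move=> j; rewrite ltnS leq_eqVlt => /orP[/eqP->|lt]; first by rewrite addn1 eqxx.
        by rewrite ifF ?h4 //; lia.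
      + move=> j; rewrite ltnS leq_eqVlt => /orP[/eqP->|lt]; first by rewrite addn1 eqxx.
        by rewrite ifF ?h5 //; lia.
    by [].
  - move=> s1 fr [h1 h2 h3 h4 h5].
    have [k0 k1 k2 k3] : [/\ nmem s1 0 = nmem s 0, nmem s1 1 = nmem s 1, nmem s1 2 = nmem s 2
        & nmem s1 3 = nmem s 3] by rewrite !(frn fr).
    have [k80 k81 k82 k111] : [/\ nmem s1 80 = nmem s 80, nmem s1 81 = nmem s 81, nmem s1 82 = nmem s 82
        & nmem s1 111 = nmem s 111] by rewrite !(frn fr).
    have k85 : nmem s1 85 0 = N by rewrite (frn fr) //= /upd /= e85.
    have k33 : nmem s1 33 0 = K by rewrite (frn fr) //= /upd /= e33.
    eapply (wp_for (N := L) (T := 9) (Inv := fun i s2 =>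
      [/\ forall x, x < VB1 -> nmem s2 82 x = nmem s 82 x /\ nmem s2 111 x = 0,
        forall x, nmem s2 82 x != 0 -> VB1 <= x -> exists2 p, p < i & x = addr p,
        forall p, p < i -> nmem s2 82 (addr p) = (nd p).+1 /\ nmem s2 111 (addr p) = nmem s 3 p,
        forall t, t <= N -> nmem s2 84 t = nmem s 84 t &
        forall j, j < m -> nmem s2 84 (N.+1 + j) = mxb i j])).
    + by rewrite /= k0 sL.
    + by [].
    + by [].
    + split=> //.
      * by move=> x _; rewrite k82 k111 z111.
      * by move=> x nz le; move: nz; rewrite k82 z82 //; apply: leq_trans le; apply: leq_addr.
      * by move=> j jm; rewrite h4 // /mxb big_pred0.
    + move=> i s2 iL xi fr2 [g1 g2 g3 g4 g5].
      have jm := ejP iL; have un := ndP iL.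
      have l1 : nmem s2 1 i = ej i by rewrite (frn fr2) // k1 se.
      have l2 : nmem s2 2 i = nd i by rewrite (frn fr2) // k2 sd.
      have l3 : nmem s2 3 = nmem s 3 by rewrite (frn fr2).
      have l85 : nmem s2 85 0 = N by rewrite (frn fr2).
      have l80 : nmem s2 80 = nmem s 80 by rewrite (frn fr2).
      have l81 : nmem s2 81 = nmem s 81 by rewrite (frn fr2).
      have l83 : nmem s2 83 (N.+1 + ej i) = VB1 + ej i * stride.
        rewrite (frn fr2) // h2 ?ltn_add2l // /base /= ifF ?addKn //; lia.
      have mxS j : mxb i.+1 j = if ej i == j then maxn (mxb i j) (nmem s 80 (nd i)) else mxb i j.
        rewrite /mxb; case: eqP => [E|ne].
          rewrite (bigD1 (Ordinal iL)) /=; last by rewrite ltnSn E eqxx.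
          rewrite maxnC; congr maxn; apply: eq_bigl => p; rewrite -val_eqE /= ltnS ltn_neqAle.
          by case: (p <= i); case: (nat_of_ord p == i); case: (ej p == j).
        apply: eq_bigl => p; rewrite ltnS leq_eqVlt; case: (nat_of_ord p =P i) => [->|//].
        by rewrite ltnn; apply/eqP.
      have post (s3 : state R) : nmem s3 82 =1 upd (nmem s2) 82 (addr i) (nd i).+1 82 ->
          nmem s3 111 =1 upd (nmem s2) 111 (addr i) (nmem s 3 i) 111 ->
          (forall t, t <= N -> nmem s3 84 t = nmem s2 84 t) ->
          (forall j, j < m -> nmem s3 84 (N.+1 + j) = if ej i == j then maxn (mxb i j) (nmem s 80 (nd i)) else mxb i j) ->
        [/\ forall x, x < VB1 -> nmem s3 82 x = nmem s 82 x /\ nmem s3 111 x = 0,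
          forall x, nmem s3 82 x != 0 -> VB1 <= x -> exists2 p, p < i.+1 & x = addr p,
          forall p, p < i.+1 -> nmem s3 82 (addr p) = (nd p).+1 /\ nmem s3 111 (addr p) = nmem s 3 p,
          forall t, t <= N -> nmem s3 84 t = nmem s 84 t &
          forall j, j < m -> nmem s3 84 (N.+1 + j) = mxb i.+1 j].
        move=> f82 f111 f84 f84'; split.
        * move=> x xV; have xa : x < addr i by apply: leq_trans xV _; rewrite /addr -addnA leq_addr.
          by rewrite f82 f111 /upd eqxx (ltn_eqF xa) /=; apply: g1.
        * move=> x; rewrite f82 /upd eqxx /=; case: (x =P addr i) => [-> _ _|_ nz le]; first by exists i.
          by have [p pi ->] := g2 x nz le; exists p => //; apply: ltnW.
        * move=> p; rewrite ltnS f82 f111 /upd eqxx /= => pi.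
          (* Incidences with the same address agree in hyperedge and colour. Two nodes of a
             hyperedge both lie in the birth bag of the later one, where colours are distinct, so
             the node is the same and the write repeats old values. *)
          case: eqP => [E|ne].
            have pL : p < L := leq_ltn_trans pi iL.
            have [E1 E2] := addr_inj _ _ pL iL E.
            have p1 : Ordinal (ndP pL) \in edge (Ordinal (ejP pL)) by apply/incP; exists p.
            have i1 : Ordinal (ndP iL) \in edge (Ordinal (ejP pL)) by apply/incP; exists i.
            have same : nd p = nd i.
              have inj (u w : 'I_n) : u \in edge (Ordinal (ejP pL)) -> w \in edge (Ordinal (ejP pL)) ->
                  birth_in s u <= birth_in s w -> nmem s 81 u = nmem s 81 w -> u = w.
                move=> uE wE le EC.
                have b0 : 0 < birth_in s u by rewrite lt0n born.
                have b1 : 0 < birth_in s w by rewrite lt0n born.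
                have uB := be _ w u wE uE (ltac:(by rewrite b0) : 0 < birth_in s u <= birth_in s w).
                have [_ [r1 _]] := rows (birth_in s w) (ltac:(by rewrite b1 bN) : 0 < birth_in s w <= N).
                have := r1 u uB; have := r1 w (bV w b1); rewrite EC (colS w (ltn_ord w)) => -> [].
                by move/val_inj.
              case: (leqP (birth_in s (Ordinal (ndP pL))) (birth_in s (Ordinal (ndP iL)))) => le.
                by have := inj _ _ p1 i1 le E2; case.
              by have := inj _ _ i1 p1 (ltnW le) (esym E2); case.
            rewrite same; split=> //.
            rewrite (benE p (Ordinal (ejP pL)) (Ordinal (ndP pL))) //.
            by rewrite (benE i (Ordinal (ejP pL)) (Ordinal (ndP pL))).
          apply: g3; rewrite ltn_neqAle pi andbT; apply/eqP => E; by rewrite E in ne.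
        * by move=> t tN; rewrite f84 ?g4.
        * by move=> j jm'; rewrite f84' // mxS.
      eapply wp_le.
        do 4 (eapply wp_seq; apply: wp_nset => /=).
        rewrite /upd /= xi l85 l1 l2 addn1 l83 l81 l3.
        apply: wp_if => /=; rewrite /upd /= l80 g5 // => t.
          apply: wp_nset; apply: post.
          - by move=> x; rewrite /= /upd /addr /= addn1.
          - by [].
          - by move=> x tN; rewrite /= /upd /= ifF //; lia.
          - move=> j jm'; rewrite /= /upd /= eqn_add2l eq_sym l80.
            by case: eqP => [<-|_]; [rewrite (maxn_idPr (ltnW t)) | rewrite g5].
        apply: wp_skip; apply: post.
        - by move=> x; rewrite /= /upd /addr /= addn1.
        - by [].
        - by [].
        - move=> j jm'; rewrite /= /upd /= g5 //; case: eqP => // <-.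
          by rewrite -leqNgt in t; rewrite (maxn_idPl t).
      by [].
    + move=> s2 fr2 [g1 g2 g3 g4 g5].
      have l83 t : t <= N + m -> nmem s2 83 t = base t by move=> tNm; rewrite (frn fr2) // h2 // addSn ltnS.
      have l81 : nmem s2 81 = nmem s 81 by rewrite (frn fr2).
      have l80 : nmem s2 80 = nmem s 80 by rewrite (frn fr2).
      have bE : @birth_in R n s2 = birth_in s by apply: funext => u; rewrite /birth_in l80.
      have bagE t : t <= N -> bag_in n s2 t = bag_in n s t.
        rewrite /bag_in; case: eqP => // t0 tN; apply/setP => u; rewrite !inE l81 l83; last by lia.
        have [le _] := rows t (ltac:(lia) : 0 < t <= N).
        rewrite /base (introF eqP t0) tN (g1 _ _).1 // /VB1.
        by have := colS u (ltn_ord u); lia.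
      have setE t : t <= N -> item_set N s2 t = bag_in n s t by move=> tN; rewrite /item_set tN bagE.
      have setE' (j : 'I_m) : item_set N s2 (N.+1 + j) = edge j.
        by rewrite /item_set ifF ?addKn ?valK //; lia.
      have vn0 c : vn_in K s2 0 c = 0.
        rewrite /vn_in; case: ifP => // cK; rewrite l83 // /base /=.
        by rewrite (g1 _ _).1 ?z82 ?leq_addr // /VB1; lia.
      have vnt t c : 0 < t <= N -> vn_in K s2 t c = if c < K then nmem s 82 (nmem s 83 t + c) else 0.
        move=> tN; have /andP[t0 tN'] := tN; rewrite /vn_in; case: ifP => // cK; rewrite l83; last by lia.
        rewrite /base (gtn_eqF t0) tN'; have [le _] := rows t tN.
        by rewrite (g1 _ _).1 // /VB1; lia.
      have vnj j c : j < m -> vn_in K s2 (N.+1 + j) c = if c < K then nmem s2 82 (VB1 + j * stride + c) else 0.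
        move=> jm; rewrite /vn_in; case: ifP => // cK; rewrite l83; last by lia.
        by rewrite /base /= ifF ?addKn //; lia.
      have split_item t : t <= N + m -> [\/ t = 0, 0 < t <= N | exists j : 'I_m, t = N.+1 + j].
        move=> tNm; case: (posnP t) => [|t0]; first by constructor 1.
        case: (leqP t N) => tN; first by constructor 2.
        constructor 3; have h : t - N.+1 < m by lia.
        by exists (Ordinal h); rewrite /= subnKC.
      have edge_p (j : 'I_m) (i : 'I_n) : i \in edge j -> exists2 p, p < L &
          [/\ nd p = i, ej p = j & addr p = VB1 + j * stride + nmem s 81 i].
        by case/incP => p pL [E1 E2]; exists p => //; split=> //; rewrite /addr E1 E2.
      have mx_ge (j : 'I_m) (i : 'I_n) : i \in edge j -> birth_in s i <= mxb L j.
        case/edge_p => p pL [E1 E2 _]; rewrite /mxb.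
        apply: (@leq_trans (nmem s 80 (nd (Ordinal pL)))); first by rewrite /= E1.
        by apply: (leq_bigmax_cond (F := fun p : 'I_L => nmem s 80 (nd p))); rewrite /= pL E2 eqxx.
      have mx_at (j : 'I_m) (i : 'I_n) : i \in edge j -> exists2 u, u \in edge j & mxb L j = birth_in s u.
        case/edge_p => p pL [E1 E2 _].
        have c0 : 0 < #|[pred p : 'I_L | (p < L) && (ej p == j)]|.
          by apply/card_gt0P; exists (Ordinal pL); rewrite inE /= pL E2 eqxx.
        have [p' /andP[_ /eqP E'] Em] := eq_bigmax_cond (fun p : 'I_L => nmem s 80 (nd p)) c0.
        rewrite [mxb L j](_ : _ = nmem s 80 (nd p')) -?Em //.
        exists (Ordinal (ndP (ltn_ord p'))) => //.
        by apply/incP; exists p'.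
      have b0 (i : 'I_n) : 0 < birth_in s i by rewrite lt0n born.
      split; last by move=> u; rewrite bE.
      split.
      * by apply: (inputs_frame fr2) => //; apply: (inputs_frame fr) => //; split; rewrite /= ?upd_neq.
      * by rewrite (frn fr2).
      * by rewrite (frn fr2).
      * by move=> u; rewrite l81.
      * move=> t u tNm; rewrite l81; have [->|tN|[j ->]] := split_item t tNm.
        - by rewrite setE // /bag_in eqxx inE.
        - rewrite setE; last by case/andP: tN.
          have [_ [r1 _]] := rows t tN; move=> /r1; rewrite vnt // colK.
          by rewrite (colS u (ltn_ord u)).
        rewrite setE' => /edge_p[p pL [E1 E2 E3]]; rewrite vnj // colK -E3.
        by rewrite (g3 p pL).1 E1.
      * move=> t c tNm; rewrite l81; have [->|tN|[j ->]] := split_item t tNm.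
        - by rewrite vn0.
        - rewrite setE; last by case/andP: tN.
          have [_ [_ r2]] := rows t tN; rewrite vnt //; case: ifP => // cK nz.
          have [|u uB [E1 E2]] := r2 c; first by rewrite (leq_trans cK Ks).
          by exists u; rewrite // E1; split=> //; rewrite -E2 (leq_trans cK Ks).
        rewrite setE' vnj //; case: ifP => // cK nz.
        have [|p pL E] := g2 _ nz; first by rewrite -addnA leq_addr.
        have cS := colS _ (ndP pL).
        have E2 : j * stride + c = ej p * stride + nmem s 81 (nd p) by move: E; rewrite /addr; lia.
        have Ec : c = nmem s 81 (nd p).
          by have := congr1 (modn^~ stride) E2; rewrite !modnMDl !modn_small // (leq_trans cK).
        have Ej : j = ej p :> nat.
          move: E2; rewrite Ec => /addIn/eqP; rewrite eqn_pmul2r; last by rewrite /stride; lia.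
          by move/eqP.
        exists (Ordinal (ndP pL)); first by apply/incP; exists p.
        by rewrite /= -Ec; split=> //; rewrite E (g3 p pL).1.
      * by rewrite setE // /bag_in eqxx.
      * move=> t /andP[t0 tNm]; have [E|tN|[j ->]] := split_item t tNm.
        - by rewrite E in t0.
        - by rewrite g4; [case: (bp t tN) | case/andP: tN].
        rewrite g5 // addSn ltnS; apply: (@leq_trans N); last exact: leq_addr.
        by apply/bigmax_leqP => p _; apply: (bN (Ordinal (ndP (ltn_ord p)))).
      * by move=> i; rewrite bE setE // bV.
      * by move=> i; rewrite bE.
      * move=> t i tNm; rewrite bE; have [->|tN|[j ->]] := split_item t tNm.
        - by rewrite setE // /bag_in eqxx inE.
        - rewrite setE; last by case/andP: tN.
          by case/(bt t i tN)/andP.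
        by move=> _; apply: leq_trans (bN i) _; rewrite addSn ltnW // ltnS leq_addr.
      * move=> t i tNm; rewrite bE; have [->|tN|[j ->]] := split_item t tNm.
        - by rewrite setE // /bag_in eqxx inE.
        - have /andP[t0 tN'] := tN; rewrite setE // => iB ne.
          have [pt pB] := bp t tN; rewrite g4 // setE; last by rewrite ltnW // (leq_trans pt).
          by apply: pB => //; rewrite ltn_neqAle ne; case/andP: (bt t i tN iB).
        (* The parent is the birth bag of the last-born node of the hyperedge, which contains all
           its other nodes. *)
        rewrite setE' g5 // => iE _; have [u uE Eu] := mx_at j i iE.
        have le : 0 < birth_in s i <= birth_in s u by rewrite b0 -Eu mx_ge.
        by rewrite Eu (setE _ (bN u)); apply: be uE iE le.
      * exact: setE'.
      * by move=> j; rewrite (frn fr2) // h5 // thrE.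
      * move=> j i /edge_p[p pL [E1 E2 E3]]; rewrite l81 /rv_in colK l83; last by rewrite addSn ltn_add2l.
        rewrite /base /= ifF ?addKn -?E3 ?(g3 p pL).2; last by lia.
        by apply: benE.
      * move=> t c tN; rewrite /rv_in; case: ifP => // cK; rewrite l83; last by lia.
        rewrite (g1 _ _).2 // /base; case: eqP => [_|t0]; first by rewrite /VB1; lia.
        by rewrite tN; have [le _] := rows t (ltac:(lia) : 0 < t <= N); rewrite /VB1; lia.
by rewrite /=; lia.
Qed.

End EdgeItems.

(** * Programs for the tables *)

(* Registers: 120 item, 121 code of its parent, 122 its own code, 124 outcome of the
   test, 29 resulting code; 21 and 22 base and length of the codes, 30 their number.
   Arrays 41 and 42 hold the digits of the two codes. *)
Definition Step : cmd := (
  Set' 20 (Var 121) ;; Decode 41 ;; Set' 20 (Var 122) ;; Decode 42 ;;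
  Set' 123 (NGet 84 (Var 120)) ;; Set' 128 (NGet 83 (Var 120)) ;;
  Set' 129 (NGet 83 (Var 123)) ;; Set' 124 (NCst 1) ;;
  For 126 (Var 33) (
    Set' 130 (NGet 82 (Var 128 + Var 126)) ;;
    If' (BEq (Var 130) (NCst 0)) Skip (
      If' (BEq (NGet 82 (Var 129 + Var 126)) (Var 130)) (
        If' (BEq (NGet 41 (Var 33 + Var 126)) (NGet 42 (Var 33 + Var 126))) Skip
          (Set' 124 (NCst 0)) ;;
        For 127 (Var 33) (
          If' (BAnd (BAnd (BNot (BEq (NGet 82 (Var 128 + Var 127)) (NCst 0)))
                 (BEq (NGet 82 (Var 129 + Var 127)) (NGet 82 (Var 128 + Var 127))))
               (BAnd (BNot (BAnd (BLt (NGet 41 (Var 126)) (NGet 41 (Var 127)))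
                                 (BLt (NGet 42 (Var 126)) (NGet 42 (Var 127)))))
                     (BNot (BAnd (BNot (BLt (NGet 41 (Var 126)) (NGet 41 (Var 127))))
                                 (BNot (BLt (NGet 42 (Var 126)) (NGet 42 (Var 127))))))))
            (Set' 124 (NCst 0)) Skip))
        (If' (BAnd (BEq (NGet 42 (Var 33 + Var 126)) (NCst 0))
                   (BLt (NGet 42 (Var 33 + Var 33 + Var 126)) (NGet 5 (Var 130 - NCst 1))))
          (Set' 124 (NCst 0)) Skip))) ;;
  For 126 (Var 33) (
    Set' 130 (NGet 82 (Var 128 + Var 126)) ;;
    If' (BAnd (BNot (BEq (Var 130) (NCst 0))) (BEq (NGet 82 (Var 129 + Var 126)) (Var 130)))
      (Set' 131 (NGet 41 (Var 33 + Var 33 + Var 126) + NGet 42 (Var 33 + Var 33 + Var 126)) ;;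
       If' (BLe (Var 21) (Var 131)) (NSet 41 (Var 33 + Var 33 + Var 126) (Var 21 - NCst 1))
         (NSet 41 (Var 33 + Var 33 + Var 126) (Var 131))) Skip) ;;
  Encode)%cmd.

Definition CheckInit : cmd := (
  Set' 20 (Var 121) ;; Decode 41 ;; Set' 128 (NGet 83 (Var 120)) ;; Set' 124 (NCst 1) ;;
  For 126 (Var 33) (
    Set' 131 (NCst 0) ;;
    For 127 (Var 33) (
      If' (BAnd (BNot (BEq (NGet 82 (Var 128 + Var 127)) (NCst 0)))
                (BLt (NGet 41 (Var 127)) (NGet 41 (Var 126))))
        (Set' 131 (Var 131 + NCst 1)) Skip) ;;
    If' (BLe (NGet 110 (Var 120) - NCst 1) (Var 131))
      (Set' 132 (NGet 111 (Var 128 + Var 126))) (Set' 132 (NCst 0)) ;;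
    If' (BLe (NGet 41 (Var 33 + Var 33 + Var 126)) (Var 132)) Skip (Set' 124 (NCst 0))))%cmd.

Lemma forall_iota K (P : nat -> bool) : [forall c : 'I_K, P c] = all P (iota 0 K).
Proof.
apply/forallP/allP => [H c|H c]; last by apply: H; rewrite mem_iota /=.
by rewrite mem_iota /= => cK; apply: (H (Ordinal cK)).
Qed.

Lemma all_iotaS K (P : nat -> bool) : all P (iota 0 K.+1) = all P (iota 0 K) && P K.
Proof. by rewrite -addn1 iotaD all_cat /= andbT. Qed.

Lemma card_iota K (P : nat -> bool) : #|[set c : 'I_K | P c]| = count P (iota 0 K).
Proof.
rewrite cardsE -sum1_card big_mkcond /= -(big_mkord xpredT (fun c => if P c then 1 else 0)).
by rewrite -sum1_count [RHS]big_mkcond /index_iota subn0.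
Qed.

Lemma count_iotaS K (P : nat -> bool) : count P (iota 0 K.+1) = count P (iota 0 K) + P K.
Proof. by rewrite -addn1 iotaD count_cat /= addn0. Qed.

Section Tables.
Variables (R : realType).
Implicit Types s : state R.

(** Two codes of [3 * K] digits are decoded by subtraction, pairs of colours are compared, and one
    code is encoded. *)
Definition step_cost K b := 6 * K * (b ^ (3 * K) * 8 + 12) + K * (K * 6 + 40) + 3 * K * (b * 4 + 8) + 60.

Lemma Step_wp s K b q x a :
  let vn := vn_in K s in let par := nmem s 84 in let cst := nmem s 5 in
  nmem s 33 0 = K -> nmem s 21 0 = b -> nmem s 22 0 = 3 * K -> 0 < b ->
  nmem s 120 0 = q -> nmem s 121 0 = x -> nmem s 122 0 = a -> x < b ^ (3 * K) -> a < b ^ (3 * K) ->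
  wp Step s (step_cost K b) (fun s' => [/\ (nmem s' 124 0 != 0) = valid K b vn par cst q x a,
    nmem s' 29 0 = after K b vn par q x a & forall c, c < 3 * K -> nmem s' 42 c = digit_of b c a]).
Proof.
move=> vn par cst s33 s21 s22 b0 s120 s121 s122 xD aD.
have vnE q' c : c < K -> nmem s 82 (nmem s 83 q' + c) = vn q' c by move=> cK; rewrite /vn /vn_in cK.
eapply wp_le.
  eapply wp_seq; apply: wp_nset => /=.
  eapply wp_seq, wp_call; first by apply: (Decode_wp (x := x) (b := b) (L := 3 * K)); rewrite //= /upd /= s121.
  move=> s1 fr1 d41.
  have {fr1} fr1 arr : arr \notin [:: 20; 23; 24; 25; 26; 41] -> nmem s1 arr = nmem s arr.
    by move=> h; rewrite (frn fr1) /= ?upd_neq //; move: h; rewrite /= !inE; lia.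
  eapply wp_seq; apply: wp_nset => /=.
  eapply wp_seq, wp_call; first by apply: (Decode_wp (x := a) (b := b) (L := 3 * K)); rewrite //= /upd /= fr1.
  move=> s2 fr2 d42.
  have e41 c : c < 3 * K -> nmem s2 41 c = digit_of b c x by move=> cK; rewrite (frn fr2) //= /upd /= d41.
  have {}fr2 arr : arr \notin [:: 20; 23; 24; 25; 26; 41; 42] -> nmem s2 arr = nmem s arr.
    by move=> h; rewrite (frn fr2) /= ?upd_neq ?fr1 //; move: h; rewrite /= !inE; lia.
  do 4 (eapply wp_seq; apply: wp_nset => /=).
  rewrite !fr2 //= /upd /= !fr2 //=.
  set s3 := setn _ _ _ _.
  have m3 arr : arr \notin [:: 20; 23; 24; 25; 26; 41; 42; 123; 124; 128; 129] -> nmem s3 arr = nmem s arr.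
    move=> h; rewrite -fr2; last by move: h; rewrite !inE; lia.
    by rewrite /s3 /= !upd_neq //; move: h; rewrite !inE; lia.
  have m128 : nmem s3 128 0 = nmem s 83 q by rewrite /s3 /= /upd /= s120.
  have m129 : nmem s3 129 0 = nmem s 83 (par q) by rewrite /s3 /= /upd /= s120.
  have m41 c : c < 3 * K -> nmem s3 41 c = digit_of b c x by move=> cK; rewrite /s3 /= /upd /= e41.
  have m42 c : c < 3 * K -> nmem s3 42 c = digit_of b c a by move=> cK; rewrite /s3 /= /upd /= d42.
  have m124 : nmem s3 124 0 = 1 by rewrite /s3 /= /upd.
  clearbody s3.
  pose shc c d := (rankd b x c < rankd b x d) == (rankd b a c < rankd b a d).
  pose cond c := (vn q c != 0) ==>
    if vn (par q) c == vn q c then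
      (seedd K b x c == seedd K b a c) && all (fun d => shared vn par q d ==> shc c d) (iota 0 K)
    else (seedd K b a c != 0) || (cst (vn q c).-1 <= accd K b a c).
  eapply wp_seq, (wp_for (N := K) (T := K * 6 + 20) (Inv := fun i s4 => (nmem s4 124 0 != 0) = all cond (iota 0 i))).
  - by rewrite /= m3 // s33.
  - by [].
  - by [].
  - by rewrite m124.
  - move=> i s4 iK xi fr4 H.
    have n33 : nmem s4 33 0 = K by rewrite (frn fr4) // m3.
    have n82 : nmem s4 82 = nmem s 82 by rewrite (frn fr4) // m3.
    have n5 : nmem s4 5 = nmem s 5 by rewrite (frn fr4) // m3.
    have n128 : nmem s4 128 0 = nmem s 83 q by rewrite (frn fr4) // m3.
    have n129 : nmem s4 129 0 = nmem s 83 (par q) by rewrite (frn fr4) // m3.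
    have n41 c : c < 3 * K -> nmem s4 41 c = digit_of b c x by move=> cK; rewrite (frn fr4) // m41.
    have n42 c : c < 3 * K -> nmem s4 42 c = digit_of b c a by move=> cK; rewrite (frn fr4) // m42.
    rewrite all_iotaS -H.
    eapply wp_le.
      eapply wp_seq; apply: wp_nset => /=; rewrite /upd /= xi n128 n82 vnE //.
      apply: wp_if => /=; rewrite /upd /= => t1.
        by apply: wp_skip; rewrite /= /cond t1 andbT.
      apply: wp_if => /=; rewrite /upd /= xi n129 n82 vnE // => t2.
        eapply wp_seq; eapply (wp_call (Q := fun s5 => (nmem s5 124 0 != 0) = (nmem s4 124 0 != 0) && (seedd K b x i == seedd K b a i))).
          apply: wp_if => /=; rewrite /upd /= n33 xi n41 ?n42; try by lia.
            by move=> e; apply: wp_skip; rewrite /= /seedd e andbT.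
          by move=> e; apply: wp_nset; rewrite /= /upd /= /seedd (negPf e) andbF.
        move=> s5 fr5 H5.
        eapply (wp_for (N := K) (T := 3) (Inv := fun d s6 => (nmem s6 124 0 != 0) = (nmem s5 124 0 != 0) && all (fun d => shared vn par q d ==> shc i d) (iota 0 d))).
        * by rewrite /= (frn fr5) //= /upd /= n33.
        * by [].
        * by [].
        * by rewrite andbT.
        * move=> d s6 dK xd fr6 H6.
          have o82 : nmem s6 82 = nmem s 82 by rewrite (frn fr6) // (frn fr5) /= ?upd_neq.
          have o128 : nmem s6 128 0 = nmem s 83 q by rewrite (frn fr6) // (frn fr5) /= ?upd_neq.
          have o129 : nmem s6 129 0 = nmem s 83 (par q) by rewrite (frn fr6) // (frn fr5) /= ?upd_neq.
          have o126 : nmem s6 126 0 = i by rewrite (frn fr6) // (frn fr5) /= ?upd_neq.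
          have o41 c : c < 3 * K -> nmem s6 41 c = digit_of b c x by move=> cK; rewrite (frn fr6) // (frn fr5) /= ?upd_neq ?n41.
          have o42 c : c < 3 * K -> nmem s6 42 c = digit_of b c a by move=> cK; rewrite (frn fr6) // (frn fr5) /= ?upd_neq ?n42.
          have i3 : i < 3 * K by rewrite (leq_trans iK) ?leq_pmull.
          have d3 : d < 3 * K by rewrite (leq_trans dK) ?leq_pmull.
          (* Conditions cannot be compared with each other, so disagreement is tested as neither
             both nor none. *)
          have E : (vn q d != 0) && (vn (par q) d == vn q d) && (~~ ((rankd b x i < rankd b x d) && (rankd b a i < rankd b a d))
            && ~~ (~~ (rankd b x i < rankd b x d) && ~~ (rankd b a i < rankd b a d))) =
            ~~ (shared vn par q d ==> shc i d).
            rewrite /shared /shc; case: (vn q d != 0); case: (vn (par q) d == _); case: (rankd b x i < _); by case: (rankd b a i < _).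
          rewrite all_iotaS andbA -H6.
          eapply wp_le.
            apply: wp_if => /=; rewrite xd o126 o128 o129 o82 !vnE // !o41 ?o42 //;
            rewrite -![digit_of b _ x]/(rankd b x _) -![digit_of b _ a]/(rankd b a _) E => t3.
              by apply: wp_nset; rewrite /= /upd /= (negPf t3) andbF.
            by apply: wp_skip; rewrite negbK in t3; rewrite t3 andbT.
          by [].
        * move=> s6 _ ->; rewrite H5 /cond t1 /= t2 -andbA.
          by [].
      eapply wp_le.
        apply: wp_if => /=; rewrite /upd /= n33 xi n5 !n42 ?subn1; try (by lia); move=> t3.
          apply: wp_nset; rewrite /= /upd /= /cond t1 /= (negPf t2) /seedd /accd.
          by case/andP: t3 => -> /=; rewrite ltnNge mul2n -addnn => /negPf->; rewrite andbF.
        apply: wp_skip; rewrite /= /upd /= /cond t1 /= (negPf t2) /seedd /accd.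
        by move: t3; rewrite negb_and -leqNgt mul2n -addnn => ->; rewrite andbT.
      by [].
    by lia.
  - move=> s4 fr4 H4.
    have Ev : all cond (iota 0 K) = valid K b vn par cst q x a.
      rewrite -forall_iota /valid; apply: eq_forallb => c; rewrite /cond; congr (_ ==> _).
      by case: ifP => // _; rewrite -(forall_iota _ (fun d => shared vn par q d ==> shc c d)).
    rewrite Ev in H4.
    have n33 : nmem s4 33 0 = K by rewrite (frn fr4) // m3.
    have n82 : nmem s4 82 = nmem s 82 by rewrite (frn fr4) // m3.
    have n128 : nmem s4 128 0 = nmem s 83 q by rewrite (frn fr4) // m3.
    have n129 : nmem s4 129 0 = nmem s 83 (par q) by rewrite (frn fr4) // m3.
    have n21 : nmem s4 21 0 = b by rewrite (frn fr4) // m3.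
    have n22 : nmem s4 22 0 = 3 * K by rewrite (frn fr4) // m3.
    have n41 c : c < 3 * K -> nmem s4 41 c = digit_of b c x by move=> cK; rewrite (frn fr4) // m41.
    have n42 c : c < 3 * K -> nmem s4 42 c = digit_of b c a by move=> cK; rewrite (frn fr4) // m42.
    eapply wp_seq, (wp_for (N := K) (T := 9) (Inv := fun i s5 => forall c, c < 3 * K ->
       nmem s5 41 c = if c < 2 * K + i then after_digit K b vn par q x a c else digit_of b c x)).
    + by rewrite /= n33.
    + by [].
    + by [].
    + by move=> c cK; rewrite n41 // addn0 /after_digit; case: ltnP => // lt; rewrite leqNgt lt.
    + move=> i s5 iK xi fr5 H.
      have o33 : nmem s5 33 0 = K by rewrite (frn fr5).
      have o82 : nmem s5 82 = nmem s 82 by rewrite (frn fr5).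
      have o128 : nmem s5 128 0 = nmem s 83 q by rewrite (frn fr5).
      have o129 : nmem s5 129 0 = nmem s 83 (par q) by rewrite (frn fr5).
      have o21 : nmem s5 21 0 = b by rewrite (frn fr5).
      have o42 c : c < 3 * K -> nmem s5 42 c = digit_of b c a by move=> cK; rewrite (frn fr5) // n42.
      have K2 : K + K + i = 2 * K + i by lia.
      have post v : v = after_digit K b vn par q x a (2 * K + i) -> forall f : nat -> nat,
        (forall c, f c = if c == 2 * K + i then v else nmem s5 41 c) ->
        forall c, c < 3 * K -> f c = if c < 2 * K + i.+1 then after_digit K b vn par q x a c else digit_of b c x.
        move=> vE f fE c cK; rewrite fE addnS ltnS leq_eqVlt; case: (c =P 2 * K + i) => [->//|_] /=.
        exact: H.
      have l2 : 2 * K + i < 3 * K by lia.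
      eapply wp_le.
        eapply wp_seq; apply: wp_nset => /=; rewrite /upd /= xi o128 o82 vnE //.
        apply: wp_if => /=; rewrite /upd /= xi o129 o82 !vnE // => t.
          eapply wp_seq; apply: wp_nset => /=; rewrite /upd /= xi o33 K2 o42 // H // ltnn.
          apply: wp_if => /=; rewrite /upd /= o21 => t2; apply: wp_nset; apply: (post _ _) => [|c];
            rewrite /= /upd /= ?o33 ?xi ?K2 ?o21 // /after_digit leq_addr addKn /shared t //=.
          - by rewrite (minn_idPl _) ?subn1 //; lia.
          - by rewrite (minn_idPr _) //; lia.
        apply: wp_skip; apply: (post _ _ (nmem s5 41)) => [|c].
          reflexivity.
        case: eqP => // ->; rewrite H // ltnn /after_digit leq_addr addKn /shared.
        by rewrite (negPf t).
      by [].
    + move=> s5 fr5 H5.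
      eapply wp_call; first by apply: (Encode_wp (b := b) (L := 3 * K)); rewrite (frn fr5).
      move=> s6 fr6 E6; split.
      * by rewrite (frn fr6) // (frn fr5).
      * rewrite E6; apply: eq_enc => c cK; rewrite H5 // ifT //; lia.
      * by move=> c cK; rewrite (frn fr6) // (frn fr5) // n42.
rewrite /= /step_cost.
have h1 : 3 * K * (x * 8 + 12) <= 3 * K * (b ^ (3 * K) * 8 + 12) by rewrite leq_mul2l; apply/orP; right; lia.
have h2 : 3 * K * (a * 8 + 12) <= 3 * K * (b ^ (3 * K) * 8 + 12) by rewrite leq_mul2l; apply/orP; right; lia.
lia.
Qed.

Lemma CheckInit_wp s K b q x :
  let vn := vn_in K s in
  nmem s 33 0 = K -> nmem s 21 0 = b -> nmem s 22 0 = 3 * K -> 0 < b ->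
  nmem s 120 0 = q -> nmem s 121 0 = x -> x < b ^ (3 * K) ->
  wp CheckInit s (step_cost K b) (fun s' => (nmem s' 124 0 != 0) =
    initok K b vn (nmem s 110) (rv_in K s) q x).
Proof.
move=> vn s33 s21 s22 b0 s120 s121 xD.
have vnE q' c : c < K -> nmem s 82 (nmem s 83 q' + c) = vn q' c by move=> cK; rewrite /vn /vn_in cK.
have rvE q' c : c < K -> nmem s 111 (nmem s 83 q' + c) = rv_in K s q' c by move=> cK; rewrite /rv_in cK.
eapply wp_le.
  eapply wp_seq; apply: wp_nset => /=.
  eapply wp_seq, wp_call; first by apply: (Decode_wp (x := x) (b := b) (L := 3 * K)); rewrite //= /upd /= s121.
  move=> s1 fr1 d41.
  eapply wp_seq; apply: wp_nset => /=; eapply wp_seq; apply: wp_nset => /=.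
  have {fr1} fr1 arr : arr \notin [:: 20; 23; 24; 25; 26; 41] -> nmem s1 arr = nmem s arr.
    by move=> h; rewrite (frn fr1) /= ?upd_neq //; move: h; rewrite /= !inE; lia.
  rewrite /upd /= !fr1 //= s120.
  pose cond c := accd K b x c <= promise K b vn (nmem s 110) (rv_in K s) q x c.
  eapply (wp_for (N := K) (T := K * 6 + 20) (Inv := fun i s4 => (nmem s4 124 0 != 0) = all cond (iota 0 i))).
  - by rewrite /= /upd /= fr1.
  - by [].
  - by [].
  - by rewrite /= /upd.
  - move=> i s4 iK xi fr4 H.
    have n33 : nmem s4 33 0 = K by rewrite (frn fr4) //= /upd /= fr1.
    have n82 : nmem s4 82 = nmem s 82 by rewrite (frn fr4) //= /upd /= fr1.
    have n110 : nmem s4 110 = nmem s 110 by rewrite (frn fr4) //= /upd /= fr1.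
    have n111 : nmem s4 111 = nmem s 111 by rewrite (frn fr4) //= /upd /= fr1.
    have n120 : nmem s4 120 0 = q by rewrite (frn fr4) //= /upd /= fr1.
    have n128 : nmem s4 128 0 = nmem s 83 q by rewrite (frn fr4).
    have n41 c : c < 3 * K -> nmem s4 41 c = digit_of b c x.
      by move=> cK; rewrite (frn fr4) //= /upd /= d41.
    rewrite all_iotaS -H.
    pose P d := (vn q d != 0) && (rankd b x d < rankd b x i).
    eapply wp_le.
      eapply wp_seq; apply: wp_nset => /=.
      eapply wp_seq, (wp_for (N := K) (T := 3) (Inv := fun d s5 => nmem s5 131 0 = count P (iota 0 d))).
      + by [].
      + by [].
      + by [].
      + by [].
      + move=> d s5 dK xd fr5 H5.
        have i3 : i < 3 * K by rewrite (leq_trans iK) ?leq_pmull.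
        have d3 : d < 3 * K by rewrite (leq_trans dK) ?leq_pmull.
        rewrite count_iotaS -H5.
        eapply wp_le.
          apply: wp_if => /=; rewrite xd !(frn (a := 41) fr5) //= !(frn (a := 128) fr5) //= (frn (a := 82) fr5) //=
            (frn (a := 126) fr5) //= /upd /= xi n128 n82 vnE // !n41 //;
            rewrite -![digit_of b _ x]/(rankd b x _) -/(P d) => t.
            by apply: wp_nset; rewrite /= /upd /= t.
          by apply: wp_skip; rewrite (negPf t) addn0.
        by [].
      + move=> s5 fr5 H5.
        have o33 : nmem s5 33 0 = K by rewrite (frn fr5) //= /upd /= n33.
        have o110 : nmem s5 110 = nmem s 110 by rewrite (frn fr5).
        have o111 : nmem s5 111 = nmem s 111 by rewrite (frn fr5).
        have o120 : nmem s5 120 0 = q by rewrite (frn fr5).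
        have o128 : nmem s5 128 0 = nmem s 83 q by rewrite (frn fr5).
        have o126 : nmem s5 126 0 = i by rewrite (frn fr5).
        have o124 : nmem s5 124 0 = nmem s4 124 0 by rewrite (frn fr5).
        have o41 c : c < 3 * K -> nmem s5 41 c = digit_of b c x by move=> cK; rewrite (frn fr5) //= /upd /= n41.
        eapply wp_seq, (wp_call (Q := fun s6 => nmem s6 132 0 = promise K b vn (nmem s 110) (rv_in K s) q x i)).
          rewrite /promise /preds (card_iota K P).
          apply: wp_if => /=; rewrite o110 o120 H5 => t; apply: wp_nset; rewrite /= /upd /=.
            by rewrite t o111 o128 o126 rvE.
          by rewrite (negPf t).
        move=> s6 fr6 E6.
        apply: wp_if => /=; rewrite E6 !(frn (a := 33) fr6) // (frn (a := 126) fr6) // (frn (a := 41) fr6) //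
           o33 o126 o41; try (by lia); rewrite (_ : K + K + i = 2 * K + i) ?mul2n ?addnn //= => t.
          by apply: wp_skip; rewrite (frn fr6) // o124 /cond /accd mul2n t andbT.
        by apply: wp_nset; rewrite /= /upd /= /cond /accd mul2n (negPf t) andbF.
    by lia.
  - by move=> s4 _ ->; rewrite -forall_iota.
rewrite /= /step_cost.
have h1 : 3 * K * (x * 8 + 12) <= 3 * K * (b ^ (3 * K) * 8 + 12) by rewrite leq_mul2l; apply/orP; right; lia.
lia.
Qed.

End Tables.

(** * Writing down the linear program *)

(* Registers: 112 number of items, 114 next variable, 115 row of the product of the
   current merge, 116 and 117 row and column of an entry, 118 distance of opposite
   inequalities, 119 first seed row.  Array 125 is [ver], array 136 the first variable
   of each merge. *)
Definition Put (row : nexpr) (neg : bool) : cmd := (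
  NSet 7 (NGet 6 (NCst 2)) row ;;
  NSet 8 (NGet 6 (NCst 2)) (Var 117) ;;
  RSet 1 (NGet 6 (NCst 2))
    (if neg then RSub (RNat (NCst 0)) (RNat (NCst 1)) else RNat (NCst 1)) ;;
  NSet 6 (NCst 2) (NGet 6 (NCst 2) + NCst 1))%cmd.

Definition Emit (neg : bool) : cmd :=
  (Put (Var 116) neg ;; Put (Var 118 + Var 116) (~~ neg))%cmd.

Definition EmitOp : cmd := (
  Step ;;
  If' (BEq (Var 124) (NCst 0)) Skip (
    Set' 117 (Var 114) ;;
    Set' 116 (Var 115 + Var 29) ;; Emit false ;;
    Set' 116 (NGet 125 (NGet 84 (Var 120)) + Var 121) ;; Emit true ;;
    Set' 116 (NGet 125 (Var 120) + Var 122) ;; Emit true ;;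
    For 133 eN (
      If' (BAnd (BEq (NGet 80 (Var 133)) (Var 120))
                (BNot (BEq (NGet 42 (Var 33 + NGet 81 (Var 133))) (NCst 0))))
        (Set' 116 (Var 119 + Var 133) ;; Emit true) Skip)) ;;
  Set' 114 (Var 114 + NCst 1))%cmd.

Definition EmitOps : cmd :=
  For 134 (Var 112) (
    NSet 136 (Var 134) (Var 114) ;;
    Set' 120 (Var 112 - Var 134) ;;
    For 121 (Var 30) (For 122 (Var 30) EmitOp) ;;
    NSet 125 (NGet 84 (Var 120)) (Var 115) ;;
    Set' 115 (Var 115 + Var 30))%cmd.

Definition EmitSeeds : cmd :=
  For 133 eN (
    Set' 116 (Var 119 + Var 133) ;; Set' 117 (Var 133) ;; Emit false ;;
    RSet 3 (Var 133) (RGet 0 (Var 133)))%cmd.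

Definition EmitInits : cmd := (
  Set' 135 (NCst 0) ;;
  For 120 (Var 112 + NCst 1) (
    For 121 (Var 30) (
      CheckInit ;;
      If' (BEq (Var 124) (NCst 0)) Skip
        (Set' 116 (Var 135) ;; Set' 117 (Var 114) ;; Emit false) ;;
      Set' 114 (Var 114 + NCst 1) ;; Set' 135 (Var 135 + NCst 1))))%cmd.

Definition EmitRest : cmd := (
  For 133 (Var 114)
    (Set' 117 (Var 133) ;; Put (Var 118 + Var 118 + Var 133) false) ;;
  RSet 2 (Var 119 - Var 30) (RNat (NCst 1)) ;;
  RSet 2 (Var 118 + (Var 119 - Var 30)) (RSub (RNat (NCst 0)) (RNat (NCst 1))) ;;
  NSet 6 (NCst 0) (Var 114) ;;
  NSet 6 (NCst 1) (Var 118 + Var 118 + Var 114))%cmd.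

Section Emission.
Variable R : realType.
Implicit Types s : state R.

Definition asum s (r : nat) (Y : nat -> R) : R :=
  (\sum_(p < nmem s 6 2 | nmem s 7 p == r) rmem s 1 p * Y (nmem s 8 p))%R.

Definition inside s W H := forall p, p < nmem s 6 2 -> nmem s 8 p < W /\ nmem s 7 p < H.

(** Equation [r] is kept as the opposite inequalities [r] and [H + r]. Stating this for all [Y] at
    once identifies the stored triples with the linear form [E], whatever their order. *)
Definition emitted s (H W : nat) (E : (nat -> R) -> nat -> R) :=
  (forall Y r, r < H -> asum s r Y = E Y r /\ asum s (H + r) Y = (- E Y r)%R) /\
  inside s W (H + H).

Lemma asum_eq s s' r Y : nmem s' 6 2 = nmem s 6 2 ->
  (forall p, p < nmem s 6 2 -> [/\ nmem s' 7 p = nmem s 7 p, nmem s' 8 p = nmem s 8 p &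
    rmem s' 1 p = rmem s 1 p]) -> asum s' r Y = asum s r Y.
Proof.
move=> e6 e; rewrite /asum e6 (eq_bigl (fun p : 'I_(nmem s 6 2) => nmem s 7 p == r)) => [|p].
  by apply: eq_bigr => p _; have [_ -> ->] := e p (ltn_ord p).
by have [-> _ _] := e p (ltn_ord p).
Qed.

Lemma emitted_same s s' H W E : nmem s' 6 2 = nmem s 6 2 -> nmem s' 7 = nmem s 7 ->
  nmem s' 8 = nmem s 8 -> rmem s' 1 = rmem s 1 -> emitted s H W E -> emitted s' H W E.
Proof.
move=> e6 e7 e8 e1 [h1 h2]; split=> [Y r rH|p]; last by rewrite e6 e7 e8; apply: h2.
by rewrite !(@asum_eq s s') ?e7 ?e8 ?e1 //; apply: h1.
Qed.

Lemma emitted_ext s H W E E' : (forall Y r, r < H -> E Y r = E' Y r) ->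
  emitted s H W E -> emitted s H W E'.
Proof. by move=> e [h1 h2]; split=> // Y r rH; rewrite -e //; apply: h1. Qed.

Lemma Put_wp s row neg :
  wp (Put row neg) s 4 (fun s' =>
    [/\ nmem s' 6 2 = (nmem s 6 2).+1,
      forall r Y, asum s' r Y =
       (asum s r Y + (neval s row == r)%N%:R * ((if neg then -1 else 1) * Y (nmem s 117 0)))%R,
      forall W H, inside s W H -> nmem s 117 0 < W -> neval s row < H -> inside s' W H &
      forall i, i != 2 -> nmem s' 6 i = nmem s 6 i]).
Proof.
have vE (s1 : state R) : reval s1 (if neg then RSub (RNat (NCst 0)) (RNat (NCst 1)) else RNat (NCst 1)) =
    (if neg then -1 else 1)%R by case: neg; rewrite /= ?sub0r.
eapply wp_le.
  do 2 (eapply wp_seq; apply: wp_nset => /=).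
  eapply wp_seq; apply: wp_rset => /=.
  apply: wp_nset.
  set c := nmem s 6 2; set s' := setn _ _ _ _.
  have e6 : nmem s' 6 2 = c.+1 by rewrite /s' /= /upd /= addn1.
  have e7 p : nmem s' 7 p = if p == c then neval s row else nmem s 7 p by rewrite /s' /= /upd /=.
  have e8 p : nmem s' 8 p = if p == c then nmem s 117 0 else nmem s 8 p by rewrite /s' /= /upd /=.
  have e1 p : rmem s' 1 p = if p == c then (if neg then -1 else 1)%R else rmem s 1 p.
    by rewrite /s' /= vE /upd /=.
  have e6' i : i != 2 -> nmem s' 6 i = nmem s 6 i by move=> /negPf ne; rewrite /s' /= /upd /= ne.
  clearbody s'; split=> //.
  - move=> r Y; rewrite /asum e6 big_mkcond big_ord_recr /= e7 e8 e1 eqxx; congr (_ + _)%R; last first.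
      by case: eqP; rewrite ?mul1r ?mul0r.
    rewrite [RHS]big_mkcond; apply: eq_bigr => p _.
    by rewrite e7 e8 e1 (ltn_eqF (ltn_ord p)).
  - move=> W H ins cW rH p; rewrite e6 e7 e8 ltnS leq_eqVlt; case: (p =P c) => //= _.
    exact: ins.
by [].
Qed.

Lemma Emit_wp s H W E neg r0 col : nmem s 118 0 = H -> nmem s 116 0 = r0 -> nmem s 117 0 = col ->
  r0 < H -> col < W -> emitted s H W E ->
  wp (Emit neg) s 8 (fun s' =>
    emitted s' H W (fun Y r => E Y r + (r0 == r)%N%:R * ((if neg then -1 else 1) * Y col))%R).
Proof.
move=> s118 s116 s117 rH cW [h1 h2]; eapply wp_le.
  eapply wp_seq, wp_call; first exact: Put_wp.
  move=> s1 fr1 [e6 e1 i1 _].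
  have k118 : nmem s1 118 0 = H by rewrite (frn fr1).
  have k116 : nmem s1 116 0 = r0 by rewrite (frn fr1).
  have k117 : nmem s1 117 0 = col by rewrite (frn fr1).
  apply: wp_call; first exact: Put_wp.
  move=> s2 _ [e6' e2 i2 _]; split; last first.
    apply: i2; rewrite /= ?k117 ?k118 ?k116 ?ltn_add2l //; apply: i1; rewrite /= ?s117 ?s116 //.
    by rewrite ltn_addr.
  move=> Y r rL; have [a1 a2] := h1 Y r rL.
  rewrite !e2 !e1 a1 a2 /= k118 k116 s116 s117 k117 eqn_add2l.
  rewrite [(H + r0 == r)%N]gtn_eqF ?ltn_addr // [(r0 == H + r)%N]ltn_eqF ?ltn_addr //.
  have sg (c : bool) : (if ~~ c then -1 else 1)%R = (- (if c then -1 else 1))%R :> R by case: c; rewrite ?opprK.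
  by rewrite sg /= !mul0r !addr0; split=> //; ring.
by [].
Qed.

End Emission.

Lemma sum_ltS (T : nmodType) n (F : 'I_n -> T) i (iN : i < n) :
  (\sum_(u < n | (u < i.+1)%N) F u = \sum_(u < n | (u < i)%N) F u + F (Ordinal iN))%R.
Proof.
rewrite (bigD1 (Ordinal iN)) /= ?ltnSn // addrC; congr (_ + _)%R; apply: eq_bigl => u.
by rewrite -val_eqE /= ltnS ltn_neqAle andbC.
Qed.

(** * The stored triples are the hyperflow system *)

Section EmitProgram.
Variables (R : realType) (n m N K b : nat) (s0 : state R).
Implicit Types s : state R.
Local Notation Q := (N + m).
Local Notation D := (b ^ (3 * K)).
Let vn := vn_in K s0.
Let par := nmem s0 84.
Let cst := nmem s0 5.
Let birth : 'I_n -> nat := birth_in s0.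
Let sdf a (i : 'I_n) := seedd K b a (nmem s0 81 i) != 0.
Local Notation valid := (valid K b vn par cst).
Local Notation after := (after K b vn par).
Local Notation initok := (initok K b vn (nmem s0 110) (rv_in K s0)).
Local Notation wop := (@wop R n Q D par after birth sdf).
Local Notation RB := (RB Q D).
Local Notation H := (RB + n).
Local Notation W := (NV n Q D).
Local Notation vop := (vop n D).
Local Notation vg := (vg n Q D).
Local Notation ver := (ver Q D par).
Local Notation orow := (orow Q D).

Definition fixed_arrays := [:: 0; 5; 21; 22; 30; 33; 80; 81; 82; 83; 84; 110; 111; 112; 118; 119].

Definition ctx s := (forall a, a \in fixed_arrays -> nmem s a = nmem s0 a) /\ rmem s 0 = rmem s0 0.

Hypothesis b0 : 0 < b.
Hypothesis n0 : nmem s0 0 0 = n.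
Hypothesis K0 : nmem s0 33 0 = K.
Hypothesis b21 : nmem s0 21 0 = b.
Hypothesis L22 : nmem s0 22 0 = 3 * K.
Hypothesis D30 : nmem s0 30 0 = D.
Hypothesis Q112 : nmem s0 112 0 = Q.
Hypothesis H118 : nmem s0 118 0 = H.
Hypothesis RB119 : nmem s0 119 0 = RB.
Hypothesis Q0 : 0 < Q.
Hypothesis par_lt : forall q, 0 < q <= Q -> par q < q.
Hypothesis colK : forall u : 'I_n, nmem s0 81 u < K.

Lemma D_gt0 : 0 < D. Proof. by rewrite expn_gt0 b0. Qed.

Lemma ctx_frame c s s' : frame c s s' -> all (fun a => a \notin nwr c) fixed_arrays ->
  0 \notin rwr c -> ctx s -> ctx s'.
Proof.
move=> fr /allP h h0 [cx cr]; split; last by rewrite (frr fr).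
by move=> a aF; rewrite (frn fr) ?cx // h.
Qed.

Lemma ctx_vn s : ctx s -> vn_in K s = vn.
Proof.
move=> [cx _]; apply: funext => q; apply: funext => c; rewrite /vn /vn_in.
by rewrite (cx 82) // (cx 83).
Qed.

Lemma ctx_rv s : ctx s -> rv_in K s = rv_in K s0.
Proof.
move=> [cx _]; apply: funext => q; apply: funext => c; rewrite /rv_in.
by rewrite (cx 111) // (cx 83).
Qed.

Definition op_cost := step_cost K b + n * 18 + 45.

Lemma EmitOp_wp s it x a E : ctx s -> it < Q -> x < D -> a < D ->
  nmem s 120 0 = Q - it -> nmem s 121 0 = x -> nmem s 122 0 = a ->
  nmem s 115 0 = orow it -> (forall p, p <= Q -> nmem s 125 p = ver it p) ->
  nmem s 114 0 = vop it x a -> emitted s H W E ->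
  wp EmitOp s op_cost (fun s' => nmem s' 114 0 = (vop it x a).+1 /\
    emitted s' H W (fun Y r => E Y r +
      (if valid (Q - it)%N x a then wop it x a r * Y (vop it x a) else 0))%R).
Proof.
move=> cx iQ xD aD s120 s121 s122 s115 s125 s114 em.
have [q0 qQ pq pQ] := qP par_lt iQ.
have [cn cr] := cx.
have vW : vop it x a < W.
  by have /andP[_ h] := vop_lt n iQ xD aD; apply: leq_trans h _; rewrite leq_add2l leq_addr.
have lrow t : t < RB -> t < H by move=> h; apply: leq_trans h (leq_addr _ _).
eapply wp_le.
  eapply wp_seq, wp_call.
    by apply: (Step_wp (K := K) (b := b) (q := Q - it) (x := x) (a := a)); rewrite ?(cn 33) ?(cn 21) ?(cn 22).
  move=> s1 fr1; rewrite (ctx_vn cx) (cn 84) // (cn 5) // => -[e124 e29 e42].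
  have cx1 : ctx s1 by apply: (ctx_frame fr1).
  have em1 : emitted s1 H W E by apply: emitted_same em; rewrite ?(frn fr1) ?(frr fr1).
  have k120 : nmem s1 120 0 = Q - it by rewrite (frn fr1).
  have k121 : nmem s1 121 0 = x by rewrite (frn fr1).
  have k122 : nmem s1 122 0 = a by rewrite (frn fr1).
  have k115 : nmem s1 115 0 = orow it by rewrite (frn fr1).
  have k114 : nmem s1 114 0 = vop it x a by rewrite (frn fr1).
  have k125 : nmem s1 125 = nmem s 125 by rewrite (frn fr1).
  eapply wp_seq, (wp_call (Q := fun s2 => emitted s2 H W (fun Y r => E Y r +
      (if valid (Q - it)%N x a then wop it x a r * Y (vop it x a) else 0))%R)); last first.
    move=> s2 fr2 em2; apply: wp_nset; split; last by apply: emitted_same em2.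
    by rewrite /= /upd /= (frn fr2) // k114 addn1.
  apply: wp_if => /= t.
    apply: wp_skip; apply: emitted_ext em1 => Y r _.
    by rewrite -e124 t addr0.
  rewrite -e124 t.
  eapply wp_seq; apply: wp_nset => /=; eapply wp_seq; apply: wp_nset => /=.
  rewrite /upd /= k114 k115 e29.
  set s2 := setn _ _ _ _.
  have em2 : emitted s2 H W E by apply: emitted_same em1.
  have m2 arr : arr \notin [:: 116; 117] -> nmem s2 arr = nmem s1 arr.
    by move=> h; rewrite /s2 /= !upd_neq //; move: h; rewrite !inE; lia.
  have m116 : nmem s2 116 0 = orow it + after (Q - it) x a by rewrite /s2 /= /upd.
  have m117 : nmem s2 117 0 = vop it x a by rewrite /s2 /= /upd.
  clearbody s2.
  have h118 : nmem s2 118 0 = H by rewrite m2 // (proj1 cx1).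
  eapply wp_seq, wp_call.
    by apply: (Emit_wp (W := W) (E := E) _ h118 m116 m117) => //; apply/lrow/orow_lt; rewrite ?after_lt.
  move=> s3 fr3 em3.
  have m3 arr : arr \notin [:: 6; 7; 8; 116; 117] -> nmem s3 arr = nmem s1 arr.
    move=> h; rewrite (frn fr3) ?m2 //; move: h; rewrite /= !inE; lia.
  eapply wp_seq; apply: wp_nset => /=.
  rewrite !m3 // k120 k121 k125 (proj1 cx1 84) // -/par s125 //.
  set s4 := setn _ _ _ _.
  have {}em3 := @emitted_same _ s3 s4 _ _ _ (erefl _) (erefl _) (erefl _) (erefl _) em3.
  have m4 arr : arr \notin [:: 6; 7; 8; 116; 117] -> nmem s4 arr = nmem s1 arr.
    by move=> h; rewrite /s4 /= upd_neq ?m3 //; move: h; rewrite !inE; lia.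
  have m416 : nmem s4 116 0 = ver it (par (Q - it)) + x by rewrite /s4 /= /upd.
  have m417 : nmem s4 117 0 = vop it x a by rewrite /s4 /= /upd /= (frn fr3).
  clearbody s4.
  have h418 : nmem s4 118 0 = H by rewrite m4 // (proj1 cx1).
  eapply wp_seq, wp_call.
    by apply: (Emit_wp true h418 m416 m417 _ _ em3) => //; apply: ver_ltRB.
  move=> s5 fr5 em5.
  have m5 arr : arr \notin [:: 6; 7; 8; 116; 117] -> nmem s5 arr = nmem s1 arr.
    move=> h; rewrite (frn fr5) ?m4 //; move: h; rewrite /= !inE; lia.
  eapply wp_seq; apply: wp_nset => /=.
  rewrite !m5 // k120 k122 k125 s125 //.
  set s6 := setn _ _ _ _.
  have {}em5 := @emitted_same _ s5 s6 _ _ _ (erefl _) (erefl _) (erefl _) (erefl _) em5.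
  have m6 arr : arr \notin [:: 6; 7; 8; 116; 117] -> nmem s6 arr = nmem s1 arr.
    by move=> h; rewrite /s6 /= upd_neq ?m5 //; move: h; rewrite !inE; lia.
  have m616 : nmem s6 116 0 = ver it (Q - it) + a by rewrite /s6 /= /upd.
  have m617 : nmem s6 117 0 = vop it x a by rewrite /s6 /= /upd /= (frn fr5).
  clearbody s6.
  have h618 : nmem s6 118 0 = H by rewrite m6 // (proj1 cx1).
  eapply wp_seq, wp_call.
    by apply: (Emit_wp true h618 m616 m617 _ _ em5) => //; apply: ver_ltRB.
  pose E7 (Y : nat -> R) r := (E Y r + (orow it + after (Q - it) x a == r)%N%:R * (1 * Y (vop it x a))
    + (ver it (par (Q - it)) + x == r)%N%:R * (-1 * Y (vop it x a))
    + (ver it (Q - it) + a == r)%N%:R * (-1 * Y (vop it x a)))%R.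
  move=> s7 fr7 em7; 
  have {}em7 : emitted s7 H W E7 by apply: emitted_ext em7.
  have m7 arr : arr \notin [:: 6; 7; 8; 116; 117] -> nmem s7 arr = nmem s1 arr.
    move=> h; rewrite (frn fr7) ?m6 //; move: h; rewrite /= !inE; lia.
  have m717 : nmem s7 117 0 = vop it x a by rewrite (frn fr7).
  eapply (wp_for (N := n) (T := 13) (Inv := fun i s8 => nmem s8 117 0 = vop it x a /\
     emitted s8 H W (fun Y r => E7 Y r -
       \sum_(u < n | (u < i)%N) (seeded birth sdf (Q - it)%N a u && (RB + u == r))%N%:R * Y (vop it x a))%R)).
  - by rewrite /= m7 // (proj1 cx1).
  - by [].
  - by move=> i s8 j v [h1 h2]; split; [rewrite /= upd_neq | apply: emitted_same h2].
  - split=> //; apply: emitted_ext em7 => Y r _; by rewrite big_pred0 ?subr0.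
  - move=> i s8 iN xi fr8 [h117 em8].
    have m8 arr : arr \notin [:: 6; 7; 8; 116; 117; 133] -> nmem s8 arr = nmem s1 arr.
      move=> h; rewrite (frn fr8) ?m7 //; move: h; rewrite /= !inE; lia.
    have Es : (nmem s1 80 i == Q - it) && (nmem s1 42 (K + nmem s1 81 i) != 0) =
        seeded birth sdf (Q - it) a (Ordinal iN).
      rewrite /seeded /birth /birth_in /= (proj1 cx1 80) // (proj1 cx1 81) //.
      by rewrite e42 //; have := colK (Ordinal iN); rewrite /=; lia.
    eapply wp_le.
      apply: wp_if => /=; rewrite xi !m8 // k120 (proj1 cx1 33) // K0 Es => t8.
        eapply wp_seq; apply: wp_nset => /=; rewrite xi m8 // (proj1 cx1 119) // RB119.
        set s9 := setn _ _ _ _.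
        have {}em8 := @emitted_same _ s8 s9 _ _ _ (erefl _) (erefl _) (erefl _) (erefl _) em8.
        have h916 : nmem s9 116 0 = RB + i by rewrite /s9 /= /upd.
        have h917 : nmem s9 117 0 = vop it x a by rewrite /s9 /= /upd.
        have h918 : nmem s9 118 0 = H by rewrite /s9 /= /upd /= m8 // (proj1 cx1).
        clearbody s9.
        apply: wp_call; first by apply: (Emit_wp true h918 h916 h917 _ _ em8) => //; rewrite ltn_add2l.
        move=> s10 fr10 em10; split; first by rewrite (frn fr10).
        apply: emitted_ext em10 => Y r _; rewrite (sum_ltS _ iN) t8 /=; ring.
      apply: wp_skip; split=> //; apply: emitted_ext em8 => Y r _.
      by rewrite (sum_ltS _ iN) (negPf t8) /= mul0r addr0.
    by [].
  - move=> s8 fr8 [_]; apply: emitted_ext => Y r _.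
    rewrite (eq_bigl xpredT) => [|u]; last by rewrite ltn_ord.
    by rewrite -mulr_suml /E7 /wop; ring.
by rewrite /op_cost; lia.
Qed.

Local Notation g := (fun (Y : nat -> R) r it x a =>
  if valid (Q - it)%N x a then (wop it x a r * Y (vop it x a))%R else 0%R).

(** The variable register is only ever incremented, so the numbering has to run on across the ends
    of the two inner loops. *)
Lemma vopS it x a : (vop it x a).+1 = vop it x a.+1. Proof. by rewrite /vop !addnS. Qed.

Lemma vopSx it x : vop it x D = vop it x.+1 0.
Proof. by rewrite /vop addn0 addnS (mulSnr (it * D + x)). Qed.

Lemma vopSit it : vop it D 0 = vop it.+1 0 0.
Proof. by rewrite /vop !addn0 (mulSnr it). Qed.

Lemma EmitRow_wp s it x E : ctx s -> it < Q -> x < D ->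
  nmem s 120 0 = Q - it -> nmem s 121 0 = x ->
  nmem s 115 0 = orow it -> (forall p, p <= Q -> nmem s 125 p = ver it p) ->
  nmem s 114 0 = vop it x 0 -> emitted s H W E ->
  wp (For 122 (Var 30) EmitOp) s (D * (op_cost + 3) + 3) (fun s' => nmem s' 114 0 = vop it x D /\
    emitted s' H W (fun Y r => E Y r + \sum_(a < D) g Y r it x a)%R).
Proof.
move=> cx iQ xD s120 s121 s115 s125 s114 em.
eapply (wp_for (N := D) (Inv := fun a s1 => nmem s1 114 0 = vop it x a /\
   emitted s1 H W (fun Y r => E Y r + \sum_(a0 < a) g Y r it x a0)%R)).
- by rewrite /= (proj1 cx).
- by [].
- by move=> i s1 j v [h1 h2]; split; [rewrite /= upd_neq | apply: emitted_same h2].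
- by split=> //; apply: emitted_ext em => Y r _; rewrite big_ord0 addr0.
- move=> a s1 aD xa fr [h1 h2].
  have cx1 : ctx s1 by apply: (ctx_frame fr).
  apply: wp_call.
    apply: (EmitOp_wp cx1 iQ xD aD _ _ xa _ _ h1 h2); rewrite ?(frn (a := 120) fr) ?(frn (a := 121) fr) ?(frn (a := 115) fr) //.
    by move=> p pQ; rewrite (frn fr) // s125.
  move=> s2 _ [e1 e2]; split; first by rewrite e1 vopS.
  by apply: emitted_ext e2 => Y r _; rewrite big_ord_recr /= addrA.
- by [].
Qed.

Definition ops_cost := Q * (D * (D * (op_cost + 3) + 6) + 10) + 3.

Lemma EmitOps_wp s : ctx s -> nmem s 115 0 = orow 0 -> (forall p, p <= Q -> nmem s 125 p = p * D) ->
  nmem s 114 0 = n -> emitted s H W (fun _ _ => 0%R) ->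
  wp EmitOps s ops_cost (fun s' => [/\ nmem s' 114 0 = n + Q * D * D,
    emitted s' H W (fun Y r => opsum Q D valid (fun it x a => wop it x a r * Y (vop it x a))%R) &
    forall it, it < Q -> nmem s' 136 it = vop it 0 0]).
Proof.
move=> cx s115 s125 s114 em.
eapply wp_le.
  eapply (wp_for (N := Q) (T := D * (D * (op_cost + 3) + 6) + 7) (Inv := fun it s1 =>
    [/\ nmem s1 114 0 = vop it 0 0, nmem s1 115 0 = orow it,
     forall p, p <= Q -> nmem s1 125 p = ver it p,
     emitted s1 H W (fun Y r => \sum_(it0 < it) \sum_(x < D) \sum_(a < D) g Y r it0 x a)%R &
     forall it0, it0 < it -> nmem s1 136 it0 = vop it0 0 0])).
  - by rewrite /= (proj1 cx).
  - by [].
  - by move=> i s1 j v [h1 h2 h3 h4 h5]; split; rewrite /= ?upd_neq.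
  - split=> //; first by rewrite s114 /vop !mul0n !addn0.
    by apply: emitted_ext em => Y r _; rewrite big_ord0.
  - move=> it s1 iQ xi fr [h1 h2 h3 h4 h5].
    have cx1 : ctx s1 by apply: (ctx_frame fr).
    eapply wp_le.
      eapply wp_seq; apply: wp_nset => /=; eapply wp_seq; apply: wp_nset => /=.
      rewrite /upd /= xi h1 (proj1 cx1) // Q112.
      set s2 := setn _ _ _ _.
      have m2 arr : arr \notin [:: 136; 120] -> nmem s2 arr = nmem s1 arr.
        by move=> h; rewrite /s2 /= !upd_neq //; move: h; rewrite !inE; lia.
      have cx2 : ctx s2.
        by split=> [a aF|]; [rewrite m2 ?(proj1 cx1) //; move: aF; rewrite !inE; lia | case: cx1].
      have k120 : nmem s2 120 0 = Q - it by rewrite /s2 /= /upd.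
      have k136 it0 : it0 < it.+1 -> nmem s2 136 it0 = vop it0 0 0.
        rewrite ltnS leq_eqVlt /s2 /= upd_neq // /upd eqxx /=; case: (it0 =P it) => [->//|_] /=.
        exact: h5.
      have em2 := @emitted_same _ s1 s2 _ _ _ (erefl _) (erefl _) (erefl _) (erefl _) h4.
      clearbody s2.
      eapply wp_seq, (wp_for (N := D) (Inv := fun x s3 => nmem s3 114 0 = vop it x 0 /\
        emitted s3 H W (fun Y r => \sum_(it0 < it) \sum_(x < D) \sum_(a < D) g Y r it0 x a +
           \sum_(x0 < x) \sum_(a < D) g Y r it x0 a)%R)).
      + by rewrite /= (proj1 cx2).
      + by [].
      + by move=> i s3 j v [g1 g2]; split; [rewrite /= upd_neq | apply: emitted_same g2].
      + split; first by rewrite m2.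
        by apply: emitted_ext em2 => Y r _; rewrite big_ord0 addr0.
      + move=> x s3 xD xx fr3 [g1 g2].
        have cx3 : ctx s3 by apply: (ctx_frame fr3).
        apply: wp_call.
          apply: (EmitRow_wp cx3 iQ xD _ xx _ _ g1 g2); rewrite ?(frn (a := 120) fr3) ?(frn (a := 115) fr3) ?(m2 115) //.
          by move=> p pQ; rewrite (frn fr3) // m2 // h3.
        move=> s4 _ [e1 e2]; split; first by rewrite e1 vopSx.
        by apply: emitted_ext e2 => Y r _; rewrite big_ord_recr /= addrA.
      + move=> s3 fr3 [g1 g2].
        have k3 arr : arr \in [:: 30; 84; 120; 125; 115] -> nmem s3 arr = nmem s2 arr.
          by move=> h; rewrite (frn fr3) //; move: h; rewrite /= !inE; lia.
        eapply wp_seq; apply: wp_nset; apply: wp_nset => /=; rewrite /upd /=.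
        have e84 : nmem s3 84 (nmem s3 120 0) = par (Q - it).
          by rewrite k3 // (proj1 cx2) // k3 // k120.
        have e115 : nmem s3 115 0 = orow it by rewrite k3 // m2.
        have e30 : nmem s3 30 0 = D by rewrite k3 // (proj1 cx2).
        rewrite e84 e115 e30; split.
        * by rewrite g1 vopSit.
        * by rewrite /orow addnS (mulSnr (Q.+1 + it)).
        * by move=> p pQ /=; case: ifP => // _; rewrite k3 // m2 // h3.
        * apply: emitted_same (emitted_ext _ g2) => // Y r _.
          by rewrite [RHS]big_ord_recr.
        * by move=> it0 h; rewrite (frn fr3) // k136.
    by lia.
  - move=> s1 fr [h1 h2 h3 h4 h5]; split=> //.
      by rewrite h1 /vop !addn0.
    apply: emitted_ext h4 => Y r _; rewrite /opsum; apply: eq_bigr => it _.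
    by apply: eq_bigr => x _; rewrite [RHS]big_mkcond.
by rewrite /ops_cost; lia.
Qed.

Lemma EmitSeeds_wp s E : ctx s -> n <= W -> emitted s H W E ->
  wp EmitSeeds s (n * 14 + 3) (fun s' => [/\
    emitted s' H W (fun Y r => E Y r + \sum_(i < n) (RB + i == r)%N%:R * Y i)%R &
    forall i, rmem s' 3 i = if i < n then rmem s0 0 i else rmem s 3 i]).
Proof.
move=> cx nW em.
eapply (wp_for (N := n) (T := 11) (Inv := fun i s1 => [/\
    emitted s1 H W (fun Y r => E Y r + \sum_(j < i) (RB + j == r)%N%:R * Y j)%R &
    forall j, rmem s1 3 j = if j < i then rmem s0 0 j else rmem s 3 j])).
- by rewrite /= (proj1 cx).
- by [].
- by move=> i s1 j v [h1 h2]; split=> //; apply: emitted_same h1.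
- by split=> //; apply: emitted_ext em => Y r _; rewrite big_ord0 addr0.
- move=> i s1 iN xi fr [h1 h2].
  have cx1 : ctx s1 by apply: (ctx_frame fr).
  eapply wp_le.
    eapply wp_seq; apply: wp_nset => /=; eapply wp_seq; apply: wp_nset => /=.
    rewrite /upd /= (proj1 cx1) // xi RB119.
    set s2 := setn _ _ _ _.
    have em2 := @emitted_same _ s1 s2 _ _ _ (erefl _) (erefl _) (erefl _) (erefl _) h1.
    have k116 : nmem s2 116 0 = RB + i by rewrite /s2 /= /upd.
    have k117 : nmem s2 117 0 = i by rewrite /s2 /= /upd.
    have k118 : nmem s2 118 0 = H by rewrite /s2 /= /upd /= (proj1 cx1).
    have k133 : nmem s2 133 0 = i by rewrite /s2 /= /upd.
    have kr : rmem s2 = rmem s1 by [].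
    clearbody s2.
    eapply wp_seq, wp_call.
      by apply: (Emit_wp false k118 k116 k117 _ _ em2); rewrite ?ltn_add2l // (leq_trans iN nW).
    move=> s3 fr3 em3; apply: wp_rset; split.
      apply: emitted_same (emitted_ext _ em3) => // Y r _.
      by rewrite big_ord_recr /= mul1r addrA.
    move=> j; rewrite [j < i.+1]ltnS leq_eqVlt /= /upd eqxx /= (frn (a := 133) fr3) // k133.
    rewrite (frr (a := 0) fr3) // (frr (a := 3) fr3) // kr; case: (j =P i) => [->|_] //=.
    by case: cx1 => _ ->.
  by [].
- by [].
Qed.

Definition inits_cost := Q.+1 * (D * (step_cost K b + 20) + 6) + 5.

Lemma EmitInits_wp s E : ctx s -> nmem s 114 0 = n + Q * D * D -> emitted s H W E ->
  wp EmitInits s inits_cost (fun s' => nmem s' 114 0 = W /\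
    emitted s' H W (fun Y r => E Y r + initsum Q D initok (fun q x => (q * D + x == r)%N%:R * Y (vg q x)))%R).
Proof.
move=> cx s114 em.
pose h (Y : nat -> R) r q x := if initok q x then ((q * D + x == r)%N%:R * Y (vg q x))%R else 0%R.
eapply wp_le.
  eapply wp_seq; apply: wp_nset => /=.
  set s1 := setn _ _ _ _.
  have cx1 : ctx s1.
    by split=> [a aF|]; [rewrite /s1 /= upd_neq ?(proj1 cx) //; move: aF; rewrite !inE; lia | case: cx].
  have em1 := @emitted_same _ s s1 _ _ _ (erefl _) (erefl _) (erefl _) (erefl _) em.
  have k114 : nmem s1 114 0 = vg 0 0 by rewrite /s1 /= upd_neq // s114 /vg mul0n !addn0.
  have k135 : nmem s1 135 0 = 0 by rewrite /s1 /= /upd.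
  clearbody s1.
  eapply (wp_for (N := Q.+1) (T := D * (step_cost K b + 20) + 3) (Inv := fun q s2 => [/\
     nmem s2 114 0 = vg q 0, nmem s2 135 0 = q * D &
     emitted s2 H W (fun Y r => E Y r + \sum_(q0 < q) \sum_(x < D) h Y r q0 x)%R])).
  - by rewrite /= (proj1 cx1) // Q112 addn1.
  - by [].
  - by move=> i s2 j v [h1 h2 h3]; split; rewrite /= ?upd_neq.
  - by split; rewrite ?k114 //; apply: emitted_ext em1 => Y r _; rewrite big_ord0 addr0.
  - move=> q s2 qQ xq fr2 [h1 h2 h3].
    have cx2 : ctx s2 by apply: (ctx_frame fr2).
    eapply wp_le.
      eapply (wp_for (N := D) (T := step_cost K b + 16) (Inv := fun x s3 => [/\
        nmem s3 114 0 = vg q x, nmem s3 135 0 = q * D + x &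
        emitted s3 H W (fun Y r => E Y r + \sum_(q0 < q) \sum_(x < D) h Y r q0 x
          + \sum_(x0 < x) h Y r q x0)%R])).
      + by rewrite /= (proj1 cx2).
      + by [].
      + by move=> i s3 j v [g1 g2 g3]; split; rewrite /= ?upd_neq.
      + by split; rewrite ?addn0 //; apply: emitted_ext h3 => Y r _; rewrite big_ord0 addr0.
      + move=> x s3 xD xx fr3 [g1 g2 g3].
        have cx3 : ctx s3 by apply: (ctx_frame fr3).
        eapply wp_le.
          eapply wp_seq, wp_call.
            apply: (CheckInit_wp (K := K) (b := b) (q := q) (x := x)); rewrite ?(proj1 cx3 33) ?(proj1 cx3 21) ?(proj1 cx3 22) //.
            by rewrite (frn fr3).
          move=> s4 fr4; rewrite (ctx_vn cx3) (ctx_rv cx3) (proj1 cx3 110) // => e124.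
          have cx4 : ctx s4 by apply: (ctx_frame fr4).
          have {}em4 : emitted s4 H W (fun Y r => E Y r + \sum_(q0 < q) \sum_(x < D) h Y r q0 x
              + \sum_(x0 < x) h Y r q x0)%R.
            by apply: emitted_same g3; rewrite ?(frn fr4) ?(frr fr4).
          have l114 : nmem s4 114 0 = vg q x by rewrite (frn fr4).
          have l135 : nmem s4 135 0 = q * D + x by rewrite (frn fr4).
          eapply wp_seq, (wp_call (Q := fun s5 => emitted s5 H W (fun Y r => E Y r + \sum_(q0 < q) \sum_(x < D) h Y r q0 x
              + \sum_(x0 < x.+1) h Y r q x0)%R)); last first.
            move=> s5 fr5 em5; eapply wp_seq; apply: wp_nset; apply: wp_nset; split.
            * by rewrite /= /upd /= (frn fr5) // l114 /vg !addnS addn0.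
            * by rewrite /= /upd /= (frn fr5) // l135 addn1 addnS.
            * exact: emitted_same em5.
          apply: wp_if => /= t.
            apply: wp_skip; apply: emitted_ext em4 => Y r _.
            by rewrite big_ord_recr /= /h -e124 t addr0.
          eapply wp_seq; apply: wp_nset => /=; eapply wp_seq; apply: wp_nset => /=.
          rewrite /upd /= l135 l114.
          set s5 := setn _ _ _ _.
          have em5 := @emitted_same _ s4 s5 _ _ _ (erefl _) (erefl _) (erefl _) (erefl _) em4.
          have k116 : nmem s5 116 0 = q * D + x by rewrite /s5 /= /upd.
          have k117 : nmem s5 117 0 = vg q x by rewrite /s5 /= /upd.
          have k118 : nmem s5 118 0 = H by rewrite /s5 /= /upd /= (proj1 cx4).
          clearbody s5.
          apply: wp_call.
            apply: (Emit_wp false k118 k116 k117 _ _ em5).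
              apply: leq_trans (leq_addr _ _).
              apply: (@leq_trans (q.+1 * D)); first by rewrite (mulSnr q) ltn_add2l.
              by rewrite leq_mul2r (leq_trans qQ) ?orbT // leq_addr.
            by have /andP[_] := @vg_lt n Q D q x (ltac:(by rewrite -ltnS) : q <= Q) xD.
          move=> s6 _ em6; apply: emitted_ext em6 => Y r _.
          by rewrite [in RHS]big_ord_recr /= addrA /h -e124 t mul1r.
        by lia.
      + move=> s3 _ [g1 g2 g3]; split.
        * by rewrite g1 /vg addn0 (mulSnr q).
        * by rewrite g2 (mulSnr q).
        * by apply: emitted_ext g3 => Y r _; rewrite [in RHS]big_ord_recr /= addrA.
    by lia.
  - move=> s2 _ [h1 h2 h3]; split; first by rewrite h1 /vg /NV addn0.
    apply: emitted_ext h3 => Y r _; congr (_ + _)%R; apply: eq_bigr => q _.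
    by rewrite [RHS]big_mkcond.
rewrite /inits_cost; lia.
Qed.

(** Rows from [H + H] on are the sign constraints, one for each variable, since the variables of the
    linear program are free. Objective coefficients vanish beyond the seed variables. *)
Definition written s := [/\ nmem s 6 0 = W, nmem s 6 1 = H + H + W,
  forall p, p < nmem s 6 2 -> nmem s 8 p < W,
  [/\ forall Y r, r < H -> asum s r Y = lhs Q D par valid after initok birth sdf r Y
        /\ asum s (H + r) Y = (- lhs Q D par valid after initok birth sdf r Y)%R,
    forall Y v, v < W -> asum s (H + H + v) Y = Y v,
    forall r, r < H -> rmem s 2 r = (r == last_row Q D)%:R%R /\ rmem s 2 (H + r) = (- (r == last_row Q D)%:R)%R &
    forall v, v < W -> rmem s 2 (H + H + v) = 0%R] &
  forall v, v < W -> rmem s 3 v = if v < n then rmem s0 0 v else 0%R].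

Lemma last_rowE : RB - D = last_row Q D.
Proof. by rewrite /RB /last_row /orow -{2}[D]mul1n -mulnBl -addnBA // subn1. Qed.

Lemma EmitRest_wp s : ctx s -> nmem s 114 0 = W ->
  emitted s H W (fun Y r => lhs Q D par valid after initok birth sdf r Y) ->
  rmem s 2 =1 (fun=> 0%R) -> (forall v, rmem s 3 v = if v < n then rmem s0 0 v else 0%R) ->
  wp EmitRest s (W * 8 + 7) written.
Proof.
move=> cx s114 [em ins] r2 r3.
have lr : last_row Q D < RB.
  have := @orow_lt Q D Q.-1 0; rewrite addn0; apply; last exact: D_gt0.
  by rewrite prednK.
have lrH := leq_trans lr (leq_addr n RB).
eapply wp_le.
  eapply wp_seq, (wp_for (N := W) (T := 5) (Inv := fun v s1 => [/\
      forall Y r, r < H -> asum s1 r Y = lhs Q D par valid after initok birth sdf r Y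
        /\ asum s1 (H + r) Y = (- lhs Q D par valid after initok birth sdf r Y)%R,
      forall Y u, u < W -> asum s1 (H + H + u) Y = if u < v then Y u else 0%R &
      inside s1 W (H + H + W)])).
  - by [].
  - by [].
  - by [].
  - split=> // [Y u uW|p pc]; last by case: (ins p pc) => -> /leq_trans-> //; rewrite leq_addr.
    rewrite /asum big1 // => p /eqP E; have [_] := ins p (ltn_ord p).
    by rewrite E ltnNge leq_addr.
  - move=> v s1 vW xv fr [h1 h2 h3].
    have cx1 : ctx s1 by apply: (ctx_frame fr).
    eapply wp_le.
      eapply wp_seq; apply: wp_nset => /=.
      set s2 := setn _ _ _ _.
      have k117 : nmem s2 117 0 = v by rewrite /s2 /= /upd /= xv.
      have krow : neval s2 (Var 118 + Var 118 + Var 133)%cmd = H + H + v.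
        by rewrite /s2 /= /upd /= (proj1 cx1) // H118 xv.
      have as2 r Y : asum s2 r Y = asum s1 r Y by apply: asum_eq.
      have in2 : inside s2 W (H + H + W) by [].
      clearbody s2.
      apply: wp_call; first exact: Put_wp.
      move=> s3 _ [_ e1 i1 _]; rewrite krow k117 in e1 i1; split.
      + move=> Y r rH; rewrite !e1 !as2; have [-> ->] := h1 Y r rH.
        have l1 : H + r < H + H + v by clear -rH; lia.
        have l2 : r < H + H + v by clear -rH; lia.
        by rewrite (gtn_eqF l1) (gtn_eqF l2) mul0r !addr0.
      + move=> Y u uW; rewrite e1 as2 h2 // eqn_add2l mul1r ltnS [u <= v]leq_eqVlt eq_sym.
        case: (u =P v) => [->|_] /=; first by rewrite ltnn add0r mul1r.
        by rewrite mul0r addr0.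
      + by apply: i1; rewrite // ltn_add2l.
    by [].
  - move=> s1 fr [h1 h2 h3].
    have cx1 : ctx s1 by apply: (ctx_frame fr).
    eapply wp_seq; apply: wp_rset; eapply wp_seq; apply: wp_rset.
    eapply wp_seq; apply: wp_nset; apply: wp_nset.
    have e119 : nmem s1 119 0 - nmem s1 30 0 = last_row Q D.
      by rewrite !(proj1 cx1) // RB119 D30 last_rowE.
    have e118 : nmem s1 118 0 = H by rewrite (proj1 cx1).
    have e114 : nmem s1 114 0 = W by rewrite (frn fr).
    set s2 := setn _ _ _ _.
    have m6 : nmem s2 6 2 = nmem s1 6 2 by rewrite /s2 /= /upd.
    have as2 r Y : asum s2 r Y = asum s1 r Y by apply: asum_eq.
    have m2 i : rmem s2 2 i = if i == H + last_row Q D then (-1)%R else if i == last_row Q D then 1%R else 0%R.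
      by rewrite /s2 /= /upd eqxx /= e119 e118 sub0r (frr fr) // r2.
    split.
    + by rewrite /s2 /= /upd /= e114.
    + by rewrite /s2 /= /upd /= e118 e114.
    + by move=> p pc; rewrite m6 in pc; case: (h3 p pc).
    + split=> [Y r rH|Y v vW|r rH|v vW].
      * by rewrite !as2; apply: h1.
      * by rewrite as2 h2 // vW.
      * have l1 : r < H + last_row Q D by rewrite ltn_addr.
        have l2 : last_row Q D < H + r by rewrite ltn_addr.
        rewrite !m2 eqn_add2l (ltn_eqF l1) (gtn_eqF l2).
        by split; case: eqP; rewrite ?oppr0.
      * have l1 : H + last_row Q D < H + H + v by clear -lrH; lia.
        have l2 : last_row Q D < H + H + v by clear -lrH; lia.
        by rewrite m2 (gtn_eqF l1) (gtn_eqF l2).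
    + by move=> v vW; rewrite -r3 /s2 /= /upd /= (frr fr).
by rewrite /=; lia.
Qed.

End EmitProgram.

(** The base in register 21 exceeds every rank, which is at most [K], and every cost, so that
    truncation at [b - 1] loses nothing. *)
Definition Constants : cmd := (
  Set' 113 (NCst 0) ;;
  For 97 eN (If' (BLt (Var 113) (NGet 5 (Var 97))) (Set' 113 (NGet 5 (Var 97))) Skip) ;;
  Set' 21 (Var 33 + Var 113 + NCst 1) ;; Set' 22 (Var 33 + Var 33 + Var 33) ;; Pow ;;
  Set' 112 (Var 85 + eM) ;; Set' 115 (NCst 0) ;;
  For 133 (Var 112 + NCst 1) (NSet 125 (Var 133) (Var 115) ;; Set' 115 (Var 115 + Var 30)) ;;
  Set' 119 (Var 115) ;; For 133 (Var 112) (Set' 119 (Var 119 + Var 30)) ;;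
  Set' 118 (Var 119 + eN) ;; Set' 114 eN)%cmd.

Definition WriteLP : cmd := (EmitOps ;; EmitSeeds ;; EmitInits ;; EmitRest)%cmd.

(* Descending from the root, array 137 holds the current code of each item. *)
Definition FindOp : cmd :=
  For 121 (Var 30) (For 122 (Var 30) (
    Step ;;
    If' (BAnd (BAnd (BNot (BEq (Var 124) (NCst 0))) (BEq (Var 29) (Var 138)))
              (BEq (Var 139) (NCst 0)))
      (If (RLe (RGet 4 (Var 114)) (RNat (NCst 0))) Skip
        (Set' 139 (NCst 1) ;; Set' 140 (Var 121) ;; Set' 141 (Var 122))) Skip ;;
    Set' 114 (Var 114 + NCst 1)))%cmd.

Definition OutputSeeds : cmd :=
  For 133 eN (
    If' (BAnd (BEq (NGet 80 (Var 133)) (Var 120))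
              (BNot (BEq (NGet 42 (Var 33 + NGet 81 (Var 133))) (NCst 0))))
      (NSet 9 (Var 133) (NCst 1) ;;
       RSet 5 (NCst 0) (RAdd (RGet 5 (NCst 0)) (RGet 0 (Var 133)))) Skip)%cmd.

Definition ReadLP : cmd := (
  NSet 137 (NCst 0) (NCst 0) ;; RSet 5 (NCst 0) (RNat (NCst 0)) ;;
  For 134 (Var 112) (
    Set' 120 (Var 134 + NCst 1) ;; Set' 138 (NGet 137 (NGet 84 (Var 120))) ;;
    Set' 114 (NGet 136 (Var 112 - Var 120)) ;; Set' 139 (NCst 0) ;;
    FindOp ;;
    NSet 137 (NGet 84 (Var 120)) (Var 140) ;; NSet 137 (Var 120) (Var 141) ;;
    Set' 20 (Var 141) ;; Decode 42 ;; OutputSeeds))%cmd.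

Section Constants.
Variable R : realType.
Implicit Types s : state R.

Definition consts_cost n K b Q := n * 6 + 3 * K * (b * 4 + 8) + Q * 10 + 40.

Lemma Constants_wp s n m N K : nmem s 0 0 = n -> nmem s 0 1 = m -> nmem s 33 0 = K -> nmem s 85 0 = N ->
  let b := K + \max_(i < n) nmem s 5 i + 1 in let D := b ^ (3 * K) in let Q := N + m in
  wp Constants s (consts_cost n K b Q) (fun s' => [/\
    [/\ nmem s' 21 0 = b, nmem s' 22 0 = 3 * K, nmem s' 30 0 = D & nmem s' 112 0 = Q],
    [/\ nmem s' 118 0 = RB Q D + n, nmem s' 119 0 = RB Q D, nmem s' 115 0 = orow Q D 0 & nmem s' 114 0 = n] &
    forall p, p <= Q -> nmem s' 125 p = p * D]).
Proof.
move=> sn sm sK sN b D Q; eapply wp_le.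
  eapply wp_seq; apply: wp_nset => /=.
  eapply wp_seq, (wp_for (N := n) (T := 3) (Inv := fun i s1 => nmem s1 113 0 = \max_(j < n | j < i) nmem s 5 j)).
  - by rewrite /= /upd /= sn.
  - by [].
  - by [].
  - by rewrite big_pred0.
  - move=> i s1 iN xi fr h.
    have E : \max_(j < n | j < i.+1) nmem s 5 j = maxn (\max_(j < n | j < i) nmem s 5 j) (nmem s 5 i).
      rewrite (bigD1 (Ordinal iN)) /= ?ltnSn // maxnC; congr maxn; apply: eq_bigl => u.
      by rewrite -val_eqE /= ltnS ltn_neqAle andbC.
    eapply wp_le.
      apply: wp_if => /=; rewrite xi (frn (a := 5) fr) //= h => t.
        by apply: wp_nset; rewrite E /= /upd /= xi (frn (a := 5) fr) //= (maxn_idPr (ltnW t)).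
      by apply: wp_skip; rewrite E h (maxn_idPl _) // leqNgt.
    by [].
  - move=> s1 fr h.
    have {}h : nmem s1 113 0 = \max_(i < n) nmem s 5 i by rewrite h; apply: eq_bigl => i; rewrite ltn_ord.
    have e33 : nmem s1 33 0 = K by rewrite (frn fr).
    eapply wp_seq; apply: wp_nset => /=; eapply wp_seq; apply: wp_nset => /=.
    rewrite /upd /= h e33 -/b.
    set s2 := setn _ _ _ _.
    have m2 arr : arr \notin [:: 21; 22; 97; 113] -> nmem s2 arr = nmem s arr.
      move=> ar; rewrite /s2 /= !upd_neq ?(frn fr) /= ?upd_neq //; move: ar; rewrite /= !inE; lia.
    have e21 : nmem s2 21 0 = b by rewrite /s2 /= /upd.
    have e22 : nmem s2 22 0 = 3 * K by rewrite /s2 /= /upd /=; lia.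
    clearbody s2.
    eapply wp_seq, wp_call; first by apply: (Pow_wp (b := b) (L := 3 * K)).
    move=> s3 fr3 e30.
    have m3 arr : arr \notin [:: 21; 22; 23; 24; 25; 26; 30; 97; 113] -> nmem s3 arr = nmem s arr.
      move=> ar; rewrite (frn fr3) ?m2 //; move: ar; rewrite /= !inE; lia.
    have k21 : nmem s3 21 0 = b by rewrite (frn fr3).
    have k22 : nmem s3 22 0 = 3 * K by rewrite (frn fr3).
    eapply wp_seq; apply: wp_nset => /=; eapply wp_seq; apply: wp_nset => /=.
    rewrite !m3 // sN sm.
    eapply wp_seq, (wp_for (N := Q.+1) (T := 2) (Inv := fun i s4 => nmem s4 115 0 = i * D /\
       forall p, p < i -> nmem s4 125 p = p * D)).
    + by rewrite /= /upd /= addn1.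
    + by [].
    + by move=> i s4 j v; rewrite /= !upd_neq.
    + by rewrite /= /upd.
    + move=> i s4 iQ xi fr4 [h1 h2].
      have k30 : nmem s4 30 0 = D by rewrite (frn fr4).
      eapply wp_le.
        eapply wp_seq; apply: wp_nset => /=; apply: wp_nset; split.
          by rewrite /= /upd /= h1 k30 (mulSnr i).
        move=> p; rewrite ltnS leq_eqVlt /= /upd /= xi h1.
        by case: (p =P i) => [->|_] //=; apply: h2.
      by [].
    + move=> s4 fr4 [h1 h2].
      have k30 : nmem s4 30 0 = D by rewrite (frn fr4).
      have k112 : nmem s4 112 0 = Q by rewrite (frn fr4).
      have kn : nmem s4 0 0 = n by rewrite (frn fr4) //= /upd /= m3.
      eapply wp_seq; apply: wp_nset => /=; rewrite h1.
      eapply wp_seq, (wp_for (N := Q) (T := 1) (Inv := fun i s5 => nmem s5 119 0 = (Q.+1 + i) * D)).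
      * by rewrite /= /upd /= k112.
      * by [].
      * by [].
      * by rewrite /= /upd /= addn0.
      * move=> i s5 iQ xi fr5 h5; apply: wp_nset; rewrite /= /upd /= h5 (frn fr5) //= /upd /= k30.
        by rewrite addnS (mulSnr (Q.+1 + i)).
      * move=> s5 fr5 h5.
        eapply wp_seq; apply: wp_nset => /=; apply: wp_nset; split; [split|split|].
        - by rewrite /= /upd /= (frn fr5) //= /upd /= (frn fr4).
        - by rewrite /= /upd /= (frn fr5) //= /upd /= (frn fr4).
        - by rewrite /= /upd /= (frn fr5).
        - by rewrite /= /upd /= (frn fr5).
        - by rewrite /= /upd /= h5 (frn fr5) //= /upd /= kn.
        - by rewrite /= /upd /= h5.
        - by rewrite /= /upd /= (frn fr5) //= /upd /= h1 /orow addn0.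
        - by rewrite /= /upd /= (frn fr5) //= /upd /= kn.
        - by move=> p pQ; rewrite /= /upd /= (frn fr5) //= /upd /= h2.
by rewrite /consts_cost -/b; lia.
Qed.

End Constants.

(** * Writing the program, and reading a derivation from one of its optimal points *)

Section Reading.
Variables (R : realType) (n m N K b : nat) (s0 : state R).
Implicit Types s : state R.
Local Notation Q := (N + m).
Local Notation D := (b ^ (3 * K)).
Let vn := vn_in K s0.
Let par := nmem s0 84.
Let cst := nmem s0 5.
Let birth : 'I_n -> nat := birth_in s0.
Let sdf a (i : 'I_n) := seedd K b a (nmem s0 81 i) != 0.
Local Notation valid := (valid K b vn par cst).
Local Notation after := (after K b vn par).
Local Notation initok := (initok K b vn (nmem s0 110) (rv_in K s0)).
Local Notation RB := (RB Q D).
Local Notation H := (RB + n).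
Local Notation W := (NV n Q D).
Local Notation vop := (vop n D).
Local Notation ctx := (ctx s0).
Local Notation flow := (flow Q D par valid after initok birth sdf).

Hypothesis b0 : 0 < b.
Hypothesis n0 : nmem s0 0 0 = n.
Hypothesis K0 : nmem s0 33 0 = K.
Hypothesis b21 : nmem s0 21 0 = b.
Hypothesis L22 : nmem s0 22 0 = 3 * K.
Hypothesis D30 : nmem s0 30 0 = D.
Hypothesis Q112 : nmem s0 112 0 = Q.
Hypothesis H118 : nmem s0 118 0 = H.
Hypothesis RB119 : nmem s0 119 0 = RB.
Hypothesis Q0 : 0 < Q.
Hypothesis par_lt : forall q, 0 < q <= Q -> par q < q.
Hypothesis colK : forall u : 'I_n, nmem s0 81 u < K.
Hypothesis birthP : forall u, 0 < birth u <= Q.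

Lemma WriteLP_wp s : ctx s -> nmem s 115 0 = orow Q D 0 -> (forall p, p <= Q -> nmem s 125 p = p * D) ->
  nmem s 114 0 = n -> nmem s 6 2 = 0 -> rmem s 2 =1 (fun=> 0%R) -> rmem s 3 =1 (fun=> 0%R) ->
  wp WriteLP s (ops_cost n m N K b + (n * 14 + 3) + inits_cost m N K b + (W * 8 + 7)) (fun s' =>
    written n m N K b s0 s' /\ forall it, it < Q -> nmem s' 136 it = vop it 0 0).
Proof.
move=> cx s115 s125 s114 s6 r2 r3.
have em0 : emitted s H W (fun _ _ => 0%R).
  split=> [Y r rH|p]; last by rewrite s6.
  by rewrite /asum s6 !big_ord0 oppr0.
have nW : n <= W by rewrite /NV leq_addr.
eapply wp_le.
  eapply wp_seq, wp_call; first exact: (EmitOps_wp b0 n0 K0 b21 L22 D30 Q112 H118 RB119 Q0 par_lt colK cx s115 s125 s114 em0).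
  move=> s1 fr1 [e1 em1 e136].
  have cx1 : ctx s1 by apply: (ctx_frame fr1).
  eapply wp_seq, wp_call; first exact: (EmitSeeds_wp n0 H118 RB119 cx1 nW em1).
  move=> s2 fr2 [em2 er2].
  have cx2 : ctx s2 by apply: (ctx_frame fr2).
  have k114 : nmem s2 114 0 = n + Q * D * D by rewrite (frn fr2).
  eapply wp_seq, wp_call; first exact: (EmitInits_wp b0 n0 K0 b21 L22 D30 Q112 H118 RB119 Q0 cx2 k114 em2).
  move=> s3 fr3 [e3 em3].
  have cx3 : ctx s3 by apply: (ctx_frame fr3).
  apply: wp_call.
    apply: (EmitRest_wp b0 n0 K0 b21 L22 D30 Q112 H118 RB119 Q0 cx3 e3 em3).
      by move=> i; rewrite (frr fr3) // (frr fr2) // (frr fr1) // r2.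
    by move=> v; rewrite (frr fr3) // er2; case: ifP => // _; rewrite (frr fr1) // r3.
  move=> s4 fr4 wr; split=> // it iQ.
  by rewrite (frn fr4) // (frn fr3) // (frn fr2) // e136.
by lia.
Qed.

Section Search.
Variables (Y : nat -> R) (it Z : nat).
Let q := Q - it.
Let good x a := [&& valid q x a, after q x a == Z & (0 < Y (vop it x a))%R].

(** As long as there is no hit, all pairs tried so far are known to fail; the existence of a good
    pair then forces a hit by the end. *)
Definition op_found s (tried : nat -> nat -> bool) : bool := if nmem s 139 0 == 0
  then [forall x : 'I_D, forall a : 'I_D, tried x a ==> ~~ good x a]
  else [&& nmem s 140 0 < D, nmem s 141 0 < D & good (nmem s 140 0) (nmem s 141 0)].

Lemma found_eq s tried tried' : (forall x a, x < D -> a < D -> tried x a = tried' x a) ->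
  op_found s tried = op_found s tried'.
Proof.
move=> e; rewrite /op_found; case: ifP => // _; apply: eq_forallb => x; apply: eq_forallb => a.
by rewrite e.
Qed.

Lemma FindOp_wp s : ctx s -> it < Q -> nmem s 120 0 = q -> nmem s 138 0 = Z ->
  nmem s 114 0 = vop it 0 0 -> nmem s 139 0 = 0 -> rmem s 4 = Y ->
  (exists x a, [/\ x < D, a < D & good x a]) ->
  wp FindOp s (D * (D * (step_cost K b + 15) + 3 + 3) + 3) (fun s' =>
    [/\ nmem s' 140 0 < D, nmem s' 141 0 < D & good (nmem s' 140 0) (nmem s' 141 0)]).
Proof.
move=> cx iQ s120 s138 s114 s139 s4 [x1 [a1 [x1D a1D good1]]].
eapply (wp_for (N := D) (T := D * (step_cost K b + 15) + 3) (Inv := fun x s1 =>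
   nmem s1 114 0 = vop it x 0 /\ op_found s1 (fun x' a' => x' < x))).
- by rewrite /= (proj1 cx).
- by [].
- by move=> i s1 j v; rewrite /op_found /= !upd_neq.
- split=> //; rewrite /op_found s139 /=; by apply/forallP => x; apply/forallP => a.
- move=> x s1 xD xx fr [h1 h2].
  have cx1 : ctx s1 by apply: (ctx_frame fr).
  eapply wp_le.
    eapply (wp_for (N := D) (T := step_cost K b + 12) (Inv := fun a s2 =>
      nmem s2 114 0 = vop it x a /\ op_found s2 (fun x' a' => (x' < x) || ((x' == x) && (a' < a))))).
    + by rewrite /= (proj1 cx1).
    + by [].
    + by move=> i s2 j v; rewrite /op_found /= !upd_neq.
    + split=> //; rewrite (_ : op_found s1 _ = op_found s1 (fun x' _ => x' < x)) //; apply: found_eq => x' a' _ _.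
      by rewrite andbF orbF.
    + move=> a s2 aD xa fr2 [g1 g2].
      have cx2 : ctx s2 by apply: (ctx_frame fr2).
      have k120 : nmem s2 120 0 = q by rewrite (frn fr2) // (frn fr).
      have k138 : nmem s2 138 0 = Z by rewrite (frn fr2) // (frn fr).
      have k121 : nmem s2 121 0 = x by rewrite (frn fr2).
      have k4 : rmem s2 4 = Y by rewrite (frr fr2) // (frr fr).
      eapply wp_le.
        eapply wp_seq, wp_call.
          by apply: (Step_wp (K := K) (b := b) (q := q) (x := x) (a := a)); rewrite ?(proj1 cx2 33) ?(proj1 cx2 21) ?(proj1 cx2 22).
        move=> s3 fr3; rewrite (ctx_vn K cx2) (proj1 cx2 84) // (proj1 cx2 5) // => -[e124 e29 _].
        have l138 : nmem s3 138 0 = Z by rewrite (frn fr3).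
        have l139 : nmem s3 139 0 = nmem s2 139 0 by rewrite (frn fr3).
        have l140 : nmem s3 140 0 = nmem s2 140 0 by rewrite (frn fr3).
        have l141 : nmem s3 141 0 = nmem s2 141 0 by rewrite (frn fr3).
        have l121 : nmem s3 121 0 = x by rewrite (frn fr3).
        have l122 : nmem s3 122 0 = a by rewrite (frn fr3).
        have l114 : nmem s3 114 0 = vop it x a by rewrite (frn fr3).
        have l4 : rmem s3 4 = Y by rewrite (frr fr3).
        pose next := fun x' a' => (x' < x) || ((x' == x) && (a' < a.+1)).
        eapply wp_seq, (wp_call (Q := fun s4 => op_found s4 next)); last first.
          move=> s5 fr5 F5; apply: wp_nset; split; last exact: F5.
          by rewrite /= /upd /= (frn fr5) // l114 addn1 vopS.
        have keep : ~~ [&& valid q x a, after q x a == Z, nmem s2 139 0 == 0 & (0 < Y (vop it x a))%R] -> op_found s3 next.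
          move: g2; rewrite /op_found l139 l140 l141; case: (nmem s2 139 0 == 0) => //= H ng.
          apply/forallP => x'; apply/forallP => a'; apply/implyP; rewrite /next ltnS [a' <= a]leq_eqVlt => t.
          have := implyP (forallP (forallP H x') a').
          case: (boolP ((x' == x :> nat) && (a' == a :> nat))) => [/andP[/eqP-> /eqP->] _|ne]; first by rewrite /good.
          apply; move: t ne; case: (x' < x) => //=; case: (x' == x :> nat) => //=; by case: (a' == a :> nat).
        apply: wp_if => /=; rewrite e29 l138 l139 e124 => t.
          have /andP[/andP[t1 /eqP t2] t3] := t.
          apply: wp_test; rewrite /= l4 l114 => t4.
            apply: wp_skip; apply: keep; by rewrite t1 t2 t3 eqxx /= -leNgt.
          eapply wp_seq; apply: wp_nset => /=; eapply wp_seq; apply: wp_nset => /=; apply: wp_nset.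
          rewrite /op_found /= /upd /= l121 l122 xD aD /= /good t1 t2 eqxx /=.
          by rewrite ltNge.
        apply: wp_skip; apply: keep; apply: contra t => /and4P[-> -> -> _]; by [].
      by lia.
    + move=> s2 fr2 [g1 g2]; split; first by rewrite g1 vopSx.
      rewrite (_ : op_found s2 _ = op_found s2 (fun x' a' => (x' < x) || ((x' == x) && (a' < D)))) //; apply: found_eq => x' a' x'D a'D.
      by rewrite a'D andbT ltnS leq_eqVlt orbC.
  by lia.
- move=> s1 fr [_]; rewrite /op_found; case: ifP => _; last by move=> /and3P[].
  move=> /forallP/(_ (Ordinal x1D))/forallP/(_ (Ordinal a1D)); rewrite /= x1D.
  by rewrite good1.
Qed.

End Search.

Lemma OutputSeeds_wp s q a : ctx s -> nmem s 120 0 = q ->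
  (forall c, c < 3 * K -> nmem s 42 c = digit_of b c a) ->
  wp OutputSeeds s (n * 7 + 3) (fun s' =>
    (forall u : 'I_n, nmem s' 9 u = if (birth u == q) && sdf a u then 1 else nmem s 9 u) /\
    rmem s' 5 0 = (rmem s 5 0%N + \sum_(u < n | (birth u == q) && sdf a u) rmem s0 0%N u)%R).
Proof.
move=> cx s120 s42.
eapply wp_le.
  eapply (wp_for (N := n) (T := 4) (Inv := fun i s1 =>
    (forall u : 'I_n, nmem s1 9 u = if [&& u < i, birth u == q & sdf a u] then 1 else nmem s 9 u) /\
    rmem s1 5 0 = (rmem s 5 0%N + \sum_(u < n | (u < i)%N) (if (birth u == q) && sdf a u then rmem s0 0%N u else 0))%R)).
  - by rewrite /= (proj1 cx).
  - by [].
  - by [].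
  - by split=> //; rewrite big_pred0 ?addr0.
  - move=> i s1 iN xi fr [h1 h2].
    have cx1 : ctx s1 by apply: (ctx_frame fr).
    have Es : (nmem s1 80 i == nmem s1 120 0) && (nmem s1 42 (K + nmem s1 81 i) != 0) =
        (birth (Ordinal iN) == q) && sdf a (Ordinal iN).
      rewrite /birth /birth_in /= (proj1 cx1 80) // (proj1 cx1 81) // !(frn (a := 120) fr) // s120.
      rewrite (frn (a := 42) fr) // s42 //.
      by have := colK (Ordinal iN); rewrite /=; lia.
    eapply wp_le.
      apply: wp_if => /=; rewrite xi (proj1 cx1 33) // K0 Es => t.
        eapply wp_seq; apply: wp_nset => /=; apply: wp_rset; split.
          move=> u; rewrite /= /upd /= xi h1 ltnS [u <= i]leq_eqVlt.
          case: (nat_of_ord u =P i) => [E|_] //=.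
          by rewrite (_ : u = Ordinal iN) ?t //; apply: val_inj.
        rewrite /= /upd /= xi h2 (sum_ltS _ iN) t addrA; congr (_ + _)%R.
        by case: cx1 => _ ->.
      apply: wp_skip; split.
        move=> u; rewrite h1 ltnS [u <= i]leq_eqVlt; case: (nat_of_ord u =P i) => [E|_] //=.
        by rewrite (_ : u = Ordinal iN) ?(negPf t) ?andbF //; apply: val_inj.
      by rewrite h2 (sum_ltS _ iN) (negPf t) addr0.
    by [].
  - move=> s1 _ [h1 h2]; split; first by move=> u; rewrite h1 ltn_ord.
    rewrite h2 [in RHS]big_mkcond; congr (_ + _)%R; apply: eq_bigl => u.
    by rewrite ltn_ord.
by lia.
Qed.

Definition read_cost := Q * (D * (D * (step_cost K b + 15) + 6) + 3 * K * (D * 8 + 12) + n * 7 + 40) + 10.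

Lemma ReadLP_wp s Y : ctx s -> rmem s 4 = Y -> flow 1%R Y -> nmem s 9 =1 (fun=> 0) ->
  (forall it, it < Q -> nmem s 136 it = vop it 0 0) ->
  wp ReadLP s read_cost (fun s' => exists st, [/\
    selection Q D par valid after initok st,
    forall v, n <= v -> sel_vec R Q D par birth sdf st v != 0%R -> (0 < Y v)%R,
    forall u : 'I_n, (nmem s' 9 u != 0) = (u \in sel_seeds Q birth sdf st) &
    rmem s' 5 0 = (\sum_(u in sel_seeds Q birth sdf st) rmem s0 0%N u)%R]).
Proof.
move=> cx s4 fl s9 s136.
have after_D q x a : after q x a < D by apply: after_lt.
have D0 : 0 < D by rewrite expn_gt0 b0.
(* The seeds found after [i] rounds. Each node is reported once, in the round of its birth item, so
   its weight is added once. *)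
pose mine (st : nat -> nat -> nat) i u := (birth u <= i) && sdf (st (Q - birth u) (birth u)) u.
eapply wp_le.
  eapply wp_seq; apply: wp_nset => /=; eapply wp_seq; apply: wp_rset => /=.
  set s1 := setr _ _ _ _.
  have cx1 : ctx s1.
    by split=> [a aF|]; [rewrite /s1 /= upd_neq ?(proj1 cx) //; move: aF; rewrite !inE; lia | case: cx].
  eapply (wp_for (N := Q) (T := D * (D * (step_cost K b + 15) + 6) + 3 * K * (D * 8 + 12) + n * 7 + 35)
    (Inv := fun i s2 => exists st, [/\
     partial n Q D par valid after 1%R Y st (Q - i),
     forall p, p <= i -> nmem s2 137 p = st (Q - i) p,
     forall u : 'I_n, nmem s2 9 u = mine st i u &
     rmem s2 5 0 = (\sum_(u < n | mine st i u) rmem s0 0%N u)%R])).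
  - by rewrite /= /upd /= (proj1 cx).
  - by [].
  - by move=> i s2 j v [st H2]; exists st.
  - exists (fun _ _ => 0); rewrite subn0; split.
    + exact: (partial_init Q0 D0 par_lt fl ltr01).
    + by move=> p; rewrite leqn0 => /eqP->; rewrite /s1 /= /upd.
    + by move=> u; rewrite /s1 /= upd_neq // s9 /mine leqn0 gtn_eqF //; case/andP: (birthP u).
    + rewrite /s1 /= /upd /= big_pred0 // => u.
      by rewrite /mine leqn0 gtn_eqF //; case/andP: (birthP u).
  - move=> i s2 iQ xi fr2 [st [ps h137 h9 h5]].
    have cx2 : ctx s2 by apply: (ctx_frame fr2).
    have itQ : Q - i.+1 < Q by lia.
    have Eit : Q - i = (Q - i.+1).+1 by lia.
    have Eq : Q - (Q - i.+1) = i.+1 by lia.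
    have pq : par i.+1 < i.+1 by apply: par_lt; rewrite ltnS leq0n.
    have k4 : rmem s2 4 = Y by rewrite (frr fr2).
    have k136 : nmem s2 136 (Q - i.+1) = vop (Q - i.+1) 0 0 by rewrite (frn fr2) // /s1 /= upd_neq // s136.
    rewrite Eit in ps h137.
    eapply wp_le.
      eapply wp_seq; apply: wp_nset => /=; eapply wp_seq; apply: wp_nset => /=.
      rewrite /upd /= xi addn1 (proj1 cx2 84) // -/par h137 //.
      eapply wp_seq; apply: wp_nset => /=; eapply wp_seq; apply: wp_nset => /=.
      rewrite /upd /= (proj1 cx2 112) // Q112 k136.
      set s3 := setn _ _ _ _.
      have m3 arr : arr \notin [:: 120; 138; 114; 139] -> nmem s3 arr = nmem s2 arr.
        by move=> h; rewrite /s3 /= !upd_neq //; move: h; rewrite !inE; lia.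
      have cx3 : ctx s3.
        by split=> [a aF|]; [rewrite m3 ?(proj1 cx2) //; move: aF; rewrite !inE; lia | case: cx2].
      have l120 : nmem s3 120 0 = i.+1 by rewrite /s3 /= /upd.
      have l138 : nmem s3 138 0 = st (Q - i.+1).+1 (par i.+1) by rewrite /s3 /= /upd.
      have l114 : nmem s3 114 0 = vop (Q - i.+1) 0 0 by rewrite /s3 /= /upd.
      have l139 : nmem s3 139 0 = 0 by rewrite /s3 /= /upd.
      have lr : rmem s3 = rmem s2 by [].
      clearbody s3.
      eapply wp_seq, wp_call.
        apply: (FindOp_wp (Y := Y) (it := Q - i.+1) cx3 itQ _ l138 l114 l139); rewrite ?Eq ?lr //.
        have [x [a [xD aD V E Y0]]] := partial_ex Q0 D0 par_lt after_D fl ps itQ.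
        by exists x, a; split=> //; rewrite Eq in V E; rewrite V E eqxx Y0.
      move=> s4'; rewrite Eq => fr4 [xD aD /and3P[V /eqP E Y0]].
      have cx4 : ctx s4' by apply: (ctx_frame fr4).
      set x := nmem s4' 140 0 in xD V E Y0 *; set a := nmem s4' 141 0 in aD V E Y0 *.
      eapply wp_seq; apply: wp_nset => /=; eapply wp_seq; apply: wp_nset => /=.
      eapply wp_seq; apply: wp_nset => /=.
      rewrite /upd /= (frn (a := 120) fr4) // l120 (proj1 cx4) // -/par -/x -/a.
      set s5 := setn _ _ _ _.
      have m5 arr : arr \notin [:: 20; 137] -> nmem s5 arr = nmem s4' arr.
        by move=> h; rewrite /s5 /= !upd_neq //; move: h; rewrite !inE; lia.
      have cx5 : ctx s5.
        by split=> [a' aF|]; [rewrite m5 ?(proj1 cx4) //; move: aF; rewrite !inE; lia | case: cx4].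
      have e137 p : nmem s5 137 p = if p == i.+1 then a else if p == par i.+1 then x else nmem s2 137 p.
        by rewrite /s5 /= upd_neq // /upd eqxx /= (frn fr4) // m3.
      have e20 : nmem s5 20 0 = a by rewrite /s5 /= /upd.
      have n120 : nmem s5 120 0 = i.+1 by rewrite m5 // (frn fr4).
      have n9 : nmem s5 9 = nmem s2 9 by rewrite m5 // (frn fr4) // m3.
      have nr : rmem s5 = rmem s4' by [].
      clearbody s5.
      eapply wp_seq, (wp_mono (T' := 3 * K * (D * 8 + 12) + 10)).
      - by apply: (Decode_wp (x := a) (b := b) (L := 3 * K)); rewrite ?(proj1 cx5 21) ?(proj1 cx5 22).
      - by rewrite leq_add2r leq_mul2l leq_add2r leq_mul2r (ltnW aD) !orbT.
      move=> s6 fr6 e42.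
      have cx6 : ctx s6 by apply: (ctx_frame fr6).
      apply: wp_call.
        by apply: (OutputSeeds_wp (q := i.+1) (a := a) cx6); rewrite ?(frn (a := 120) fr6).
      move=> s7 fr7 [g9 g5].
      (* The very update made by [partial_step]. The codes at which earlier items were read are
         untouched, because their merges have other indices. *)
      pose st' it' p := if it' == Q - i.+1 then
         if p == i.+1 then a else if p == par i.+1 then x else st (Q - i.+1).+1 p else st it' p.
      have fresh u : birth u <= i -> (Q - birth u == Q - i.+1) = false.
        by move=> le; apply/negbTE/eqP; have := iQ; lia.
      have mS u : mine st' i.+1 u = mine st i u || ((birth u == i.+1) && sdf a u).
        rewrite /mine leq_eqVlt; case: (birth u =P i.+1) => [->|_] /=.
          by rewrite /st' !eqxx ltnn.
        by rewrite orbF ltnS /st'; case: leqP => //= /fresh->.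
      exists st'; split.
      + have := partial_step Q0 D0 par_lt fl ler01 ps itQ xD aD.
        by rewrite Eq => /(_ V E Y0).
      + move=> p pi; rewrite (frn fr7) // (frn fr6) // e137 /st' eqxx.
        case: (p =P i.+1) => // ne; case: (p =P par i.+1) => // _.
        by apply: h137; have := pi; lia.
      + move=> u; rewrite g9 (frn fr6) // n9 h9 mS.
        case: (boolP ((birth u == i.+1) && sdf a u)) => [_|_]; first by rewrite orbT.
        by rewrite orbF.
      + rewrite g5 (frr fr6) // nr (frr fr4) // lr h5.
        rewrite (bigID (fun u => mine st i u) (mine st' i.+1)) /=; congr (_ + _)%R; apply: eq_bigl => u; rewrite mS.
          by case: (mine st i u); rewrite ?andbF.
        case: (boolP (mine st i u)) => [/andP[le _]|_]; rewrite ?andbF ?andbT //=.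
        by rewrite ltn_eqF.
    by lia.
  - move=> s2 fr2 [st [ps h137 h9 h5]]; rewrite subnn in ps.
    have [sel sup] := partial_sel D0 fl ps.
    have mE u : mine st Q u = (u \in sel_seeds Q birth sdf st).
      by rewrite inE /mine; case/andP: (birthP u) => _ ->.
    exists st; split=> //.
    + by move=> u; rewrite h9 mE; case: (u \in _).
    + by rewrite h5; apply: eq_bigl => u; rewrite mE.
by rewrite /read_cost; lia.
Qed.

End Reading.

(** * The algorithm *)

Section Instance.
Variables (R : realType) (I : instance R).
Local Notation n := (nodes I).
Local Notation m := (edges I).
Local Notation inc := (incidences I).
Local Notation L := (size inc).
Local Notation s := (load I).
Let nd := nmem s 2.
Let ej := nmem s 1.

Lemma incidenceE p : p < L -> exists2 ji, ji \in inc &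
  [/\ nd p = ji.2, ej p = ji.1 & nmem s 3 p = benefit ji.1 ji.2].
Proof.
move=> pL; have x0 : 'I_m * 'I_n by case: inc pL.
exists (nth x0 inc p); first exact: mem_nth.
by rewrite /nd /ej /= !(nth_map x0).
Qed.

Lemma mem_incidences j i : ((j, i) \in inc) = (i \in edge I j).
Proof.
apply/allpairsPdep/idP => [[j' [i' [_ iE [-> ->]]]]|iE]; first by rewrite mem_enum in iE.
by exists j, i; rewrite !mem_enum.
Qed.

Lemma nd_lt p : p < L -> nd p < n.
Proof. by move=> /incidenceE[ji _ [-> _ _]]. Qed.

Lemma ej_lt p : p < L -> ej p < m.
Proof. by move=> /incidenceE[ji _ [_ -> _]]. Qed.

Lemma incP (i : 'I_n) (j : 'I_m) : reflect (exists2 p, p < L & nd p = i /\ ej p = j) (i \in edge I j).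
Proof.
rewrite -mem_incidences; apply: (iffP idP) => [ij|[p pL [E1 E2]]].
  exists (index (j, i) inc); first by rewrite index_mem.
  by rewrite /nd /ej /= !(nth_map (j, i)) ?index_mem ?nth_index.
have [ji jiI [F1 F2 _]] := incidenceE pL.
rewrite (_ : (j, i) = ji) //; case: ji {jiI} F1 F2 => j' i' /=; rewrite E1 E2.
by move=> /val_inj-> /val_inj->.
Qed.

Lemma load_benefit p (j : 'I_m) (i : 'I_n) : p < L -> ej p = j -> nd p = i -> nmem s 3 p = benefit j i.
Proof.
move=> pL E1 E2; have [[j' i'] _ /= [F1 F2 ->]] := incidenceE pL.
have Ej : j' = j by apply: val_inj; rewrite /= -F2.
have Ei : i' = i by apply: val_inj; rewrite /= -F1.
by rewrite Ej Ei.
Qed.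

Lemma load_threshold (j : 'I_m) : nmem s 4 j = threshold j.
Proof. by rewrite /= (nth_map j) ?size_enum_ord // nth_ord_enum. Qed.

Lemma load_cost (i : 'I_n) : nmem s 5 i = cost i.
Proof. by rewrite /= (nth_map i) ?size_enum_ord // nth_ord_enum. Qed.

Lemma load_weight (i : 'I_n) : rmem s 0 i = weight i.
Proof. by rewrite /= (nth_map i) ?size_enum_ord // nth_ord_enum. Qed.

Lemma load_zero a : 5 < a -> nmem s a =1 (fun=> 0).
Proof. by move=> a5 i /=; do 6 (case: a a5 => //= a a5); rewrite nth_nil. Qed.

Lemma load_rzero a : 0 < a -> rmem s a =1 (fun=> 0%R).
Proof. by case: a => // a _ i /=; rewrite nth_nil. Qed.

Lemma load_inputs : inputs_in n m L nd ej s.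
Proof. by []. Qed.

Lemma size_incidences k : (forall j, #|edge I j| <= k) -> L <= k * m.
Proof.
move=> ek; rewrite size_allpairs_dep sumnE big_map big_enum /=.
rewrite -[m in k * m]card_ord mulnC -sum_nat_const; apply: leq_sum => j _.
by rewrite -cardE.
Qed.

Hypothesis ok : standing_assumptions I.

Lemma nodes_gt0 : 0 < n. Proof. by case: ok => -[]. Qed.

Lemma theta_gt0 : 0 < theta_max I.
Proof.
have [_ c0 _ _] := ok; apply: leq_trans (c0 (Ordinal nodes_gt0)) _.
by rewrite /theta_max leq_max; apply/orP; left; apply: leq_bigmax.
Qed.

Lemma cost_theta (i : 'I_n) : cost i <= theta_max I.
Proof. by rewrite /theta_max leq_max; apply/orP; left; apply: leq_bigmax. Qed.

(** Costs are positive and must be coverable, so there is a hyperedge; its threshold forces two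
    nodes into one bag. This lets multiples of the treewidth absorb additive constants in the
    exponents. *)
Lemma treewidth_gt0 : 0 < treewidth (edge I).
Proof.
have [_ c0 cs th] := ok.
pose i := Ordinal nodes_gt0.
have [j ij] : exists j, i \in edge I j.
  apply: contrapT => no; have := leq_trans (c0 i) (cs i).
  by rewrite big_pred0 // => j; apply/negP => ij; apply: no; exists j.
have [V [t [X [[_ _ ed _] sz]]]] := treewidth_bags (edge I).
have [z jz] := ed j.
have /andP[t2 tk] := th j.
have := leq_trans t2 (leq_trans tk (leq_trans (subset_leq_card jz) (sz z))).
by case: treewidth.
Qed.

End Instance.

(** ** Running times *)

Section Bounds.
Variables (n m N K b P M : nat).
Hypotheses (nM : n <= M) (QM : N + m <= M) (M0 : 0 < M).
Hypotheses (KP : K <= P) (bP : b <= P) (DP : b ^ (3 * K) <= P) (b0 : 0 < b).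
Let D := b ^ (3 * K).
Let Q := N + m.

Lemma P_gt0 : 0 < P. Proof. exact: leq_trans b0 bP. Qed.

Lemma step_bound : step_cost K b <= 270 * P ^ 2.
Proof.
have p0 := P_gt0; rewrite /step_cost -/D.
have h1 : K * D <= P ^ 2 by rewrite -mulnn leq_mul.
have h2 : K * K <= P ^ 2 by rewrite -mulnn leq_mul.
have h3 : K * b <= P ^ 2 by rewrite -mulnn leq_mul.
have h4 : K <= P ^ 2 by rewrite (leq_trans KP) // -{1}[P]expn1 leq_pexp2l.
have h5 : 0 < P ^ 2 by rewrite expn_gt0 p0.
nia.
Qed.

Lemma op_bound : op_cost n K b <= 333 * P ^ 2 * M.
Proof.
have p0 := P_gt0; have h := step_bound; rewrite /op_cost.
have h5 : 0 < P ^ 2 by rewrite expn_gt0 p0.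
have h6 : P ^ 2 <= P ^ 2 * M by rewrite leq_pmulr.
have h7 : n <= P ^ 2 * M by rewrite (leq_trans nM) // leq_pmull.
rewrite -mulnA; lia.
Qed.

Lemma D_Q_bound x c : x <= c * P ^ 2 * M -> Q * (D * (D * x)) <= c * P ^ 4 * M ^ 2.
Proof.
move=> xc; apply: (@leq_trans (M * (P * (P * (c * P ^ 2 * M))))).
  by do 3 apply: leq_mul => //.
by rewrite leq_eqVlt; apply/orP; left; apply/eqP; ring.
Qed.

Lemma PM_ge c d : c <= 4 -> d <= 2 -> P ^ c * M ^ d <= P ^ 4 * M ^ 2.
Proof. by move=> c4 d2; rewrite leq_mul // leq_pexp2l // P_gt0. Qed.

Lemma NV_bound : NV n Q D <= 4 * (P ^ 2 * M).
Proof.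
have p0 := P_gt0; rewrite /NV.
have h1 : Q * D * D <= P ^ 2 * M by rewrite -mulnA mulnC -mulnn leq_mul // leq_mul.
have h2 : P <= P ^ 2 by rewrite -{1}[P]expn1 leq_pexp2l.
have h3 : Q * D <= P ^ 2 * M by rewrite mulnC leq_mul // (leq_trans DP).
have h4 : D <= P ^ 2 * M by rewrite (leq_trans DP) // (leq_trans h2) // leq_pmulr.
have h5 : n <= P ^ 2 * M by rewrite (leq_trans nM) // leq_pmull // expn_gt0 p0.
rewrite mulSn; lia.
Qed.

Lemma size_bound : NV n Q D + (RB Q D + n + (RB Q D + n) + NV n Q D) <= 16 * (P ^ 2 * M).
Proof.
have h := NV_bound; have p0 := P_gt0.
have h2 : P <= P ^ 2 by rewrite -{1}[P]expn1 leq_pexp2l.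
have h3 : Q * D <= P ^ 2 * M by rewrite mulnC leq_mul // (leq_trans DP).
have h4 : D <= P ^ 2 * M by rewrite (leq_trans DP) // (leq_trans h2) // leq_pmulr.
have h5 : n <= P ^ 2 * M by rewrite (leq_trans nM) // leq_pmull // expn_gt0 p0.
rewrite /RB mulnDl mulSn; lia.
Qed.

Lemma consts_bound : consts_cost n K b Q <= 92 * (P ^ 4 * M ^ 2).
Proof.
have p0 := P_gt0; rewrite /consts_cost.
have := @PM_ge 2 0 isT isT; have := @PM_ge 0 1 isT isT; have := @PM_ge 0 0 isT isT.
rewrite !expn0 !expn1 !mul1n !muln1 => g0 g1 g2.
have h3 : K * b <= P ^ 2 by rewrite -mulnn leq_mul.
have h4 : K <= P ^ 2 by rewrite (leq_trans KP) // -{1}[P]expn1 leq_pexp2l.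
have : 3 * K * (b * 4 + 8) = 12 * (K * b) + 24 * K by ring.
have := nM; have := QM; rewrite -/Q; lia.
Qed.

Lemma write_bound :
  ops_cost n m N K b + (n * 14 + 3) + inits_cost m N K b + (NV n Q D * 8 + 7) <= 1100 * (P ^ 4 * M ^ 2).
Proof.
have p0 := P_gt0; rewrite /ops_cost /inits_cost -/Q -/D.
have := @PM_ge 2 1 isT isT; have := @PM_ge 0 1 isT isT; have := @PM_ge 0 0 isT isT.
rewrite !expn0 !expn1 !mul1n => g0 g1 g2.
have h1 := D_Q_bound op_bound.
have h2 := NV_bound.
have e1 : P <= P ^ 2 by rewrite -{1}[P]expn1 leq_pexp2l.
have qd : Q * D <= P ^ 2 * M by rewrite mulnC leq_mul // (leq_trans DP).
have qdd : Q * (D * D) <= P ^ 2 * M by rewrite mulnC leq_mul // -mulnn leq_mul.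
have d : D <= P ^ 2 * M by rewrite (leq_trans DP) // (leq_trans e1) // leq_pmulr.
have h3 : Q.+1 * (D * step_cost K b) <= 540 * (P ^ 4 * M ^ 2).
  apply: (@leq_trans (M.+1 * (P * (270 * P ^ 2)))); first by do 2 apply: leq_mul => //; exact: step_bound.
  have -> : M.+1 * (P * (270 * P ^ 2)) = 270 * (P ^ 3 * M) + 270 * P ^ 3 by ring.
  have := @PM_ge 3 1 isT isT; have := @PM_ge 3 0 isT isT; rewrite expn0 expn1 muln1; lia.
have := nM; have := QM; rewrite -/Q => qm.
have -> : Q * (D * (D * (op_cost n K b + 3) + 6) + 10) =
  Q * (D * (D * op_cost n K b)) + 3 * (Q * (D * D)) + 6 * (Q * D) + 10 * Q by ring.
have -> : Q.+1 * (D * (step_cost K b + 20) + 6) = Q.+1 * (D * step_cost K b) + 20 * (Q * D) + 20 * D + 6 * Q + 6 by ring.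
lia.
Qed.

Lemma read_bound : read_cost n m N K b <= 600 * (P ^ 4 * M ^ 2).
Proof.
have p0 := P_gt0; rewrite /read_cost -/Q -/D.
have := @PM_ge 2 1 isT isT; have := @PM_ge 0 1 isT isT; have := @PM_ge 0 0 isT isT; have := @PM_ge 0 2 isT isT.
rewrite !expn0 !expn1 !mul1n => g3 g0 g1 g2.
have e2 : 270 * P ^ 2 <= 270 * P ^ 2 * M by rewrite leq_pmulr.
have h1 := D_Q_bound (leq_trans step_bound e2).
have e1 : P <= P ^ 2 by rewrite -{1}[P]expn1 leq_pexp2l.
have qd : Q * D <= P ^ 2 * M by rewrite mulnC leq_mul // (leq_trans DP).
have qdd : Q * (D * D) <= P ^ 2 * M by rewrite mulnC leq_mul // -mulnn leq_mul.
have qkd : Q * (K * D) <= P ^ 2 * M by rewrite mulnC leq_mul // -mulnn leq_mul.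
have qk : Q * K <= P ^ 2 * M by rewrite mulnC leq_mul // (leq_trans KP).
have qn : Q * n <= M ^ 2 by rewrite -mulnn leq_mul.
have -> : Q * (D * (D * (step_cost K b + 15) + 6) + 3 * K * (D * 8 + 12) + n * 7 + 40) =
  Q * (D * (D * step_cost K b)) + 15 * (Q * (D * D)) + 6 * (Q * D) + 24 * (Q * (K * D)) + 36 * (Q * K)
   + 7 * (Q * n) + 40 * Q by ring.
have := QM; rewrite -/Q; lia.
Qed.

End Bounds.

Lemma leq_expl a b e : a <= b -> a ^ e <= b ^ e.
Proof. by case: e => // e ab; rewrite leq_exp2r. Qed.

Section TreeDecBound.
Variables (n m L : nat) (edge : 'I_m -> {set 'I_n}) (k theta : nat).
Local Notation tw := (treewidth edge).
Let B := 2 ^ (5 * tw) * theta.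
Let P := B ^ (36 * tw).
Let M := n + m.
Hypotheses (tw0 : 0 < tw) (theta0 : 0 < theta).

Lemma B_gt1 : 1 < B.
Proof.
apply: (@leq_trans (2 ^ (5 * tw))); last by rewrite leq_pmulr.
by apply: (@leq_ltn_trans (2 ^ 0)) => //; rewrite ltn_exp2l // muln_gt0.
Qed.

Lemma B_le_P : B <= P.
Proof. by rewrite -{1}[B]expn1 leq_pexp2l ?(ltnW B_gt1) // muln_gt0. Qed.

(** For positive treewidth and [theta] the sum is at most [16 * tw * theta], and
    [16 * tw <= 2 ^ (5 * tw)]; this is the origin of the 5 in [B]. *)
Lemma colours_B K mc : K <= 4 * tw + 8 -> mc <= theta -> K + mc + 1 <= B.
Proof.
move=> Kt mt; rewrite /B mulSn expnD.
have h1 : tw <= 2 ^ tw by apply/ltnW/ltn_expl.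
have h2 : 16 <= 2 ^ (4 * tw) by rewrite (leq_pexp2l (isT : 0 < 2) (_ : 4 <= 4 * tw)) // leq_pmulr.
have h3 : 16 * tw <= 2 ^ tw * 2 ^ (4 * tw) by rewrite mulnC leq_mul.
apply: (@leq_trans (16 * tw * theta)); last by rewrite leq_mul2r h3 orbT.
nia.
Qed.

(** The exponent satisfies [3 * K <= 12 * tw + 24 <= 36 * tw]. *)
Lemma table_P K b : K <= 4 * tw + 8 -> 0 < b -> b <= B -> b ^ (3 * K) <= P.
Proof.
move=> Kt b0 bB; apply: (@leq_trans (B ^ (3 * K))); first exact: leq_expl.
by rewrite leq_pexp2l ?(ltnW B_gt1) //; lia.
Qed.

Hypotheses (n0 : 0 < n) (Lk : L <= k * m).

Lemma treedec_bound : (n + n + n + L + L) * 100 + (n + n + m + 2) * 30 + 120 +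
    (n + n) * (iter_cost L edge + 3) + (m * 7 + L * 12 + 8) <= (200 * 100) * k.+1 * (P ^ 4 * M ^ 2).
Proof.
have P0 : 0 < P by rewrite expn_gt0 (ltnW B_gt1).
have M0 : 0 < M by rewrite /M addn_gt0 n0.
have eP : 2 ^ (3 * (4 * tw + 8)) <= P.
  apply: (@leq_trans (2 ^ (36 * tw))); first by rewrite leq_pexp2l //; lia.
  exact: leq_expl B_gt1.
have LM : L <= k * M by rewrite (leq_trans Lk) // leq_mul2l /M leq_addl orbT.
have nM : n <= M by rewrite leq_addr.
have mM : m <= M by rewrite leq_addl.
have kM : k.+1 * M = k * M + M by rewrite mulSn addnC.
have step : iter_cost L edge <= (90 * 100) * k.+1 * (P * M).
  rewrite /iter_cost; apply: (@leq_trans (700 * P * (12 * (k.+1 * M)))); last first.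
    by rewrite leq_eqVlt; apply/orP; right; nia.
  by apply: leq_mul; [rewrite leq_mul2l | lia].
have g1 : (n + n) * iter_cost L edge <= (180 * 100) * k.+1 * (P * M ^ 2).
  apply: (@leq_trans (2 * M * ((90 * 100) * k.+1 * (P * M)))).
    by apply: leq_mul => //; lia.
  by rewrite leq_eqVlt; apply/orP; left; apply/eqP; ring.
have p4 : P * M ^ 2 <= P ^ 4 * M ^ 2 by rewrite leq_mul2r -{1}[P]expn1 leq_pexp2l ?orbT.
have mm : M <= M ^ 2 by rewrite -mulnn leq_pmulr.
have m4 : M <= P ^ 4 * M ^ 2 by apply: (leq_trans mm); rewrite leq_pmull // expn_gt0 P0.
have k4 : k.+1 * M <= k.+1 * (P ^ 4 * M ^ 2) by rewrite leq_mul2l m4 orbT.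
have g2 : (180 * 100) * k.+1 * (P * M ^ 2) <= (180 * 100) * k.+1 * (P ^ 4 * M ^ 2) by rewrite leq_mul2l p4 orbT.
rewrite mulnDr; pose G := k.+1 * (P ^ 4 * M ^ 2); rewrite -/G in k4.
have -> : (200 * 100) * k.+1 * (P ^ 4 * M ^ 2) = (200 * 100) * G by rewrite /G [RHS]mulnA.
have {}g2 : (n + n) * iter_cost L edge <= (180 * 100) * G.
  by apply: (leq_trans g1); apply: (leq_trans g2); rewrite /G [X in _ <= X]mulnA.
lia.
Qed.

End TreeDecBound.

(** ** The linear program in memory *)

Lemma flow_ext (R : realType) n Q D par valid after initok (birth : 'I_n -> nat) sdf (M : R) Y Y' :
  (forall v, v < NV n Q D -> Y v = Y' v) ->
  flow Q D par valid after initok birth sdf M Y -> flow Q D par valid after initok birth sdf M Y'.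
Proof.
move=> e [Y0 rows]; split=> [v vW|r rR]; first by rewrite -e // Y0.
rewrite -rows //; apply: esym; rewrite /lhs; congr (_ + _ + _)%R.
- apply: eq_bigr => it _; apply: eq_bigr => x _; apply: eq_bigr => a _; rewrite e //.
  have /andP[_ h] := vop_lt n (ltn_ord it) (ltn_ord x) (ltn_ord a).
  by apply: leq_trans h _; rewrite leq_add2l leq_addr.
- by apply: eq_bigr => i _; rewrite e // /NV ltn_addr.
- apply: eq_bigr => q _; apply: eq_bigr => x _; rewrite e //.
  by have /andP[_] := @vg_lt n Q D q x (ltac:(by rewrite -ltnS) : q <= Q) (ltn_ord x).
Qed.

(** * Points of the stored linear program are flows of amount 1 *)

Section Memory.
Variables (R : realType) (n m N K b : nat) (s0 s : state R).
Local Notation Q := (N + m).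
Local Notation D := (b ^ (3 * K)).
Local Notation W := (NV n Q D).
Local Notation H := (RB Q D + n).
Local Notation vars := (lp_vars (lp_of_state s)).
Local Notation flow := (flow Q D (nmem s0 84) (valid K b (vn_in K s0) (nmem s0 84) (nmem s0 5))
  (after K b (vn_in K s0) (nmem s0 84)) (initok K b (vn_in K s0) (nmem s0 110) (rv_in K s0))
  (birth_in s0) (fun a (i : 'I_n) => seedd K b a (nmem s0 81 i) != 0)).
Hypothesis wr : written n m N K b s0 s.

(** The same default 0 as in [put_solution], so that the delivered real array is this function by
    conversion. *)
Definition vec_fun h (y : 'cV[R]_h) (i : nat) : R := oapp (fun j : 'I_h => y j 0%R) 0%R (insub i).

Lemma vec_funE h (y : 'cV[R]_h) (j : 'I_h) : vec_fun y j = y j 0%R.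
Proof. by rewrite /vec_fun valK. Qed.

Lemma lp_rowE (y : 'cV[R]_vars) i : (lp_mat (lp_of_state s) *m y)%R i 0%R = asum s i (vec_fun y).
Proof.
have [w6 _ w8 _ _] := wr.
rewrite mxE /asum.
transitivity (\sum_(j < vars) \sum_(p < nmem s 6 2 | nmem s 7 p == i)
   (if nmem s 8 p == j then rmem s 1 p * y j 0%R else 0))%R.
  apply: eq_bigr => j _; rewrite mxE mulr_suml -big_mkcondr; exact: eq_bigl.
rewrite exchange_big; apply: eq_bigr => p _.
have pW : nmem s 8 p < vars by rewrite /= w6 w8.
rewrite (bigD1 (Ordinal pW)) //= eqxx big1 ?addr0 => [|j ne].
  by rewrite -(vec_funE y (Ordinal pW)).
by case: eqP => // E; case/eqP: ne; apply: val_inj.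
Qed.

Lemma lp_feasibleE (y : 'cV[R]_vars) : lp_feasible (lp_of_state s) y <-> flow 1%R (vec_fun y).
Proof.
have [w6 w61 _ [w1 w2 w3 w4] _] := wr.
have consE : lp_cons (lp_of_state s) = H + H + W by rewrite /= w61.
split=> [fe|[Y0 rows] i].
  have row i : i < H + H + W -> (rmem s 2 i <= asum s i (vec_fun y))%R.
    rewrite -consE => iC; have := fe (Ordinal iC).
    by rewrite lp_rowE /= !mxE.
  split=> [v vW|r rH].
    by have := row (H + H + v); rewrite ltn_add2l w2 // w4 //; apply.
  have [a1 a2] := w1 (vec_fun y) r rH; have [b1 b2] := w3 r rH.
  have := row r; rewrite a1 b1 => /(_ ltac:(by clear -rH; lia)) g1.
  have := row (H + r); rewrite a2 b2 lerN2 => /(_ ltac:(by clear -rH; lia)) g2.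
  by apply/eqP; rewrite mulr1 eq_le g1 g2.
rewrite lp_rowE /= !mxE.
have iC : i < H + H + W by rewrite -consE.
case: (ltnP i H) => iH.
  by have [-> _] := w1 (vec_fun y) i iH; have [-> _] := w3 i iH; rewrite rows // mulr1.
case: (ltnP i (H + H)) => iH2.
  have [r rH ->] : exists2 r, r < H & nat_of_ord i = H + r.
    by exists (i - H); [rewrite ltn_subLR | rewrite subnKC].
  by have [_ ->] := w1 (vec_fun y) r rH; have [_ ->] := w3 r rH; rewrite rows // mulr1.
have [v vW ->] : exists2 v, v < W & nat_of_ord i = H + H + v.
  by exists (i - (H + H)); [rewrite ltn_subLR | rewrite subnKC].
by rewrite w2 // w4 // Y0.
Qed.

Lemma lp_le_n : n <= vars. Proof. by have [w6 _ _ _ _] := wr; rewrite /= w6 /NV leq_addr. Qed.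

Lemma lp_valueE (w : 'I_n -> R) (y : 'cV[R]_vars) : (forall i : 'I_n, rmem s0 0 i = w i) ->
  lp_value (lp_of_state s) y = (\sum_(i < n) w i * vec_fun y i)%R.
Proof.
move=> wE; have [w6 _ _ _ w3] := wr; rewrite /lp_value mxE.
transitivity (\sum_(0 <= j < vars) rmem s 3 j * vec_fun y j)%R.
  by rewrite big_mkord; apply: eq_bigr => j _; rewrite !mxE vec_funE.
rewrite (@big_cat_nat _ _ _ n) ?lp_le_n //= [X in (_ + X)%R]big_nat_cond [X in (_ + X)%R]big1 ?addr0.
  rewrite big_mkord; apply: eq_bigr => i _.
  by rewrite w3 ?ltn_ord ?wE // (leq_trans (ltn_ord i)) // -w6 lp_le_n.
move=> j /andP[/andP[nj jv] _]; rewrite w3 -?w6 // ifN ?mul0r // -leqNgt //.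
Qed.

End Memory.

Definition Build : cmd := (TreeDec ;; EdgeItems ;; Constants ;; WriteLP)%cmd.

(** * Composition of the phases and their total cost *)

Section Correct.
Variables (R : realType) (I : instance R) (k : nat).
Local Notation n := (nodes I).
Local Notation m := (edges I).
Local Notation L := (size (incidences I)).
Local Notation tw := (treewidth (edge I)).
Local Notation theta := (theta_max I).
Hypothesis ok : standing_assumptions I.
Hypothesis small : forall j, #|edge I j| <= k.
Let B := 2 ^ (5 * tw) * theta.
Let P := B ^ (36 * tw).
Let M := n + m.

Record ready (s0 : state R) (N K b : nat) : Prop := Ready {
  rd_items : items_ok L (nmem (load I) 2) (nmem (load I) 1) (edge I) (fun j i => benefit j i)
    (fun j => threshold j) s0 N K;
  rd_birth : forall i : 'I_n, 0 < birth_in s0 i;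
  rd_consts : [/\ nmem s0 21 0 = b, nmem s0 22 0 = 3 * K, nmem s0 30 0 = b ^ (3 * K)
    & nmem s0 112 0 = N + m];
  rd_rows : nmem s0 118 0 = RB (N + m) (b ^ (3 * K)) + n /\ nmem s0 119 0 = RB (N + m) (b ^ (3 * K));
  rd_cost : forall i : 'I_n, nmem s0 5 i = cost i;
  rd_weight : forall i : 'I_n, rmem s0 0 i = weight i;
  rd_base : [/\ 0 < b, K < b & forall i : 'I_n, cost i < b];
  rd_bounds : [/\ N + m <= M, K <= P, b <= P & b ^ (3 * K) <= P]
}.

Section Ready.
Variables (s0 : state R) (N K b : nat).
Hypothesis rd : ready s0 N K b.
Local Notation Q := (N + m).
Local Notation D := (b ^ (3 * K)).
Local Notation sdf := (fun a (i : 'I_n) => seedd K b a (nmem s0 81 i) != 0).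
Local Notation sel := (selection Q D (nmem s0 84) (valid K b (vn_in K s0) (nmem s0 84) (nmem s0 5))
  (after K b (vn_in K s0) (nmem s0 84)) (initok K b (vn_in K s0) (nmem s0 110) (rv_in K s0))).
Local Notation seeds := (sel_seeds Q (birth_in s0) sdf).

Lemma ready_Q : 0 < Q.
Proof.
have it := rd_items rd; have i := Ordinal (nodes_gt0 ok).
by rewrite addn_gt0 (leq_trans (rd_birth rd i) (ok_birth_le it i)).
Qed.

Lemma ready_birth (i : 'I_n) : 0 < birth_in s0 i <= Q.
Proof. by rewrite (rd_birth rd) (leq_trans (ok_birth_le (rd_items rd) i)) ?leq_addr. Qed.

Let birthQ (i : 'I_n) : birth_in s0 i <= Q. Proof. by case/andP: (ready_birth i). Qed.

Lemma ready_sound st : sel st -> sctm_feasible (seeds st).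
Proof.
have [b0 _ _] := rd_base rd; have it := rd_items rd.
exact: (selection_feasible (col := fun i : 'I_n => nmem s0 81 i) b0 (ok_col it) (ok_vnV it)
  (ok_Vvn it) (ok_V0 it) (ok_par it) (ok_birth it) birthQ (ok_birth_min it) (ok_Vpar it)
  (ok_Vedge it) (ok_thr it) (ok_rv it) (ok_rv0 it) (rd_cost rd)).
Qed.

Lemma ready_complete S : sctm_feasible S -> exists2 st, sel st & seeds st = S.
Proof.
have [b0 Kb cb] := rd_base rd; have it := rd_items rd; move=> feas.
have [s1 s2] := sel_of_selection (col := fun i : 'I_n => nmem s0 81 i) b0 (ok_col it) (ok_vnV it)
  (ok_Vvn it) (ok_V0 it) (ok_par it) (ok_birth it) birthQ (ok_birth_min it) (ok_Vpar it)
  (ok_Vedge it) (ok_thr it) (ok_rv it) (rd_cost rd) feas Kb cb.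
by eexists; [exact: s1 | exact: s2].
Qed.

End Ready.

Lemma Build_wp : wp Build (load I) ((220 * 100) * k.+1 * (P ^ 4 * M ^ 2)) (fun s1 => exists s0 N K b,
  [/\ ready s0 N K b, ctx s0 s1, written n m N K b s0 s1, nmem s1 9 =1 (fun=> 0) &
    forall it, it < N + m -> nmem s1 136 it = vop n (b ^ (3 * K)) it 0 0]).
Proof.
have n0 := nodes_gt0 ok; have tw0 := treewidth_gt0 ok; have th0 := theta_gt0 ok.
have bound := treedec_bound tw0 th0 n0 (size_incidences small).
have G0 : 0 < P ^ 4 * M ^ 2.
  have P0 : 0 < P := leq_trans (ltnW (B_gt1 tw0 th0)) (B_le_P tw0 th0).
  by rewrite muln_gt0 [0 < P ^ 4]expn_gt0 [0 < M ^ 2]expn_gt0 P0 /M addn_gt0 n0.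
eapply wp_le.
  eapply wp_seq, wp_call.
    by apply: (TreeDec_wp (@nd_lt _ I) (@ej_lt _ I) (@incP _ I) (load_inputs I) n0); apply: load_zero.
  move=> s1 fr1 [N [q [VB [td born]]]].
  have [_ _ _ _ [_ _ qtw Nb _]] := td.
  have Nn : N <= n by rewrite (leq_trans Nb) // -[n in _ <= n]card_ord max_card.
  eapply wp_seq, wp_call.
    apply: (EdgeItems_wp (ben := fun j i => benefit j i) (thf := fun j => threshold j)
      (@nd_lt _ I) (@ej_lt _ I) (@incP _ I) td born).
    - by move=> p j i pL; rewrite (frn fr1) //; apply: load_benefit.
    - by move=> j; rewrite (frn fr1) // load_threshold.
    - by move=> i; rewrite (frn fr1) // load_zero.
  move=> s2 fr2 [it birthE].
  have [sn sm _ _ _] := ok_inputs it.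
  have c5 (i : 'I_n) : nmem s2 5 i = cost i by rewrite (frn fr2) // (frn fr1) // load_cost.
  have Kt : 4 * q <= 4 * tw + 8 by lia.
  set K := 4 * q in Kt it *.
  pose b := K + \max_(i < n) nmem s2 5 i + 1.
  have mt : \max_(i < n) nmem s2 5 i <= theta.
    by apply/bigmax_leqP => i _; rewrite c5 cost_theta.
  have bB : b <= B := colours_B tw0 th0 Kt mt.
  have b0 : 0 < b by rewrite /b addn1.
  have bP : b <= P by rewrite (leq_trans bB) // B_le_P.
  have DP : b ^ (3 * K) <= P := table_P tw0 th0 Kt b0 bB.
  have Kb : K < b by rewrite /b addn1 ltnS leq_addr.
  have KP : K <= P := leq_trans (ltnW Kb) bP.
  have QM : N + m <= M by rewrite leq_add2r.
  have nM : n <= M by rewrite leq_addr.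
  have M0 : 0 < M by rewrite addn_gt0 n0.
  eapply wp_seq, (wp_mono (T' := 92 * (P ^ 4 * M ^ 2))).
  - exact: (Constants_wp sn sm (ok_K it) (ok_N it)).
  - exact: (consts_bound nM QM M0 KP bP DP b0).
  rewrite -/b => s3 fr3 [e1 e2 e125].
  have rd : ready s3 N K b.
    split.
    - by apply: (items_frame fr3 _ it).
    - by move=> i; rewrite /birth_in (frn fr3) // -/(birth_in s2 i) birthE lt0n.
    - exact: e1.
    - by case: e2.
    - by move=> i; rewrite (frn fr3).
    - by move=> i; rewrite (frr fr3) // (frr fr2) // (frr fr1) // load_weight.
    - split=> // i; rewrite -c5 /b addn1 ltnS.
      by apply: leq_trans (leq_addl _ _); apply: (leq_bigmax (F := fun i : 'I_n => nmem s2 5 i)).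
    - by [].
  have it3 := rd_items rd.
  have [sn3 _ _ _ _] := ok_inputs it3.
  have [a1 a2 a3 a4] := e1; have [c1 c2 c3 c4] := e2.
  apply: (wp_mono (T' := 1100 * (P ^ 4 * M ^ 2))).
  - apply: (WriteLP_wp b0 sn3 (ok_K it3) a1 a2 a3 a4 c1 c2 (ready_Q rd) (ok_par it3) (ok_col it3)
      (s := s3)) => //.
    + by rewrite (frn fr3) // (frn fr2) // (frn fr1) // load_zero.
    + by move=> i; rewrite (frr fr3) // (frr fr2) // (frr fr1) // load_rzero.
    + by move=> i; rewrite (frr fr3) // (frr fr2) // (frr fr1) // load_rzero.
  - exact: (write_bound nM QM M0 KP bP DP b0).
  move=> s4 fr4 [wr w136]; exists s3, N, K, b; split=> //.
  - by apply: (ctx_frame fr4).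
  - by move=> i; rewrite (frn fr4) // (frn fr3) // (frn fr2) // (frn fr1) // load_zero.
have : 1192 * (P ^ 4 * M ^ 2) <= 1192 * k.+1 * (P ^ 4 * M ^ 2) by rewrite leq_mul2r leq_pmulr ?orbT.
rewrite -!mulnA; set G := k.+1 * _.
move: bound; rewrite -!mulnA -/B -/P -/M -/G; lia.
Qed.

Lemma algorithm_correct : exists t1 s1, [/\ exec Build (load I) t1 s1,
  t1 <= (220 * 100) * k.+1 * (P ^ 4 * M ^ 2), lp_equivalent I (lp_of_state s1),
  lp_size (lp_of_state s1) <= 16 * (P ^ 2 * M) &
  forall y, lp_optimal (lp_of_state s1) y -> exists t2 s2, [/\ exec ReadLP (put_solution s1 y) t2 s2,
    t2 <= 600 * (P ^ 4 * M ^ 2) & sctm_solution (output_seeds n s2) (output_value s2)]].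
Proof.
have [t1 [s1 [ex1 le1 [s0 [N [K [b [rd cx wr z9 w136]]]]]]]] := Build_wp.
exists t1, s1.
have it := rd_items rd.
have [b0 _ _] := rd_base rd.
have [QM KP bP DP] := rd_bounds rd.
have nM : n <= M by rewrite leq_addr.
have M0 : 0 < M by rewrite addn_gt0 (nodes_gt0 ok).
have D0 : 0 < b ^ (3 * K) by rewrite expn_gt0 b0.
have aD q x a : after K b (vn_in K s0) (nmem s0 84) q x a < b ^ (3 * K) by apply: after_lt.
have proj := flow_project (R := R) (ready_Q rd) D0 (ok_par it) aD (ready_birth rd) (ready_sound rd) (ready_complete rd).
split=> //.
- exists (lp_le_n wr); split.
    move=> x; split=> [[y [fe yx]]|hull].
      apply/proj; exists (vec_fun y); first exact/(lp_feasibleE wr).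
      by move=> i; rewrite -yx -[in RHS]vec_funE.
    have [Y fl Yx] := (proj x).2 hull.
    pose y : 'cV[R]_(lp_vars (lp_of_state s1)) := (\col_j Y j)%R.
    have yY v : v < lp_vars (lp_of_state s1) -> vec_fun y v = Y v.
      by move=> vW; rewrite -[v]/(val (Ordinal vW)) vec_funE mxE.
    exists y; split; last by move=> i; rewrite -vec_funE yY ?ltn_ord //; apply: Yx.
    apply/(lp_feasibleE wr); apply: flow_ext fl => v vW; rewrite yY //=.
    by have [-> _ _ _ _] := wr.
  move=> y _; rewrite (lp_valueE wr _ (rd_weight rd)); apply: eq_bigr => i _.
  by rewrite -[in RHS]vec_funE.
- rewrite /lp_size /=; have [-> -> _ _ _] := wr.
  exact: (size_bound nM QM M0 KP bP DP b0).
move=> y [fe opt].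
have fl := (lp_feasibleE wr y).1 fe.
have [a1 a2 a3 a4] := rd_consts rd; have [c1 c2] := rd_rows rd.
have [sn _ _ _ _] := ok_inputs it.
have cx' : ctx s0 (put_solution s1 y) by case: cx => h1 h2; split=> //=.
have r4 : rmem (put_solution s1 y) 4 = vec_fun y by [].
have [t2 [s2 [ex2 le2 [st [sel sup o9 o5]]]]] := ReadLP_wp b0 sn (ok_K it) a1 a2 a3 a4 c1 c2
  (ready_Q rd) (ok_par it) (ok_col it) (ready_birth rd) cx' r4 fl z9 w136.
exists t2, s2; split=> //.
  exact: leq_trans le2 (read_bound nM QM M0 KP bP DP b0).
have Es : output_seeds n s2 = sel_seeds (N + m) (birth_in s0)
    (fun a (i : 'I_n) => seedd K b a (nmem s0 81 i) != 0) st.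
  by apply/setP => i; rewrite inE o9.
have Ew (S : {set 'I_n}) : (\sum_(i in S) rmem s0 0%N (nat_of_ord i) = seeding_cost S)%R.
  by apply: eq_bigr => i _; rewrite (rd_weight rd).
split.
- by rewrite Es; apply: (ready_sound rd).
- by rewrite /output_value o5 Es Ew.
move=> S fS; rewrite /output_value o5 Ew /seeding_cost.
apply: (flow_optimal (ready_Q rd) D0 (ok_par it) aD (ready_birth rd) (ready_sound rd) (ready_complete rd) fl sel sup _ fS).
(* A competing flow is cut down to the variables of the program. This changes neither its rows nor
   its value, and yields a feasible point with which [y] can be compared. *)
move=> Y' fl'; rewrite -!(lp_valueE wr _ (rd_weight rd)).
pose y' : 'cV[R]_(lp_vars (lp_of_state s1)) := (\col_j Y' j)%R.
have yY v : v < lp_vars (lp_of_state s1) -> vec_fun y' v = Y' v.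
  by move=> vW; rewrite -[v]/(val (Ordinal vW)) vec_funE mxE.
have fe' : lp_feasible (lp_of_state s1) y'.
  apply/(lp_feasibleE wr); apply: flow_ext fl' => v vW; rewrite yY //=.
  by have [-> _ _ _ _] := wr.
have := opt y' fe'; rewrite !(lp_valueE wr _ (rd_weight rd)) => /le_trans; apply.
rewrite le_eqVlt; apply/orP; left; apply/eqP; apply: eq_bigr => i _; rewrite yY //.
exact: leq_trans (ltn_ord i) (lp_le_n wr).
Qed.

End Correct.

Local Open Scope ring_scope.

Lemma sqr_powR52 (R : realType) (x : R) : 0 <= x -> (x ^+ 2) `^ (5 / 2) = x ^+ 5.
Proof.
move=> x0; rewrite -(powR_mulrn 2 x0) -powRrM.
by rewrite (_ : 2%:R * (5 / 2) = 5%:R :> R) ?powR_mulrn //; lra.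
Qed.

(** The bound is [(4 * P) ^ 2 * M], whose power [5 / 2] has the factors [4 ^ 5 = 1024] and
    [P ^ 5]. *)
Lemma lp_time (R : realType) (P M h : nat) : (h <= 16 * (P ^ 2 * M))%N ->
  h%:R `^ (5 / 2) <= 1024%:R * P%:R ^+ 5 * M%:R `^ (5 / 2) :> R.
Proof.
move=> hb; apply: (@le_trans _ _ ((16 * (P ^ 2 * M))%N%:R `^ (5 / 2))).
  by apply: ge0_ler_powR; rewrite ?nnegrE ?ler0n ?ler_nat //; lra.
have -> : (16 * (P ^ 2 * M))%N%:R = (4 * P%:R) ^+ 2 * M%:R :> R.
  by rewrite !natrM; ring.
rewrite powRM ?mulr_ge0 ?ler0n ?exprn_ge0 // sqr_powR52 ?mulr_ge0 ?ler0n //.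
rewrite exprMn (_ : 4 ^+ 5 = 1024%:R :> R) //; ring.
Qed.

Lemma sqr_le_powR52 (R : realType) (M : nat) : (0 < M)%N -> (M ^ 2)%N%:R <= M%:R `^ (5 / 2) :> R.
Proof.
move=> M0; rewrite natrX -(powR_mulrn 2 (ler0n R M)) ler_powR ?ler1n //; lra.
Qed.

Theorem corollary2 (R : realType) (k : nat) (kappa : R) (kappa_ge0 : 0 <= kappa) :
  exists (alg : lp_algorithm) (C1 C2 C3 : nat),
    forall I : instance R,
      standing_assumptions I ->
      (forall j : 'I_(edges I), (#|edge I j| <= k)%N) ->
      let omega := treewidth (edge I) in
      solves_within kappa alg I
        (2 ^+ (C1 * omega ^ 2) * (theta_max I)%:R ^+ (C2 * omega)
          * (C3%:R * (nodes I + edges I)%:R `^ (5 / 2))).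
Proof.
(* The exponents are those of [P ^ 5]: 900 is [5 * 36 * 5] and 180 is [36 * 5]. The third constant
   adds the shares of building, which grows with [k], of reading, and of the solver, with [kappa]
   replaced by a natural number above it. *)
exists (LPAlgorithm Build ReadLP), 900%N, 180%N,
  (220 * 100 * k.+1 + 600 + 1024 * Num.bound kappa)%N => I ok small w.
have [t1 [s1 [ex1 le1 eqv size rd]]] := algorithm_correct ok small.
exists t1, s1; split=> //; split=> // y /rd[t2 [s2 [ex2 le2 sol]]].
exists t2, s2; split=> //; split=> //; move: le1 le2 size; rewrite -/w.
set th := theta_max I; set M := (nodes I + edges I)%N.
set P := ((2 ^ (5 * w) * th) ^ (36 * w))%N => le1 le2 size.
have M0 : (0 < M)%N by rewrite addn_gt0 (nodes_gt0 ok).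
have P0 : (0 < P)%N.
  exact: leq_trans (ltnW (B_gt1 (treewidth_gt0 ok) (theta_gt0 ok))) (B_le_P (treewidth_gt0 ok) (theta_gt0 ok)).
have PE : P%:R ^+ 5 = 2 ^+ (900 * w ^ 2) * th%:R ^+ (180 * w) :> R.
  rewrite -natrX -!natrX -natrM; congr _%:R.
  by rewrite /P -expnM expnMn -expnM; congr (_ ^ _ * _ ^ _)%N; ring.
rewrite -PE.
set G := M%:R `^ (5 / 2) : R.
have G0 : 0 <= G by exact: powR_ge0.
have le45 : (P ^ 4 * M ^ 2)%N%:R <= P%:R ^+ 5 * G :> R.
  rewrite natrM natrX ler_pM ?exprn_ge0 ?ler0n ?sqr_le_powR52 //.
  by rewrite ler_weXn2l ?ler1n.
have b1 : t1%:R + t2%:R <= (220 * 100 * k.+1 + 600)%N%:R * (P%:R ^+ 5 * G) :> R.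
  apply: le_trans (ler_wpM2l (ler0n R _) le45).
  by rewrite -natrD -natrM ler_nat mulnDl leq_add.
have b2 : kappa * (lp_size (lp_of_state s1))%:R `^ (5 / 2) <=
    (Num.bound kappa)%:R * (1024%:R * (P%:R ^+ 5 * G)).
  apply: ler_pM => //; first exact: powR_ge0.
    exact/ltW/archi_boundP.
  by rewrite mulrA; apply: lp_time.
rewrite natrD natrM [X in _ <= X](_ : _ = (220 * 100 * k.+1 + 600)%N%:R * (P%:R ^+ 5 * G) +
  (Num.bound kappa)%:R * (1024%:R * (P%:R ^+ 5 * G))); last by ring.
by rewrite addrAC lerD.
Qed.
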